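(* Let $J(u)=\frac12\int_B|\nabla u|^2\,dx-\frac1{8\pi}\int_BF(u)\,dx$, $u\in H^1_0(B)$, with $f$ of $4\pi$-critical growth satisfying (g0), (g1) and (g2). If $C_-=\emptyset$ and $C=C_+$ is a nonempty compact subset of $(0,1)$ of measure zero, then there exist a sequence $s_k\to+\infty$ and a sequence $\psi_k\in H^1_{0;r}(B)$ such that $\|\nabla\psi_k\|_2\to0$, $J'(\delta_{1/s_k}\mu_C+\psi_k)\to0$, and $J(\delta_{1/s_k}\mu_C+\psi_k)\to\frac12\|\nabla\mu_C\|_2^2$.
   Context: $B\subset\mathbb{R}^2$ is the open unit disk, $r=|x|$; radial functions are written as functions of $r$. $H^1_{0;r}(B)$ is the subspace of radial functions in $H^1_0(B)$. For $s>0$, $\delta_su(r)=s^{-1/2}u(r^s)$; $\delta_s$ is an isometry of $H^1_{0;r}(B)$ with the norm $\|\nabla u\|_2$. $J'$ is the derivative of $J$ on $H^1_0(B)$, and its convergence is in the norm of the dual space $H^{-1}(B)$. Nonlinearity: $f:\mathbb{R}\to\mathbb{R}$ is continuous, $F(s)=\int_0^sf(t)\,dt$, and $g$ is defined by $\frac1{8\pi}f(t)=g(t)e^{4\pi t^2}$. The function $f$ is of $4\pi$-critical growth if $\lim_{|s|\to\infty}g(s)e^{-\delta s^2}=0$ for every $\delta>0$. Conditions: (g0) $\lim_{|t|\to\infty}\frac{g'(t)}{g(t)t}=0$; (g1) there is $T>0$ such that $\inf_{t\ge T}g(t)>0$ and $\sup_{t\le-T}g(t)<0$; (g2) $\lim_{|t|\to\infty}\frac{F(t)}{f(t)t}=0$.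 Tower function: for disjoint closed sets $C_+,C_-\subset(0,1)$ with nonempty union $C$, a tower is the continuous radial function in $H^1_0(B)$ equal to $\pm\sqrt{\frac1{2\pi}\log\frac1r}$ on $C_\pm$ and of the form $A_I+B_I\log\frac1r$ ($A_I,B_I\in\mathbb{R}$) on each connected component $I$ of $(0,1)\setminus C$. When $C_-=\emptyset$ it is denoted $\mu_C$, so that $\mu_C(r)=\sqrt{\frac1{2\pi}\log\frac1r}$ for $r\in C$. (In particular $\mu_C$ is constant on the component with left endpoint $0$ and vanishes at $r=1$.)
   Formalization: The formal statement adds the hypothesis f(0)=0; without it the claim is false (e.g. g(t)=t+e^{-t^2}), since the points tend weakly to 0 and J'→0 there forces f(0)=0. *)

(* Defs.v *)
From HB Require Import structures.
From mathcomp Require Import all_boot all_order all_algebra.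
From mathcomp Require Import all_classical all_reals all_analysis.

Set Implicit Arguments.
Unset Strict Implicit.
Unset Printing Implicit Defensive.

Import Order.TTheory GRing.Theory Num.Theory.
Import numFieldNormedType.Exports.

Local Open Scope classical_set_scope.
Local Open Scope ring_scope.

Section Plane.
Context {R : realType}.

(* The library norm of R * R is the sup norm, hence a separate Euclidean one. *)
Definition enorm (x : R * R) : R := Num.sqrt (x.1 ^+ 2 + x.2 ^+ 2).

Definition B : set (R * R) := [set x | enorm x < 1].

Definition leb2 :
    {measure set (measurableTypeR R * measurableTypeR R) -> \bar R} :=
  (@lebesgue_measure R \x @lebesgue_measure R)%E.

Definition dx (phi : R * R -> R) : R * R -> R := 'D_((1, 0) : R * R) phi.
Definition dy (phi : R * R -> R) : R * R -> R := 'D_((0, 1) : R * R) phi.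

Fixpoint Ck (k : nat) (phi : R * R -> R) : Prop :=
  if k is k'.+1 then
    [/\ continuous phi,
        forall x, derivable phi x (1, 0) /\ derivable phi x (0, 1),
        Ck k' (dx phi) & Ck k' (dy phi)]
  else continuous phi.

(* C_c^oo(B), each function being extended by 0 to the plane *)
Definition test_fun (phi : R * R -> R) : Prop :=
  (forall k, Ck k phi) /\
  exists K : set (R * R),
    [/\ compact K, K `<=` B & forall x, ~ K x -> phi x = 0].

(* Functions on B are represented by functions on the plane, whose values
   outside B play no role. *)
Definition L2 (u : R * R -> R) : Prop :=
  measurable_fun B u /\ leb2.-integrable B (fun x => (u x ^+ 2)%:E).

Definition weak_grad (u : R * R -> R) (G : R * R -> R * R) : Prop :=
  [/\ L2 (fun x => (G x).1), L2 (fun x => (G x).2) &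
      forall phi, test_fun phi ->
        Rintegral leb2 B (fun x => u x * dx phi x) =
          - Rintegral leb2 B (fun x => (G x).1 * phi x) /\
        Rintegral leb2 B (fun x => u x * dy phi x) =
          - Rintegral leb2 B (fun x => (G x).2 * phi x)].

Definition H1 (u : R * R -> R) : Prop := L2 u /\ exists G, weak_grad u G.

(* The weak gradient of u \in H^1(B), unique up to a null subset of B. *)
Definition grad (u : R * R -> R) : R * R -> R * R :=
  xget (fun=> (0, 0)) [set G | weak_grad u G].

(* H^1_0(B), the closure of C_c^oo(B) in H^1(B) *)
Definition H10 (u : R * R -> R) : Prop :=
  H1 u /\
  exists phi : nat -> R * R -> R,
    [/\ forall n, test_fun (phi n),
        (\int[leb2]_(x in B) ((phi n x - u x) ^+ 2)%:E)%E
          @[n --> \oo] --> 0%E &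
        (\int[leb2]_(x in B) (enorm (dx (phi n) x - (grad u x).1,
                                     dy (phi n) x - (grad u x).2) ^+ 2)%:E)%E
          @[n --> \oo] --> 0%E].

Definition dirichlet (u : R * R -> R) : R :=
  Rintegral leb2 B (fun x => enorm (grad u x) ^+ 2).

Definition dnorm (u : R * R -> R) : R := Num.sqrt (dirichlet u).

(* L is the Frechet derivative at u of Phi on the space H^1_0(B) normed by
   dnorm; in particular L is a bounded linear form on that space. *)
Definition frechet_H10 (Phi : (R * R -> R) -> R) (u : R * R -> R)
    (L : (R * R -> R) -> R) : Prop :=
  [/\ forall (a : R) v w, H10 v -> H10 w -> L (a *: v + w) = a * L v + L w,
      exists c : R, forall v, H10 v -> `|L v| <= c * dnorm v &
      forall e : R, 0 < e -> exists2 d : R, 0 < d &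
        forall v, H10 v -> dnorm v < d ->
          `|Phi (u + v) - Phi u - L v| <= e * dnorm v].

(* For unbounded L the supremum of reals is a dummy value 0, so the norm is
   only to be used on bounded L, such as those of frechet_H10. *)
Definition Hm1_norm (L : (R * R -> R) -> R) : R :=
  sup [set `|L v| | v in [set v | H10 v /\ dnorm v <= 1]].

Definition radial (p : R -> R) : R * R -> R := fun x => p (enorm x).

Definition delta (s : R) (p : R -> R) : R -> R :=
  fun r => s `^ (- 2^-1) * p (r `^ s).

End Plane.

Section Nonlinearity.
Context {R : realType}.
Implicit Types f : R -> R.

Definition primitive f (s : R) : R :=
  if 0 <= s then Rintegral (@lebesgue_measure R) `[0, s] f
  else - Rintegral (@lebesgue_measure R) `[s, 0] f.

(* (8 pi)^-1 f(t) = g(t) exp(4 pi t^2) *)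
Definition gfun f (t : R) : R := (8 * pi)^-1 * f t / expR (4 * pi * t ^+ 2).

Definition lim_absoo (h : R -> R) (l : R) : Prop :=
  h t @[t --> +oo] --> l /\ h t @[t --> -oo] --> l.

Definition critical_growth f : Prop :=
  forall d : R, 0 < d -> lim_absoo (fun t => gfun f t * expR (- d * t ^+ 2)) 0.

(* f is only continuous, so the existence of g'(t) for large |t| is part of
   the condition. *)
Definition g0 f : Prop :=
  [/\ \forall t \near +oo, derivable (gfun f) t 1,
      \forall t \near -oo, derivable (gfun f) t 1 &
      lim_absoo (fun t => derive1 (gfun f) t / (gfun f t * t)) 0].

(* inf (resp. sup) of a set that is not bounded below (resp. above) is 0. *)
Definition g1 f : Prop :=
  exists T : R, [/\ 0 < T, 0 < inf (gfun f @` `[T, +oo[) &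
                    sup (gfun f @` `]-oo, (- T)]) < 0].

Definition g2 f : Prop := lim_absoo (fun t => primitive f t / (f t * t)) 0.

Definition J f (u : R * R -> R) : R :=
  2^-1 * dirichlet u
  - (8 * pi)^-1 * Rintegral leb2 B (fun x => primitive f (u x)).

End Nonlinearity.

Section Tower.
Context {R : realType}.

Definition tower (Cp Cm : set R) (p : R -> R) : Prop :=
  let C := Cp `|` Cm in
  let m := fun r : R => Num.sqrt ((2 * pi)^-1 * ln r^-1) in
  [/\ H10 (radial p),
      {within B, continuous (radial p)},
      forall r, Cp r -> p r = m r,
      forall r, Cm r -> p r = - m r &
      forall x, (`]0, 1[ `\` C) x -> exists a b : R,
        forall r, connected_component (`]0, 1[ `\` C) x r ->
          p r = a + b * ln r^-1].

End Tower.

(* Main.v *)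
Require Import Defs.
From HB Require Import structures.
From mathcomp Require Import all_boot all_order all_algebra.
From mathcomp Require Import all_classical all_reals all_analysis.
From mathcomp Require Import measurable_realfun.
From mathcomp Require Import ring lra zify.

Set Implicit Arguments.
Unset Strict Implicit.
Unset Printing Implicit Defensive.
Import Order.TTheory GRing.Theory Num.Theory.
Import numFieldNormedType.Exports.
Local Open Scope classical_set_scope.
Local Open Scope ring_scope.

(* Put t = ln(1/r) and let C be given by K in this variable. A function with
   finitely many kinks sum_j p_j min(t, b_j) is radial in H^1_0(B); for finitely
   many nodes the b_j can be placed, at distance O(log s) from the dilated nodes
   s t_j, so that the mass of f(u) concentrated at each kink matches the jump of
   the slope. Testing J' against v and integrating by parts radially turns
   ||J'(u)|| into the L^2 norm on (0,oo) of the difference between the slope and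
   the accumulated mass, which tends to 0 as s -> oo by dominated convergence.
   The tower mu_C is approximated in energy by the towers whose nodes are the
   endpoints of finitely many gaps of K (K being null), and a diagonal choice of
   the two parameters gives the sequence. *)

(** In the variable t the density of f(u) / (8 pi) is, up to a constant, g(u) exp(4 pi u^2 - 2 t).
    For a dilated tower the exponent is s times 4 pi V(x)^2 - 2 x with x = t / s: it vanishes where
    V touches the curve sqrt(x / (2 pi)) and is negative inside the chords of this concave curve.
    The mass therefore sits near the kinks, where it is the integral of two exponentials whose rates
    are read off the adjacent slopes; prescribing its total prescribes the density at the kink, and
    with it the shift of the kink. The factor g is not explicit, but (g0) controls the ratio g(u) /
    g(y) near a kink of height y and makes the shift o(s). This picture fails for small t, where u
    is not large; there critical growth gives an exponentially decaying majorant and f(0) = 0 makes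
    the mass vanish in the limit. A second obstacle is that [grad] is an arbitrary choice among weak
    gradients, determined almost everywhere only. H^1_0 is therefore handled through explicit pairs
    of a function and a field that are joint L^2 limits of test functions. *)

(** * Square-integrable functions on a measurable set and their inner product *)

Section SquareIntegrable.
Context d (T : measurableType d) (R : realType) (mu : {measure set T -> \bar R}).
Variables (D : set T) (mD : measurable D).
Implicit Types f g h : T -> R.

Definition sqint f :=
  measurable_fun D f /\ mu.-integrable D (fun x => (f x ^+ 2)%:E).

Definition ip f g : R := Rintegral mu D (fun x => f x * g x).

Lemma le_integrable_real f g : measurable_fun D f ->
  mu.-integrable D (EFin \o g) -> (forall x, D x -> `|f x| <= g x) ->
  mu.-integrable D (EFin \o f).
Proof.
move=> mf ig fg; apply: (le_integrable mD) ig; first exact/measurable_EFinP.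
by move=> x Dx /=; rewrite lee_fin (le_trans (fg x Dx))// ler_norm.
Qed.

Lemma sqint_mul f g : sqint f -> sqint g ->
  mu.-integrable D (EFin \o (fun x => f x * g x)).
Proof.
move=> [mf f2] [mg g2].
apply: (@le_integrable_real _ (fun x => f x ^+ 2 + g x ^+ 2)).
- exact: measurable_funM.
- by rewrite (_ : _ \o _ = (fun x => (f x ^+ 2)%:E + (g x ^+ 2)%:E)%E)//;
    exact: integrableD.
- move=> x Dx; have := sqr_ge0 (`|f x| - `|g x|).
  rewrite normrM -(real_normK (num_real (f x))) -(real_normK (num_real (g x))).
  have := normr_ge0 (f x); have := normr_ge0 (g x); nra.
Qed.

Lemma sqintD f g : sqint f -> sqint g -> sqint (fun x => f x + g x).
Proof.
move=> sf sg; have [mf f2] := sf; have [mg g2] := sg.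
split; first exact: measurable_funD.
apply: (@le_integrable_real _ (fun x => 2 * (f x ^+ 2) + 2 * g x ^+ 2)).
- by apply: (@measurable_funX _ _ _ _ _ 2); exact: measurable_funD.
- rewrite (_ : _ \o _ = (fun x => 2%:E * (f x ^+ 2)%:E + 2%:E * (g x ^+ 2)%:E)%E)//.
  by apply: integrableD => //; exact: integrableZl.
- move=> x Dx; rewrite ger0_norm ?sqr_ge0//.
  by have := sqr_ge0 (f x - g x); nra.
Qed.

Lemma sqintZ a f : sqint f -> sqint (fun x => a * f x).
Proof.
move=> [mf f2]; split; first exact: measurable_funM.
rewrite (_ : (fun x => _) = (fun x => (a ^+ 2)%:E * (f x ^+ 2)%:E)%E).
  exact: integrableZl.
by apply/funext => x; rewrite -EFinM exprMn.
Qed.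

Lemma sqintN f : sqint f -> sqint (fun x => - f x).
Proof.
move=> /(sqintZ (-1)); congr sqint; apply/funext => x; ring.
Qed.

Lemma sqintB f g : sqint f -> sqint g -> sqint (fun x => f x - g x).
Proof. by move=> sf /sqintN; exact: sqintD. Qed.

Lemma sqint_le f g : measurable_fun D f -> sqint g ->
  (forall x, D x -> `|f x| <= `|g x|) -> sqint f.
Proof.
move=> mf [mg g2] fg; split => //.
apply: (@le_integrable_real _ (fun x => g x ^+ 2)) => //.
  exact: (@measurable_funX _ _ _ _ _ 2).
move=> x Dx; rewrite ger0_norm ?sqr_ge0//.
rewrite -(real_normK (num_real (f x))) -(real_normK (num_real (g x))).
by rewrite lerXn2r ?nnegrE ?fg.
Qed.

Lemma integrable_cst_fin a : (mu D < +oo)%E ->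
  mu.-integrable D (EFin \o (fun=> a : R)).
Proof.
move=> Dfin; apply/integrableP; split; first exact/measurable_EFinP.
by rewrite integral_cst//= lte_mul_pinfty.
Qed.

Lemma sqint_bounded M f : (mu D < +oo)%E -> measurable_fun D f ->
  (forall x, D x -> `|f x| <= M) -> sqint f.
Proof.
move=> Dfin mf fM; split => //.
apply: (@le_integrable_real _ (fun=> M ^+ 2)).
- exact: (@measurable_funX _ _ _ _ _ 2).
- exact: integrable_cst_fin.
- move=> x Dx; rewrite ger0_norm ?sqr_ge0//.
  rewrite -(real_normK (num_real (f x))) lerXn2r ?nnegrE ?fM//.
  exact: le_trans (fM _ Dx).
Qed.

Lemma sqint_integrable f : (mu D < +oo)%E -> sqint f ->
  mu.-integrable D (EFin \o f).
Proof.
move=> Dfin sf; have s1 : sqint (fun=> 1).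
  by apply: (@sqint_bounded 1) => // x _; rewrite normr1.
have := sqint_mul sf s1; congr integrable; apply/funext => x /=.
by rewrite mulr1.
Qed.

Lemma ipC f g : ip f g = ip g f.
Proof. by congr (fine _); apply: eq_integral => x _; rewrite mulrC. Qed.

Lemma ipDl f g h : sqint f -> sqint g -> sqint h ->
  ip (fun x => f x + g x) h = ip f h + ip g h.
Proof.
move=> sf sg sh; rewrite /ip -RintegralD//; [|exact: sqint_mul..].
by apply: eq_Rintegral => x _; rewrite mulrDl.
Qed.

Lemma ipZl a f g : sqint f -> sqint g -> ip (fun x => a * f x) g = a * ip f g.
Proof.
move=> sf sg; rewrite /ip -RintegralZl//; last exact: sqint_mul.
by apply: eq_Rintegral => x _; rewrite mulrA.
Qed.

Lemma ipBl f g h : sqint f -> sqint g -> sqint h ->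
  ip (fun x => f x - g x) h = ip f h - ip g h.
Proof.
move=> sf sg sh; rewrite /ip -RintegralB//; [|exact: sqint_mul..].
by apply: eq_Rintegral => x _; rewrite mulrBl.
Qed.

Lemma ipDr f g h : sqint f -> sqint g -> sqint h ->
  ip h (fun x => f x + g x) = ip h f + ip h g.
Proof. by move=> *; rewrite ipC ipDl// ipC (ipC g). Qed.

Lemma ipBr f g h : sqint f -> sqint g -> sqint h ->
  ip h (fun x => f x - g x) = ip h f - ip h g.
Proof. by move=> *; rewrite ipC ipBl// ipC (ipC g). Qed.

Lemma ipZr a f g : sqint f -> sqint g -> ip g (fun x => a * f x) = a * ip g f.
Proof. by move=> *; rewrite ipC ipZl// ipC. Qed.

Lemma ip_ge0 f : 0 <= ip f f.
Proof. by apply: Rintegral_ge0 => x _; rewrite -expr2 sqr_ge0. Qed.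

Lemma ip_sqrB f g : sqint f -> sqint g ->
  ip (fun x => f x - g x) (fun x => f x - g x) = ip f f - 2 * ip f g + ip g g.
Proof.
move=> sf sg; have sfg := sqintB sf sg.
by rewrite ipBl// !ipBr// (ipC g f); ring.
Qed.

Lemma ip_sqrD f g : sqint f -> sqint g ->
  ip (fun x => f x + g x) (fun x => f x + g x) = ip f f + 2 * ip f g + ip g g.
Proof.
move=> sf sg; have sfg := sqintD sf sg.
by rewrite ipDl// !ipDr// (ipC g f); ring.
Qed.

Lemma ip_sqrZ a f : sqint f ->
  ip (fun x => a * f x) (fun x => a * f x) = a ^+ 2 * ip f f.
Proof. by move=> sf; have saf := sqintZ a sf; rewrite ipZl// ipZr//; ring. Qed.

Lemma ip_sqrD_le f g : sqint f -> sqint g ->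
  ip (fun x => f x + g x) (fun x => f x + g x) <= 2 * ip f f + 2 * ip g g.
Proof.
move=> sf sg; have := ip_ge0 (fun x => f x - g x).
by rewrite (ip_sqrB sf sg) (ip_sqrD sf sg); lra.
Qed.

Lemma ip_CS f g : sqint f -> sqint g -> ip f g ^+ 2 <= ip f f * ip g g.
Proof.
move=> sf sg; have sag := sqintZ _ sg.
have q t : 0 <= ip f f - 2 * t * ip f g + t ^+ 2 * ip g g.
  have := ip_ge0 (fun x => f x - t * g x).
  rewrite ip_sqrB// ipZr// ip_sqrZ//; congr (0 <= _); ring.
have [g0|gN0] := eqVneq (ip g g) 0.
  rewrite g0 mulr0; have [->|fgN0] := eqVneq (ip f g) 0; first by rewrite expr0n.
  (* When g has norm 0 the form is affine in t, and this t gives it the value -1. *)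
  have := q ((ip f f + 1) / (2 * ip f g)).
  rewrite g0 mulr0 addr0.
  have -> : 2 * ((ip f f + 1) / (2 * ip f g)) * ip f g = ip f f + 1 by field.
  by rewrite opprD addrA subrr add0r ler0N1.
have gp : 0 < ip g g by rewrite lt_def gN0 ip_ge0.
have := q (ip f g / ip g g); rewrite -(pmulr_lge0 _ gp).
have -> : (ip f f - 2 * (ip f g / ip g g) * ip f g +
   (ip f g / ip g g) ^+ 2 * ip g g) * ip g g = ip f f * ip g g - ip f g ^+ 2 by field.
by rewrite subr_ge0.
Qed.

Lemma ip_CS_sqrt f g : sqint f -> sqint g ->
  `|ip f g| <= Num.sqrt (ip f f) * Num.sqrt (ip g g).
Proof.
move=> sf sg; rewrite -sqrtrM ?ip_ge0// -sqrtr_sqr ler_sqrt ?ip_CS//.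
by rewrite mulr_ge0// ip_ge0.
Qed.

Lemma integral_sqr_EFin f : sqint f ->
  (\int[mu]_(x in D) (f x ^+ 2)%:E)%E = (ip f f)%:E.
Proof.
move=> [mf f2]; rewrite /ip /Rintegral fineK//.
exact: (@integrable_fin_num _ _ _ mu D mD _ f2).
Qed.

Lemma ip_eq0_ae f : sqint f -> ip f f = 0 -> {ae mu, forall x, D x -> f x = 0}.
Proof.
move=> sf f0; have [mf f2] := sf.
have m2 : measurable_fun D (fun x => (f x ^+ 2)%:E).
  by apply/measurable_EFinP; exact: (@measurable_funX _ _ _ _ _ 2).
have [+ _] := @ae_eq_integral_abs _ _ _ mu D mD _ m2.
have -> : (\int[mu]_(x in D) `|(f x ^+ 2)%:E| = 0)%E.
  rewrite -[RHS]/(0%:E) -f0 -integral_sqr_EFin//; apply: eq_integral => x _.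
  by rewrite gee0_abs// lee_fin sqr_ge0.
move=> /(_ erefl); apply: filterS => x /= h Dx.
by have [/eqP] := h Dx; rewrite sqrf_eq0 => /eqP.
Qed.

Lemma ip_ae_eq f f' g g' : {ae mu, forall x, D x -> f x = f' x} ->
  {ae mu, forall x, D x -> g x = g' x} ->
  measurable_fun D f -> measurable_fun D f' ->
  measurable_fun D g -> measurable_fun D g' -> ip f g = ip f' g'.
Proof.
move=> ef eg mf mf' mg mg'; congr (fine _); apply: ae_eq_integral => //.
- by apply/measurable_EFinP; exact: measurable_funM.
- by apply/measurable_EFinP; exact: measurable_funM.
- by apply: filterS2 ef eg => x e1 e2 Dx; rewrite e1// e2.
Qed.

Definition cvgL2 (u : nat -> T -> R) f :=
  ip (fun x => u n x - f x) (fun x => u n x - f x) @[n --> \oo] --> (0 : R).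

Lemma cvgL2P u f : (forall n, sqint (u n)) -> sqint f ->
  (\int[mu]_(x in D) ((u n x - f x) ^+ 2)%:E)%E @[n --> \oo] --> 0%E <->
  cvgL2 u f.
Proof.
move=> su sf.
have E : (fun n => (\int[mu]_(x in D) ((u n x - f x) ^+ 2)%:E)%E) =
  (fun n => (ip (fun x => u n x - f x) (fun x => u n x - f x))%:E).
  by apply/funext => n; rewrite -integral_sqr_EFin//; exact: sqintB.
rewrite E; split => [|h]; first by move/fine_cvg.
exact: (cvg_EFin _ h) || (apply: cvg_EFin => //; exact: nearW).
Qed.

End SquareIntegrable.

(** * The fundamental theorem of calculus for continuous derivatives *)

Section Calculus1.
Context {R : realType}.
Implicit Types f F : R -> R.

Lemma continuous_is_derive f F : (forall x : R, is_derive x (1 : R) F (f x)) -> continuous F.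
Proof.
by move=> FF x; apply/differentiable_continuous/derivable1_diffP; case: (FF x).
Qed.

Lemma FTC_continuous f F a b : a <= b -> continuous f ->
  (forall x : R, is_derive x (1 : R) F (f x)) ->
  (\int[lebesgue_measure]_(x in `[a, b]) (f x)%:E)%E = (F b - F a)%:E.
Proof.
move=> ab cf FF; have cF := continuous_is_derive FF.
move: ab; rewrite le_eqVlt => /orP[/eqP <-|ab].
  by rewrite set_itv1 integral_set1 subrr.
rewrite EFinB; apply: continuous_FTC2 => //.
- exact: continuous_subspaceT.
- split; first by move=> x _; case: (FF x).
  + by apply: cvg_at_right_filter; exact: cF.
  + by apply: cvg_at_left_filter; exact: cF.
- by move=> x _; rewrite derive1E; exact: derive_val.
Qed.

Lemma integrable_continuous f a b : continuous f ->
  lebesgue_measure.-integrable `[a, b] (EFin \o f).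
Proof.
move=> cf; apply: continuous_compact_integrable; first exact: segment_compact.
exact: continuous_subspaceT.
Qed.

Lemma continuous_measurable1D (D : set R) f : continuous f -> measurable_fun D f.
Proof. by move=> cf; apply: measurable_funTS; exact: continuous_measurable_fun. Qed.

End Calculus1.

(** * C^1 functions vanishing off the disk: Fubini, partial derivatives and the Gagliardo-Nirenberg
    inequality *)

Section Plane.
Context {R : realType}.
Implicit Types (phi psi : R * R -> R).

Lemma line1E phi (x y : R) :
  (fun h : R => h^-1 *: (phi (h *: (1, 0) + (x, y)) - phi (x, y))) =
  (fun h : R => h^-1 *: (phi (h *: (1 : R) + x, y) - phi (x, y))).
Proof.
by apply/funext => h; congr (_ *: (phi _ - _)); congr pair;
exact: etrans (congr1 (+%R^~ y) (mulr0 h)) (add0r y).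
Qed.

Lemma line2E phi (x y : R) :
  (fun h : R => h^-1 *: (phi (h *: (0, 1) + (x, y)) - phi (x, y))) =
  (fun h : R => h^-1 *: (phi (x, h *: (1 : R) + y) - phi (x, y))).
Proof.
by apply/funext => h; congr (_ *: (phi _ - _)); congr pair;
exact: etrans (congr1 (+%R^~ x) (mulr0 h)) (add0r x).
Qed.

(** The difference quotients of [phi] along (1, 0) and those of its restriction to a horizontal line
    are the same function; every question on partial derivatives is thereby reduced to one
    variable. *)
Lemma is_derive_line1 phi (x y d : R) :
  is_derive ((x, y) : R * R) (1, 0) phi d <-> is_derive x (1 : R) (fun t => phi (t, y)) d.
Proof.
have E : derivable phi (x, y) (1, 0) = derivable (fun t => phi (t, y)) x 1.
  by rewrite /derivable line1E.
have E' : 'D_(1, 0) phi (x, y) = 'D_1 (fun t => phi (t, y)) x.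
  by rewrite /derive line1E.
split=> -[d1 d2]; apply: DeriveDef.
- by rewrite -E.
- by rewrite -E'.
- by rewrite E.
- by rewrite E'.
Qed.

Lemma is_derive_line2 phi (x y d : R) :
  is_derive ((x, y) : R * R) (0, 1) phi d <-> is_derive y (1 : R) (fun t => phi (x, t)) d.
Proof.
have E : derivable phi (x, y) (0, 1) = derivable (fun t => phi (x, t)) y 1.
  by rewrite /derivable line2E.
have E' : 'D_(0, 1) phi (x, y) = 'D_1 (fun t => phi (x, t)) y.
  by rewrite /derive line2E.
split=> -[d1 d2]; apply: DeriveDef.
- by rewrite -E.
- by rewrite -E'.
- by rewrite E.
- by rewrite E'.
Qed.

Lemma continuous_pairl (y : R) : continuous ((fun t => (t, y)) : R -> R * R).
Proof.
move=> x; apply: (@cvg_pair _ _ _ (nbhs x) (nbhs x) (nbhs y)).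
- exact: cvg_id.
- exact: cvg_cst.
Qed.

Lemma continuous_pairr (x : R) : continuous ((fun t => (x, t)) : R -> R * R).
Proof.
move=> y; apply: (@cvg_pair _ _ _ (nbhs y) (nbhs x) (nbhs y)).
- exact: cvg_cst.
- exact: cvg_id.
Qed.

Lemma continuous_line1 phi (y : R) : continuous phi -> continuous (fun t => phi (t, y)).
Proof.
by move=> cphi x; apply: continuous_comp; [exact: continuous_pairl|exact: cphi].
Qed.

Lemma continuous_line2 phi (x : R) : continuous phi -> continuous (fun t => phi (x, t)).
Proof.
by move=> cphi y; apply: continuous_comp; [exact: continuous_pairr|exact: cphi].
Qed.

(** The plane carries the product sigma-algebra, so Borel sets have to be recovered: an open set is
    a countable union of products of balls with rational centres and radii 1/(n+1). *)
Lemma open_measurable2 (U : set (R * R)) : open U -> measurable U.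
Proof.
move=> oU.
pose bx (p : rat) (n : nat) := ball (ratr p : R) n.+1%:R^-1.
pose V p q n := if `[< bx p n `*` bx q n `<=` U >] then bx p n `*` bx q n else set0.
have -> : U = \bigcup_(p : rat) \bigcup_(q : rat) \bigcup_n V p q n.
  apply/seteqP; split => [[x y] Uxy|z [p _ [q _ [n _]]]]; last first.
    by rewrite /V; case: ifPn => // /asboolP; apply.
  have : nbhs (x, y) U by apply: open_nbhs_nbhs.
  move=> /nbhs_ballP[e /= e0 eU].
  have [n ne] : exists n : nat, n.+1%:R^-1 < e / 2.
    have /ltr_add_invr[n] : (0 : R) < e / 2 by rewrite divr_gt0.
    by rewrite add0r => ?; exists n.
  have n0 : 0 < n.+1%:R^-1 :> R by rewrite invr_gt0 ltr0n.
  have near_rat (z : R) : exists p : rat, bx p n z.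
    have zn : z - n.+1%:R^-1 < z + n.+1%:R^-1 by rewrite ltrD2l gtrN.
    have [p] := rat_in_itvoo zn; rewrite in_itv/= => /andP[p1 p2].
    by exists p; rewrite /bx /ball/= ltr_distl p1 p2.
  have [p px] := near_rat x; have [q qy] := near_rat y.
  exists p => //; exists q => //; exists n => //.
  rewrite /V ifT//; apply/asboolP => -[x' y'] [/= px' qy']; apply: eU.
  move: px qy px' qy' n0 ne; rewrite /bx /ball/= /prod_ball/= /ball/=.
  move: (n.+1%:R^-1 : R) => r; rewrite !ltr_norml => /andP[? ?] /andP[? ?].
  by move=> /andP[? ?] /andP[? ?] ? ?; split; apply/andP; split; lra.
apply: bigcupT_measurable_rat => p; apply: bigcupT_measurable_rat => q.
apply: bigcup_measurable => n _; rewrite /V; case: ifP => // _.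
by apply: measurableX; exact: measurable_ball.
Qed.

Lemma continuous_measurable2 phi : continuous phi -> measurable_fun setT phi.
Proof.
move=> cphi; apply: (measurability _ (RGenOInfty.measurableE R)).
move=> _ [_ [r ->] <-]; rewrite setTI; apply: open_measurable2.
by apply: open_comp => [x _|]; [exact: cphi|exact: interval_open].
Qed.

Lemma continuous_measurable2D (D : set (R * R)) phi : continuous phi ->
  measurable_fun D phi.
Proof. by move=> cf; apply: measurable_funTS; exact: continuous_measurable2. Qed.

Lemma BE (x y : R) : B (x, y) <-> x ^+ 2 + y ^+ 2 < 1.
Proof.
rewrite /B /= /enorm /=; split => [h|h].
  rewrite -(sqr_sqrtr (addr_ge0 (sqr_ge0 x) (sqr_ge0 y))).
  by rewrite -[ltRHS](expr1n _ 2) ltrXn2r// ?nnegrE ?sqrtr_ge0.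
by rewrite -sqrtr1 ltr_sqrt.
Qed.

Lemma enorm_sqr (x : R * R) : enorm x ^+ 2 = x.1 ^+ 2 + x.2 ^+ 2.
Proof. by rewrite sqr_sqrtr// addr_ge0// sqr_ge0. Qed.

Lemma continuous_rho : continuous (fun x : R * R => x.1 ^+ 2 + x.2 ^+ 2).
Proof.
move=> x; apply: cvgD; (apply: (@continuous_comp _ _ _ _ (fun t : R => t ^+ 2));
  last exact: exprn_continuous).
- exact: cvg_fst.
- exact: cvg_snd.
Qed.

Lemma BEset : B = [set x : R * R | x.1 ^+ 2 + x.2 ^+ 2 < 1].
Proof. by apply/seteqP; split => -[x y] /BE. Qed.

Lemma open_B : open (B : set (R * R)).
Proof.
rewrite BEset; apply: (@open_comp _ _ (fun x : R * R => x.1 ^+ 2 + x.2 ^+ 2) [set t | t < 1]).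
- by move=> x _; exact: continuous_rho.
- exact: open_lt.
Qed.

Lemma measurable_B : measurable (B : set (R * R)).
Proof. by apply: open_measurable2; exact: open_B. Qed.

Lemma B_square (x y : R) : B (x, y) -> (-1 <= x <= 1) && (-1 <= y <= 1).
Proof.
move=> /BE xy; have := sqr_ge0 x; have := sqr_ge0 y => y0 x0.
by apply/andP; split; apply/andP; split; nra.
Qed.

Lemma leb2X (X Y : set R) : measurable X -> measurable Y ->
  @leb2 R (X `*` Y) = (lebesgue_measure X * lebesgue_measure Y)%E.
Proof. by move=> mX mY; exact: product_measure1E. Qed.

Lemma leb2_B_lty : (@leb2 R B < +oo)%E.
Proof.
apply: (@le_lt_trans _ _ (leb2 (`[-1, 1] `*` `[-1, 1]))).
  apply: le_measure; rewrite ?inE.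
  - exact: measurable_B.
  - exact: measurableX.
  - by move=> [x y] /B_square /andP[? ?]; split; rewrite /= in_itv.
rewrite leb2X//= !lebesgue_measure_itv/= lte_fin.
by rewrite ifT ?ltry//; lra.
Qed.

Lemma continuous_bounded_B phi : continuous phi ->
  exists M, forall x, B x -> `|phi x| <= M.
Proof.
move=> cphi.
have cK : compact (`[-1, 1] `*` `[-1, 1] : set (R * R)).
  by apply: compact_setX; exact: segment_compact.
have [M [_ MK]] : bounded_set (phi @` (`[-1, 1] `*` `[-1, 1])).
  by apply/compact_bounded/continuous_compact => //; exact: continuous_subspaceT.
exists (M + 1) => -[x y] /B_square/andP[xB yB]; apply: (MK (M + 1)); first by rewrite ltrDl.
by exists (x, y) => //; split; rewrite /= in_itv.
Qed.

Lemma line_integral0 (u u1 : R -> R) (a : R) : 0 <= a -> continuous u1 ->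
  (forall x : R, is_derive x (1 : R) u (u1 x)) -> u a = 0 -> u (- a) = 0 ->
  (\int[lebesgue_measure]_(x in `](- a)%R, a[) (u1 x)%:E = 0)%E.
Proof.
move=> a0 cu1 uu1 ua una.
have m1 (D : set R) : measurable_fun D (EFin \o u1).
  by apply/measurable_EFinP; exact: continuous_measurable1D.
rewrite integral_itv_obnd_cbnd// integral_itv_bndo_bndc// (@FTC_continuous _ _ u)//.
  by rewrite ua una subrr.
lra.
Qed.

Lemma line_bound (u u1 : R -> R) (a x : R) : continuous u1 ->
  (forall x : R, is_derive x (1 : R) u (u1 x)) -> u (- a) = 0 -> - a < x < a ->
  (`|u x|%:E <= \int[lebesgue_measure]_(x in `](- a)%R, a[) `|u1 x|%:E)%E.
Proof.
move=> cu1 uu1 una /andP[ax xa].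
have m1 (D : set R) : measurable_fun D (EFin \o u1).
  by apply/measurable_EFinP; exact: continuous_measurable1D.
have m2 (D : set R) : measurable_fun D (fun x => `|u1 x|%:E).
  by apply/measurable_EFinP; apply: measurableT_comp => //; exact: continuous_measurable1D.
have -> : (`|u x|%:E = `| \int[lebesgue_measure]_(x in `[(- a)%R, x]) (u1 x)%:E |)%E.
  by rewrite (@FTC_continuous _ _ u) ?una ?subr0//; lra.
apply: (le_trans (le_abse_integral _ _ _)) => //; first exact: m1.
rewrite -integral_itv_obnd_cbnd; last exact: m2.
apply: ge0_subset_integral => //; first exact: m2.
by move=> t /=; rewrite !in_itv/= => /andP[-> tx]; exact: le_lt_trans tx xa.
Qed.

(** The square root of a negative number is 0 by convention, so the interval is empty for |y| >= 1,
    as it must be. *)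
Lemma B_line1 (y : R) :
  [set x | B (x, y)] = `]- Num.sqrt (1 - y ^+ 2), Num.sqrt (1 - y ^+ 2)[%classic.
Proof.
apply/seteqP; split => [x /BE xy|x /=].
  rewrite /= in_itv/= -ltr_norml -sqrtr_sqr ltr_sqrt; nra.
rewrite in_itv/= -ltr_norml => h; apply/BE.
have [y1|y1] := leP (1 - y ^+ 2) 0.
  by move: h; rewrite (ler0_sqrtr y1) ltNge normr_ge0.
by move: h; rewrite -sqrtr_sqr ltr_sqrt//; lra.
Qed.

Lemma B_swap (x y : R) : B (x, y) -> B (y, x).
Proof. by move=> /BE h; apply/BE; rewrite addrC. Qed.

Lemma B_line2 (x : R) :
  [set y | B (x, y)] = `]- Num.sqrt (1 - x ^+ 2), Num.sqrt (1 - x ^+ 2)[%classic.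
Proof. by rewrite -B_line1; apply/seteqP; split => y /= /B_swap. Qed.

Lemma B_line_end (y : R) (a := Num.sqrt (1 - y ^+ 2)) :
  ~ B (a, y) /\ ~ B (- a, y).
Proof.
suff h : ~ (a ^+ 2 + y ^+ 2 < 1).
  by split; move=> /BE; rewrite ?sqrrN.
rewrite /a; have [y1|y1] := leP (1 - y ^+ 2) 0.
  by rewrite (ler0_sqrtr y1); lra.
by rewrite sqr_sqrtr; lra.
Qed.

Lemma restrict_B_line1 (g : R * R -> \bar R) (y : R) :
  (fun x => (g \_ B) (x, y)) = (fun x => g (x, y)) \_ [set x | B (x, y)].
Proof.
by apply/funext.
Qed.

Lemma restrict_B_line2 (g : R * R -> \bar R) (x : R) :
  (fun y => (g \_ B) (x, y)) = (fun y => g (x, y)) \_ [set y | B (x, y)].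
Proof.
by apply/funext.
Qed.

Lemma bounded_B_integrable (g : R * R -> R) : continuous g ->
  (@leb2 R).-integrable B (EFin \o g).
Proof.
move=> cg; have [M gM] := continuous_bounded_B cg.
apply: (@le_integrable_real _ _ _ (@leb2 R) B measurable_B g (fun=> M)).
- exact: continuous_measurable2D.
- exact: (@integrable_cst_fin _ _ _ (@leb2 R) B measurable_B M leb2_B_lty).
- by [].
Qed.

Lemma restrict_B_integrable (g : R * R -> R) : continuous g ->
  (@leb2 R).-integrable setT ((fun z => (g z)%:E) \_ B).
Proof.
move=> cg; have := bounded_B_integrable cg.
exact: (@integrable_mkcond _ _ _ (@leb2 R) B (EFin \o g) measurable_B).1.
Qed.

Section ZeroOutside.
Variables (psi psi1 psi2 : R * R -> R).
Hypothesis cpsi : continuous psi.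
Hypothesis cpsi1 : continuous psi1.
Hypothesis cpsi2 : continuous psi2.
Hypothesis dpsi1 : forall z : R * R, is_derive z ((1, 0) : R * R) psi (psi1 z).
Hypothesis dpsi2 : forall z : R * R, is_derive z ((0, 1) : R * R) psi (psi2 z).
Hypothesis psi0 : forall z, ~ B z -> psi z = 0.

Let d1 (y x : R) : is_derive x (1 : R) (fun t => psi (t, y)) (psi1 (x, y)).
Proof. by apply/is_derive_line1; exact: dpsi1. Qed.

Let d2 (x y : R) : is_derive y (1 : R) (fun t => psi (x, t)) (psi2 (x, y)).
Proof. by apply/is_derive_line2; exact: dpsi2. Qed.

(** On each horizontal chord the integral is the difference of the values of [psi] at the two ends,
    where it vanishes. Applied to products, this is the source of all integrations by parts in the
    plane. *)
Lemma integral_partial1_eq0 : Rintegral leb2 B psi1 = 0.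
Proof.
rewrite /Rintegral integral_mkcond -integral21_prod_meas1; last first.
  exact: restrict_B_integrable.
rewrite integral0_eq// => y _; rewrite /fubini_G restrict_B_line1 -integral_mkcond B_line1.
have [B1 B2] := B_line_end y.
by apply: (@line_integral0 (fun t => psi (t, y))) => //;
  [exact: continuous_line1|exact: psi0|exact: psi0].
Qed.

Lemma integral_partial2_eq0 : Rintegral leb2 B psi2 = 0.
Proof.
rewrite /Rintegral integral_mkcond -integral12_prod_meas1; last first.
  exact: restrict_B_integrable.
rewrite integral0_eq// => x _; rewrite /fubini_F restrict_B_line2 -integral_mkcond B_line2.
have [B1 B2] := B_line_end x.
by apply: (@line_integral0 (fun t => psi (x, t))) => //;
  [exact: continuous_line2|apply: psi0 => /B_swap..].
Qed.

(** |psi(x, y)| is at most the integral of |psi1| along the horizontal chord, which depends on y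
    only, and at most that of |psi2| along the vertical chord, which depends on x only. The product
    of the two bounds integrates to the product of the two L^1 norms. Both the Poincare inequality
    and the tail estimates come from here. *)
Lemma gagliardo_nirenberg :
  Rintegral leb2 B (fun z => psi z ^+ 2) <=
  Rintegral leb2 B (fun z => `|psi1 z|) * Rintegral leb2 B (fun z => `|psi2 z|).
Proof.
pose p := (fun z => `|psi1 z|%:E) \_ (B : set (R * R)).
pose q := (fun z => `|psi2 z|%:E) \_ (B : set (R * R)).
have mabs (g : R * R -> R) : continuous g ->
    measurable_fun setT ((fun z => `|g z|%:E) \_ (B : set (R * R))).
  move=> cg; apply/(measurable_restrictT _ measurable_B)/measurable_EFinP.
  apply: measurableT_comp => //.
  exact: continuous_measurable2D.
have p0 z : (0 <= p z)%E by rewrite /p /patch; case: ifP => // _; rewrite lee_fin.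
have q0 z : (0 <= q z)%E by rewrite /q /patch; case: ifP => // _; rewrite lee_fin.
have mp := mabs _ cpsi1; have mq := mabs _ cpsi2.
pose P := fubini_G lebesgue_measure p; pose Q := fubini_F lebesgue_measure q.
have mP : measurable_fun setT P by exact: measurable_fun_fubini_tonelli_G.
have mQ : measurable_fun setT Q by exact: measurable_fun_fubini_tonelli_F.
have P0 y : (0 <= P y)%E by apply: integral_ge0 => x _; exact: p0.
have Q0 x : (0 <= Q x)%E by apply: integral_ge0 => y _; exact: q0.
have iP : (\int[lebesgue_measure]_y P y = \int[leb2]_(z in B) `|psi1 z|%:E)%E.
  by rewrite [RHS]integral_mkcond; apply/esym; exact: (@fubini_tonelli2 _ _ _ _ R lebesgue_measure lebesgue_measure p mp p0).
have iQ : (\int[lebesgue_measure]_x Q x = \int[leb2]_(z in B) `|psi2 z|%:E)%E.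
  by rewrite [RHS]integral_mkcond; apply/esym; exact: (@fubini_tonelli1 _ _ _ _ R lebesgue_measure lebesgue_measure q mq q0).
have fin (g : R * R -> R) : continuous g ->
    (\int[leb2]_(z in B) `|g z|%:E)%E \is a fin_num.
  move=> cg; apply: integrable_fin_num; first exact: measurable_B.
  by apply: integrable_norm; exact: bounded_B_integrable.
have le1 (x y : R) : B (x, y) -> (`|psi (x, y)|%:E <= P y)%E.
  move=> xy; rewrite /P /fubini_G /p restrict_B_line1 -integral_mkcond B_line1.
  apply: (@line_bound (fun t => psi (t, y))) => //.
  - exact: continuous_line1.
  - by apply: psi0; have [] := B_line_end y.
  - by have := B_line1 y; move=> /seteqP[/(_ x xy)] /=; rewrite in_itv.
have le2 (x y : R) : B (x, y) -> (`|psi (x, y)|%:E <= Q x)%E.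
  move=> xy; rewrite /Q /fubini_F /q restrict_B_line2 -integral_mkcond B_line2.
  apply: (@line_bound (fun t => psi (x, t))) => //.
  - exact: continuous_line2.
  - by apply: psi0; have [_ h] := B_line_end x; move=> /B_swap.
  - by have := B_line2 x; move=> /seteqP[/(_ y xy)] /=; rewrite in_itv.
have mPQ : measurable_fun setT (fun z : R * R => (P z.2 * Q z.1)%E).
  by apply: emeasurable_funM; apply: measurableT_comp.
have PQ0 (z : R * R) : (0 <= P z.2 * Q z.1)%E by exact: mule_ge0.
have main : (\int[leb2]_(z in B) (psi z ^+ 2)%:E <=
    \int[leb2]_(z in B) `|psi1 z|%:E * \int[leb2]_(z in B) `|psi2 z|%:E)%E.
  rewrite -iP -iQ; apply: (@le_trans _ _ (\int[leb2]_z (P z.2 * Q z.1))%E).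
    rewrite [leLHS]integral_mkcond; apply: ge0_le_integral => //.
    - move=> z _; rewrite /patch; case: ifP => // _; rewrite lee_fin sqr_ge0//.
    - apply/(measurable_restrictT _ measurable_B)/measurable_EFinP.
      apply: (@measurable_funX _ _ _ _ _ 2).
      exact: continuous_measurable2D.
    - move=> [x y] _; rewrite /patch; case: ifPn => xy; last exact: (PQ0 (x, y)).
      move: xy; rewrite inE/= => xy.
      rewrite -(real_normK (num_real _)) expr2 EFinM.
      by apply: lee_pmul => //; rewrite ?lee_fin// ?le1// le2.
  apply: (@le_trans _ _ (\int[lebesgue_measure]_x \int[lebesgue_measure]_y (P y * Q x))%E).
    rewrite le_eqVlt; apply/orP; left; apply/eqP.
    have E := (@fubini_tonelli1 _ _ _ _ R lebesgue_measure lebesgue_measure (fun z : R * R => (P z.2 * Q z.1)%E) mPQ PQ0).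
    rewrite /fubini_F/= in E.
    exact: E.
  under eq_integral do rewrite ge0_integralZr//.
  by rewrite ge0_integralZl// integral_ge0.
rewrite /Rintegral -fineM ?fin// fine_le//; last by rewrite fin_numM ?fin.
apply: integrable_fin_num; first exact: measurable_B.
apply: bounded_B_integrable => z; apply: (@continuous_comp _ _ _ psi (fun t => t ^+ 2)).
  exact: cpsi.
exact: exprn_continuous.
Qed.

End ZeroOutside.

End Plane.

Lemma cvgy_mulr {R : realType} {T : Type} {F : set_system T} {FF : Filter F}
  (f : T -> R) (a : R) : 0 < a -> f @ F --> +oo -> f x * a @[x --> F] --> +oo.
Proof.
move=> a0 /cvgryPge fy; apply/cvgryPge => A.
by apply: filterS (fy (A / a)) => x; rewrite ler_pdivrMr.
Qed.

(** * Calculus of [Ck] and smooth cutoffs built from exp(-1/x) *)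

Section Smooth.
Context {R : realType}.
Implicit Types (phi psi p : R * R -> R) (Q : R -> R).

Notation ex := ((1, 0) : R * R).
Notation ey := ((0, 1) : R * R).

Lemma CkSE k phi : Ck k.+1 phi = [/\ continuous phi,
  forall x, derivable phi x ex /\ derivable phi x ey, Ck k (dx phi) & Ck k (dy phi)].
Proof. by []. Qed.

(** [Ck] refers to the chosen derivatives [dx] and [dy]; this form allows inductions on k with
    explicit partial derivatives. *)
Lemma Ck_intro k phi phi1 phi2 : continuous phi ->
  (forall z, is_derive z ex phi (phi1 z)) -> (forall z, is_derive z ey phi (phi2 z)) ->
  Ck k phi1 -> Ck k phi2 -> Ck k.+1 phi.
Proof.
move=> cphi d1 d2 c1 c2; have e1 : dx phi = phi1.
  by apply/funext => z; have d := d1 z; exact: derive_val.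
have e2 : dy phi = phi2 by apply/funext => z; have d := d2 z; exact: derive_val.
split.
- exact: cphi.
- by move=> z; split; [have [] := d1 z|have [] := d2 z].
- by rewrite e1.
- by rewrite e2.
Qed.

Lemma Ck_continuous k phi : Ck k phi -> continuous phi.
Proof. by case: k => //= k []. Qed.

Lemma Ck_is_derive1 k phi : Ck k.+1 phi -> forall z, is_derive z ex phi (dx phi z).
Proof. by move=> [_ h _ _] z; exact: (DeriveDef (h z).1 erefl). Qed.

Lemma Ck_is_derive2 k phi : Ck k.+1 phi -> forall z, is_derive z ey phi (dy phi z).
Proof. by move=> [_ h _ _] z; exact: (DeriveDef (h z).2 erefl). Qed.

Lemma Ck_pred k phi : Ck k.+1 phi -> Ck k phi.
Proof.
elim: k phi => [phi [] //|k IH phi].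
rewrite CkSE => -[c d c1 c2].
split; [exact: c|exact: d|exact: IH|exact: IH].
Qed.

Lemma Ck_cst k (c : R) : Ck k (fun=> c).
Proof.
elim: k c => [c|k IH c]; first exact: cst_continuous.
apply: (@Ck_intro _ _ (fun=> 0) (fun=> 0)) => //; exact: cst_continuous.
Qed.

Lemma CkD k phi psi : Ck k phi -> Ck k psi -> Ck k (fun z => phi z + psi z).
Proof.
elim: k phi psi => [phi psi cphi cpsi z|k IH phi psi hphi hpsi].
  by apply: cvgD; [exact: cphi|exact: cpsi].
move: (hphi) (hpsi); rewrite !CkSE => -[c1 _ a1 a2] [c2 _ b1 b2].
apply: (@Ck_intro _ _ (fun z => dx phi z + dx psi z) (fun z => dy phi z + dy psi z)).
- by move=> z; apply: cvgD; [exact: c1|exact: c2].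
- by move=> z; exact: (is_deriveD (Ck_is_derive1 hphi z) (Ck_is_derive1 hpsi z)).
- by move=> z; exact: (is_deriveD (Ck_is_derive2 hphi z) (Ck_is_derive2 hpsi z)).
- exact: IH.
- exact: IH.
Qed.

Lemma CkM k phi psi : Ck k phi -> Ck k psi -> Ck k (fun z => phi z * psi z).
Proof.
elim: k phi psi => [phi psi cphi cpsi z|k IH phi psi hphi hpsi].
  by apply: cvgM; [exact: cphi|exact: cpsi].
move: (hphi) (hpsi); rewrite !CkSE => -[c1 _ a1 a2] [c2 _ b1 b2].
apply: (@Ck_intro _ _ (fun z => phi z * dx psi z + psi z * dx phi z)
  (fun z => phi z * dy psi z + psi z * dy phi z)).
- by move=> z; apply: cvgM; [exact: c1|exact: c2].
- by move=> z; exact: (is_deriveM (Ck_is_derive1 hphi z) (Ck_is_derive1 hpsi z)).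
- by move=> z; exact: (is_deriveM (Ck_is_derive2 hphi z) (Ck_is_derive2 hpsi z)).
- by apply: CkD; apply: IH => //; exact: Ck_pred.
- by apply: CkD; apply: IH => //; exact: Ck_pred.
Qed.

(** A function of one variable is encoded as z -> Q z.1, so that [Ck] on the plane also measures its
    regularity. The chain rule turns the derivatives into products, and the induction closes with
    [CkM]. *)
Lemma Ck_comp k Q p : Ck k (fun z => Q z.1) -> (forall j, Ck j p) ->
  Ck k (fun z => Q (p z)).
Proof.
move=> + sp; elim: k Q => [Q cQ z|k IH Q hQ].
  apply: continuous_comp; first exact: (sp 0).
  exact: (@continuous_line1 _ (fun z => Q z.1) 0).
move: (hQ); rewrite CkSE => -[cQ _ hQ1 _].
pose Q1 t := dx (fun z : R * R => Q z.1) (t, 0).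
have dQ (t : R) : is_derive t (1 : R) Q (Q1 t).
  exact/(is_derive_line1 (fun z => Q z.1))/(Ck_is_derive1 hQ).
have E1 : dx (fun z : R * R => Q z.1) = fun z => Q1 z.1.
  apply/funext => -[x y].
  suff h : is_derive (x, y) ex (fun z : R * R => Q z.1) (Q1 x) by exact: derive_val.
  exact/is_derive_line1.
have cQ1 : Ck k (fun z => Q1 z.1) by rewrite -E1.
move: (sp k.+1); rewrite CkSE => -[_ _ sp1 sp2].
apply: (@Ck_intro _ _ (fun z => Q1 (p z) * dx p z) (fun z => Q1 (p z) * dy p z)).
- move=> z; apply: continuous_comp; first exact: (sp 0).
  exact: (@continuous_line1 _ (fun z => Q z.1) 0).
- move=> [x y]; apply/is_derive_line1.
  have h : is_derive x (1 : R) (fun t => p (t, y)) (dx p (x, y)).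
    by apply/is_derive_line1; exact: (Ck_is_derive1 (sp 1)).
  exact: (@is_derive1_comp _ Q (fun t => p (t, y)) x _ _ (dQ (p (x, y))) h).
- move=> [x y]; apply/is_derive_line2.
  have h : is_derive y (1 : R) (fun t => p (x, t)) (dy p (x, y)).
    by apply/is_derive_line2; exact: (Ck_is_derive2 (sp 1)).
  exact: (@is_derive1_comp _ Q (fun t => p (x, t)) y _ _ (dQ (p (x, y))) h).
- by apply: CkM => //; exact: IH.
- by apply: CkM => //; exact: IH.
Qed.

Lemma Ck_fst_derive k Q Q1 : (forall x : R, is_derive x (1 : R) Q (Q1 x)) ->
  Ck k (fun z => Q1 z.1) -> Ck k.+1 (fun z => Q z.1).
Proof.
move=> dQ cQ1; apply: (@Ck_intro _ _ (fun z => Q1 z.1) (fun=> 0)) => //.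
- move=> z; apply: continuous_comp; first exact: cvg_fst.
  exact: (continuous_is_derive dQ).
- by move=> [x y]; apply/is_derive_line1.
- by move=> [x y]; apply/is_derive_line2; exact: (is_derive_cst (Q x)).
- exact: Ck_cst.
Qed.

Lemma Ck_fst k : Ck k (fun z : R * R => z.1).
Proof.
case: k => [|k]; first by move=> z; exact: cvg_fst.
by apply: (@Ck_fst_derive _ id (fun=> 1)); exact: Ck_cst.
Qed.

Lemma Ck_snd k : Ck k (fun z : R * R => z.2).
Proof.
case: k => [|k]; first by move=> z; exact: cvg_snd.
apply: (@Ck_intro _ _ (fun=> 0) (fun=> 1)).
- by move=> z; exact: cvg_snd.
- by move=> [x y]; apply/is_derive_line1; exact: (is_derive_cst (y : R)).
- by move=> [x y]; apply/is_derive_line2; exact: is_derive_id.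
- exact: Ck_cst.
- exact: Ck_cst.
Qed.

Lemma Ck_rho k : Ck k (fun z : R * R => z.1 ^+ 2 + z.2 ^+ 2).
Proof.
apply: CkD; apply: CkM; try exact: Ck_fst; exact: Ck_snd.
Qed.

(* [flat n] is x^-n e^(-1/x) on the positive half-line and 0 elsewhere. *)
Definition flat n (x : R) := if 0 < x then x^-1 ^+ n * expR (- x^-1) else 0.

(** This is e^(y/n) >= y/n raised to the power n. *)
Lemma pow_expN_le n (y : R) : 0 < y -> y ^+ n * expR (- y) <= n%:R ^+ n.
Proof.
case: n => [|n] y0; first by rewrite !expr0 mul1r -expR0 ler_expR oppr_le0 ltW.
rewrite expRN ler_pdivrMr ?expR_gt0//.
have n0 : 0 < n.+1%:R :> R by rewrite ltr0n.
have -> : y = n.+1%:R * (y / n.+1%:R) by rewrite mulrCA divff ?mulr1 ?gt_eqF.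
rewrite expRM_natl exprMn.
rewrite ler_pM2l ?exprn_gt0// lerXn2r ?nnegrE ?expR_ge0 ?divr_ge0 ?(ltW y0)//.
by apply: le_trans (expR_ge1Dx _); rewrite lerDr.
Qed.

Lemma flat_ge0 n x : 0 <= flat n x.
Proof.
by rewrite /flat; case: ifP => // x0; rewrite mulr_ge0 ?expR_ge0// exprn_ge0// invr_ge0 ltW.
Qed.

(** A quadratic majorant is what differentiability at 0 calls for; it is [pow_expN_le] with exponent
    n + 2 at y = 1/x. *)
Lemma flat_le n x : flat n x <= n.+2%:R ^+ n.+2 * x ^+ 2.
Proof.
rewrite /flat; case: ifPn => x0; last first.
  by rewrite mulr_ge0 ?sqr_ge0// exprn_ge0.
rewrite -ler_pdivrMr ?exprn_gt0//.
apply: le_trans (@pow_expN_le n.+2 x^-1 _); last by rewrite invr_gt0.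
by rewrite -exprVn mulrAC -exprD addn2.
Qed.

Lemma is_derive_quadratic (F : R -> R) (C : R) :
  (forall h, `|F h| <= C * h ^+ 2) -> is_derive (0 : R) (1 : R) F 0.
Proof.
move=> FC; have F0 : F 0 = 0.
  by apply/eqP; rewrite -normr_le0 (le_trans (FC 0))// expr0n mulr0.
have C0 : 0 <= C by have := le_trans (normr_ge0 _) (FC 1); rewrite expr1n mulr1.
have h : (fun h : R => h^-1 *: (F (h *: (1 : R) + 0) - F 0)) @ 0^' --> (0 : R).
  apply/cvgrPdist_lt => e e0; near=> t.
  have tN0 : t != 0 by near: t; exact: nbhs_dnbhs_neq.
  have tp : 0 < `|t| by rewrite normr_gt0.
  rewrite sub0r normrN F0 subr0 addr0 /GRing.scale/= mulr1 normrM normfV.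
  rewrite ltr_pdivrMl// (le_lt_trans (FC t))// -(real_normK (num_real t)) expr2 mulrA.
  rewrite [ltRHS]mulrC ltr_pM2r//.
  apply: (@le_lt_trans _ _ ((C + 1) * `|t|)).
    by rewrite ler_wpM2r// lerDl.
  rewrite mulrC -ltr_pdivlMr; last by rewrite ltr_wpDl.
  near: t; apply: nbhs_dnbhs; exists (e / (C + 1)) => /=.
    by rewrite divr_gt0// ltr_wpDl.
  by move=> t /=; rewrite sub0r normrN.
apply: DeriveDef; first by apply/cvg_ex; exists 0.
exact: cvg_lim h.
Unshelve. all: end_near. Qed.

(** The span of the family [flat n] is stable under differentiation, the point 0 included, so
    derivatives of all orders follow by induction. *)
Lemma is_derive_flat n (x : R) :
  is_derive x (1 : R) (flat n) (- n%:R * flat n.+1 x + flat n.+2 x).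
Proof.
have [x0|x0|->] := ltgtP x 0.
- have -> : - n%:R * flat n.+1 x + flat n.+2 x = 0.
    by rewrite /flat !ltNge (ltW x0)/= mulr0 addr0.
  apply: (near_eq_is_derive _ (is_derive_cst (0 : R) x 1)).
  near=> t; rewrite /flat /= ifF//; apply: negbTE; rewrite -leNgt; near: t.
  by apply: filterS (lt_nbhsl x0) => t /ltW.
- suff h : is_derive x (1 : R) (fun t : R => (t^-1) ^+ n * expR (- t^-1))
      (- n%:R * flat n.+1 x + flat n.+2 x).
    apply: (near_eq_is_derive _ h).
    near=> t; rewrite /flat ifT//; near: t; exact: lt_nbhsr.
  rewrite /flat x0; set y := x^-1.
  have dV : is_derive x (1 : R) (fun t : R => t^-1) (- y ^+ 2).
    apply: (is_derive_eq (@is_deriveV _ id x 1 1 (lt0r_neq0 x0) (is_derive_id _ _))).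
    by rewrite /GRing.scale/= mulr1 exprVn.
  pose q (y : R) := y ^+ n * expR (- y).
  have dq : is_derive y (1 : R) q (- (y ^+ n) * expR (- y) + n%:R * y ^+ n.-1 * expR (- y)).
    have dN : is_derive y (1 : R) (fun t : R => - t) (- 1) by exact: is_deriveN.
    have dE : is_derive y (1 : R) (fun t => expR (- t)) (expR (- y) * - 1).
      exact: (@is_derive1_comp _ expR (fun t => - t) y _ _ (is_derive_expR _) dN).
    have dX : is_derive y (1 : R) (fun t : R => t ^+ n) ((n%:R * y ^+ n.-1) *: 1).
      have -> : (fun t : R => t ^+ n) = id ^+ n by apply/funext => t; rewrite exprfctE.
      exact: (@is_deriveX _ _ id n y 1 1 (is_derive_id _ _)).
    apply: (is_derive_eq (is_deriveM dX dE)); rewrite /GRing.scale/=.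
    by ring.
  apply: (is_derive_eq (@is_derive1_comp _ q (fun t : R => t^-1) x _ _ dq dV)).
  rewrite !exprS; case: n q dq => [|n] q dq /=; first by ring.
  by rewrite !exprS; ring.
- have -> : - n%:R * flat n.+1 0 + flat n.+2 0 = 0.
    by rewrite /flat ltxx mulr0 addr0.
  apply: (@is_derive_quadratic _ (n.+2%:R ^+ n.+2)) => h.
  by rewrite ger0_norm; [exact: flat_le|exact: flat_ge0].
Unshelve. all: end_near. Qed.

Lemma Ck_flat k n : Ck k (fun z : R * R => flat n z.1).
Proof.
elim: k n => [|k IH] n.
  move=> z; apply: continuous_comp; first exact: cvg_fst.
  exact: (continuous_is_derive (is_derive_flat n)).
apply: Ck_fst_derive; first exact: is_derive_flat.
by apply: CkD; [apply: CkM; [exact: Ck_cst|exact: IH]|exact: IH].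
Qed.

(* Tends to the indicator of the positive half-line as n -> oo. *)
Definition bump (n : nat) (x : R) := flat 0 (n%:R * x).

Lemma bump_ge0 n x : 0 <= bump n x. Proof. exact: flat_ge0. Qed.

Lemma bump_le1 n x : bump n x <= 1.
Proof.
rewrite /bump /flat; case: ifP => // h; rewrite expr0 mul1r -[leRHS]expR0 ler_expR.
by rewrite oppr_le0 invr_ge0 ltW.
Qed.

Lemma bump_le0 n x : x <= 0 -> bump n x = 0.
Proof. by move=> x0; rewrite /bump /flat ltNge mulr_ge0_le0. Qed.

Lemma bump_cvg x : bump n x @[n --> \oo] --> (if 0 < x then 1 else 0 : R).
Proof.
case: ifPn => x0; last first.
  rewrite -leNgt in x0; rewrite (_ : (fun n => _) = fun=> 0); first exact: cvg_cst.
  by apply/funext => n; exact: bump_le0.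
have hI : - (n%:R * x)^-1 @[n --> \oo] --> (0 : R).
  rewrite -[X in _ --> X]oppr0.
  apply: (@cvgN _ _ _ _ _ (fun n : nat => (n%:R * x)^-1)).
  apply/gtr0_cvgV0.
    near=> n; rewrite mulr_gt0// ltr0n; near: n; exact: nbhs_infty_gt.
  by apply: cvgy_mulr => //; exact: cvgr_idn.
have h : (fun n : nat => expR (- (n%:R * x)^-1)) @ \oo --> expR (0 : R).
  exact: (continuous_cvg _ (@continuous_expR R 0) hI).
rewrite expR0 in h.
apply: cvg_trans h; apply: near_eq_cvg; near=> n.
rewrite /bump /flat ifT ?expr0 ?mul1r// mulr_gt0// ltr0n; near: n.
exact: nbhs_infty_gt.
Unshelve. all: end_near. Qed.

Lemma Ck_bump k n p : (forall j, Ck j p) -> Ck k (fun z => bump n (p z)).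
Proof.
move=> sp; apply: (@Ck_comp _ (flat 0) (fun z => n%:R * p z)); first exact: Ck_flat.
by move=> j; apply: CkM; [exact: Ck_cst|].
Qed.

End Smooth.

Lemma squeeze_seq {R : realType} (u v w : nat -> R) (l : R) :
  (\forall n \near \oo, v n <= u n <= w n) ->
  v @ \oo --> l -> w @ \oo --> l -> u @ \oo --> l.
Proof. by move=> h; apply: squeeze_cvgr. Qed.

(** * Test functions on the disk: stability, integration by parts, cutoffs *)

Section TestFunctions.
Context {R : realType}.
Implicit Types (phi psi u v w : R * R -> R) (G : R * R -> R * R).

Notation ex := ((1, 0) : R * R).
Notation ey := ((0, 1) : R * R).
Notation sq := (sqint (@leb2 R) B).
Notation ipB := (ip (@leb2 R) B).
Notation cvgB := (cvgL2 (@leb2 R) B).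
Let mB := @measurable_B R.
Let Bfin := @leb2_B_lty R.

Lemma test_cont phi : test_fun phi -> continuous phi.
Proof. by move=> [/(_ 0)]. Qed.

Lemma test_derive1 phi : test_fun phi -> forall z, is_derive z ex phi (dx phi z).
Proof. by move=> [/(_ 1)] h _; exact: Ck_is_derive1 h. Qed.

Lemma test_derive2 phi : test_fun phi -> forall z, is_derive z ey phi (dy phi z).
Proof. by move=> [/(_ 1)] h _; exact: Ck_is_derive2 h. Qed.

Lemma test_outB phi z : test_fun phi -> ~ B z -> phi z = 0.
Proof. by move=> [_ [K [_ KB K0]]] nBz; apply: K0 => /KB. Qed.

Lemma near_compl (K : set (R * R)) z : compact K -> ~ K z -> \forall w \near z, ~ K w.
Proof.
move=> cK nKz; have oK : open (~` K).
  apply: closed_openC; apply: compact_closed cK.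
  exact: norm_hausdorff.
exact: open_nbhs_nbhs.
Qed.

Lemma test_dx phi : test_fun phi -> test_fun (dx phi).
Proof.
move=> [s [K [cK KB K0]]]; split; first by move=> k; have := s k.+1; rewrite CkSE => -[].
exists K; split => // z nKz; rewrite /dx -(derive_cst (0 : R) z ex).
apply: near_eq_derive; apply: filterS (near_compl cK nKz) => w; exact: K0.
Qed.

Lemma test_dy phi : test_fun phi -> test_fun (dy phi).
Proof.
move=> [s [K [cK KB K0]]]; split; first by move=> k; have := s k.+1; rewrite CkSE => -[].
exists K; split => // z nKz; rewrite /dy -(derive_cst (0 : R) z ey).
apply: near_eq_derive; apply: filterS (near_compl cK nKz) => w; exact: K0.
Qed.

Lemma testD phi psi : test_fun phi -> test_fun psi -> test_fun (fun z => phi z + psi z).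
Proof.
move=> [s [K [cK KB K0]]] [s' [K' [cK' KB' K0']]]; split.
  by move=> k; exact: CkD.
exists (K `|` K'); split; first exact: compactU.
  by rewrite subUset.
by move=> z /not_orP[h1 h2]; rewrite K0// K0'// addr0.
Qed.

Lemma testZ a phi : test_fun phi -> test_fun (fun z => a * phi z).
Proof.
move=> [s [K [cK KB K0]]]; split.
  by move=> k; apply: CkM => //; exact: Ck_cst.
by exists K; split => // z /K0 ->; rewrite mulr0.
Qed.

Lemma testM phi psi : test_fun phi -> (forall k, Ck k psi) ->
  test_fun (fun z => phi z * psi z).
Proof.
move=> [s [K [cK KB K0]]] s'; split; first by move=> k; exact: CkM.
by exists K; split => // z /K0 ->; rewrite mul0r.
Qed.

Lemma dxD phi psi : test_fun phi -> test_fun psi ->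
  dx (fun z => phi z + psi z) = fun z => dx phi z + dx psi z.
Proof.
move=> t1 t2; apply/funext => z.
have h := is_deriveD (test_derive1 t1 z) (test_derive1 t2 z).
exact: derive_val.
Qed.

Lemma dyD phi psi : test_fun phi -> test_fun psi ->
  dy (fun z => phi z + psi z) = fun z => dy phi z + dy psi z.
Proof.
move=> t1 t2; apply/funext => z.
have h := is_deriveD (test_derive2 t1 z) (test_derive2 t2 z).
exact: derive_val.
Qed.

Lemma dxZ a phi : test_fun phi -> dx (fun z => a * phi z) = fun z => a * dx phi z.
Proof.
move=> t1; apply/funext => z.
have h := is_deriveZ a (test_derive1 t1 z).
exact: derive_val.
Qed.

Lemma dyZ a phi : test_fun phi -> dy (fun z => a * phi z) = fun z => a * dy phi z.
Proof.
move=> t1; apply/funext => z.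
have h := is_deriveZ a (test_derive2 t1 z).
exact: derive_val.
Qed.

Lemma cont_sq phi : continuous phi -> sq phi.
Proof.
move=> c; have [M h] := continuous_bounded_B c.
exact: (@sqint_bounded _ _ _ (@leb2 R) B mB M phi Bfin (continuous_measurable2D c) h).
Qed.

Lemma test_sq phi : test_fun phi -> sq phi.
Proof. by move=> /test_cont; exact: cont_sq. Qed.

Lemma test_ibp1 phi psi : test_fun phi -> test_fun psi ->
  ipB phi (dx psi) = - ipB (dx phi) psi.
Proof.
move=> t1 t2; apply/eqP; rewrite -subr_eq0 opprK.
have s1 := test_sq t1; have s2 := test_sq t2.
have s3 := test_sq (test_dx t1); have s4 := test_sq (test_dx t2).
have c1 := test_cont t1; have c2 := test_cont t2.
have c3 := test_cont (test_dx t1); have c4 := test_cont (test_dx t2).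
rewrite /ip -RintegralD//; [|exact: sqint_mul..].
apply/eqP; apply: (@integral_partial1_eq0 _ (fun z => phi z * psi z)) => //.
- move=> z; apply: cvgD; apply: cvgM;
    [exact: c1|exact: c4|exact: c3|exact: c2].
- move=> z; apply: (is_derive_eq (is_deriveM (test_derive1 t1 z) (test_derive1 t2 z))).
  by rewrite /GRing.scale/= (mulrC (psi z)).
- by move=> z nB; rewrite (test_outB t1 nB) mul0r.
Qed.

Lemma test_ibp2 phi psi : test_fun phi -> test_fun psi ->
  ipB phi (dy psi) = - ipB (dy phi) psi.
Proof.
move=> t1 t2; apply/eqP; rewrite -subr_eq0 opprK.
have s1 := test_sq t1; have s2 := test_sq t2.
have s3 := test_sq (test_dy t1); have s4 := test_sq (test_dy t2).
have c1 := test_cont t1; have c2 := test_cont t2.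
have c3 := test_cont (test_dy t1); have c4 := test_cont (test_dy t2).
rewrite /ip -RintegralD//; [|exact: sqint_mul..].
apply/eqP; apply: (@integral_partial2_eq0 _ (fun z => phi z * psi z)) => //.
- move=> z; apply: cvgD; apply: cvgM;
    [exact: c1|exact: c4|exact: c3|exact: c2].
- move=> z; apply: (is_derive_eq (is_deriveM (test_derive2 t1 z) (test_derive2 t2 z))).
  by rewrite /GRing.scale/= (mulrC (psi z)).
- by move=> z nB; rewrite (test_outB t1 nB) mul0r.
Qed.

Lemma compact_disk (r : R) : r < 1 ->
  compact [set z : R * R | z.1 ^+ 2 + z.2 ^+ 2 <= r].
Proof.
move=> r1; apply: (subclosed_compact _
  (compact_setX (@segment_compact R (-1) 1) (@segment_compact R (-1) 1))).
- apply: (@closed_comp _ _ (fun x : R * R => x.1 ^+ 2 + x.2 ^+ 2) [set t | t <= r]).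
  + by move=> x _; exact: continuous_rho.
  + exact: closed_le.
- move=> [x y] /= h; have /B_square/andP[? ?] : B (x, y) by apply/BE; exact: le_lt_trans h r1.
  by split; rewrite /= in_itv.
Qed.

(* A smooth function supported in |z|^2 <= 1 - 1/(n+1) and tending to 1 in B. *)
Definition cutoff n (z : R * R) := bump n (1 - n.+1%:R^-1 - (z.1 ^+ 2 + z.2 ^+ 2)).

Lemma cutoff_test n : test_fun (cutoff n).
Proof.
split.
  move=> k; apply: (@Ck_bump _ _ n (fun z => 1 - n.+1%:R^-1 - (z.1 ^+ 2 + z.2 ^+ 2))).
  move=> j; have := @CkD R j _ _ (Ck_cst j (1 - n.+1%:R^-1)) (CkM (Ck_cst j (-1)) (Ck_rho j)).
  by congr (Ck _ _); apply/funext => z; rewrite mulN1r.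
exists [set z : R * R | z.1 ^+ 2 + z.2 ^+ 2 <= 1 - n.+1%:R^-1]; split.
- by apply: compact_disk; rewrite gtrBl invr_gt0 ltr0n.
- move=> [x y] /= h; apply/BE; apply: le_lt_trans h _.
  by rewrite gtrBl invr_gt0 ltr0n.
- move=> z /= h; apply: bump_le0; rewrite subr_le0 ltW// ltNge; exact/negP.
Qed.

Lemma bump_homo n : {homo @bump R n : x y / x <= y}.
Proof.
move=> x y xy; rewrite /bump /flat; case: ifPn => h1; last first.
  by case: ifP => // h2; rewrite expr0 mul1r expR_ge0.
have h2 : n%:R * x <= n%:R * y by rewrite ler_wpM2l.
rewrite (lt_le_trans h1 h2) !expr0 !mul1r ler_expR lerN2 lef_pV2//.
by rewrite posrE (lt_le_trans h1).
Qed.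

Lemma cutoff_cvg z : B z -> cutoff n z @[n --> \oo] --> (1 : R).
Proof.
case: z => x y /BE; set r := x ^+ 2 + y ^+ 2 => r1.
have h : bump n ((1 - r) / 2) @[n --> \oo] --> (1 : R).
  by have := @bump_cvg R ((1 - r) / 2); rewrite ifT// divr_gt0// subr_gt0.
apply: (squeeze_seq _ h (cvg_cst (1 : R))).
near=> n; rewrite bump_le1 andbT; apply: bump_homo.
suff : n.+1%:R^-1 < (1 - r) / 2 by rewrite -/r; move: (n.+1%:R^-1) => q; lra.
near: n.
have : (n.+1%:R^-1 : R) @[n --> \oo] --> 0 by exact: cvg_harmonic.
by move/cvgr_lt; apply; rewrite divr_gt0// subr_gt0.
Unshelve. all: end_near. Qed.

Lemma cutoff_le1 n z : cutoff n z <= 1. Proof. exact: bump_le1. Qed.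

Lemma cutoff_ge0 n z : 0 <= cutoff n z. Proof. exact: bump_ge0. Qed.

End TestFunctions.

(** * A square-integrable function orthogonal to all test functions vanishes *)

Section Fundamental.
Context {R : realType}.
Variable K : R * R -> R.
Notation sq := (sqint (@leb2 R) B).
Notation ipB := (ip (@leb2 R) B).
Let mB := @measurable_B R.
Let Bfin := @leb2_B_lty R.
Hypothesis sK : sq K.
Hypothesis K0 : forall phi, test_fun phi -> ipB K phi = 0.

Let iK : (@leb2 R).-integrable B (EFin \o K).
Proof. exact: (@sqint_integrable _ _ _ (@leb2 R) B mB K Bfin sK). Qed.

Let null S := (\int[@leb2 R]_(x in S `&` B) (K x)%:E = 0)%E.

Let iKS S : measurable S -> (@leb2 R).-integrable (S `&` B) (EFin \o K).
Proof.
move=> mS; apply: (@integrableS _ _ _ (@leb2 R) B) => //.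
exact: measurableI.
Qed.

(** The sets A such that [K] integrates to 0 over the part of [W] that [p] sends to A form a
    lambda-system, so a generating pi-system suffices. The set [W] carries what is already known
    about one coordinate while the other is treated. *)
Let null_dynkin d (T : measurableType d) (G : set (set T)) (p : R * R -> T)
    (W : set (R * R)) :
  measurable W -> measurable_fun setT p -> @measurable _ T = <<s G >> ->
  setI_closed G -> null W -> (forall A, G A -> null (W `&` p @^-1` A)) ->
  forall A, measurable A -> null (W `&` p @^-1` A).
Proof.
move=> mW mp GE GI nW nG.
have mpre A : measurable A -> measurable (W `&` p @^-1` A).
  by move=> mA; apply: measurableI => //; rewrite -[X in measurable X]setTI; exact: mp.
move=> A; rewrite GE; move: A.
apply: (dynkin_induction (P := fun A => null (W `&` p @^-1` A)) GE GI).
- by rewrite preimage_setT setIT.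
- by [].
- move=> S mS nS; have := nW; rewrite /null.
  have -> : W `&` B = ((W `&` p @^-1` S) `&` B) `|` ((W `&` p @^-1` (~` S)) `&` B).
    rewrite -setIUl -setIUr -preimage_setU setUv preimage_setT setIT//.
  rewrite integral_setU_EFin//.
  + by rewrite nS add0e.
  + by apply: measurableI => //; exact: mpre.
  + by apply: measurableI => //; apply: mpre; exact: measurableC.
  + rewrite -setIUl; have [mK _] := sK.
    by apply: measurable_funS mK => // z [].
  + by apply/disj_setPS => z [[[_ /= h1] _] [[_ /= h2] _]].
- move=> F mF tF nF; rewrite /null preimage_bigcup setI_bigcupr setI_bigcupl.
  rewrite integral_bigcup.
  + by rewrite eseries0// => n _ _; exact: nF.
  + move=> i j _ _ [z [[[_ /= h1] _] [[_ /= h2] _]]].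
    by apply: (tF i j) => //; exists (p z).
  + by move=> k; apply: measurableI => //; exact: mpre.
  + rewrite -setI_bigcupl; apply: iKS; apply: bigcup_measurable => k _; exact: mpre.
Qed.

(** On B the indicator of a quadrant is the pointwise limit of the test functions obtained by
    multiplying [cutoff] by a bump in each coordinate; |K| dominates. *)
Let null_quadrant (a c : R) : null [set z | a < z.1 /\ c < z.2].
Proof.
set W := [set z | _].
pose phi n z := cutoff n z * (bump n (z.1 - a) * bump n (z.2 - c)).
have t n : test_fun (phi n).
  apply: (testM (cutoff_test n)) => k; apply: CkM.
    apply: (@Ck_bump _ _ n (fun z => z.1 - a)) => j.
    by apply: CkD; [exact: Ck_fst|exact: Ck_cst].
  apply: (@Ck_bump _ _ n (fun z => z.2 - c)) => j.
  by apply: CkD; [exact: Ck_snd|exact: Ck_cst].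
have h n : (\int[@leb2 R]_(x in B) (K x * phi n x)%:E = 0)%E.
  rewrite -[LHS]fineK.
    by have := K0 (t n); rewrite /ip /Rintegral => ->.
  apply: integrable_fin_num => //.
  by apply: sqint_mul => //; exact: test_sq.
have mW : measurable W.
  apply: open_measurable2; rewrite (_ : W = [set z | a < z.1] `&` [set z | c < z.2])//.
  apply: openI.
  - apply: (@open_comp _ _ fst [set t | a < t]); last exact: open_gt.
    by move=> x _; exact: cvg_fst.
  - apply: (@open_comp _ _ snd [set t | c < t]); last exact: open_gt.
    by move=> x _; exact: cvg_snd.
have mphi n : measurable_fun B (phi n) by apply: continuous_measurable2D; exact: test_cont.
have [mK _] := sK.
have ind z : (bump n (z.1 - a) * bump n (z.2 - c)) @[n --> \oo] --> (\1_W z : R).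
  have -> : \1_W z = (if 0 < z.1 - a then 1 else 0) * (if 0 < z.2 - c then 1 else 0) :> R.
    rewrite indicE !subr_gt0; case: ifPn => h1; case: ifPn => h2;
      rewrite ?mulr1 ?mulr0 ?mul0r.
    + by rewrite mem_set.
    + by rewrite memNset// => -[_]; exact/negP.
    + by rewrite memNset// => -[+ _]; exact/negP.
    + by rewrite memNset// => -[+ _]; exact/negP.
  by apply: cvgM; exact: bump_cvg.
have lim : (\int[@leb2 R]_(x in B) (K x * phi n x)%:E)%E @[n --> \oo] -->
    (\int[@leb2 R]_(x in B) (K x * \1_W x)%:E)%E.
  apply: (@dominated_cvg _ _ _ (@leb2 R) B mB _ _ (fun x => `|K x|%:E)) => //.
  - by move=> n; apply/measurable_EFinP; exact: (measurable_funM mK (mphi n)).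
  - move=> x Bx; apply: cvg_EFin; first exact: nearW.
    apply: cvgM; first exact: cvg_cst.
    by rewrite -[X in _ --> X]mul1r; apply: cvgM; [exact: cutoff_cvg|exact: ind].
  - exact: integrable_norm.
  - move=> n x Bx; rewrite abse_EFin lee_fin normrM ler_piMr//.
    rewrite ger0_norm ?mulr_ge0 ?cutoff_ge0 ?bump_ge0//.
    by rewrite mulr_ile1 ?mulr_ge0 ?cutoff_ge0 ?bump_ge0 ?cutoff_le1// mulr_ile1 ?bump_ge0 ?bump_le1.
move: lim; rewrite (_ : (fun n => _) = fun=> 0%E); last by apply/funext => n; exact: h.
move=> /(cvg_unique _ (cvg_cst _)) => /(_ (@ereal_hausdorff R)) E.
rewrite /null integral_mkcondl; rewrite -[RHS]/(0%E) [RHS]E; apply: eq_integral => x _.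
rewrite /patch indicE; case: ifPn => xW; first by rewrite mulr1.
by rewrite mulr0.
Qed.

Lemma fundamental_lemma : {ae (@leb2 R), forall x, B x -> K x = 0}.
Proof.
have BW (S : set (R * R)) (S' : set (R * R)) :
    (forall z, B z -> S z <-> S' z) -> S `&` B = S' `&` B.
  by move=> h; apply/seteqP; split => z [Sz Bz]; split => //; exact/(h z Bz).
have n0 S S' : (forall z, B z -> S z <-> S' z) -> null S -> null S'.
  by move=> h; rewrite /null (BW _ _ h).
have RG := @RGenOInfty.measurableE R.
have RGI : setI_closed (@RGenOInfty.G R).
  move=> _ _ [x ->] [y ->]; exists (Num.max x y); apply/seteqP; split => z /=.
    by rewrite !in_itv/= !andbT gt_max => -[-> ->].
  by rewrite !in_itv/= !andbT gt_max => /andP.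
(* Half-lines are upgraded to Borel sets in the first coordinate, then in the second, and rectangles
   generate the rest. The bound -2 acts as -oo, since B lies in the square [-1, 1]^2. *)
have n1 c A : measurable A -> null ([set z | c < z.2] `&` fst @^-1` A).
  apply: (null_dynkin _ _ RG RGI) => //.
  - apply: open_measurable2; apply: (@open_comp _ _ snd [set t | c < t]); last exact: open_gt.
    by move=> x _; exact: cvg_snd.
  - apply: n0 (null_quadrant (-2) c) => -[x y] /B_square/andP[/andP[h1 _] _].
    by split=> /= [[]//|h]; split => //; apply: lt_le_trans h1; lra.
  - move=> _ [a ->]; apply: n0 (null_quadrant a c) => -[x y] _ /=.
    by rewrite in_itv/= andbT; split => [[]|[]].
have n2 A C : measurable A -> measurable C -> null (fst @^-1` A `&` snd @^-1` C).
  move=> mA; apply: (null_dynkin _ _ RG RGI) => //.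
  - by rewrite -[X in measurable X]setTI; exact: measurable_fst.
  - apply: n0 (n1 (-2) A mA) => -[x y] /B_square/andP[_ /andP[h1 _]].
    by split=> /= [[]//|h]; split => //; apply: lt_le_trans h1; lra.
  - move=> _ [c ->]; apply: n0 (n1 c A mA) => -[x y] _ /=.
    by rewrite in_itv/= andbT; split => [[]|[]].
have n3 S : measurable S -> null S.
  move=> mS; apply: (n0 (setT `&` id @^-1` S)); first by move=> z _; split => // -[].
  apply: (null_dynkin _ _ (measurable_prod_measurableType _ _)) => //.
  - move=> _ _ [A1 mA1 [A2 mA2 <-]] [B1 mB1 [B2 mB2 <-]].
    exists (A1 `&` B1); first exact: measurableI.
    by exists (A2 `&` B2); [exact: measurableI|rewrite setXI].
  - by apply: n0 (n2 setT setT _ _) => //.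
  - move=> _ [A mA [C mC <-]]; apply: n0 (n2 A C mA mC) => -[x y] _ /=.
    by split => [[]|[_ []]].
have [mK _] := sK.
have := @integral_ae_eq _ _ _ (@leb2 R) B mB (cst 0%E) (EFin \o K) iK (measurable_cst _).
case=> [E EB mE|N [mN N0 NE]].
  have := n3 E mE; rewrite /null (_ : E `&` B = E); last exact/setIidPl.
  by move=> ->; rewrite integral0.
exists N; split => //; apply: subset_trans NE => x /= h1 h2; apply: h1 => Bx.
by have [] := h2 Bx.
Qed.

End Fundamental.

Lemma seq_near3 (P Q S : nat -> Prop) : (\forall n \near \oo, P n) ->
  (\forall n \near \oo, Q n) -> (\forall n \near \oo, S n) ->
  exists n, [/\ P n, Q n & S n].
Proof.
move=> hP hQ hS; apply: (@filter_ex _ \oo).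
by apply: filterS3 hP hQ hS => n; split.
Qed.

Lemma seq_EFin_cvg {R : realType} (u : nat -> R) (l : R) :
  (u n)%:E @[n --> \oo] --> l%:E -> u @ \oo --> l.
Proof. by move=> h; exact: (fine_cvg h). Qed.

Lemma seq_cvg_EFin {R : realType} (u : nat -> R) (l : R) :
  u @ \oo --> l -> (u n)%:E @[n --> \oo] --> l%:E.
Proof. by move=> h; apply: cvg_EFin => //; exact: nearW. Qed.

Lemma seq_eq_cvg {T : topologicalType} (u v : nat -> T) (l : T) :
  (forall n, u n = v n) -> u @ \oo --> l -> v @ \oo --> l.
Proof. by move=> /funext ->. Qed.

Lemma seq_cvg_unique {R : realType} (u : nat -> R) (l l' : R) :
  u @ \oo --> l -> u @ \oo --> l' -> l = l'.
Proof. by move=> h h'; exact: (cvg_unique (@norm_hausdorff _ _) h h'). Qed.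

Lemma seq_cvgN {R : realType} (u : nat -> R) (l : R) :
  u @ \oo --> l -> - u n @[n --> \oo] --> - l.
Proof. by move=> h; exact: cvgN. Qed.

Lemma norm_squeeze0 {R : realType} (u c : nat -> R) :
  (forall n, `|u n| <= c n) -> c @ \oo --> (0 : R) -> u @ \oo --> (0 : R).
Proof.
move=> uc c0; have cN := seq_cvgN c0; rewrite oppr0 in cN.
by apply: (squeeze_seq _ cN c0); apply: nearW => n; rewrite -ler_norml.
Qed.

(** * H^1_0 as the L^2 closure of the graph of the gradient on test functions *)

Section Sobolev.
Context {R : realType}.
Implicit Types (phi psi u v w : R * R -> R) (G : R * R -> R * R).

Notation sq := (sqint (@leb2 R) B).
Notation ipB := (ip (@leb2 R) B).
Notation cvgLB := (cvgL2 (@leb2 R) B).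
Let mB := @measurable_B R.
Let Bfin := @leb2_B_lty R.

Lemma sqB_meas u : sq u -> measurable_fun B u. Proof. by case. Qed.

Lemma ipB_cvgl (u_ : nat -> R * R -> R) u w : (forall n, sq (u_ n)) -> sq u -> sq w ->
  cvgLB u_ u -> ipB (u_ n) w @[n --> \oo] --> ipB u w.
Proof.
move=> su_ su sw uu; apply/subr_cvg0.
have h : Num.sqrt (ipB (fun x => u_ n x - u x) (fun x => u_ n x - u x)) * Num.sqrt (ipB w w)
    @[n --> \oo] --> (0 : R).
  rewrite -[X in _ --> X](mul0r (Num.sqrt (ipB w w))); apply: cvgM; last exact: cvg_cst.
  by rewrite -[X in _ --> X]sqrtr0; apply: (continuous_cvg _ (@sqrt_continuous R 0)).
apply: (norm_squeeze0 _ h) => n.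
rewrite -(@ipBl _ _ _ (@leb2 R) B mB)//.
apply: (@ip_CS_sqrt _ _ _ (@leb2 R) B mB) => //.
exact: (@sqintB _ _ _ (@leb2 R) B mB).
Qed.

Lemma ipB_cvg_sqr (u_ : nat -> R * R -> R) u : (forall n, sq (u_ n)) -> sq u ->
  cvgLB u_ u -> ipB (u_ n) (u_ n) @[n --> \oo] --> ipB u u.
Proof.
move=> su_ su uu; have h1 := ipB_cvgl su_ su su uu.
have -> : (fun n => ipB (u_ n) (u_ n)) = fun n =>
    ipB (fun x => u_ n x - u x) (fun x => u_ n x - u x) + 2 * ipB (u_ n) u - ipB u u.
  by apply/funext => n; rewrite (@ip_sqrB _ _ _ (@leb2 R) B mB)//; ring.
rewrite [X in _ --> X](_ : _ = 0 + 2 * ipB u u - ipB u u); last by ring.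
apply: cvgB; last exact: cvg_cst.
by apply: cvgD => //; apply: cvgM => //; exact: cvg_cst.
Qed.

Lemma cvgB_sub (u_ : nat -> R * R -> R) u (c : nat -> R) :
  (forall n, ipB (fun x => u_ n x - u x) (fun x => u_ n x - u x) <= c n) ->
  c @ \oo --> (0 : R) -> cvgLB u_ u.
Proof.
move=> uc c0; apply: (squeeze_seq _ (cvg_cst (0 : R)) c0); apply: nearW => n.
by rewrite uc andbT (@ip_ge0 _ _ _ (@leb2 R) B).
Qed.

Lemma ipB_sqr_le2 u v w : sq u -> sq v -> sq w ->
  ipB (fun x => u x - w x) (fun x => u x - w x) <=
  2 * ipB (fun x => u x - v x) (fun x => u x - v x) +
  2 * ipB (fun x => v x - w x) (fun x => v x - w x).
Proof.
move=> su sv sw.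
have s1 := @sqintB _ _ _ (@leb2 R) B mB _ _ su sv.
have s2 := @sqintB _ _ _ (@leb2 R) B mB _ _ sv sw.
have -> : (fun x => u x - w x) = fun x => (u x - v x) + (v x - w x).
  by apply/funext => x; rewrite addrA subrK.
exact: (@ip_sqrD_le _ _ _ (@leb2 R) B mB _ _ s1 s2).
Qed.

Lemma aeS (P Q : R * R -> Prop) : (forall x, P x -> Q x) ->
  {ae (@leb2 R), forall x, P x} -> {ae (@leb2 R), forall x, Q x}.
Proof.
move=> PQ [N [mN N0 PN]]; exists N; split => //.
by apply: subset_trans PN => x /= nQ /PQ.
Qed.

Lemma aeT (P : R * R -> Prop) : (forall x, P x) -> {ae (@leb2 R), forall x, P x}.
Proof. by move=> h; exists set0; split => // x /=; apply. Qed.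

Definition fst_grad G := fun x => (G x).1.
Definition snd_grad G := fun x => (G x).2.

(** Keeping the function together with an explicit field avoids [grad], which is a choice known
    almost everywhere only. [H10_test_limit] and [test_limit_H10] translate between the two
    descriptions. *)
Definition test_limit u G := [/\ sq u, sq (fst_grad G), sq (snd_grad G) &
  exists phi : nat -> R * R -> R, [/\ forall n, test_fun (phi n), cvgLB phi u,
    cvgLB (fun n => dx (phi n)) (fst_grad G) & cvgLB (fun n => dy (phi n)) (snd_grad G)]].

Definition ipG G H := ipB (fst_grad G) (fst_grad H) + ipB (snd_grad G) (snd_grad H).

Lemma weak_gradP u G : weak_grad u G <-> [/\ sq (fst_grad G), sq (snd_grad G) &
  forall phi, test_fun phi -> ipB u (dx phi) = - ipB (fst_grad G) phi /\
    ipB u (dy phi) = - ipB (snd_grad G) phi].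
Proof. by []. Qed.

Lemma test_limit_weak u G : test_limit u G -> weak_grad u G.
Proof.
move=> [su s1 s2 [phi [tphi c0 c1 c2]]]; apply/weak_gradP; split => // psi tpsi.
have sp n := test_sq (tphi n).
have sp1 n := test_sq (test_dx (tphi n)); have sp2 n := test_sq (test_dy (tphi n)).
split.
- have h1 := ipB_cvgl sp su (test_sq (test_dx tpsi)) c0.
  have h2 := seq_cvgN (ipB_cvgl sp1 s1 (test_sq tpsi) c1).
  apply: (seq_cvg_unique h1); rewrite (_ : (fun n => _) = fun n => - ipB (dx (phi n)) psi)//.
  by apply/funext => n; exact: test_ibp1.
- have h1 := ipB_cvgl sp su (test_sq (test_dy tpsi)) c0.
  have h2 := seq_cvgN (ipB_cvgl sp2 s2 (test_sq tpsi) c2).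
  apply: (seq_cvg_unique h1); rewrite (_ : (fun n => _) = fun n => - ipB (dy (phi n)) psi)//.
  by apply/funext => n; exact: test_ibp2.
Qed.

Lemma fundamental_eq u v : sq u -> sq v ->
  (forall phi, test_fun phi -> ipB u phi = ipB v phi) ->
  {ae (@leb2 R), forall x, B x -> u x = v x}.
Proof.
move=> su sv uv; have := @fundamental_lemma R (fun x => u x - v x).
have s := @sqintB _ _ _ (@leb2 R) B mB _ _ su sv.
move=> /(_ s) h; apply: (aeS _ (h _)) => [x /= + Bx|phi tphi].
  by move=> /(_ Bx) /eqP; rewrite subr_eq0 => /eqP.
by rewrite (@ipBl _ _ _ (@leb2 R) B mB)//; [rewrite uv ?subrr|exact: test_sq].
Qed.

(** The components of two weak gradients have the same integrals against every test function, so the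
    fundamental lemma applies to their differences. *)
Lemma weak_grad_unique u G H : weak_grad u G -> weak_grad u H ->
  {ae (@leb2 R), forall x, B x -> (G x).1 = (H x).1} /\
  {ae (@leb2 R), forall x, B x -> (G x).2 = (H x).2}.
Proof.
move=> /weak_gradP[s1 s2 h] /weak_gradP[s1' s2' h']; split.
- apply: (fundamental_eq s1 s1') => phi tphi.
  by apply: oppr_inj; have [<- _] := h phi tphi; have [<- _] := h' phi tphi.
- apply: (fundamental_eq s2 s2') => phi tphi.
  by apply: oppr_inj; have [_ <-] := h phi tphi; have [_ <-] := h' phi tphi.
Qed.

Lemma cvgB_ae (u_ : nat -> R * R -> R) u v : (forall n, sq (u_ n)) -> sq u -> sq v ->
  {ae (@leb2 R), forall x, B x -> u x = v x} -> cvgLB u_ u -> cvgLB u_ v.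
Proof.
move=> su_ su sv uv; apply: seq_eq_cvg => n.
have e : {ae (@leb2 R), forall x, B x -> u_ n x - u x = u_ n x - v x}.
  by apply: (aeS _ uv) => x h Bx; rewrite h.
have m1 := sqB_meas (@sqintB _ _ _ (@leb2 R) B mB _ _ (su_ n) su).
have m2 := sqB_meas (@sqintB _ _ _ (@leb2 R) B mB _ _ (su_ n) sv).
exact: (@ip_ae_eq _ _ _ (@leb2 R) B mB).
Qed.

Lemma test_limit_ae u v G H : test_limit u G -> sq v ->
  sq (fst_grad H) -> sq (snd_grad H) ->
  {ae (@leb2 R), forall x, B x -> u x = v x} ->
  {ae (@leb2 R), forall x, B x -> (G x).1 = (H x).1} ->
  {ae (@leb2 R), forall x, B x -> (G x).2 = (H x).2} -> test_limit v H.
Proof.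
move=> [su s1 s2 [phi [tphi c0 c1 c2]]] sv t1 t2 e0 e1 e2.
split => //; exists phi; split => //.
- by apply: (cvgB_ae _ su sv e0 c0) => n; exact: test_sq.
- by apply: (cvgB_ae _ s1 t1 e1 c1) => n; exact/test_sq/test_dx.
- by apply: (cvgB_ae _ s2 t2 e2 c2) => n; exact/test_sq/test_dy.
Qed.

Lemma weak_grad_grad u : (exists G, weak_grad u G) -> weak_grad u (grad u).
Proof. by move=> [G h]; rewrite /grad; case: xgetP => [H _|/(_ G)]. Qed.

Lemma integral_enorm_sqr (G H : R * R -> R * R) :
  sq (fst_grad G) -> sq (snd_grad G) -> sq (fst_grad H) -> sq (snd_grad H) ->
  (\int[@leb2 R]_(x in B) (enorm ((G x).1 - (H x).1, (G x).2 - (H x).2) ^+ 2)%:E)%E =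
  (ipB (fun x => fst_grad G x - fst_grad H x) (fun x => fst_grad G x - fst_grad H x) +
   ipB (fun x => snd_grad G x - snd_grad H x) (fun x => snd_grad G x - snd_grad H x))%:E.
Proof.
move=> s1 s2 t1 t2.
have q1 := @sqintB _ _ _ (@leb2 R) B mB _ _ s1 t1.
have q2 := @sqintB _ _ _ (@leb2 R) B mB _ _ s2 t2.
rewrite EFinD -!(@integral_sqr_EFin _ _ _ (@leb2 R) B mB)//.
rewrite -integralD//; [|exact: (proj2 q1)|exact: (proj2 q2)].
by apply: eq_integral => x _; rewrite enorm_sqr.
Qed.

Lemma H10_test_limit u : H10 u -> test_limit u (grad u).
Proof.
move=> [[su Gex] [phi [tphi c0 c1]]].
have /weak_gradP[s1 s2 _] := weak_grad_grad Gex.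
split => //; exists phi.
have sp n := test_sq (tphi n).
have sp1 n := test_sq (test_dx (tphi n)); have sp2 n := test_sq (test_dy (tphi n)).
have hs : ipB (fun x => dx (phi n) x - fst_grad (grad u) x) (fun x => dx (phi n) x - fst_grad (grad u) x) +
    ipB (fun x => dy (phi n) x - snd_grad (grad u) x) (fun x => dy (phi n) x - snd_grad (grad u) x)
    @[n --> \oo] --> (0 : R).
  apply: seq_EFin_cvg; apply: seq_eq_cvg c1 => n.
  exact: (@integral_enorm_sqr (fun x => (dx (phi n) x, dy (phi n) x)) _ (sp1 n) (sp2 n) s1 s2).
split => //.
- exact/(@cvgL2P _ _ _ (@leb2 R) B mB).
- by apply: cvgB_sub hs => n; rewrite lerDl (@ip_ge0 _ _ _ (@leb2 R) B).
- by apply: cvgB_sub hs => n; rewrite lerDr (@ip_ge0 _ _ _ (@leb2 R) B).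
Qed.

(** The field is a weak gradient, because integration by parts passes to the limit; by uniqueness it
    agrees almost everywhere with [grad u], for which the same approximating sequence then works. *)
Lemma test_limit_H10 u G : test_limit u G -> H10 u /\
  {ae (@leb2 R), forall x, B x -> (grad u x).1 = (G x).1} /\
  {ae (@leb2 R), forall x, B x -> (grad u x).2 = (G x).2}.
Proof.
move=> tl; have w := test_limit_weak tl.
have w' := weak_grad_grad (ex_intro _ G w).
have [e1 e2] := weak_grad_unique w w'.
have /weak_gradP[s1 s2 _] := w'.
have su : sq u by case: tl.
have ae0 : {ae (@leb2 R), forall x, B x -> u x = u x} by exact: aeT.
have [_ _ _ [phi [tphi c0 c1 c2]]] := test_limit_ae tl su s1 s2 ae0 e1 e2.
split; last first.
  by split; [apply: (aeS _ e1)|apply: (aeS _ e2)] => x h Bx; rewrite h.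
split; first by split => //; exists G.
exists phi; split => //.
- by apply/(@cvgL2P _ _ _ (@leb2 R) B mB) => // n; exact: test_sq.
have -> : (fun n => (\int[@leb2 R]_(x in B) (enorm (dx (phi n) x - (grad u x).1,
   dy (phi n) x - (grad u x).2) ^+ 2)%:E)%E) = fun n =>
   (ipB (fun x => dx (phi n) x - fst_grad (grad u) x) (fun x => dx (phi n) x - fst_grad (grad u) x) +
    ipB (fun x => dy (phi n) x - snd_grad (grad u) x) (fun x => dy (phi n) x - snd_grad (grad u) x))%:E.
  apply/funext => n.
  exact: (@integral_enorm_sqr (fun x => (dx (phi n) x, dy (phi n) x)) _
    (test_sq (test_dx (tphi n))) (test_sq (test_dy (tphi n))) s1 s2).
apply: seq_cvg_EFin; rewrite -[X in _ --> X]addr0; exact: cvgD.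
Qed.

Lemma test_limit_test phi : test_fun phi -> test_limit phi (fun x => (dx phi x, dy phi x)).
Proof.
move=> t; split; [exact: test_sq|exact/test_sq/test_dx|exact/test_sq/test_dy|].
have z (f : R * R -> R) : cvgLB (fun=> f) f.
  rewrite /cvgL2 /ip; under eq_fun do under eq_Rintegral do rewrite subrr mul0r.
  by under eq_fun do rewrite Rintegral_cst// mul0r; exact: cvg_cst.
by exists (fun=> phi); split.
Qed.

Lemma test_limitD u v G H : test_limit u G -> test_limit v H ->
  test_limit (fun x => u x + v x) (fun x => ((G x).1 + (H x).1, (G x).2 + (H x).2)).
Proof.
have cD (u_ v_ : nat -> R * R -> R) f g : (forall n, sq (u_ n)) -> (forall n, sq (v_ n)) ->
    sq f -> sq g -> cvgLB u_ f -> cvgLB v_ g -> cvgLB (fun n x => u_ n x + v_ n x) (fun x => f x + g x).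
  move=> su sv sf sg uf vg.
  apply: (@cvgB_sub _ _ (fun n => 2 * ipB (fun x => u_ n x - f x) (fun x => u_ n x - f x) +
     2 * ipB (fun x => v_ n x - g x) (fun x => v_ n x - g x))).
    move=> n; have -> : (fun x => u_ n x + v_ n x - (f x + g x)) =
       fun x => (u_ n x - f x) + (v_ n x - g x) by apply/funext => x; ring.
    have s1 := @sqintB _ _ _ (@leb2 R) B mB _ _ (su n) sf.
    have s2 := @sqintB _ _ _ (@leb2 R) B mB _ _ (sv n) sg.
    exact: (@ip_sqrD_le _ _ _ (@leb2 R) B mB _ _ s1 s2).
  rewrite [X in _ --> X](_ : _ = 2 * 0 + 2 * 0); last by ring.
  by apply: cvgD; apply: cvgM => //; exact: cvg_cst.
move=> [su s1 s2 [phi [tphi c0 c1 c2]]] [sv t1 t2 [psi [tpsi d0 d1 d2]]].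
split; [exact: (@sqintD _ _ _ (@leb2 R) B mB)|exact: (@sqintD _ _ _ (@leb2 R) B mB)|
  exact: (@sqintD _ _ _ (@leb2 R) B mB)|].
exists (fun n x => phi n x + psi n x); split.
- by move=> n; exact: testD.
- by apply: cD => // n; exact: test_sq.
- rewrite (_ : (fun n => _) = fun n x => dx (phi n) x + dx (psi n) x).
    by apply: cD => // n; exact/test_sq/test_dx.
  by apply/funext => n; exact: dxD.
- rewrite (_ : (fun n => _) = fun n x => dy (phi n) x + dy (psi n) x).
    by apply: cD => // n; exact/test_sq/test_dy.
  by apply/funext => n; exact: dyD.
Qed.

Lemma test_limitZ a u G : test_limit u G ->
  test_limit (fun x => a * u x) (fun x => (a * (G x).1, a * (G x).2)).
Proof.
have cZ (u_ : nat -> R * R -> R) f : (forall n, sq (u_ n)) ->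
    sq f -> cvgLB u_ f -> cvgLB (fun n x => a * u_ n x) (fun x => a * f x).
  move=> su sf uf; rewrite /cvgL2.
  have -> : (fun n => ipB (fun x => a * u_ n x - a * f x) (fun x => a * u_ n x - a * f x)) =
     fun n => a ^+ 2 * ipB (fun x => u_ n x - f x) (fun x => u_ n x - f x).
    apply/funext => n; rewrite -(@ip_sqrZ _ _ _ (@leb2 R) B mB).
      by apply: eq_Rintegral => x _; rewrite -!mulrBr.
    exact: (@sqintB _ _ _ (@leb2 R) B mB).
  by rewrite -[X in _ --> X](mulr0 (a ^+ 2)); apply: cvgM => //; exact: cvg_cst.
move=> [su s1 s2 [phi [tphi c0 c1 c2]]].
split; [exact: (@sqintZ _ _ _ (@leb2 R) B mB)|exact: (@sqintZ _ _ _ (@leb2 R) B mB)|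
  exact: (@sqintZ _ _ _ (@leb2 R) B mB)|].
exists (fun n x => a * phi n x); split.
- by move=> n; exact: testZ.
- by apply: cZ => // n; exact: test_sq.
- rewrite (_ : (fun n => _) = fun n x => a * dx (phi n) x).
    by apply: cZ => // n; exact/test_sq/test_dx.
  by apply/funext => n; exact: dxZ.
- rewrite (_ : (fun n => _) = fun n x => a * dy (phi n) x).
    by apply: cZ => // n; exact/test_sq/test_dy.
  by apply/funext => n; exact: dyZ.
Qed.

(** Diagonal argument: for each n, a test function within 1/(n+1) of the n-th pair in all three
    squared L^2 distances. *)
Lemma test_limit_lim (u_ : nat -> R * R -> R) (G_ : nat -> R * R -> R * R) u G :
  (forall n, test_limit (u_ n) (G_ n)) -> sq u -> sq (fst_grad G) -> sq (snd_grad G) ->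
  cvgLB u_ u -> cvgLB (fun n => fst_grad (G_ n)) (fst_grad G) ->
  cvgLB (fun n => snd_grad (G_ n)) (snd_grad G) -> test_limit u G.
Proof.
move=> tl su s1 s2 c0 c1 c2; split => //.
have ex n : exists phi, [/\ test_fun phi,
    ipB (fun x => phi x - u_ n x) (fun x => phi x - u_ n x) <= n.+1%:R^-1,
    ipB (fun x => dx phi x - fst_grad (G_ n) x) (fun x => dx phi x - fst_grad (G_ n) x) <= n.+1%:R^-1 &
    ipB (fun x => dy phi x - snd_grad (G_ n) x) (fun x => dy phi x - snd_grad (G_ n) x) <= n.+1%:R^-1].
  have [_ _ _ [phi [tphi e0 e1 e2]]] := tl n.
  have n0 : 0 < n.+1%:R^-1 :> R by rewrite invr_gt0 ltr0n.
  have [m [h0 h1 h2]] : exists m, [/\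
      ipB (fun x => phi m x - u_ n x) (fun x => phi m x - u_ n x) <= n.+1%:R^-1,
      ipB (fun x => dx (phi m) x - fst_grad (G_ n) x) (fun x => dx (phi m) x - fst_grad (G_ n) x) <= n.+1%:R^-1 &
      ipB (fun x => dy (phi m) x - snd_grad (G_ n) x) (fun x => dy (phi m) x - snd_grad (G_ n) x) <= n.+1%:R^-1].
    exact: (seq_near3 (cvgr_le 0 e0 _ n0) (cvgr_le 0 e1 _ n0) (cvgr_le 0 e2 _ n0)).
  by exists (phi m).
have [phi Hphi] := choice ex.
have sp n : sq (phi n) by have [/test_sq] := Hphi n.
have sp1 n : sq (dx (phi n)) by have [/test_dx/test_sq] := Hphi n.
have sp2 n : sq (dy (phi n)) by have [/test_dy/test_sq] := Hphi n.
have main (p v_ : nat -> R * R -> R) v : (forall n, sq (p n)) -> (forall n, sq (v_ n)) -> sq v ->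
    (forall n, ipB (fun x => p n x - v_ n x) (fun x => p n x - v_ n x) <= n.+1%:R^-1) ->
    cvgLB v_ v -> cvgLB p v.
  move=> sq_p sq_v sv h cv.
  apply: (@cvgB_sub _ _ (fun n => 2 * n.+1%:R^-1 +
     2 * ipB (fun x => v_ n x - v x) (fun x => v_ n x - v x))).
    move=> n; apply: le_trans (ipB_sqr_le2 (sq_p n) (sq_v n) sv) _.
    by rewrite lerD2r ler_pM2l.
  rewrite [X in _ --> X](_ : _ = 2 * 0 + 2 * 0); last by ring.
  apply: cvgD; apply: cvgM => //; [exact: cvg_cst|exact: cvg_harmonic|exact: cvg_cst].
exists phi; split.
- by move=> n; have [] := Hphi n.
- by apply: (main _ u_) => // n; [have [] := tl n|have [] := Hphi n].
- by apply: (main _ (fun n => fst_grad (G_ n))) => // n; [have [] := tl n|have [] := Hphi n].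
- by apply: (main _ (fun n => snd_grad (G_ n))) => // n; [have [] := tl n|have [] := Hphi n].
Qed.

End Sobolev.

(** * The Dirichlet inner product and the Poincare inequality *)

Section Energy.
Context {R : realType}.
Implicit Types (phi psi u v w : R * R -> R) (G H : R * R -> R * R).

Notation sq := (sqint (@leb2 R) B).
Notation ipB := (ip (@leb2 R) B).
Notation cvgLB := (cvgL2 (@leb2 R) B).
Let mB := @measurable_B R.
Let Bfin := @leb2_B_lty R.

Definition sqG G := sq (fst_grad G) /\ sq (snd_grad G).

Lemma test_limit_sqG u G : test_limit u G -> sqG G.
Proof. by case. Qed.

Lemma ipG_ge0 G : 0 <= ipG G G.
Proof. by rewrite addr_ge0// (@ip_ge0 _ _ _ (@leb2 R) B). Qed.

Lemma ipG_CS G H : sqG G -> sqG H ->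
  `|ipG G H| <= Num.sqrt (ipG G G) * Num.sqrt (ipG H H).
Proof.
move=> [s1 s2] [t1 t2]; rewrite -sqrtrM ?ipG_ge0// -sqrtr_sqr ler_sqrt; last first.
  by rewrite mulr_ge0 ?ipG_ge0.
have h1 := @ip_CS _ _ _ (@leb2 R) B mB _ _ s1 t1.
have h2 := @ip_CS _ _ _ (@leb2 R) B mB _ _ s2 t2.
have a0 := @ip_ge0 _ _ _ (@leb2 R) B (fst_grad G).
have b0 := @ip_ge0 _ _ _ (@leb2 R) B (snd_grad G).
have c0 := @ip_ge0 _ _ _ (@leb2 R) B (fst_grad H).
have d0 := @ip_ge0 _ _ _ (@leb2 R) B (snd_grad H).
rewrite /ipG; move: h1 h2 a0 b0 c0 d0.
set p := ipB (fst_grad G) (fst_grad H); set q := ipB (snd_grad G) (snd_grad H).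
set a := ipB (fst_grad G) _; set b := ipB (snd_grad G) _.
set c := ipB (fst_grad H) _; set d := ipB (snd_grad H) _ => h1 h2 a0 b0 c0 d0.
(* The cross term of (p + q)^2 <= (a + b)(c + d): by the arithmetic-geometric mean inequality, (2 p
   q)^2 <= 4 (a d)(b c) <= (a d + b c)^2. *)
have ad : 2 * (p * q) <= a * d + b * c.
  have sq0 : (2 * (p * q)) ^+ 2 <= (a * d + b * c) ^+ 2.
    have : p ^+ 2 * q ^+ 2 <= (a * c) * (b * d) by apply: ler_pM; rewrite ?sqr_ge0.
    have := sqr_ge0 (a * d - b * c); lra.
  have s0 : 0 <= a * d + b * c by rewrite addr_ge0 ?mulr_ge0.
  have := ler_norm (2 * (p * q)); move=> /le_trans; apply.
  by rewrite -(ler_pXn2r (ltn0Sn 1)) ?nnegrE// real_normK// num_real.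
lra.
Qed.

Definition addG G H := fun x => ((G x).1 + (H x).1, (G x).2 + (H x).2).
Definition scaleG (a : R) G := fun x => (a * (G x).1, a * (G x).2).

Lemma sqG_add G H : sqG G -> sqG H -> sqG (addG G H).
Proof. by move=> [? ?] [? ?]; split; exact: (@sqintD _ _ _ (@leb2 R) B mB). Qed.

Lemma sqG_scale a G : sqG G -> sqG (scaleG a G).
Proof. by move=> [? ?]; split; exact: (@sqintZ _ _ _ (@leb2 R) B mB). Qed.

Lemma ipG_addr G H W : sqG G -> sqG H -> sqG W -> ipG W (addG G H) = ipG W G + ipG W H.
Proof.
move=> [? ?] [? ?] [? ?]; rewrite /ipG.
have -> : fst_grad (addG G H) = fun x => fst_grad G x + fst_grad H x by [].
have -> : snd_grad (addG G H) = fun x => snd_grad G x + snd_grad H x by [].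
by rewrite !(@ipDr _ _ _ (@leb2 R) B mB)//; ring.
Qed.

Lemma ipG_scaler a G W : sqG G -> sqG W -> ipG W (scaleG a G) = a * ipG W G.
Proof.
move=> [? ?] [? ?]; rewrite /ipG.
have -> : fst_grad (scaleG a G) = fun x => a * fst_grad G x by [].
have -> : snd_grad (scaleG a G) = fun x => a * snd_grad G x by [].
by rewrite !(@ipZr _ _ _ (@leb2 R) B mB)//; ring.
Qed.

Lemma ipGC G H : ipG G H = ipG H G.
Proof. by rewrite /ipG (@ipC _ _ _ (@leb2 R) B) (@ipC _ _ _ (@leb2 R) B (snd_grad G)). Qed.

Lemma ipG_sqr_add G H : sqG G -> sqG H ->
  ipG (addG G H) (addG G H) = ipG G G + 2 * ipG G H + ipG H H.
Proof.
move=> sG sH; have sGH := sqG_add sG sH.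
by rewrite ipG_addr// (ipGC (addG G H) G) (ipGC (addG G H) H) !ipG_addr// (ipGC H G); ring.
Qed.

Lemma ipG_ae G G' H H' : sqG G -> sqG G' -> sqG H -> sqG H' ->
  {ae (@leb2 R), forall x, B x -> (G x).1 = (G' x).1} ->
  {ae (@leb2 R), forall x, B x -> (G x).2 = (G' x).2} ->
  {ae (@leb2 R), forall x, B x -> (H x).1 = (H' x).1} ->
  {ae (@leb2 R), forall x, B x -> (H x).2 = (H' x).2} -> ipG G H = ipG G' H'.
Proof.
move=> [[s1 _] [s2 _]] [[s3 _] [s4 _]] [[s5 _] [s6 _]] [[s7 _] [s8 _]] e1 e2 e3 e4.
by congr (_ + _); exact: (@ip_ae_eq _ _ _ (@leb2 R) B mB).
Qed.

Lemma H10_sqG u : H10 u -> sqG (grad u).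
Proof. by move=> /H10_test_limit; exact: test_limit_sqG. Qed.

Lemma ipG_grad u v G H : test_limit u G -> test_limit v H ->
  ipG (grad u) (grad v) = ipG G H.
Proof.
move=> tu tv; have [hu [e1 e2]] := test_limit_H10 tu.
have [hv [e3 e4]] := test_limit_H10 tv.
by apply: ipG_ae => //; [exact: H10_sqG|exact: test_limit_sqG tu|exact: H10_sqG|
  exact: test_limit_sqG tv].
Qed.

Lemma dirichletE u : H10 u -> dirichlet u = ipG (grad u) (grad u).
Proof.
move=> hu; have [s1 s2] := H10_sqG hu.
rewrite /dirichlet /ipG /ip -RintegralD//; [|exact: (@sqint_mul _ _ _ (@leb2 R) B mB)..].
by apply: eq_Rintegral => x _; rewrite enorm_sqr !expr2.
Qed.

Lemma dirichlet_test_limit u G : test_limit u G -> dirichlet u = ipG G G.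
Proof.
move=> tu; have [hu _] := test_limit_H10 tu.
by rewrite dirichletE// (ipG_grad tu tu).
Qed.

Lemma dirichlet_ge0 u : 0 <= dirichlet u.
Proof. by apply: Rintegral_ge0 => x _; exact: sqr_ge0. Qed.

Lemma dnorm_ge0 u : 0 <= dnorm u. Proof. exact: sqrtr_ge0. Qed.

Lemma dnorm_sqr u : dnorm u ^+ 2 = dirichlet u.
Proof. by rewrite sqr_sqrtr// dirichlet_ge0. Qed.

Lemma H10D u v : H10 u -> H10 v -> H10 (u + v).
Proof.
by move=> /H10_test_limit tu /H10_test_limit tv; have [] := test_limit_H10 (test_limitD tu tv).
Qed.

Lemma H10Z a u : H10 u -> H10 (a *: u).
Proof.
by move=> /H10_test_limit tu; have [] := test_limit_H10 (test_limitZ a tu).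
Qed.

Lemma dirichletD u v : H10 u -> H10 v ->
  dirichlet (u + v) = dirichlet u + 2 * ipG (grad u) (grad v) + dirichlet v.
Proof.
move=> hu hv; have tu := H10_test_limit hu; have tv := H10_test_limit hv.
rewrite (dirichlet_test_limit (test_limitD tu tv)).
by rewrite -/(addG (grad u) (grad v)) ipG_sqr_add ?(dirichletE hu) ?(dirichletE hv)//;
  exact: H10_sqG.
Qed.

Lemma H10_CS u v : H10 u -> H10 v -> `|ipG (grad u) (grad v)| <= dnorm u * dnorm v.
Proof.
by move=> hu hv; rewrite /dnorm (dirichletE hu) (dirichletE hv); apply: ipG_CS; exact: H10_sqG.
Qed.

Lemma dnormD u v : H10 u -> H10 v -> dnorm (u + v) <= dnorm u + dnorm v.
Proof.
move=> hu hv.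
rewrite -(ler_pXn2r (ltn0Sn 1)) ?nnegrE ?addr_ge0 ?dnorm_ge0// dnorm_sqr dirichletD//.
have := le_trans (ler_norm _) (H10_CS hu hv).
by rewrite -(dnorm_sqr u) -(dnorm_sqr v); move: (dnorm u) (dnorm v) (ipG _ _) => a b c; lra.
Qed.

Lemma dirichletZ a u : H10 u -> dirichlet (a *: u) = a ^+ 2 * dirichlet u.
Proof.
move=> hu; have tu := H10_test_limit hu.
rewrite (dirichlet_test_limit (test_limitZ a tu)) -/(scaleG a (grad u)).
have s := H10_sqG hu; have s' := sqG_scale a s.
by rewrite ipG_scaler// (ipGC (scaleG a (grad u))) ipG_scaler// (dirichletE hu); ring.
Qed.

Lemma dnormZ a u : H10 u -> dnorm (a *: u) = `|a| * dnorm u.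
Proof.
by move=> hu; rewrite /dnorm dirichletZ// sqrtrM ?sqr_ge0// sqrtr_sqr.
Qed.

Definition areaB : R := fine (@leb2 R B).

Lemma sq_cst (a : R) : sq (fun=> a).
Proof.
by apply: (@sqint_bounded _ _ _ (@leb2 R) B mB `|a|) => //; exact: Bfin.
Qed.

Lemma ip_cst1 : ipB (fun=> 1) (fun=> 1) = areaB.
Proof. by rewrite /ip Rintegral_cst// mulr1 mul1r. Qed.

Lemma areaB_ge0 : 0 <= areaB. Proof. by rewrite fine_ge0. Qed.

Lemma sq_abs u : sq u -> sq (fun x => `|u x|).
Proof.
move=> su; apply: (@sqint_le _ _ _ (@leb2 R) B mB _ u) => //.
  by apply: measurableT_comp => //; exact: sqB_meas.
by move=> x _; rewrite normr_id.
Qed.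

Lemma ip_abs u : ipB (fun x => `|u x|) (fun x => `|u x|) = ipB u u.
Proof. by apply: eq_Rintegral => x _; rewrite -normrM -expr2 ger0_norm// sqr_ge0. Qed.

Lemma integral_abs_le u v w : sq u -> sq v -> (forall x, B x -> `|w x| <= u x * v x) ->
  measurable_fun B w ->
  Rintegral (@leb2 R) B (fun x => `|w x|) <= Num.sqrt (ipB u u) * Num.sqrt (ipB v v).
Proof.
move=> su sv h mw.
apply: le_trans (le_trans (ler_norm _) (@ip_CS_sqrt _ _ _ (@leb2 R) B mB _ _ su sv)).
apply: le_Rintegral => //.
- have iuv := @sqint_mul _ _ _ (@leb2 R) B mB _ _ su sv.
  apply: (@le_integrable_real _ _ _ (@leb2 R) B mB _ (fun x => u x * v x)) => //.
  + by apply: measurableT_comp.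
  + by move=> x Bx; rewrite normr_id; exact: h.
- exact: (@sqint_mul _ _ _ (@leb2 R) B mB).
Qed.

Lemma sqrt_mul_le (a b : R) : 0 <= a -> 0 <= b -> 2 * (Num.sqrt a * Num.sqrt b) <= a + b.
Proof.
move=> a0 b0; have := sqr_ge0 (Num.sqrt a - Num.sqrt b).
by rewrite sqrrB !sqr_sqrtr// mulr2n; lra.
Qed.

(** Cauchy-Schwarz against the constant 1 turns each L^1 norm in the Gagliardo-Nirenberg inequality
    into sqrt(area) times an L^2 norm. *)
Lemma poincare_test phi : test_fun phi ->
  ipB phi phi <= areaB * ipG (fun x => (dx phi x, dy phi x)) (fun x => (dx phi x, dy phi x)).
Proof.
move=> t; have sx := test_sq (test_dx t); have sy := test_sq (test_dy t).
have := @gagliardo_nirenberg R phi _ _ (test_cont t) (test_cont (test_dx t))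
  (test_cont (test_dy t)) (test_derive1 t) (test_derive2 t) (fun z => @test_outB _ _ z t).
have s1 := sq_cst 1.
have h (g : R * R -> R) : sq g -> Rintegral (@leb2 R) B (fun x => `|g x|) <=
    Num.sqrt areaB * Num.sqrt (ipB g g).
  move=> sg; rewrite -ip_cst1 -(ip_abs g); apply: integral_abs_le => //.
  - exact: sq_abs.
  - by move=> x _; rewrite mul1r.
  - exact: sqB_meas.
rewrite [X in X <= _](_ : _ = ipB phi phi); last by apply: eq_Rintegral => x _; rewrite expr2.
move=> /le_trans; apply.
apply: (@le_trans _ _ (Num.sqrt areaB * Num.sqrt (ipB (dx phi) (dx phi)) *
   (Num.sqrt areaB * Num.sqrt (ipB (dy phi) (dy phi))))).
  by apply: ler_pM; rewrite ?h// Rintegral_ge0.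
rewrite mulrACA -expr2 sqr_sqrtr ?areaB_ge0// ler_wpM2l ?areaB_ge0//.
have a0 := @ip_ge0 _ _ _ (@leb2 R) B (dx phi).
have b0 := @ip_ge0 _ _ _ (@leb2 R) B (dy phi).
apply: le_trans (sqrt_mul_le a0 b0).
by rewrite ler_peMl ?mulr_ge0 ?sqrtr_ge0// ler1n.
Qed.

Lemma poincare u : H10 u -> ipB u u <= areaB * dirichlet u.
Proof.
move=> hu; have tu := H10_test_limit hu; have [su s1 s2 [phi [tphi c0 c1 c2]]] := tu.
have h0 := ipB_cvg_sqr (fun n => test_sq (tphi n)) su c0.
have h1 := ipB_cvg_sqr (fun n => test_sq (test_dx (tphi n))) s1 c1.
have h2 := ipB_cvg_sqr (fun n => test_sq (test_dy (tphi n))) s2 c2.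
rewrite dirichletE//.
have h3 : areaB * (ipB (dx (phi n)) (dx (phi n)) + ipB (dy (phi n)) (dy (phi n))) @[n --> \oo]
    --> areaB * ipG (grad u) (grad u).
  by apply: cvgM; [exact: cvg_cst|exact: cvgD].
apply: (ler_cvg_to h0 h3); apply: nearW => n; exact: poincare_test.
Qed.

End Energy.

(** * A C^1 truncation between two levels *)

Section Ramp.
Context {R : realType}.

(** The squared positive part is C^1, whereas the positive part is not; [gagliardo_nirenberg] asks
    for continuous partial derivatives. *)
Definition pos2 (s : R) := Num.max s 0 ^+ 2.

Lemma is_derive_pos2 (s : R) : is_derive s (1 : R) pos2 (2 * Num.max s 0).
Proof.
have [s0|s0|->] := ltgtP s 0.
- rewrite mulr0; apply: (near_eq_is_derive _ (is_derive_cst (0 : R) s 1)).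
  near=> t; rewrite /pos2 max_r ?expr0n//; near: t.
  by apply: filterS (lt_nbhsl s0) => t /ltW.
- have h : is_derive s (1 : R) (fun t : R => t ^+ 2) (2 * s).
    have -> : (fun t : R => t ^+ 2) = id ^+ 2 by apply/funext => t; rewrite exprfctE.
    apply: (is_derive_eq (@is_deriveX _ _ id 2 s 1 1 (is_derive_id _ _))).
    by rewrite /GRing.scale/= mulr1 expr1.
  apply: (near_eq_is_derive _ h).
  near=> t; rewrite /pos2 max_l//; apply: ltW; near: t; exact: lt_nbhsr.
- rewrite mulr0; apply: (@is_derive_quadratic _ _ 1) => h.
  rewrite mul1r ger0_norm ?sqr_ge0// /pos2; have [h0|h0] := leP h 0.
    by rewrite expr0n sqr_ge0.
  by [].
Unshelve. all: end_near. Qed.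

Lemma is_derive_shift (F : R -> R) (a s d : R) :
  is_derive (s - a) (1 : R) F d -> is_derive s (1 : R) (fun t => F (t - a)) d.
Proof.
move=> h; have h1 : is_derive s (1 : R) (fun t : R => t - a) 1.
  apply: (is_derive_eq (is_deriveB (is_derive_id s 1) (is_derive_cst a s 1))).
  by rewrite subr0.
apply: (is_derive_eq (@is_derive1_comp _ F (fun t => t - a) s _ _ h h1)).
by rewrite mulr1.
Qed.

Variables a b : R.

(* A C^1 ramp from 0 on ]-oo, a] to (b - a)^2 / 2 on [b, +oo[, with slope at most b - a. *)
Definition ramp (s : R) := pos2 (s - a) - 2 * pos2 (s - (a + b) / 2) + pos2 (s - b).
Definition ramp1 (s : R) := 2 * Num.max (s - a) 0 - 4 * Num.max (s - (a + b) / 2) 0 +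
  2 * Num.max (s - b) 0.

Lemma is_derive_ramp (s : R) : is_derive s (1 : R) ramp (ramp1 s).
Proof.
have h1 := is_derive_shift (is_derive_pos2 (s - a)).
have h2 := is_deriveZ 2 (is_derive_shift (is_derive_pos2 (s - (a + b) / 2))).
have h3 := is_derive_shift (is_derive_pos2 (s - b)).
apply: (is_derive_eq (is_deriveD (is_deriveB h1 h2) h3)).
by rewrite /ramp1 /GRing.scale/=; ring.
Qed.

Lemma continuous_max0 (c : R) : continuous (fun s : R => Num.max (s - c) 0).
Proof.
move=> s; apply: (@continuous_max _ _ (fun s => s - c) (cst 0)).
  by apply: cvgB; [exact: cvg_id|exact: cvg_cst].
exact: cvg_cst.
Qed.

Lemma continuous_ramp1 : continuous ramp1.
Proof.
move=> s; apply: cvgD; first apply: cvgB.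
- by apply: cvgM; [exact: cvg_cst|exact: continuous_max0].
- by apply: cvgM; [exact: cvg_cst|exact: continuous_max0].
- by apply: cvgM; [exact: cvg_cst|exact: continuous_max0].
Qed.

Lemma ramp_le s : a <= b -> s <= a -> ramp s = 0.
Proof.
move=> ab sa; have e1 : Num.max (s - a) 0 = 0 by apply: max_r; lra.
have e2 : Num.max (s - (a + b) / 2) 0 = 0 by apply: max_r; lra.
have e3 : Num.max (s - b) 0 = 0 by apply: max_r; lra.
by rewrite /ramp /pos2 e1 e2 e3; ring.
Qed.

Lemma ramp_ge s : a <= b -> b <= s -> ramp s = (b - a) ^+ 2 / 2.
Proof.
move=> ab bs; have e1 : Num.max (s - a) 0 = s - a by apply: max_l; lra.
have e2 : Num.max (s - (a + b) / 2) 0 = s - (a + b) / 2 by apply: max_l; lra.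
have e3 : Num.max (s - b) 0 = s - b by apply: max_l; lra.
by rewrite /ramp /pos2 e1 e2 e3; field.
Qed.

Lemma ramp1_bound s : a <= b -> `|ramp1 s| <= (b - a) * (if (a < s) && (s < b) then 1 else 0).
Proof.
move=> ab; rewrite /ramp1; have [sa|sa] := leP s a => /=.
  have e1 : Num.max (s - a) 0 = 0 by apply: max_r; lra.
  have e2 : Num.max (s - (a + b) / 2) 0 = 0 by apply: max_r; lra.
  have e3 : Num.max (s - b) 0 = 0 by apply: max_r; lra.
  by rewrite e1 e2 e3 !mulr0 subr0 addr0 normr0.
have e1 : Num.max (s - a) 0 = s - a by apply: max_l; lra.
have [bs|bs] := leP b s => /=.
  have e2 : Num.max (s - (a + b) / 2) 0 = s - (a + b) / 2 by apply: max_l; lra.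
  have e3 : Num.max (s - b) 0 = s - b by apply: max_l; lra.
  by rewrite e1 e2 e3 mulr0 normr_le0; apply/eqP; field.
have e3 : Num.max (s - b) 0 = 0 by apply: max_r; lra.
rewrite mulr1 e1 e3; have [h|h] := leP (s - (a + b) / 2) 0.
  by rewrite ger0_norm; lra.
by rewrite ger0_norm; lra.
Qed.

End Ramp.

(** * Area above a level and energy between two levels *)

Section Tail.
Context {R : realType}.
Implicit Types (phi psi u v w : R * R -> R) (G H : R * R -> R * R).

Notation sq := (sqint (@leb2 R) B).
Notation ipB := (ip (@leb2 R) B).
Notation cvgLB := (cvgL2 (@leb2 R) B).
Let mB := @measurable_B R.
Let Bfin := @leb2_B_lty R.

Definition upper (s : R) u := fun x => if s <= u x then 1 else 0 : R.
Definition layer (a b : R) u g := fun x => if (a < u x) && (u x < b) then g x else 0 : R.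
Definition lower (b : R) u g := fun x => if u x < b then g x else 0 : R.

Lemma measurable_if (P : R * R -> bool) u v : measurable_fun B P ->
  measurable_fun B u -> measurable_fun B v -> measurable_fun B (fun x => if P x then u x else v x).
Proof.
move=> mP mu mv.
apply: (measurable_fun_if mB mP).
- by apply: measurable_funS mu => // x [].
- by apply: measurable_funS mv => // x [].
Qed.

Lemma sq_if (P : R * R -> bool) u : measurable_fun B P -> sq u ->
  sq (fun x => if P x then u x else 0).
Proof.
move=> mP su; apply: (@sqint_le _ _ _ (@leb2 R) B mB _ u) => //.
  by apply: measurable_if => //; exact: sqB_meas.
by move=> x _; case: ifP => // _; rewrite normr0.
Qed.

Lemma sq_upper s u : measurable_fun B u -> sq (upper s u).
Proof. by move=> mu; apply: sq_if (sq_cst 1); exact: measurable_fun_ler. Qed.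

Lemma sq_layer a b u g : measurable_fun B u -> sq g -> sq (layer a b u g).
Proof.
by move=> mu; apply: sq_if; apply: measurable_and; exact: measurable_fun_ltr.
Qed.

Lemma sq_lower b u g : measurable_fun B u -> sq g -> sq (lower b u g).
Proof. by move=> mu; apply: sq_if; exact: measurable_fun_ltr. Qed.

(** The area of the part of B where u >= s, written as an inner product so that comparison and
    scaling of [ip] apply to it. *)
Definition area_upper (s : R) u := ipB (upper s u) (upper s u).

Lemma area_upper_ge0 s u : 0 <= area_upper s u.
Proof. exact: (@ip_ge0 _ _ _ (@leb2 R) B). Qed.

Lemma le_ip u v : sq u -> sq v -> (forall x, B x -> u x ^+ 2 <= v x ^+ 2) ->
  ipB u u <= ipB v v.
Proof.
move=> su sv h; apply: le_Rintegral => //.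
- exact: (@sqint_mul _ _ _ (@leb2 R) B mB).
- exact: (@sqint_mul _ _ _ (@leb2 R) B mB).
Qed.

Lemma area_upper_le s u : measurable_fun B u -> area_upper s u <= areaB.
Proof.
move=> mu; rewrite -ip_cst1; apply: le_ip; [exact: sq_upper|exact: sq_cst|].
by move=> x _; rewrite /upper; case: ifP => _; rewrite ?expr0n//= expr1n.
Qed.

(** The arithmetic of the layer estimate: h is the thickness of the layer, A and A' are the areas
    above its lower and upper level, I is the integral of the squared ramp, p and q are the L^2
    norms of the partial derivatives in the layer, Z is the energy there. *)
Lemma layer_algebra (h A A' I p q S Z : R) : 0 <= h -> 0 <= A -> S ^+ 2 = A -> 0 <= Z ->
  (h ^+ 2 / 2) ^+ 2 * A' <= I -> I <= h * (S * p) * (h * (S * q)) ->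
  2 * (p * q) <= Z -> h ^+ 2 * A' <= 2 * A * Z.
Proof.
move=> h0 A0 SA Z0 h1 h2 h3.
have [hz|hN] := eqVneq h 0; first by rewrite hz expr0n/= mul0r mulr_ge0// mulr_ge0.
have hp : 0 < h ^+ 2 by rewrite exprn_gt0// lt_neqAle eq_sym hN.
rewrite -(ler_pM2l hp); have h4 := le_trans h1 h2.
have h5 : 2 * (h ^+ 2 * A) * (2 * (p * q)) <= 2 * (h ^+ 2 * A) * Z.
  by rewrite ler_wpM2l// mulr_ge0// mulr_ge0// ltW.
have e1 : h ^+ 2 * (h ^+ 2 * A') = 4 * ((h ^+ 2 / 2) ^+ 2 * A') by field.
have e2 : 4 * (h * (S * p) * (h * (S * q))) = 2 * (h ^+ 2 * A) * (2 * (p * q)).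
  by rewrite -SA; ring.
have e3 : h ^+ 2 * (2 * A * Z) = 2 * (h ^+ 2 * A) * Z by ring.
by rewrite e1 e3; apply: le_trans h5; rewrite -e2 ler_pM2l.
Qed.

(** Gagliardo-Nirenberg is applied to the ramp of [phi]. Its left side is at least ((b - a)^2 / 2)^2
    times the area above b; on the right the gradient lives where a < phi < b, and Cauchy-Schwarz
    costs one factor sqrt(area above a) for each partial derivative. *)
Lemma layer_estimate phi a b : test_fun phi -> 0 <= a -> a <= b ->
  (b - a) ^+ 2 * area_upper b phi <= 2 * area_upper a phi *
    (ipB (layer a b phi (dx phi)) (layer a b phi (dx phi)) +
     ipB (layer a b phi (dy phi)) (layer a b phi (dy phi))).
Proof.
move=> t a0 ab; have cphi := test_cont t.
have mphi : measurable_fun B phi by exact: continuous_measurable2D.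
have cc (F : R -> R) : continuous F -> continuous (fun z => F (phi z)).
  by move=> cF z; apply: continuous_comp; [exact: cphi|exact: cF].
have cr : continuous (fun z => ramp a b (phi z)).
  by apply: cc; apply: continuous_is_derive; exact: is_derive_ramp.
have cr1 : continuous (fun z => ramp1 a b (phi z)) by apply: cc; exact: continuous_ramp1.
have c1 : continuous (fun z => ramp1 a b (phi z) * dx phi z).
  by move=> z; apply: cvgM; [exact: cr1|exact: (test_cont (test_dx t))].
have c2 : continuous (fun z => ramp1 a b (phi z) * dy phi z).
  by move=> z; apply: cvgM; [exact: cr1|exact: (test_cont (test_dy t))].
have d1 (z : R * R) : is_derive z ((1, 0) : R * R) (fun z => ramp a b (phi z)) (ramp1 a b (phi z) * dx phi z).
  case: z => x y; apply/is_derive_line1.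
  have h : is_derive x (1 : R) (fun t => phi (t, y)) (dx phi (x, y)).
    by apply/is_derive_line1; exact: test_derive1.
  exact: (@is_derive1_comp _ (ramp a b) (fun t => phi (t, y)) x _ _ (is_derive_ramp a b _) h).
have d2 (z : R * R) : is_derive z ((0, 1) : R * R) (fun z => ramp a b (phi z)) (ramp1 a b (phi z) * dy phi z).
  case: z => x y; apply/is_derive_line2.
  have h : is_derive y (1 : R) (fun t => phi (x, t)) (dy phi (x, y)).
    by apply/is_derive_line2; exact: test_derive2.
  exact: (@is_derive1_comp _ (ramp a b) (fun t => phi (x, t)) y _ _ (is_derive_ramp a b _) h).
have z0 z : ~ B z -> ramp a b (phi z) = 0.
  by move=> nB; rewrite (test_outB t nB) ramp_le.
have := gagliardo_nirenberg cr c1 c2 d1 d2 z0.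
have sa := sq_upper a mphi.
have bound (g : R * R -> R) : continuous (fun z => ramp1 a b (phi z) * g z) -> sq g ->
    Rintegral (@leb2 R) B (fun z => `|ramp1 a b (phi z) * g z|) <=
    (b - a) * (Num.sqrt (area_upper a phi) * Num.sqrt (ipB (layer a b phi g) (layer a b phi g))).
  move=> cg sg; have sl := sq_layer a b mphi sg.
  have sl' := sq_abs sl; have sb := @sqintZ _ _ _ (@leb2 R) B mB (b - a) _ sa.
  rewrite -(ip_abs (layer a b phi g)).
  have -> : (b - a) * (Num.sqrt (area_upper a phi) * Num.sqrt (ipB (fun x => `|layer a b phi g x|) (fun x => `|layer a b phi g x|))) =
     Num.sqrt (ipB (fun x => (b - a) * upper a phi x) (fun x => (b - a) * upper a phi x)) *
     Num.sqrt (ipB (fun x => `|layer a b phi g x|) (fun x => `|layer a b phi g x|)).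
    rewrite mulrA; congr (_ * _).
    by rewrite (@ip_sqrZ _ _ _ (@leb2 R) B mB)// sqrtrM ?sqr_ge0// sqrtr_sqr ger0_norm// subr_ge0.
  apply: integral_abs_le => //; last exact: continuous_measurable2D.
  move=> x Bx; rewrite normrM.
  have := ramp1_bound (phi x) ab => /(ler_wpM2r (normr_ge0 (g x))) /le_trans; apply.
  rewrite /upper /layer; have [h1|h1] /= := ltP a (phi x); last by rewrite mulr0 mul0r normr0 mulr0.
  by rewrite (ltW h1) !mulr1; case: ifP => _; rewrite ?mulr1// mulr0 mul0r mulr_ge0// subr_ge0.
have b1 := bound _ c1 (test_sq (test_dx t)); have b2 := bound _ c2 (test_sq (test_dy t)).
have n0 (g : R * R -> R) : 0 <= Rintegral (@leb2 R) B (fun z => `|g z|).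
  by apply: Rintegral_ge0.
move=> main; have := le_trans main (ler_pM (n0 _) (n0 _) b1 b2).
have l1 : ((b - a) ^+ 2 / 2) ^+ 2 * area_upper b phi <=
    Rintegral (@leb2 R) B (fun z => ramp a b (phi z) ^+ 2).
  rewrite [leRHS](_ : _ = ipB (fun z => ramp a b (phi z)) (fun z => ramp a b (phi z))); last first.
    by apply: eq_Rintegral => z _; rewrite expr2.
  have sub := sq_upper b mphi.
  rewrite -(@ip_sqrZ _ _ _ (@leb2 R) B mB)//; apply: le_ip.
  - exact: (@sqintZ _ _ _ (@leb2 R) B mB).
  - exact: cont_sq.
  - move=> x Bx; rewrite /upper; case: ifPn => h; last by rewrite mulr0 expr0n sqr_ge0.
    by rewrite ramp_ge// mulr1.
set X := ipB (layer a b phi (dx phi)) _; set Y := ipB (layer a b phi (dy phi)) _.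
have X0 : 0 <= X by exact: (@ip_ge0 _ _ _ (@leb2 R) B).
have Y0 : 0 <= Y by exact: (@ip_ge0 _ _ _ (@leb2 R) B).
move=> h2; apply: (layer_algebra _ (area_upper_ge0 a phi) (sqr_sqrtr (area_upper_ge0 a phi))
  (addr_ge0 X0 Y0) l1 h2 (sqrt_mul_le X0 Y0)).
by rewrite subr_ge0.
Qed.

End Tail.

(** * Exponential integrability with a gain in the energy *)

Section Trudinger.
Context {R : realType}.
Implicit Types (phi psi u v w : R * R -> R) (G H : R * R -> R * R).

Notation sq := (sqint (@leb2 R) B).
Notation ipB := (ip (@leb2 R) B).
Notation cvgLB := (cvgL2 (@leb2 R) B).
Let mB := @measurable_B R.
Let Bfin := @leb2_B_lty R.

(** The open layers are disjoint and all lie below the top level. *)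
Lemma layers_sum phi g (h : R) n : 0 <= h -> measurable_fun B phi -> sq g ->
  \sum_(j < n) ipB (layer (j%:R * h) (j.+1%:R * h) phi g)
    (layer (j%:R * h) (j.+1%:R * h) phi g) <=
  ipB (lower (n%:R * h) phi g) (lower (n%:R * h) phi g).
Proof.
move=> h0 mphi sg; elim: n => [|n IH].
  by rewrite big_ord0 (@ip_ge0 _ _ _ (@leb2 R) B).
rewrite big_ord_recr/=; apply: le_trans (lerD IH (lexx _)) _.
have s1 := sq_lower (n%:R * h) mphi sg.
have s2 := sq_lower (n.+1%:R * h) mphi sg.
have s3 := sq_layer (n%:R * h) (n.+1%:R * h) mphi sg.
have i1 := @sqint_mul _ _ _ (@leb2 R) B mB _ _ s1 s1.
have i2 := @sqint_mul _ _ _ (@leb2 R) B mB _ _ s2 s2.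
have i3 := @sqint_mul _ _ _ (@leb2 R) B mB _ _ s3 s3.
rewrite /ip -RintegralD//; apply: le_Rintegral => //.
  exact: (@integrableD _ _ _ (@leb2 R) B mB _ _ i1 i3).
move=> x Bx; rewrite /lower /layer.
have nh : n%:R * h <= n.+1%:R * h by rewrite ler_wpM2r// ler_nat.
have [h1|h1] := ltP (phi x) (n%:R * h).
  rewrite ltNge (ltW h1)/= (lt_le_trans h1 nh) mul0r addr0//.
by rewrite mul0r add0r; case: ltP => _ /=; case: ltP => _ /=; rewrite ?mul0r// -expr2 sqr_ge0.
Qed.

(** The layer estimates over n equal layers multiply, and the arithmetic-geometric mean inequality
    bounds the product of the layer energies by a power of their mean. With n proportional to the
    square of the level, this is a Gaussian tail. *)
Lemma tail_test phi n (h : R) : test_fun phi -> (0 < n)%N -> 0 < h ->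
  area_upper (n%:R * h) phi <= areaB *
    (2 * ipG (fun x => (dx phi x, dy phi x)) (fun x => (dx phi x, dy phi x)) / (n%:R * h ^+ 2)) ^+ n.
Proof.
move=> t n0 h0; have mphi : measurable_fun B phi by exact: (continuous_measurable2D (test_cont t)).
pose D (j : nat) := ipB (layer (j%:R * h) (j.+1%:R * h) phi (dx phi)) (layer (j%:R * h) (j.+1%:R * h) phi (dx phi)) +
  ipB (layer (j%:R * h) (j.+1%:R * h) phi (dy phi)) (layer (j%:R * h) (j.+1%:R * h) phi (dy phi)).
have D0 j : 0 <= D j by rewrite addr_ge0// (@ip_ge0 _ _ _ (@leb2 R) B).
have h2 : 0 < h ^+ 2 by rewrite exprn_gt0.
have step m : area_upper (m%:R * h) phi <= areaB * \prod_(j < m) (2 * D j / h ^+ 2).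
  elim: m => [|m IH]; first by rewrite big_ord0 mulr1; exact: area_upper_le.
  rewrite big_ord_recr/= mulrA.
  have := @layer_estimate R phi (m%:R * h) (m.+1%:R * h) t (mulr_ge0 (ler0n _ _) (ltW h0)).
  have -> : m.+1%:R * h - m%:R * h = h by rewrite -mulrBl -natrB// subSnn mul1r.
  rewrite -/(D m) => /(_ _); rewrite ler_wpM2r ?ler_nat ?(ltW h0)// => /(_ isT).
  rewrite -ler_pdivlMl// => /le_trans; apply.
  have -> : (h ^+ 2)^-1 * (2 * area_upper (m%:R * h) phi * D m) =
     area_upper (m%:R * h) phi * (2 * D m / h ^+ 2) by field; rewrite gt_eqF.
  by apply: ler_wpM2r => //; rewrite divr_ge0 ?(ltW h2)// mulr_ge0.
apply: le_trans (step n) _; apply: ler_wpM2l; first exact: areaB_ge0.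
have := @leif_AGM R 'I_n predT (fun j => 2 * D j / h ^+ 2).
rewrite cardT size_enum_ord => -[//|+ _].
  by move=> j _; rewrite divr_ge0 ?(ltW h2)// mulr_ge0.
move=> /le_trans; apply; apply: lerXn2r; rewrite ?nnegrE.
- by rewrite divr_ge0// sumr_ge0// => j _; rewrite divr_ge0 ?(ltW h2)// mulr_ge0.
- by apply: divr_ge0; apply: mulr_ge0 => //; [exact: ipG_ge0|exact: ltW].
rewrite -mulr_suml -mulr_sumr (invfM n%:R (h ^+ 2)) [leRHS]mulrA [leRHS]mulrAC.
apply: ler_wpM2r; first by rewrite invr_ge0.
apply: ler_wpM2r; first by rewrite invr_ge0 ltW.
apply: ler_wpM2l => //.
rewrite /D big_split/= /ipG; apply: lerD.
  apply: le_trans (layers_sum n (ltW h0) mphi (test_sq (test_dx t))) _.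
  apply: le_ip; [exact: (sq_lower _ mphi (test_sq (test_dx t)))|exact: (test_sq (test_dx t))|].
  by move=> x _; rewrite /lower; case: ifP => // _; rewrite expr0n sqr_ge0.
apply: le_trans (layers_sum n (ltW h0) mphi (test_sq (test_dy t))) _.
apply: le_ip; [exact: (sq_lower _ mphi (test_sq (test_dy t)))|exact: (test_sq (test_dy t))|].
by move=> x _; rewrite /lower; case: ifP => // _; rewrite expr0n sqr_ge0.
Qed.

(** Where v >= s + e, either u >= s or |u - v| >= e; the second case is estimated by Chebyshev. Tail
    bounds thus survive L^2 limits, at the price of e in the level. *)
Lemma area_upper_perturb u v (s e : R) : sq u -> sq v -> 0 < e ->
  area_upper (s + e) v <= area_upper s u + (e ^+ 2)^-1 * ipB (fun x => u x - v x) (fun x => u x - v x).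
Proof.
move=> su sv e0; have e2 : 0 < e ^+ 2 by rewrite exprn_gt0.
have s1 := sq_upper (s + e) (sqB_meas sv); have s2 := sq_upper s (sqB_meas su).
have s3 := @sqintB _ _ _ (@leb2 R) B mB _ _ su sv.
have s4 := @sqintZ _ _ _ (@leb2 R) B mB (e^-1) _ s3.
have i1 := @sqint_mul _ _ _ (@leb2 R) B mB _ _ s1 s1.
have i2 := @sqint_mul _ _ _ (@leb2 R) B mB _ _ s2 s2.
have i4 := @sqint_mul _ _ _ (@leb2 R) B mB _ _ s4 s4.
rewrite -exprVn -(@ip_sqrZ _ _ _ (@leb2 R) B mB)// /area_upper /ip -RintegralD//.
apply: le_Rintegral => //; first exact: (@integrableD _ _ _ (@leb2 R) B mB _ _ i2 i4).
move=> x Bx; rewrite /upper; case: (leP (s + e)) => h1; last by rewrite mul0r addr_ge0// -expr2 sqr_ge0.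
case: (leP s) => h2; first by rewrite mulr1 lerDl -expr2 sqr_ge0.
rewrite mulr1 mul0r add0r -expr2 exprMn exprVn ler_pdivlMl// mulr1.
rewrite -(real_normK (num_real (u x - v x))) lerXn2r ?nnegrE ?(ltW e0)//.
by rewrite distrC; apply: le_trans (ler_norm _); lra.
Qed.

Lemma tail_H10 v n (h e : R) : H10 v -> (0 < n)%N -> 0 < h -> 0 < e ->
  area_upper (n%:R * h + e) v <= areaB * (2 * dirichlet v / (n%:R * h ^+ 2)) ^+ n.
Proof.
move=> hv n0 h0 e0; have [sv s1 s2 [phi [tphi c0 c1 c2]]] := H10_test_limit hv.
have h1 := ipB_cvg_sqr (fun n => test_sq (test_dx (tphi n))) s1 c1.
have h2 := ipB_cvg_sqr (fun n => test_sq (test_dy (tphi n))) s2 c2.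
pose E k := ipB (dx (phi k)) (dx (phi k)) + ipB (dy (phi k)) (dy (phi k)).
have hE : E k @[k --> \oo] --> dirichlet v by rewrite dirichletE//; exact: cvgD.
have lim : (areaB * (2 * E k / (n%:R * h ^+ 2)) ^+ n +
    (e ^+ 2)^-1 * ipB (fun x => phi k x - v x) (fun x => phi k x - v x)) @[k --> \oo] -->
    areaB * (2 * dirichlet v / (n%:R * h ^+ 2)) ^+ n + (e ^+ 2)^-1 * 0.
  apply: cvgD; last by apply: cvgM => //; exact: cvg_cst.
  apply: cvgM; first exact: cvg_cst.
  have hq : 2 * E k / (n%:R * h ^+ 2) @[k --> \oo] --> 2 * dirichlet v / (n%:R * h ^+ 2).
    by apply: cvgM; [apply: cvgM => //; exact: cvg_cst|exact: cvg_cst].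
  exact: (continuous_cvg _ (@exprn_continuous R n _) hq).
rewrite mulr0 addr0 in lim; apply: (ler_cvg_to (cvg_cst _) lim); apply: nearW => k.
apply: le_trans (area_upper_perturb _ (test_sq (tphi k)) sv e0) _.
by rewrite lerD2r; exact: tail_test.
Qed.

Lemma area_upper_abs s v : sq v -> area_upper s (fun x => `|v x|) <=
  area_upper s v + area_upper s (fun x => - v x).
Proof.
move=> sv; have sN := @sqintN _ _ _ (@leb2 R) B mB _ sv.
have s1 := sq_upper s (sqB_meas (sq_abs sv)); have s2 := sq_upper s (sqB_meas sv).
have s3 := sq_upper s (sqB_meas sN).
have i1 := @sqint_mul _ _ _ (@leb2 R) B mB _ _ s1 s1.
have i2 := @sqint_mul _ _ _ (@leb2 R) B mB _ _ s2 s2.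
have i3 := @sqint_mul _ _ _ (@leb2 R) B mB _ _ s3 s3.
rewrite /area_upper /ip -RintegralD//; apply: le_Rintegral => //.
  exact: (@integrableD _ _ _ (@leb2 R) B mB _ _ i2 i3).
move=> x Bx; rewrite /upper; case: (leP s `|v x|) => h1; last first.
  by rewrite mul0r addr_ge0// -expr2 sqr_ge0.
move: h1; rewrite mulr1 ler_normr => /orP[|] ->; rewrite mulr1.
  by rewrite lerDl -expr2 sqr_ge0.
by rewrite lerDr -expr2 sqr_ge0.
Qed.

Lemma tail_abs v n (h e : R) : H10 v -> (0 < n)%N -> 0 < h -> 0 < e ->
  area_upper (n%:R * h + e) (fun x => `|v x|) <=
    2 * (areaB * (2 * dirichlet v / (n%:R * h ^+ 2)) ^+ n).
Proof.
move=> hv n0 h0 e0; have sv : sq v by case: (H10_test_limit hv).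
apply: le_trans (area_upper_abs _ sv) _.
have -> : 2 * (areaB * (2 * dirichlet v / (n%:R * h ^+ 2)) ^+ n) =
  areaB * (2 * dirichlet v / (n%:R * h ^+ 2)) ^+ n +
  areaB * (2 * dirichlet v / (n%:R * h ^+ 2)) ^+ n by ring.
apply: lerD; first exact: tail_H10.
have eN : (fun x => - v x) = (-1) *: v by apply/funext => x; exact: esym (mulN1r (v x)).
rewrite eN; have -> : dirichlet v = dirichlet ((-1) *: v).
  by rewrite dirichletZ// sqrrN expr1n mul1r.
exact: (tail_H10 (H10Z (-1) hv) n0 h0 e0).
Qed.

(* The layers [m dl, (m+1) dl] of |v| have area O(x^(2 m^2)) with x proportional
   to the energy of v; one factor x is the gain and the rest beats e^(K v^2). *)
Definition expsq (K dl : R) (t : R) := if 2 * dl <= `|t| then `|t| * expR (K * t ^+ 2) else 0.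

Lemma expsq_ge0 K dl t : 0 <= expsq K dl t.
Proof. by rewrite /expsq; case: ifP => // _; rewrite mulr_ge0// expR_ge0. Qed.

Lemma measurable_expsq K dl v : measurable_fun B v -> measurable_fun B (fun x => expsq K dl (v x)).
Proof.
move=> mv; have ma : measurable_fun B (fun x => `|v x|) by apply: measurableT_comp.
apply: measurable_if => //; first exact: measurable_fun_ler.
apply: measurable_funM => //; apply: measurableT_comp; first exact: measurable_expR.
by apply: measurable_funM => //; exact: (@measurable_funX _ _ _ _ _ 2).
Qed.

Lemma layer_exists (dl t : R) : 0 < dl -> 2 * dl <= t ->
  exists m : nat, m.+2%:R * dl <= t /\ t <= m.+3%:R * dl.
Proof.
move=> dl0 h; have t0 : 0 <= t / dl by rewrite divr_ge0 ?(ltW dl0)// (le_trans _ h)// mulr_ge0 ?(ltW dl0).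
have /andP[n1 n2] := truncn_itv t0.
have n_2 : (1 < Num.truncn (t / dl))%N.
  by rewrite -ltnS -(ltr_nat R); apply: le_lt_trans n2; rewrite ler_pdivlMr.
case: (Num.truncn (t / dl)) n_2 n1 n2 => [//|[//|m]] _ n1 n2.
by exists m; split; [rewrite -ler_pdivlMr|rewrite -ler_pdivrMr// ltW].
Qed.

(** The bound is linear in the Dirichlet integral, hence quadratic in the norm of v; this is what
    makes the large values of v negligible in the differentiability of J. *)
Lemma trudinger (K dl : R) : 0 <= K -> 0 < dl ->
  exists C d : R, [/\ 0 <= C, 0 < d & forall v, H10 v -> dirichlet v < d ->
    (\int[@leb2 R]_(x in B) (expsq K dl (v x))%:E <= (C * dirichlet v)%:E)%E].
Proof.
move=> K0 dl0.
(* The 9 comes from (m + 3)^2 <= 9 (m + 1)^2: the weight |v| exp(K v^2) on the layer that ends at (m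
   + 3) dl is then at most exp(L (m + 1)^2). *)
pose L := 9 * (K * dl ^+ 2 + dl).
have L0 : 0 <= L by rewrite mulr_ge0// addr_ge0// ?(ltW dl0)// mulr_ge0// sqr_ge0.
pose c := 4 / dl ^+ 2.
have c0 : 0 < c by rewrite divr_gt0// exprn_gt0.
(* The threshold makes exp(L) x <= 1/2 for x = c * dirichlet v, so the m-th layer contributes x
   times a term of a geometric series. *)
exists (4 * areaB * c), (expR (- L) / (2 * c)).
split; first by rewrite mulr_ge0 ?(ltW c0)// mulr_ge0// areaB_ge0.
  by rewrite divr_gt0 ?expR_gt0// mulr_gt0.
move=> v hv hd; have sv : sq v by case: (H10_test_limit hv).
set x := c * dirichlet v.
have x0 : 0 <= x by rewrite mulr_ge0 ?(ltW c0)// dirichlet_ge0.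
have xq : expR L * x <= 2^-1.
  have c2 : 0 < 2 * c by exact: mulr_gt0.
  rewrite (ltr_pdivlMr _ _ c2) in hd.
  have := ler_wpM2l (expR_ge0 L) (ltW hd); rewrite -expRD subrr expR0 => h.
  have -> : expR L * x = expR L * (dirichlet v * (2 * c)) * 2^-1 by rewrite /x; field.
  by rewrite -[leRHS]mul1r; apply: ler_wpM2r.
have x1 : x <= 1.
  have : 1 * x <= expR L * x by rewrite ler_wpM2r// -expR0 ler_expR.
  by rewrite mul1r => /le_trans; apply; lra.
pose g (m : nat) := m.+3%:R * dl * expR (K * (m.+3%:R * dl) ^+ 2).
have g0 m : 0 <= g m by rewrite mulr_ge0 ?expR_ge0// mulr_ge0// ltW.
have gL m : g m <= expR L ^+ (m.+1 ^ 2).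
  have q1 : m.+3%:R * dl <= expR (m.+3%:R * dl).
    by apply: le_trans (expR_ge1Dx _); rewrite lerDr.
  apply: le_trans (ler_wpM2r (expR_ge0 _) q1) _.
  rewrite -expRD -expRM_natl ler_expR natrX.
  have m3 : m.+3%:R <= 3 * m.+1%:R :> R by rewrite -natrM ler_nat; lia.
  have m1 : 1 <= m.+3%:R :> R by rewrite ler1n.
  rewrite /L; move: (m.+3%:R : R) (m.+1%:R : R) m3 m1 => a b m3 m1.
  have ab : a ^+ 2 <= 9 * b ^+ 2 by nra.
  have aa : a <= 9 * b ^+ 2 by nra.
  have : a * dl <= 9 * b ^+ 2 * dl by rewrite ler_wpM2r// ltW.
  have : K * dl ^+ 2 * a ^+ 2 <= K * dl ^+ 2 * (9 * b ^+ 2).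
    by rewrite ler_wpM2l// mulr_ge0// sqr_ge0.
  lra.
pose av := fun x => `|v x|.
have mav : measurable_fun B av by exact: (sqB_meas (sq_abs sv)).
(* With 2 (m + 1)^2 layers of thickness dl / (2 (m + 1)) and the margin dl, the level is (m + 2) dl
   and the base of the power in the tail bound is exactly x. *)
have Ag m : g m * area_upper (m.+2%:R * dl) av <= 2 * areaB * x * (1 / 2 ^+ m.+1).
  have n0 : (0 < 2 * m.+1 ^ 2)%N by rewrite muln_gt0 expn_gt0.
  have h0 : 0 < dl / (2 * m.+1%:R) by rewrite divr_gt0// mulr_gt0.
  have := @tail_abs v (2 * m.+1 ^ 2) (dl / (2 * m.+1%:R)) dl hv n0 h0 dl0.
  have -> : (2 * m.+1 ^ 2)%:R * (dl / (2 * m.+1%:R)) + dl = m.+2%:R * dl :> R.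
    rewrite natrM natrX -[m.+2]add1n natrD; have : m.+1%:R != 0 :> R by rewrite pnatr_eq0.
    by move: (m.+1%:R : R) => q qN; field.
  have -> : 2 * dirichlet v / ((2 * m.+1 ^ 2)%:R * (dl / (2 * m.+1%:R)) ^+ 2) = x :> R.
    rewrite /x /c natrM natrX; have : m.+1%:R != 0 :> R by rewrite pnatr_eq0.
    by move: (m.+1%:R : R) => q qN; field; rewrite qN (gt_eqF dl0).
  move=> h; apply: le_trans (ler_wpM2l (g0 m) h) _.
  have -> : 2 * areaB * x * (1 / 2 ^+ m.+1) = (2 * areaB) * (x * (1 / 2 ^+ m.+1)) by ring.
  have -> : g m * (2 * (areaB * x ^+ (2 * m.+1 ^ 2))) = (2 * areaB) * (g m * x ^+ (2 * m.+1 ^ 2)) by ring.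
  apply: ler_wpM2l; first by rewrite mulr_ge0// areaB_ge0.
  rewrite mul2n -addnn exprD.
  have y1 : x ^+ (m.+1 ^ 2) <= x.
    by rewrite -[leRHS]expr1; apply: ler_wiXn2l => //; rewrite expn_gt0.
  have y2 : g m * x ^+ (m.+1 ^ 2) <= 1 / 2 ^+ m.+1.
    apply: le_trans (ler_wpM2r (exprn_ge0 _ x0) (gL m)) _; rewrite -exprMn.
    have w0 : 0 <= expR L * x by rewrite mulr_ge0// expR_ge0.
    apply: (@le_trans _ _ ((expR L * x) ^+ m.+1)).
      apply: ler_wiXn2l => //; first by apply: le_trans xq _; lra.
      by rewrite -mulnn leq_pmulr.
    by rewrite div1r -exprVn lerXn2r// nnegrE invr_ge0.
  rewrite mulrCA; apply: ler_pM; [exact: exprn_ge0| |exact: y1|exact: y2].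
  by rewrite mulr_ge0// exprn_ge0.
pose G m := fun z => (g m * upper (m.+2%:R * dl) av z ^+ 2)%:E.
have mG m : measurable_fun B (G m).
  apply/measurable_EFinP; apply: measurable_funM => //.
  by apply: (@measurable_funX _ _ _ _ _ 2); exact: (sqB_meas (sq_upper _ mav)).
have G0 m z : (0 <= G m z)%E by rewrite lee_fin mulr_ge0// sqr_ge0.
apply: (@le_trans _ _ (\int[@leb2 R]_(z in B) (\sum_(0 <= m <oo) G m z))%E).
  apply: ge0_le_integral => //.
  - by move=> z _; rewrite lee_fin expsq_ge0.
  - by apply/measurable_EFinP; apply: measurable_expsq; exact: sqB_meas.
  - by apply: ge0_emeasurable_sum => // m _; exact: mG.
  - move=> z _; rewrite /expsq; case: ifPn => [h|_]; last exact: nneseries_ge0.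
    have [m [h1 h2]] := layer_exists dl0 h.
    apply: (@le_trans _ _ (G m z)).
      rewrite lee_fin /upper /av h1 expr1n mulr1 ler_pM ?expR_ge0// ler_expR ler_wpM2l//.
      by rewrite -(real_normK (num_real (v z))) lerXn2r ?nnegrE// (le_trans _ h2).
    by rewrite (@nneseriesD1 _ _ m)// leeDl// nneseries_ge0.
rewrite integral_nneseries//.
apply: lime_le; first by apply: is_cvg_nneseries => n _ _; exact: integral_ge0.
apply: nearW => n.
apply: (@le_trans _ _ (\sum_(0 <= m < n) (2 * areaB * x * (1 / 2 ^+ m.+1))%:E)%E).
  apply: lee_sum => m _; apply: le_trans _ (_ : (g m * area_upper (m.+2%:R * dl) av)%:E <= _)%E.
    rewrite /G; under eq_integral do rewrite EFinM.
    rewrite ge0_integralZl_EFin//.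
    + rewrite (@integral_sqr_EFin _ _ _ (@leb2 R) B mB)//; exact: sq_upper.
    + by move=> z _; rewrite lee_fin sqr_ge0.
    + apply/measurable_EFinP; apply: (@measurable_funX _ _ _ _ _ 2).
      exact: (sqB_meas (sq_upper _ mav)).
  by rewrite lee_fin.
rewrite sumEFin lee_fin -mulr_sumr.
have -> : 4 * areaB * c * dirichlet v = 2 * areaB * x * 2 by rewrite /x; ring.
apply: ler_wpM2l; first by rewrite mulr_ge0// mulr_ge0// areaB_ge0.
have : \sum_(0 <= m < n) (1 / 2 ^+ m.+1) = 1 - 1 / 2 ^+ n :> R.
  elim: n => [|n IH]; first by rewrite big_geq// expr0 divr1 subrr.
  by rewrite big_nat_recr//= IH exprS; field; rewrite expf_neq0.
move=> ->; have : 0 <= 1 / 2 ^+ n :> R by rewrite divr_ge0// exprn_ge0.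
lra.
Qed.

End Trudinger.

(** * Changes of variables through image measures *)

Section Density.
Context d (T : measurableType d) (R : realType) (mu : {measure set T -> \bar R}).
Variables (w p : T -> R).
Hypothesis mw : measurable_fun setT w.
Hypothesis w0 : forall x, 0 <= w x.
Hypothesis mp : measurable_fun setT p.

(** The image under [p] of the measure with density [w]. The proofs are arguments of the definition,
    so that a measure structure can be attached to it. *)
Definition dens (mw' : measurable_fun setT w) (w0' : forall x, 0 <= w x)
  (mp' : measurable_fun setT p) (A : set (measurableTypeR R)) : \bar R :=
  (\int[mu]_(x in p @^-1` A) (w x)%:E)%E.

Let dens0 : dens mw w0 mp set0 = 0%E.
Proof. by rewrite /dens preimage_set0 integral_set0. Qed.

Let dens_ge0 A : (0 <= dens mw w0 mp A)%E.
Proof. by apply: integral_ge0 => x _; rewrite lee_fin. Qed.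

Let mpre (A : set (measurableTypeR R)) : measurable A -> measurable (p @^-1` A).
Proof. by move=> mA; rewrite -[X in measurable X]setTI; exact: mp. Qed.

Let dens_sigma_additive : semi_sigma_additive (dens mw w0 mp).
Proof.
move=> F mF tF mUF; rewrite /dens; apply: cvg_toP.
  apply: ereal_nondecreasing_is_cvgn => m n mn.
  apply: lee_sum_nneg_natr => // k _ _; apply: integral_ge0 => x _.
  by rewrite lee_fin.
rewrite preimage_bigcup ge0_integral_bigcup//=.
- by move=> k; exact: mpre.
- by apply/measurable_EFinP; exact: measurable_funTS.
- by move=> x _; rewrite lee_fin.
- move=> i j _ _ [x [/= h1 h2]]; apply: (tF i j) => //.
  by exists (p x).
Qed.

HB.instance Definition _ := isMeasure.Build _ _ _ (dens mw w0 mp)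
  dens0 dens_ge0 dens_sigma_additive.

End Density.

Section LayerCake.
Context d (T : measurableType d) (R : realType)
  (mu : {sigma_finite_measure set T -> \bar R}).
Variables (w p : T -> R).
Hypothesis mw : measurable_fun setT w.
Hypothesis w0 : forall x, 0 <= w x.
Hypothesis mp : measurable_fun setT p.

(** q(p x) is the length of [0, q(p x)[; Tonelli then leaves an expression in the image measure
    alone. *)
Lemma layer_cake (q : R -> R) : measurable_fun setT q -> (forall t, 0 <= q t) ->
  (\int[mu]_x (q (p x) * w x)%:E =
   \int[lebesgue_measure]_(r in `[0%R, +oo[) dens mu mw w0 mp [set t | (r < q t)%R])%E.
Proof.
move=> mq q0.
pose E := [set z : T * R | (0 <= z.2) && (z.2 < q (p z.1))].
have mE : measurable E.
  have h : measurable_fun setT (fun z : T * R => (0 <= z.2) && (z.2 < q (p z.1))).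
    apply: measurable_and; first by apply: measurable_fun_ler => //; exact: measurable_snd.
    apply: measurable_fun_ltr; first exact: measurable_snd.
    by apply: measurableT_comp => //; apply: measurableT_comp => //; exact: measurable_fst.
  by have := h measurableT [set true] I; rewrite setTI.
pose g (z : T * R) := (w z.1 * \1_E z)%:E.
have mg : measurable_fun setT g.
  apply/measurable_EFinP; apply: measurable_funM.
    by apply: measurableT_comp => //; exact: measurable_fst.
  exact: measurable_indic.
have g0 z : (0 <= g z)%E by rewrite lee_fin mulr_ge0.
have FT := @fubini_tonelli _ _ T (measurableTypeR R) R mu (@lebesgue_measure R) g mg g0.
transitivity (\int[mu]_x \int[lebesgue_measure]_r g (x, r))%E.
  apply: eq_integral => x _; rewrite /g.
  have -> : (fun r => (w x * \1_E (x, r))%:E) = (fun r => (w x)%:E * (\1_(`[0, q (p x)[) r)%:E)%E.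
    apply/funext => r; rewrite -EFinM; congr (_ * _)%:E; rewrite !indicE; congr (_%:R).
  rewrite ge0_integralZl_EFin//; last first.
    by apply/measurable_EFinP; exact: measurable_indic.
  rewrite integral_indic//= setIT lebesgue_measure_itv/= lte_fin.
  have := q0 (p x); rewrite le_eqVlt => /orP[/eqP <-|qp].
    by rewrite ltxx mule0 mul0r.
  by rewrite qp -EFinB subr0 -EFinM mulrC.
rewrite FT [RHS]integral_mkcond; apply: eq_integral => r _.
rewrite /patch /dens; case: ifPn => rI; last first.
  rewrite integral0_eq// => x _; rewrite /g indicE memNset ?mulr0//.
  by move=> /andP[/= r0 _]; move: rI; rewrite notin_setE/= in_itv/= andbT r0.
rewrite [RHS]integral_mkcond; apply: eq_integral => x _.
move: rI; rewrite inE/= in_itv/= andbT => r0.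
rewrite /patch /g indicE; case: ifPn => h; last first.
  by rewrite memNset ?mulr0// => /andP[_ /= hh]; move: h; rewrite notin_setE/= hh.
by rewrite mem_set ?mulr1//=; move: h; rewrite inE /E/= => ->; rewrite r0.
Qed.

End LayerCake.

Lemma measure_itv_unique (R : realType) (m1 m2 : {measure set (measurableTypeR R) -> \bar R}) :
  (forall a b : R, a < b ->
    m1 `]a, b]%classic = m2 `]a, b]%classic /\ (m1 `]a, b]%classic < +oo)%E) ->
  forall A, measurable A -> m1 A = m2 A.
Proof.
move=> h.
apply: (@measure_unique _ R (measurableTypeR R) (@ocitv R) (fun n : nat => `](- n.+1%:R)%R, n.+1%:R]%classic)).
- by [].
- exact: ocitvI.
- by move=> n; exact: is_ocitv.
- apply/seteqP; split => // x _.
  exists (Num.truncn `|x|) => //=; rewrite in_itv/=.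
  have := truncnS_gt `|x|; rewrite ltr_norml => /andP[-> hx].
  exact: ltW.
- move=> A /ocitvP[->|[[a b] /= ab ->]]; first by rewrite !measure0.
  by have [] := h a b ab.
- move=> n; have [] := h (- n.+1%:R) n.+1%:R _ => //.
  by apply: (@lt_trans _ _ 0); rewrite ?oppr_lt0 ltr0n.
Qed.

Section Transfer.
Context d (T : measurableType d) (R : realType)
  (mu : {sigma_finite_measure set T -> \bar R}).
Variables (w p : T -> R) (w2 : R -> R).
Hypothesis mw : measurable_fun setT w.
Hypothesis w0 : forall x, 0 <= w x.
Hypothesis mp : measurable_fun setT p.
Hypothesis mw2 : measurable_fun setT w2.
Hypothesis w20 : forall x, 0 <= w2 x.
Hypothesis H : forall a b : R, a < b ->
  (\int[mu]_(x in p @^-1` `]a, b]) (w x)%:E =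
   \int[lebesgue_measure]_(t in `]a, b]) (w2 t)%:E)%E /\
  (\int[lebesgue_measure]_(t in `]a, b]) (w2 t)%:E < +oo)%E.

(** By the layer cake formula both sides depend on image measures only, and these agree as soon as
    they agree on the intervals ]a, b]. A change of variables then amounts to computing the measures
    of preimages of intervals, with no Jacobian. *)
Lemma transfer (q : R -> R) : measurable_fun setT q -> (forall t, 0 <= q t) ->
  (\int[mu]_x (q (p x) * w x)%:E =
   \int[lebesgue_measure]_t (q t * w2 t)%:E)%E.
Proof.
move=> mq q0.
have mid : measurable_fun setT (id : R -> R) by exact: measurable_id.
have E : forall A : set (measurableTypeR R), measurable A -> dens mu mw w0 mp A =
    dens (@lebesgue_measure R) mw2 w20 mid A.
  apply: measure_itv_unique => a b ab; have [h1 h2] := H ab.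
  by split; [exact: h1 | apply: le_lt_trans h2; rewrite -h1].
rewrite (layer_cake mu mw w0 mp mq q0).
rewrite (layer_cake (@lebesgue_measure R) mw2 w20 mid mq q0).
apply: eq_integral => r _; apply: E.
have h := measurable_fun_ltr (measurable_cst r) mq.
by have := h measurableT [set true] I; rewrite setTI.
Qed.
End Transfer.

(** * Polar coordinates in the logarithmic variable *)

Section Polar.
Context {R : realType}.
Notation leb1 := (@lebesgue_measure R).

(** Inversion is discontinuous at 0, where its value is 0 by convention; the formula r exp(-
    ln(r^2)) covers that point as well. *)
Lemma measurable_inv : measurable_fun setT (@GRing.inv R).
Proof.
rewrite (_ : GRing.inv = fun r : R => r * expR (- ln (r ^+ 2))); last first.
  apply/funext => r; have [->|r0] := eqVneq r 0; first by rewrite invr0 mul0r.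
  rewrite expRN lnK ?posrE ?exprn_even_gt0//.
  by rewrite expr2 invfM mulrA mulfV ?mul1r.
apply: measurable_funM; first exact: measurable_id.
apply: measurableT_comp => //; apply: measurable_funN.
by apply: measurableT_comp => //; exact: exprn_measurable.
Qed.

Lemma scale_integral (s : R) (q : R -> R) : 0 < s -> measurable_fun setT q ->
  (forall t, 0 <= q t) ->
  (\int[leb1]_x (q (x / s))%:E = s%:E * \int[leb1]_x (q x)%:E)%E.
Proof.
move=> s0 mq q0.
have mp : measurable_fun setT (fun x : R => x / s).
  by apply: measurable_funM => //; exact: measurable_id.
have := @transfer _ _ R leb1 (fun=> 1) (fun x => x / s) (fun=> s)
  (measurable_cst _) (fun=> ler01) mp (measurable_cst _) (fun=> ltW s0).
move=> /(_ _ q mq q0) h.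
transitivity (\int[leb1]_x (q (x / s) * 1)%:E)%E.
  by apply: eq_integral => x _; rewrite mulr1.
rewrite h; last first.
  move=> a b ab; rewrite (_ : _ @^-1` _ = `]a * s, b * s]%classic); last first.
    by apply/seteqP; split => x /=; rewrite !in_itv/= ltr_pdivlMr// ler_pdivrMr.
  rewrite !integral_cst//= !lebesgue_measure_itv/= !lte_fin ltr_pM2r// ab.
  by rewrite -!EFinB -!EFinM ltry; split => //; congr (_%:E); ring.
rewrite -ge0_integralZl_EFin//; last by rewrite ltW.
- by apply: eq_integral => x _; rewrite -EFinM mulrC.
- by move=> x _; rewrite lee_fin.
- by apply/measurable_EFinP.
Qed.

Lemma leb2_sigma_finite : sigma_finite setT (@leb2 R).
Proof.
exists (fun n : nat => `](- n.+1%:R)%R, n.+1%:R] `*` `](- n.+1%:R)%R, n.+1%:R]).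
  apply/seteqP; split => // -[x y] _.
  exists (Num.truncn `|x| + Num.truncn `|y|)%N => //=; rewrite !in_itv/=.
  have hx := truncnS_gt `|x|; have hy := truncnS_gt `|y|.
  have h1 : `|x| < (Num.truncn `|x| + Num.truncn `|y|).+1%:R.
    by apply: lt_le_trans hx _; rewrite ler_nat ltnS leq_addr.
  have h2 : `|y| < (Num.truncn `|x| + Num.truncn `|y|).+1%:R.
    by apply: lt_le_trans hy _; rewrite ler_nat ltnS leq_addl.
  move: h1 h2; rewrite !ltr_norml => /andP[-> /ltW ->] /andP[-> /ltW ->] //.
move=> n; split; first exact: measurableX.
by rewrite leb2X//= !lebesgue_measure_itv/= lte_fin; case: ifPn => _; rewrite ?mule0// ltry.
Qed.

(** A copy of [leb2] equipped with the sigma-finiteness that [transfer] asks for. *)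
Definition leb2f : set (measurableTypeR R * measurableTypeR R) -> \bar R := @leb2 R.
HB.instance Definition _ := Measure.copy leb2f (@leb2 R).
HB.instance Definition _ := @Measure_isSigmaFinite.Build _ _ _ leb2f leb2_sigma_finite.

Definition rho (x : R * R) : R := x.1 ^+ 2 + x.2 ^+ 2.

Lemma measurable_rho : measurable_fun setT rho.
Proof. exact: continuous_measurable2 continuous_rho. Qed.

Lemma measurable_disc (b : R) : measurable [set x | rho x <= b].
Proof.
have h := measurable_fun_ler measurable_rho (measurable_cst b).
by have := h measurableT [set true] I; rewrite setTI.
Qed.

Lemma disc_section (b : R) :
  leb2 [set x | rho x <= b] =
    (\int[leb1]_x (2 * Num.sqrt (b - x ^+ 2))%:E)%E.
Proof.
rewrite /leb2 /product_measure1; apply: eq_integral => x _ /=.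
have [bx|bx] := ltP (b - x ^+ 2) 0.
  rewrite (ler0_sqrtr (ltW bx)) mulr0 (_ : xsection _ _ = set0) ?measure0//.
  apply/seteqP; split => // y; rewrite /xsection/= inE/= /rho/=.
  by move: bx; have := sqr_ge0 y; lra.
rewrite (_ : xsection _ _ = `[- Num.sqrt (b - x ^+ 2), Num.sqrt (b - x ^+ 2)]%classic).
  rewrite lebesgue_measure_itv/= lte_fin; case: ifPn => h.
    by rewrite -EFinB; congr (_%:E); ring.
  have : Num.sqrt (b - x ^+ 2) = 0.
    by apply/eqP; rewrite eq_le sqrtr_ge0 andbT; move: h; lra.
  by move=> ->; rewrite mulr0.
apply/seteqP; split => y; rewrite /xsection/= inE/= /rho/= in_itv/= -ler_norml.
  by move=> h; rewrite -sqrtr_sqr ler_wsqrtr//; move: h; lra.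
move=> h; have : `|y| ^+ 2 <= Num.sqrt (b - x ^+ 2) ^+ 2 by rewrite lerXn2r ?nnegrE ?sqrtr_ge0.
by rewrite sqr_sqrtr// real_normK ?num_real//; lra.
Qed.

(** The area of the unit disk stays a symbol: it enters the energies of radial fields as a common
    factor. *)
Definition disc1 : R := fine (@leb2 R [set x | rho x <= 1]).

Lemma disc1_ge0 : 0 <= disc1. Proof. by rewrite fine_ge0. Qed.

Lemma disc1E : @leb2 R [set x | rho x <= 1] = disc1%:E.
Proof.
rewrite fineK// ge0_fin_numE//.
apply: (@le_lt_trans _ _ (@leb2 R (`[(-1)%R, 1%R] `*` `[(-1)%R, 1%R]))).
  apply: le_measure; rewrite ?inE.
  - exact: measurable_disc.
  - exact: measurableX.
  - move=> [x y] /=; rewrite /rho/= !in_itv/= -!ler_norml => h.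
    split; rewrite -(@expr_le1 _ 2)// real_normK ?num_real//.
      by move: h; have := sqr_ge0 y; lra.
    by move: h; have := sqr_ge0 x; lra.
by rewrite leb2X//= !lebesgue_measure_itv/= lte_fin; case: ifPn => _; rewrite ?ltry// mule0.
Qed.

Lemma disc_area (b : R) : leb2 [set x | rho x <= b] = (disc1 * Num.max b 0)%:E.
Proof.
rewrite disc_section; have [b0|b0] := leP b 0.
  rewrite mulr0 integral0_eq// => x _; rewrite ler0_sqrtr ?mulr0//.
  by have := sqr_ge0 x; lra.
have s0 : 0 < Num.sqrt b by rewrite sqrtr_gt0.
pose q (x : R) := 2 * Num.sqrt (1 - x ^+ 2).
have mq : measurable_fun setT q.
  apply: measurable_funM => //; apply: continuous_measurable1D => //.
  move=> x; apply: continuous_comp; last exact: sqrt_continuous.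
  by apply: cvgB; [exact: cvg_cst | exact: exprn_continuous].
have q0 x : 0 <= q x by rewrite mulr_ge0// sqrtr_ge0.
transitivity (\int[leb1]_x ((Num.sqrt b)%:E * (q (x / Num.sqrt b))%:E))%E.
  apply: eq_integral => x _; rewrite -EFinM; congr (_%:E); rewrite /q mulrCA -sqrtrM ?(ltW b0)//.
  by rewrite mulrBr mulr1 expr_div_n sqr_sqrtr ?(ltW b0)// mulrCA mulfV ?mulr1// gt_eqF.
have mqs : measurable_fun setT (fun x : R => (q (x / Num.sqrt b))%:E).
  apply/measurable_EFinP; apply: (measurableT_comp mq).
  by apply: measurable_funM => //; exact: measurable_id.
rewrite ge0_integralZl_EFin ?sqrtr_ge0//; last by move=> x _; rewrite lee_fin.
rewrite scale_integral// -(disc_section 1) disc1E muleA -!EFinM; congr (_%:E).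
by rewrite -expr2 sqr_sqrtr 1?mulrC// ltW.
Qed.

(** The disk where rho <= b has area proportional to b, so [rho] maps Lebesgue measure to [disc1]
    times Lebesgue measure on the half-line. *)
Lemma polar_rho (q : R -> R) : measurable_fun setT q -> (forall t, 0 <= q t) ->
  (\int[@leb2 R]_x (q (rho x))%:E =
   disc1%:E * \int[leb1]_(r in `]0%R, +oo[) (q r)%:E)%E.
Proof.
move=> mq q0.
pose w2 (r : R) := disc1 * \1_(`]0%R, +oo[) r.
have mw2 : measurable_fun setT w2 by apply: measurable_funM => //; exact: measurable_indic.
have w20 r : 0 <= w2 r by rewrite mulr_ge0// disc1_ge0.
have := @transfer _ _ R leb2f (fun=> 1) rho w2
  (measurable_cst _) (fun=> ler01) measurable_rho mw2 w20.
move=> /(_ _ q mq q0) h.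
transitivity (\int[@leb2 R]_x (q (rho x) * 1)%:E)%E.
  by apply: eq_integral => x _; rewrite mulr1.
rewrite [LHS]h; last first.
  move=> a b ab.
  have E : (\int[leb1]_(t in `]a, b]) (w2 t)%:E)%E =
      (disc1 * (Num.max b 0 - Num.max a 0))%:E.
    rewrite /w2; under eq_integral do rewrite EFinM.
    rewrite ge0_integralZl_EFin ?disc1_ge0//; last first.
      by apply/measurable_EFinP; exact: measurable_funTS.
    rewrite integral_indic//= (_ : _ `&` _ = `]Num.max a 0, Num.max b 0]%classic); last first.
      apply/seteqP; split => t /=; rewrite !in_itv/= andbT.
        by move=> [t0 /andP[at_ tb]]; rewrite gt_max at_ t0 le_max tb.
      rewrite gt_max le_max => /andP[/andP[h1 h2] h3]; split => //; rewrite h1/=.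
      by move: h3; rewrite [t <= 0]leNgt h2 orbF.
    rewrite lebesgue_measure_itv/= lte_fin; case: ifPn => h0.
      by rewrite -EFinB EFinM.
    rewrite mule0; congr (_%:E); apply/esym/eqP; rewrite mulf_eq0 subr_eq0; apply/orP; right.
    move: h0; rewrite -leNgt => h0; apply/eqP/le_anti; rewrite h0/=.
    by rewrite ge_max !le_max lexx (ltW ab) orbT.
  split.
    rewrite integral_cst//; last first.
      by rewrite -[X in measurable X]setTI; exact: measurable_rho.
    rewrite mul1e.
    have -> : rho @^-1` `]a, b] = [set x | rho x <= b] `\` [set x | rho x <= a].
      apply/seteqP; split => x /=; rewrite in_itv/=.
        by move=> /andP[h1 h2]; split => //; apply/negP; rewrite -ltNge.
      by move=> [-> /negP]; rewrite -ltNge => ->.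
    have hD := @measureD _ _ _ (@leb2 R) _ _ (measurable_disc b) (measurable_disc a).
    have hb : (@leb2 R [set x | (rho x <= b)%R] < +oo)%E by rewrite disc_area ltry.
    transitivity (@leb2 R [set x | (rho x <= b)%R] - @leb2 R ([set x | (rho x <= b)%R] `&` [set x | (rho x <= a)%R]))%E.
      exact: hD hb.
    rewrite (_ : _ `&` _ = [set x | rho x <= a]); last first.
      by apply/seteqP; split => x /= => [[]//|xa]; split => //; apply: le_trans xa (ltW ab).
    transitivity ((disc1 * Num.max b 0)%:E - (disc1 * Num.max a 0)%:E)%E.
      by congr (_ - _)%E; exact: disc_area.
    rewrite E -EFinB.
    by rewrite -mulrBr.
  rewrite E; exact: ltry.
rewrite [X in (_ * X)%E]integral_mkcond -ge0_integralZl_EFin ?disc1_ge0//; last 2 first.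
- by move=> t _; rewrite /patch; case: ifP => // _; rewrite lee_fin.
- apply/(measurable_restrictT _ _).1 => //; apply/measurable_EFinP; exact: measurable_funTS.
apply: eq_integral => t _; rewrite /patch /w2 indicE; case: ifPn => ht; rewrite ?mulr0 ?mule0//.
by rewrite mulr1 -EFinM mulrC.
Qed.

(** This is ln(1/|x|), expressed through |x|^2, which unlike |x| is smooth at the origin. *)
Definition tt (x : R * R) : R := - (ln (rho x) / 2).

Lemma ln_inv_integral (a b : R) : 0 < a -> a < b ->
  (\int[leb1]_(r in `[a, b]) (r^-1)%:E = (ln b - ln a)%:E)%E.
Proof.
move=> a0 ab; apply: (@continuous_FTC2 _ _ (@ln R)) => //.
- apply: continuous_in_subspaceT => x; rewrite inE/= in_itv/= => /andP[ax _].
  by apply: inv_continuous; rewrite gt_eqF// (lt_le_trans a0).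
- split.
  + move=> x; rewrite in_itv/= => /andP[ax _]; have x0 : 0 < x by rewrite (lt_trans a0).
    by have /@ex_derive := is_derive1_ln x0.
  + by apply: cvg_at_right_filter; apply: continuous_ln.
  + by apply: cvg_at_left_filter; apply: continuous_ln; rewrite (lt_trans a0).
- by move=> x; rewrite in_itv/= => /andP[ax _]; rewrite derive1E; apply: derive_val; apply: is_derive1_ln; rewrite (lt_trans a0).
Qed.

Lemma half_lt (x s l : R) : (x * s < - (l / 2)) = (l < - (2 * s * x)).
Proof. by apply/idP/idP; lra. Qed.

(** After [polar_rho] the measure is dr / r, which becomes 2 s dt under t = - ln(r) / (2 s). *)
Lemma polar_full (s : R) (q : R -> R) : 0 < s -> measurable_fun setT q -> (forall t, 0 <= q t) ->
  (\int[@leb2 R]_x (q (tt x / s) / rho x)%:E =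
   (2 * disc1 * s)%:E * \int[leb1]_t (q t)%:E)%E.
Proof.
move=> s0 mq q0.
pose p (r : R) := - (ln r / 2) / s.
pose w (r : R) := r^-1 * \1_(`]0%R, +oo[) r.
have mw : measurable_fun setT w.
  apply: measurable_funM; last exact: measurable_indic.
  exact: measurable_inv.
have w0 r : 0 <= w r.
  rewrite /w indicE; case: (boolP (r \in _)) => [|_]; last by rewrite mulr0.
  by rewrite inE/= in_itv/= andbT => r0; rewrite mulr1 invr_ge0 ltW.
have mp : measurable_fun setT p.
  apply: measurable_funM => //; apply: measurable_funN; apply: measurable_funM => //.
have := @transfer _ _ R leb1 w p (fun=> 2 * s) mw w0 mp (measurable_cst _).
move=> /(_ _ _ q mq q0) h.
have m1 : measurable_fun setT (fun r => q (p r) * w r).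
  by apply: measurable_funM => //; exact: measurableT_comp.
transitivity (\int[@leb2 R]_x (q (p (rho x)) * w (rho x))%:E)%E.
  apply: eq_integral => x _; congr (_ * _)%:E; rewrite /w indicE.
  have : 0 <= rho x by rewrite addr_ge0 ?sqr_ge0.
  rewrite le_eqVlt => /orP[/eqP <-|x0]; first by rewrite invr0 mul0r.
  by rewrite mem_set ?mulr1//= in_itv/= x0.
rewrite (polar_rho m1); last by move=> r; rewrite mulr_ge0.
transitivity (disc1%:E * \int[leb1]_r (q (p r) * w r)%:E)%E.
  congr (_ * _)%E; rewrite [LHS]integral_mkcond; apply: eq_integral => r _.
  rewrite /patch; case: ifPn => // hr; rewrite /w indicE (_ : (r \in _) = false) ?mulr0//.
  exact: negbTE.
rewrite h; first last.
- move=> a b ab.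
  have sE (x y : R) : 0 < y -> (x < p y) = (y < expR (- (2 * s * x))).
    move=> y0; rewrite -[in RHS](lnK y0) ltr_expR /p ltr_pdivlMr//.
    exact: half_lt.
  have pE : p @^-1` `]a, b] `&` `]0, +oo[ = `[expR (- (2 * s * b)), expR (- (2 * s * a))[%classic.
    apply/seteqP; split => y /=; rewrite !in_itv/= ?andbT.
      by move=> [/andP[h1 h2] y0]; rewrite -sE// h1 andbT leNgt -sE// -leNgt.
    move=> /andP[h1 h2]; have y0 : 0 < y by rewrite (lt_le_trans (expR_gt0 _) h1).
    by split => //; rewrite sE// h2 leNgt sE// -leNgt h1.
  have -> : (\int[leb1]_(x in p @^-1` `]a, b]) (w x)%:E = (2 * s * (b - a))%:E)%E.
    transitivity (\int[leb1]_(x in (p @^-1` `]a, b]) `&` `]0%R, +oo[) (x^-1)%:E)%E.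
      rewrite [LHS]integral_mkcond [RHS]integral_mkcond; apply: eq_integral => x _.
      rewrite /patch in_setI /w indicE; case: (x \in p @^-1` _) => //=.
      by case: ifPn => _; rewrite ?mulr0 ?mulr1.
    rewrite pE integral_itv_bndo_bndc; last first.
      by apply/measurable_EFinP; apply: measurable_funTS; exact: measurable_inv.
    rewrite ln_inv_integral ?expR_gt0// ?expRK.
      by congr (_%:E); ring.
    by rewrite ltr_expR ltrN2 ltr_pM2l// mulr_gt0.
  rewrite integral_cst//= lebesgue_measure_itv/= lte_fin ab -EFinB -EFinM.
  by split=> //; exact: ltry.
- by move=> _; rewrite mulr_ge0// ltW.
rewrite (_ : (fun t => _) = fun t => ((2 * s)%:E * (q t)%:E)%E); last first.
  by apply/funext => t; rewrite EFinM muleC.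
rewrite ge0_integralZl_EFin//; last by rewrite mulr_ge0// ltW.
- by rewrite muleA -EFinM; congr (_%:E * _)%E; ring.
- by move=> t _; rewrite lee_fin.
- by apply/measurable_EFinP.
Qed.

Lemma tt_gt0 (x : R * R) : 0 < rho x -> (0 < tt x) = (rho x < 1).
Proof.
move=> x0; rewrite /tt oppr_gt0 pmulr_llt0 ?invr_gt0//.
by rewrite -ln1 ltr_ln ?posrE.
Qed.

Lemma polar (s : R) (q : R -> R) : 0 < s -> measurable_fun setT q -> (forall t, 0 <= q t) ->
  (\int[@leb2 R]_(x in B) (q (tt x / s) / rho x)%:E =
   (2 * disc1 * s)%:E * \int[leb1]_(t in `]0%R, +oo[) (q t)%:E)%E.
Proof.
move=> s0 mq q0.
pose q1 (t : R) := q t * \1_(`]0%R, +oo[) t.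
have mq1 : measurable_fun setT q1 by apply: measurable_funM => //; exact: measurable_indic.
have q10 t : 0 <= q1 t by rewrite mulr_ge0.
have := polar_full s0 mq1 q10.
rewrite [X in _ = (_ * X)%E -> _](_ : _ = \int[leb1]_(t in `]0%R, +oo[) (q t)%:E)%E; last first.
  rewrite [RHS]integral_mkcond; apply: eq_integral => t _; rewrite /patch /q1 indicE.
  by case: (t \in _); rewrite ?mulr1// mulr0.
move=> <-; rewrite [LHS]integral_mkcond; apply: eq_integral => x _.
rewrite /patch /q1 indicE.
have : 0 <= rho x by rewrite addr_ge0 ?sqr_ge0.
rewrite le_eqVlt => /orP[/eqP x0|x0].
  by rewrite -!x0 invr0 !mulr0; case: ifP.
have -> : (tt x / s \in `]0, +oo[%classic) = (x \in B).
  apply/idP/idP; rewrite !inE/= in_itv/= andbT pmulr_lgt0 ?invr_gt0// tt_gt0//.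
    by move=> h; case: (x) h => a b h; apply/BE.
  by case: (x) => a b /BE.
by case: (x \in B); rewrite ?mulr1// !(mulr0, mul0r).
Qed.

End Polar.

(** * Dominated convergence for real-valued integrals *)

Section Dominated.
Context d (T : measurableType d) (R : realType) (mu : {measure set T -> \bar R}).
Variables (D : set T) (mD : measurable D).

Lemma EFin_Rintegral (f : T -> R) : mu.-integrable D (EFin \o f) ->
  (Rintegral mu D f)%:E = (\int[mu]_(x in D) (f x)%:E)%E.
Proof. by move=> i; rewrite fineK//; exact: integrable_fin_num i. Qed.

Lemma Rintegral_dominated (u_ : nat -> T -> R) (v g : T -> R) :
  (forall n, measurable_fun D (u_ n)) -> measurable_fun D v ->
  mu.-integrable D (EFin \o g) ->
  (forall n x, D x -> `|u_ n x| <= g x) ->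
  {ae mu, forall x, D x -> u_ n x @[n --> \oo] --> v x} ->
  Rintegral mu D (u_ n) @[n --> \oo] --> Rintegral mu D v.
Proof.
move=> mu_ mv ig h ae.
have [|||iv _ cv] := @dominated_convergence _ _ _ mu D mD (fun n x => (u_ n x)%:E)
  (EFin \o v) (EFin \o g) (fun n => (measurable_EFinP _ _).2 (mu_ n)) ((measurable_EFinP _ _).2 mv).
- by apply: filterS ae => x hx Dx; exact: seq_cvg_EFin (hx Dx).
- exact: ig.
- by apply: nearW => x n Dx; rewrite /= lee_fin h.
- apply: seq_EFin_cvg.
  have iu n : mu.-integrable D (EFin \o u_ n) by exact: le_integrable_real ig (h n).
  rewrite (EFin_Rintegral iv).
  apply: seq_eq_cvg cv => n; by rewrite (EFin_Rintegral (iu n)).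
Qed.

Lemma cvgL2_bounded (u_ : nat -> T -> R) (v : T -> R) (M : R) : (mu D < +oo)%E ->
  (forall n, measurable_fun D (u_ n)) -> measurable_fun D v ->
  (forall n x, D x -> `|u_ n x| <= M) -> (forall x, D x -> `|v x| <= M) ->
  {ae mu, forall x, D x -> u_ n x @[n --> \oo] --> v x} -> cvgL2 mu D u_ v.
Proof.
move=> muD mu_ mv hu hv cv.
have := @Rintegral_dominated
  (fun n x => (u_ n x - v x) * (u_ n x - v x)) (fun=> 0) (fun=> (2 * M) * (2 * M)).
rewrite [X in _ --> X](_ : _ = 0); last by rewrite /Rintegral integral0.
apply.
- by move=> n; apply: measurable_funM; apply: measurable_funB.
- exact: measurable_cst.
- exact: integrable_cst_fin.
- move=> n x Bx; rewrite normrM; have h : `|u_ n x - v x| <= 2 * M.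
    by apply: le_trans (ler_normB _ _) _; rewrite mulr2n mulrDl mul1r lerD// ?hu// hv.
  by apply: ler_pM.
- apply: filterS cv => x cv Bx.
  have h : u_ n x - v x @[n --> \oo] --> (0 : R).
    by rewrite -(subrr (v x)); apply: cvgB; [exact: cv|exact: cvg_cst].
  by rewrite -[X in _ --> X](mulr0 (0 : R)); apply: cvgM.
Qed.

End Dominated.

(** * Primitives, and derivatives of functions of |x|^2 *)

Section Primitive.
Context {R : realType}.
Notation leb1 := (@lebesgue_measure R).

Lemma Rintegral_itv_split (f : R -> R) (a b c : R) : continuous f -> a <= b -> b <= c ->
  Rintegral leb1 `[a, c] f = Rintegral leb1 `[a, b] f + Rintegral leb1 `[b, c] f.
Proof.
move=> cf ab bc.
have := @Rintegral_itvB R f (BLeft a) (BRight c) b (integrable_continuous a c cf).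
rewrite !bnd_simp => /(_ ab bc) h.
rewrite (@Rintegral_itv_obnd_cbnd R b (BRight c)) in h; last first.
  by apply: integrableS (integrable_continuous b c cf) => //; apply: subset_itv_oc_cc.
by rewrite -h addrC subrK.
Qed.

Lemma primitive_shift (f : R -> R) (M x : R) : continuous f -> - M <= x -> 0 <= M ->
  primitive f x = Rintegral leb1 `[- M, x] f - Rintegral leb1 `[- M, 0] f.
Proof.
move=> cf Mx M0; rewrite /primitive; case: ifPn => [x0|].
  by rewrite (@Rintegral_itv_split f (- M) 0 x)//; [ring|rewrite oppr_le0].
rewrite -ltNge => x0; rewrite (@Rintegral_itv_split f (- M) x 0)//; [ring|exact: ltW].
Qed.

(** [primitive] splits on the sign of its argument; moving the base point to -M, to the left of x,
    makes it a single integral near x. *)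
Lemma is_derive_primitive (f : R -> R) (x : R) : continuous f ->
  is_derive x (1 : R) (primitive f) (f x).
Proof.
move=> cf; pose M := `|x| + 1.
have M0 : 0 <= M by rewrite addr_ge0.
have Mx : - M < x by rewrite /M; have := ler_norm (- x); rewrite normrN; lra.
have xM : x < M by rewrite /M; have := ler_norm x; lra.
have [d1 d2] := @continuous_FTC1_closed R f (- M) x M xM (integrable_continuous _ _ cf) Mx (cf x).
have dF : is_derive x (1 : R) (fun y => Rintegral leb1 `[- M, y] f - Rintegral leb1 `[- M, 0] f) (f x).
  apply: (is_derive_eq (is_deriveB (DeriveDef d1 (esym (derive1E _ _))) (is_derive_cst _ _ _))).
  by rewrite subr0.
apply: near_eq_is_derive dF.
near=> y; apply/esym/primitive_shift => //; near: y.
exact: (@cvgr_ge _ _ (nbhs x) _ id x (@cvg_id _ _) _ Mx).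
Unshelve. all: by end_near. Qed.

Lemma Rintegral_primitive (f : R -> R) (a b : R) : continuous f -> a <= b ->
  Rintegral leb1 `[a, b] f = primitive f b - primitive f a.
Proof.
move=> cf ab; rewrite /Rintegral.
by rewrite (FTC_continuous ab cf (fun x => is_derive_primitive x cf)).
Qed.

Lemma is_derive_sqrD (x c : R) : is_derive x (1 : R) (fun t : R => t ^+ 2 + c) (2 * x).
Proof.
have dX : is_derive x (1 : R) (fun t : R => t ^+ 2) ((2 * x ^+ 1) *: 1).
  have -> : (fun t : R => t ^+ 2) = id ^+ 2 by apply/funext => t; rewrite exprfctE.
  exact: (@is_deriveX _ _ id 2 x 1 1 (is_derive_id _ _)).
apply: (is_derive_eq (is_deriveD dX (is_derive_cst c x 1))).
by rewrite /GRing.scale/=; ring.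
Qed.

Lemma is_derive_rho1 (Q : R -> R) (d : R) (z : R * R) : is_derive (rho z) (1 : R) Q d ->
  is_derive z ((1, 0) : R * R) (fun z => Q (rho z)) (d * (2 * z.1)).
Proof.
case: z => x y dQ; apply/is_derive_line1.
exact: (@is_derive1_comp _ Q (fun t => t ^+ 2 + y ^+ 2) x _ _ dQ (is_derive_sqrD x _)).
Qed.

Lemma is_derive_rho2 (Q : R -> R) (d : R) (z : R * R) : is_derive (rho z) (1 : R) Q d ->
  is_derive z ((0, 1) : R * R) (fun z => Q (rho z)) (d * (2 * z.2)).
Proof.
case: z => x y dQ; apply/is_derive_line2; rewrite /rho/= addrC in dQ.
have := @is_derive1_comp _ Q (fun t => t ^+ 2 + x ^+ 2) y _ _ dQ (is_derive_sqrD y _).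
by rewrite /comp; under eq_fun do rewrite addrC.
Qed.

End Primitive.

(** * The truncated logarithm min(t, a) as an element of H^1_0 *)

Section Truncation.
Context {R : realType}.
Notation leb1 := (@lebesgue_measure R).
Notation sq := (sqint (@leb2 R) B).
Notation ipB := (ip (@leb2 R) B).
Notation cvgLB := (cvgL2 (@leb2 R) B).

Lemma cvgLB_bounded (u_ : nat -> R * R -> R) (v : R * R -> R) (M : R) :
  (forall n, measurable_fun B (u_ n)) -> measurable_fun B v ->
  (forall n x, B x -> `|u_ n x| <= M) -> (forall x, B x -> `|v x| <= M) ->
  (forall x, B x -> u_ n x @[n --> \oo] --> v x) -> cvgLB u_ v.
Proof.
move=> mu_ mv hu hv cv.
exact: (@cvgL2_bounded _ _ _ (@leb2 R) B measurable_B u_ v M leb2_B_lty mu_ mv hu hv (aeT cv)).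
Qed.

Variable a : R.
Hypothesis a0 : 0 < a.
Let ra := expR (- (2 * a)).

(** A smooth approximation of 1/(2 r) on ]ra, 1[. The partial sums of the geometric series of 1 - r
    tend to 1/r and, being polynomials, are smooth everywhere; the two bumps cut off at [ra] and
    just before 1. *)
Definition slope n (r : R) := 2^-1 * bump n (r - ra) * bump n (1 - n.+1%:R^-1 - r) *
  \sum_(j < n) (1 - r) ^+ j.

Lemma Ck_slope k n : Ck k (fun z : R * R => slope n z.1).
Proof.
have C1 j : Ck j (fun z : R * R => z.1 - ra) by apply: CkD; [exact: Ck_fst|exact: Ck_cst].
have CN j : Ck j (fun z : R * R => - z.1).
  by under eq_fun do rewrite -mulN1r; apply: CkM; [exact: Ck_cst|exact: Ck_fst].
have C2 j c : Ck j (fun z : R * R => c - z.1) by apply: CkD; [exact: Ck_cst|exact: CN].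
apply: CkM; first (apply: CkM; first (apply: CkM; first exact: Ck_cst)).
- exact: Ck_bump C1.
- by apply: Ck_bump => j; exact: C2.
- have Cp i j : Ck j (fun z : R * R => (1 - z.1) ^+ i).
    elim: i => [|i IH]; first by under eq_fun do rewrite expr0; exact: Ck_cst.
    by under eq_fun do rewrite exprS; apply: CkM => //; exact: C2.
  elim: n => [|n IH]; first by under eq_fun do rewrite big_ord0; exact: Ck_cst.
  by under eq_fun do rewrite big_ord_recr/=; exact: CkD.
Qed.

Lemma slope_cont n : continuous (slope n).
Proof.
have := Ck_continuous (Ck_slope 0 n) => h.
exact: (@continuous_line1 R (fun z => slope n z.1) 0 h).
Qed.

Lemma geometric_lt (r : R) n : 0 < r -> r < 1 -> 0 <= \sum_(j < n) (1 - r) ^+ j <= r^-1.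
Proof.
move=> r0 r1; have h : (1 - r) ^+ n - 1 = - (r * \sum_(j < n) (1 - r) ^+ j).
  by rewrite subrX1; ring.
apply/andP; split; first by apply: sumr_ge0 => j _; rewrite exprn_ge0// subr_ge0 ltW.
rewrite -[leRHS]mul1r ler_pdivlMr// mulrC.
have := exprn_ge0 n (_ : 0 <= 1 - r); rewrite subr_ge0 (ltW r1) => /(_ isT).
by move: h; lra.
Qed.

Lemma geometric_cvg (r : R) : 0 < r -> r < 1 ->
  \sum_(j < n) (1 - r) ^+ j @[n --> \oo] --> r^-1.
Proof.
move=> r0 r1.
have h n : (1 - (1 - r) ^+ n) * r^-1 = \sum_(j < n) (1 - r) ^+ j.
  have := subrX1 (1 - r) n => e; rewrite -[1 - _ ^+ n]opprB e.
  by field; rewrite gt_eqF.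
apply: seq_eq_cvg h _.
rewrite -[X in _ --> X]mul1r -[in X in _ --> X](subr0 1).
apply: cvgM; last exact: cvg_cst.
apply: cvgB; first exact: cvg_cst.
by apply: cvg_expr; rewrite ger0_norm; lra.
Qed.

Lemma ra_lt1 : ra < 1. Proof. by rewrite /ra expR_lt1 oppr_lt0 mulr_gt0. Qed.

Lemma ra_gt0 : 0 < ra. Proof. exact: expR_gt0. Qed.

Lemma slope_ge1 n r : 1 <= r -> slope n r = 0.
Proof.
move=> r1; rewrite /slope [X in _ * X * _]bump_le0 ?mulr0 ?mul0r//.
have : 0 < n.+1%:R^-1 :> R by rewrite invr_gt0.
by move: (n.+1%:R^-1) r1 => q; lra.
Qed.

Lemma slope_bound n r : 0 <= slope n r <= (2 * ra)^-1.
Proof.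
have [ra0 ra1] := (ra_gt0, ra_lt1).
have [h|h] := leP r ra.
  by rewrite /slope bump_le0 ?subr_le0// mulr0 !mul0r lexx invr_ge0 mulr_ge0// ltW.
have [h1|h1] := leP 1 r.
  by rewrite slope_ge1 // lexx invr_ge0 mulr_ge0 ?(ltW ra0).
have r0 := lt_trans ra0 h; have /andP[g0 g1] := geometric_lt n r0 h1.
have b0 := bump_ge0 n (r - ra); have b1 := bump_le1 n (r - ra).
have c0 := bump_ge0 n (1 - n.+1%:R^-1 - r); have c1 := bump_le1 n (1 - n.+1%:R^-1 - r).
rewrite /slope !mulr_ge0//= invfM; apply: ler_pM => //.
- by rewrite !mulr_ge0.
- by rewrite -[leRHS]mulr1 ler_pM ?mulr_ge0// -[leRHS]mulr1 ler_pM.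
- by apply: le_trans g1 _; rewrite lef_pV2 ?posrE// ltW.
Qed.

Lemma slope_cvg r :
  slope n r @[n --> \oo] --> (if (ra < r) && (r < 1) then (2 * r)^-1 else 0).
Proof.
have [r1|r1] := ltP r 1; rewrite ?andbT ?andbF; last first.
  by apply: seq_eq_cvg (cvg_cst 0) => n; rewrite slope_ge1.
case: ifPn => [h|]; last first.
  rewrite -leNgt => h; apply: seq_eq_cvg (cvg_cst 0) => n.
  by rewrite /slope bump_le0 ?subr_le0// mulr0 !mul0r.
have r0 := lt_trans ra_gt0 h.
rewrite invfM -[X in X * _]mulr1 -[X in X * _]mulr1.
apply: cvgM; last exact: geometric_cvg.
apply: cvgM; first (apply: cvgM; first exact: cvg_cst).
  by have := @bump_cvg R (r - ra); rewrite subr_gt0 h.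
have := @cutoff_cvg R (Num.sqrt r, 0); rewrite /cutoff/= sqr_sqrtr ?(ltW r0)// expr0n addr0.
by apply; apply/BE; rewrite sqr_sqrtr ?(ltW r0)// expr0n addr0.
Qed.

(** In the variable t = ln(1/|x|) this is min(t, a). *)
Definition trunc (x : R * R) : R := - ln (Num.max (enorm x) (expR (- a))).

Lemma truncE x : trunc x = - (ln (Num.max (rho x) ra) / 2).
Proof.
rewrite /trunc; have e0 : 0 <= enorm x by exact: sqrtr_ge0.
have -> : Num.max (rho x) ra = Num.max (enorm x) (expR (- a)) ^+ 2.
  have -> : ra = expR (- a) ^+ 2 by rewrite /ra -expRM_natl; congr expR; ring.
  rewrite /rho -enorm_sqr; have [h|h] := leP (enorm x) (expR (- a)).
    by rewrite max_r// lerXn2r ?nnegrE// expR_ge0.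
  by rewrite max_l// lerXn2r ?nnegrE ?expR_ge0// ltW.
have m0 : 0 < Num.max (enorm x) (expR (- a)) by rewrite lt_max expR_gt0 orbT.
by rewrite lnXn// mulr2n -mulr2n -[X in X / 2]mulr_natr mulfK.
Qed.

(** The integral of [slope n] from |x|^2 to 1; it has compact support in B because [slope n]
    vanishes from 1 - 1/(n+1) on. *)
Definition Phi n (x : R * R) := primitive (slope n) 1 - primitive (slope n) (rho x).

Lemma PhiE n r : r <= 1 -> primitive (slope n) 1 - primitive (slope n) r =
  Rintegral leb1 `[r, 1] (slope n).
Proof.
by move=> r1; rewrite Rintegral_primitive//; exact: slope_cont.
Qed.

Lemma Phi_test n : test_fun (Phi n).
Proof.
have C0 k : Ck k (fun z : R * R => primitive (slope n) z.1).
  apply: Ck_pred; apply: Ck_fst_derive (Ck_slope k n) => x.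
  by apply: is_derive_primitive; exact: slope_cont.
split.
  move=> k; apply: CkD; first exact: Ck_cst.
  under eq_fun do rewrite -mulN1r; apply: CkM; first exact: Ck_cst.
  by apply: (@Ck_comp _ _ (primitive (slope n)) rho (C0 k)) => j; exact: Ck_rho.
have n1 : 1 - n.+1%:R^-1 < 1 :> R by rewrite gtrBl invr_gt0 ltr0n.
exists [set z : R * R | z.1 ^+ 2 + z.2 ^+ 2 <= 1 - n.+1%:R^-1]; split.
- exact: compact_disk.
- by move=> [x y] /= h; apply/BE; apply: le_lt_trans h _.
- move=> z /= /negP; rewrite -ltNge => h.
  have z0 t : 1 - n.+1%:R^-1 <= t -> slope n t = 0.
    by move=> ht; rewrite /slope [X in _ * X * _]bump_le0 ?mulr0 ?mul0r// subr_le0.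
  rewrite /Phi; have [r1|/ltW r1] := leP (rho z) 1.
    rewrite PhiE// /Rintegral integral0_eq// => t /=; rewrite in_itv/= => /andP[t0 _].
    by rewrite z0// (le_trans _ t0)// ltW.
  rewrite -opprB.
  have <- : Rintegral leb1 `[1, rho z] (slope n) = primitive (slope n) (rho z) - primitive (slope n) 1.
    by rewrite Rintegral_primitive//; exact: slope_cont.
  rewrite /Rintegral integral0_eq ?oppr0// => t /=; rewrite in_itv/= => /andP[t0 _].
  by rewrite slope_ge1.
Qed.

Lemma dx_Phi n x : dx (Phi n) x = - (2 * x.1 * slope n (rho x)).
Proof.
apply: derive_val; have h := is_derive_rho1 (is_derive_primitive (rho x) (@slope_cont n)).
apply: (is_derive_eq (is_deriveB (is_derive_cst _ _ _) h)).
by rewrite sub0r mulrC.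
Qed.

Lemma dy_Phi n x : dy (Phi n) x = - (2 * x.2 * slope n (rho x)).
Proof.
apply: derive_val; have h := is_derive_rho2 (is_derive_primitive (rho x) (@slope_cont n)).
apply: (is_derive_eq (is_deriveB (is_derive_cst _ _ _) h)).
by rewrite sub0r mulrC.
Qed.

Let L t := if (ra < t) && (t < 1) then (2 * t)^-1 else 0.

Let mL : measurable_fun setT L.
Proof.
apply: (measurable_fun_ifT (f := fun t => (ra < t) && (t < 1))) => //.
- apply: measurable_and; first exact: measurable_fun_ltr.
  exact: measurable_fun_ltr.
- apply: (measurableT_comp measurable_inv).
  by apply: measurable_funM => //; exact: measurable_id.
Qed.

Let L_bound t : 0 <= L t <= (2 * ra)^-1.
Proof.
rewrite /L; case: ifPn => [/andP[h _]|_]; last by rewrite lexx invr_ge0 mulr_ge0// ltW// ra_gt0.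
have t0 := lt_trans ra_gt0 h.
by rewrite invr_ge0 mulr_ge0 ?(ltW t0)//= lef_pV2 ?posrE ?mulr_gt0 ?ra_gt0// ler_pM2l// ltW.
Qed.

Lemma half_inv_integral (m : R) : 0 < m -> m < 1 ->
  (\int[leb1]_(t in `[m, 1%R]) ((2 * t)^-1)%:E = (- (ln m / 2))%:E)%E.
Proof.
move=> m0 m1; rewrite (_ : (fun t => _) = fun t : R => ((2^-1)%:E * (t^-1)%:E)%E); last first.
  by apply/funext => t; rewrite invfM EFinM.
rewrite ge0_integralZl_EFin//.
- by rewrite ln_inv_integral// ln1 -EFinM; congr (_%:E); ring.
- by move=> t; rewrite /= in_itv/= => /andP[h _]; rewrite lee_fin invr_ge0 (le_trans _ h)// ltW.
- by apply/measurable_EFinP; apply: measurable_funTS; exact: measurable_inv.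
Qed.

Let meas_half (D : set R) : measurable_fun D (fun t : R => (2 * t)^-1).
Proof.
apply: measurable_funTS; apply: (measurableT_comp measurable_inv).
by apply: measurable_funM => //; exact: measurable_id.
Qed.

Lemma L_integral r : 0 <= r -> r < 1 -> Rintegral leb1 `[r, 1] L = - (ln (Num.max r ra) / 2).
Proof.
move=> r0 r1; rewrite /Rintegral.
have -> : (\int[leb1]_(t in `[r, 1%R]) (L t)%:E =
    \int[leb1]_(t in `[r, 1%R] `&` `]ra, 1%R[) ((2 * t)^-1)%:E)%E.
  rewrite [LHS]integral_mkcond [RHS]integral_mkcond; apply: eq_integral => t _.
  rewrite /patch in_setI /L; case: (t \in `[r, 1]%classic) => //=.
  by rewrite mem_setE in_itv/=; case: ifP.
have [h|h] := leP r ra.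
  rewrite (_ : _ `&` _ = `]ra, 1[%classic); last first.
    apply/seteqP; split => t /= => [[]//|]; rewrite !in_itv/= => /andP[h1 h2].
    by rewrite h1 h2 (ltW h2) (le_trans h (ltW h1)).
  rewrite integral_itv_obnd_cbnd; last by apply/measurable_EFinP; exact: meas_half.
  rewrite integral_itv_bndo_bndc; last by apply/measurable_EFinP; exact: meas_half.
  by rewrite half_inv_integral ?ra_gt0 ?ra_lt1.
rewrite (_ : _ `&` _ = `[r, 1[%classic); last first.
  apply/seteqP; split => t /=; rewrite !in_itv/=.
    by move=> [/andP[-> _] /andP[_ ->]].
  by move=> /andP[h1 h2]; rewrite h1 h2 (ltW h2) (lt_le_trans h h1).
rewrite integral_itv_bndo_bndc; last by apply/measurable_EFinP; exact: meas_half.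
by rewrite half_inv_integral// (lt_trans ra_gt0).
Qed.

Lemma rho_ge0 (x : R * R) : 0 <= rho x.
Proof. by rewrite addr_ge0 ?sqr_ge0. Qed.

Lemma rhoB (x : R * R) : B x <-> rho x < 1.
Proof. by case: x => x y; exact: BE. Qed.

Lemma Phi_cvg x : B x -> Phi n x @[n --> \oo] --> trunc x.
Proof.
move=> /rhoB r1; rewrite truncE -L_integral ?rho_ge0//.
apply: (@seq_eq_cvg _ (fun n => Rintegral leb1 `[rho x, 1] (slope n))).
  by move=> n; rewrite /Phi PhiE// ltW.
apply: (@Rintegral_dominated _ _ R leb1 _ _ slope L (fun=> (2 * ra)^-1)) => //.
- by move=> n; apply: continuous_measurable1D; exact: slope_cont.
- exact: measurable_funTS.
- exact: (@integrable_continuous _ (fun=> (2 * ra)^-1) _ _ (fun x => @cvg_cst _ _ _ _ _)).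
- by move=> n t _; have /andP[h1 h2] := slope_bound n t; rewrite ger0_norm.
- by apply: nearW => t _; exact: slope_cvg.
Qed.

Lemma Phi_bound n x : B x -> `|Phi n x| <= (2 * ra)^-1.
Proof.
move=> /rhoB r1; rewrite /Phi (PhiE _ (ltW r1)).
have h0 : 0 <= Rintegral leb1 `[rho x, 1] (slope n).
  by apply: Rintegral_ge0 => t _; have /andP[] := slope_bound n t.
rewrite ger0_norm// -lee_fin EFin_Rintegral//; last exact: integrable_continuous (@slope_cont n).
apply: (@le_trans _ _ (\int[leb1]_(t in `[rho x, 1%R]) ((2 * ra)^-1)%:E)%E).
  apply: ge0_le_integral => //.
  - by move=> t _; rewrite lee_fin; have /andP[] := slope_bound n t.
  - by apply/measurable_EFinP; apply: continuous_measurable1D; exact: slope_cont.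
  - by move=> t _; rewrite lee_fin; have /andP[h1 h2] := slope_bound n t; exact: le_trans h2.
rewrite integral_cst//= lebesgue_measure_itv/= lte_fin r1 -EFinB -EFinM lee_fin.
rewrite -[leRHS]mulr1 ler_wpM2l ?invr_ge0 ?mulr_ge0 ?(ltW ra_gt0)//.
by rewrite gerBl rho_ge0.
Qed.

Definition trunc_grad (x : R * R) : R * R :=
  (- ((if tt x < a then 1 else 0) * x.1 / rho x), - ((if tt x < a then 1 else 0) * x.2 / rho x)).

Lemma half_lt' (l : R) : (- (l / 2) < a) = (- (2 * a) < l).
Proof. by apply/idP/idP; lra. Qed.

Lemma trunc_gradE x : B x ->
  (trunc_grad x).1 = - (2 * x.1 * L (rho x)) /\ (trunc_grad x).2 = - (2 * x.2 * L (rho x)).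
Proof.
move=> /rhoB r1; rewrite /trunc_grad/= /L r1 andbT.
have [x0|x0] := eqVneq (rho x) 0.
  by rewrite !x0 invr0 !mulr0 ltNge (ltW ra_gt0)/= !mulr0 oppr0.
have x1 : 0 < rho x by rewrite lt_neqAle eq_sym x0 rho_ge0.
have -> : (tt x < a) = (ra < rho x).
  rewrite /ra -[in RHS](lnK x1) ltr_expR /tt; move: (ln (rho x)) => l.
  exact: half_lt'.
by case: ifP => _; split; [field|field|rewrite mul0r mulr0 mul0r|rewrite mul0r mulr0 mul0r].
Qed.

Lemma trunc_cont : continuous trunc.
Proof.
have -> : trunc = fun x => - (ln (Num.max (rho x) ra) / 2).
  by apply/funext => x; rewrite truncE.
move=> x; apply: cvgN; apply: cvgMl.
apply: (@continuous_comp _ _ _ (fun x => Num.max (rho x) ra) (@ln R)).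
  by apply: (@continuous_max _ _ rho (fun=> ra)); [exact: continuous_rho|exact: cst_continuous].
by apply: continuous_ln; rewrite lt_max ra_gt0 orbT.
Qed.

Lemma trunc_bound x : B x -> `|trunc x| <= a.
Proof.
move=> /rhoB r1; rewrite truncE normrN.
have m1 : Num.max (rho x) ra <= 1 by rewrite ge_max (ltW r1) (ltW ra_lt1).
have m0 : ra <= Num.max (rho x) ra by rewrite le_max lexx orbT.
have l0 : ln (Num.max (rho x) ra) <= 0 by exact: ln_le0.
have l1 : - (2 * a) <= ln (Num.max (rho x) ra).
  by rewrite -[leLHS]expRK ler_ln ?posrE ?(lt_le_trans ra_gt0)// ra_gt0.
move: (ln _) l0 l1 => l l0 l1; rewrite ler0_norm; lra.
Qed.

Lemma enorm_comp (x : R * R) : `|x.1| <= enorm x /\ `|x.2| <= enorm x.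
Proof.
split; rewrite -(@ler_pXn2r _ 2) ?nnegrE ?sqrtr_ge0// enorm_sqr real_normK ?num_real//.
  by rewrite lerDl sqr_ge0.
by rewrite lerDr sqr_ge0.
Qed.

Let comp_bound (y l : R) : `|y| <= 1 -> 0 <= l <= (2 * ra)^-1 -> `|- (2 * y * l)| <= ra^-1.
Proof.
move=> y1 /andP[l0 l1]; rewrite normrN !normrM (ger0_norm l0) ger0_norm//.
apply: (@le_trans _ _ (2 * 1 * (2 * ra)^-1)).
  by rewrite ler_pM ?mulr_ge0// ler_pM2l.
by rewrite mulr1 invfM mulrA mulfV// mul1r.
Qed.

(** [Phi n] and its partial derivatives converge pointwise under bounds uniform in n, and B has
    finite area, so all three convergences hold in L^2. *)
Lemma trunc_limit : test_limit trunc trunc_grad.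
Proof.
have mLr : measurable_fun setT (fun x => L (rho x)) by exact: measurableT_comp mL measurable_rho.
have mx1 : measurable_fun B (fun x : R * R => - (2 * x.1 * L (rho x))).
  apply: measurable_funN; apply: measurable_funM; last exact: measurable_funTS.
  by apply: continuous_measurable2D => x; apply: cvgMr; exact: cvg_fst.
have mx2 : measurable_fun B (fun x : R * R => - (2 * x.2 * L (rho x))).
  apply: measurable_funN; apply: measurable_funM; last exact: measurable_funTS.
  by apply: continuous_measurable2D => x; apply: cvgMr; exact: cvg_snd.
have eB (x : R * R) : B x -> `|x.1| <= 1 /\ `|x.2| <= 1.
  move=> Bx; have [h1 h2] := enorm_comp x.
  by split; [apply: le_trans h1 _|apply: le_trans h2 _]; exact: ltW.
have g1 x : B x -> fst_grad trunc_grad x = - (2 * x.1 * L (rho x)).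
  by move=> Bx; have [] := trunc_gradE Bx.
have g2 x : B x -> snd_grad trunc_grad x = - (2 * x.2 * L (rho x)).
  by move=> Bx; have [] := trunc_gradE Bx.
have mg1 : measurable_fun B (fst_grad trunc_grad).
  apply: (eq_measurable_fun _ _ mx1) => x; rewrite inE => Bx; by rewrite g1.
have mg2 : measurable_fun B (snd_grad trunc_grad).
  apply: (eq_measurable_fun _ _ mx2) => x; rewrite inE => Bx; by rewrite g2.
have bg1 x : B x -> `|fst_grad trunc_grad x| <= ra^-1.
  by move=> Bx; rewrite g1//; apply: comp_bound; [have [] := eB x Bx|exact: L_bound].
have bg2 x : B x -> `|snd_grad trunc_grad x| <= ra^-1.
  by move=> Bx; rewrite g2//; apply: comp_bound; [have [] := eB x Bx|exact: L_bound].
split.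
- exact: cont_sq trunc_cont.
- exact: (@sqint_bounded _ _ _ (@leb2 R) B measurable_B _ _ leb2_B_lty mg1 bg1).
- exact: (@sqint_bounded _ _ _ (@leb2 R) B measurable_B _ _ leb2_B_lty mg2 bg2).
exists Phi; split.
- exact: Phi_test.
- apply: (@cvgLB_bounded _ _ (Num.max (2 * ra)^-1 a)).
  + by move=> n; apply: continuous_measurable2D; exact: test_cont (Phi_test n).
  + exact: continuous_measurable2D trunc_cont.
  + by move=> n x Bx; rewrite le_max Phi_bound.
  + by move=> x Bx; rewrite le_max trunc_bound// orbT.
  + exact: Phi_cvg.
- apply: (@cvgLB_bounded _ _ ra^-1) => //.
  + by move=> n; apply: continuous_measurable2D; exact: test_cont (test_dx (Phi_test n)).
  + move=> n x Bx; rewrite dx_Phi; apply: comp_bound; [by have [] := eB x Bx|exact: slope_bound].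
  + move=> x Bx; rewrite g1//; under eq_fun do rewrite dx_Phi.
    by apply: cvgN; apply: cvgMr; exact: slope_cvg.
- apply: (@cvgLB_bounded _ _ ra^-1) => //.
  + by move=> n; apply: continuous_measurable2D; exact: test_cont (test_dy (Phi_test n)).
  + move=> n x Bx; rewrite dy_Phi; apply: comp_bound; [by have [] := eB x Bx|exact: slope_bound].
  + move=> x Bx; rewrite g2//; under eq_fun do rewrite dy_Phi.
    by apply: cvgN; apply: cvgMr; exact: slope_cvg.
Qed.
End Truncation.

(** * Gradient fields of radial functions and their energy *)

Section RadialField.
Context {R : realType}.
Notation leb1 := (@lebesgue_measure R).
Notation sq := (sqint (@leb2 R) B).
Notation ipB := (ip (@leb2 R) B).
Notation cvgLB := (cvgL2 (@leb2 R) B).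

(** The gradient of x -> V(tt x) when V' = w, since the gradient of [tt] is - x / |x|^2. *)
Definition rfield (w : R -> R) (x : R * R) : R * R :=
  (- (w (tt x) * x.1 / rho x), - (w (tt x) * x.2 / rho x)).

Lemma measurable_tt : measurable_fun setT (@tt R).
Proof.
apply: measurable_funN; apply: measurable_funM => //.
by apply: measurableT_comp => //; exact: measurable_rho.
Qed.

Lemma measurable_rfield w : measurable_fun setT w ->
  measurable_fun B (fst_grad (rfield w)) /\ measurable_fun B (snd_grad (rfield w)).
Proof.
move=> mw.
have mq : measurable_fun setT (fun x : R * R => (rho x)^-1).
  by apply: (measurableT_comp measurable_inv); exact: measurable_rho.
have mt : measurable_fun setT (fun x : R * R => w (tt x)).
  exact: measurableT_comp mw measurable_tt.
by split; apply: measurable_funTS; apply: measurable_funN; apply: measurable_funM => //;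
  apply: measurable_funM.
Qed.

Definition sqint1 (w : R -> R) :=
  measurable_fun setT w /\ (\int[leb1]_(t in `]0%R, +oo[) (w t ^+ 2)%:E < +oo)%E.

Lemma rfield_sqr w x : fst_grad (rfield w) x ^+ 2 + snd_grad (rfield w) x ^+ 2 = w (tt x) ^+ 2 / rho x.
Proof.
rewrite /fst_grad/snd_grad/=; have [x0|x0] := eqVneq (rho x) 0.
  by rewrite x0 invr0 !mulr0 oppr0 expr0n/= addr0.
by move: x0; rewrite /rho; move: (w _) => c h; field.
Qed.

Lemma ipG_EFin G : sqG G -> (ipG G G)%:E =
  (\int[@leb2 R]_(x in B) (fst_grad G x ^+ 2 + snd_grad G x ^+ 2)%:E)%E.
Proof.
move=> [s1 s2]; rewrite /ipG EFinD.
rewrite -(@integral_sqr_EFin _ _ _ (@leb2 R) B measurable_B _ s1).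
rewrite -(@integral_sqr_EFin _ _ _ (@leb2 R) B measurable_B _ s2).
rewrite -ge0_integralD//.
- exact: measurable_B.
- by move=> x _; rewrite lee_fin sqr_ge0.
- by case: s1 => m1 _; apply/measurable_EFinP; apply: (@measurable_funX _ _ _ _ _ 2).
- by move=> x _; rewrite lee_fin sqr_ge0.
- by case: s2 => m1 _; apply/measurable_EFinP; apply: (@measurable_funX _ _ _ _ _ 2).
Qed.

(** The parameter s builds the dilation into the formula: after t = s x the integrand is (sqrt(s)
    w(s x))^2, which has a limit for slopes of size 1 / sqrt(s) with kinks at distances of order
    s. *)
Lemma rfield_energy (w : R -> R) (s : R) : 0 < s -> measurable_fun setT w ->
  (\int[@leb2 R]_(x in B) (fst_grad (rfield w) x ^+ 2 + snd_grad (rfield w) x ^+ 2)%:E =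
   (2 * @disc1 R)%:E * \int[leb1]_(t in `]0%R, +oo[) ((Num.sqrt s * w (s * t)) ^+ 2)%:E)%E.
Proof.
move=> s0 mw; pose q t := w (s * t) ^+ 2.
have mq : measurable_fun setT q.
  apply: (@measurable_funX _ _ _ _ _ 2); apply: (measurableT_comp mw).
  by apply: measurable_funM => //; exact: measurable_id.
have := polar s0 mq (fun t => sqr_ge0 _).
under eq_integral => x _ do rewrite /q mulrCA mulfV ?gt_eqF// mulr1 -rfield_sqr.
move=> ->; rewrite EFinM -muleA; congr (_ * _)%E.
rewrite -ge0_integralZl_EFin ?(ltW s0)//.
- by apply: eq_integral => t _; rewrite exprMn sqr_sqrtr ?(ltW s0)// EFinM.
- by move=> t _; rewrite lee_fin sqr_ge0.
- by apply/measurable_EFinP; exact: measurable_funTS.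
Qed.

Lemma rfield_sqG w : sqint1 w -> sqG (rfield w).
Proof.
move=> [mw w2]; have [m1 m2] := measurable_rfield mw.
have fin : (\int[@leb2 R]_(x in B) (fst_grad (rfield w) x ^+ 2 + snd_grad (rfield w) x ^+ 2)%:E < +oo)%E.
  rewrite (rfield_energy ltr01 mw).
  under eq_integral => t _ do rewrite sqrtr1 !mul1r.
  apply: lte_mul_pinfty => //; rewrite lee_fin mulr_ge0//; exact: disc1_ge0.
have aux (a b : R * R -> R) : measurable_fun B a -> measurable_fun B b ->
    (forall x, a x ^+ 2 <= b x) -> (\int[@leb2 R]_(x in B) (b x)%:E < +oo)%E -> sq a.
  move=> ma mb ab fb; split => //; apply/integrableP; split.
    by apply/measurable_EFinP; apply: (@measurable_funX _ _ _ _ _ 2).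
  apply: le_lt_trans fb; apply: ge0_le_integral => //; first exact: measurable_B.
  - by apply/measurable_EFinP; apply: measurableT_comp => //; apply: (@measurable_funX _ _ _ _ _ 2).
  - exact/measurable_EFinP.
  - by move=> x _; rewrite /= ger0_norm ?sqr_ge0// lee_fin.
have ms : measurable_fun B (fun x => fst_grad (rfield w) x ^+ 2 + snd_grad (rfield w) x ^+ 2).
  by apply: measurable_funD; apply: (@measurable_funX _ _ _ _ _ 2).
split.
  by apply: aux fin => // x; rewrite lerDl sqr_ge0.
by apply: aux fin => // x; rewrite lerDr sqr_ge0.
Qed.

Lemma ipG_rfield w (s : R) : 0 < s -> sqint1 w -> (ipG (rfield w) (rfield w))%:E =
   ((2 * @disc1 R)%:E * \int[leb1]_(t in `]0%R, +oo[) ((Num.sqrt s * w (s * t)) ^+ 2)%:E)%E.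
Proof.
by move=> s0 w2; rewrite (ipG_EFin (rfield_sqG w2)) (rfield_energy s0)//; case: w2.
Qed.

(** A pair (p, b) stands for the profile p min(t, b); [wsum] is the derivative in t of the whole
    sum. *)
Definition tsum (s : seq (R * R)) (x : R * R) : R := \sum_(p <- s) p.1 * trunc p.2 x.
Definition wsum (s : seq (R * R)) (t : R) : R := \sum_(p <- s) p.1 * (if t < p.2 then 1 else 0).

Lemma test_limit0 : test_limit (fun=> 0 : R) (fun=> (0, 0)).
Proof.
have t0 : test_fun (fun=> 0 : R).
  split; first by move=> k; exact: Ck_cst.
  by exists set0; split => //; exact: compact0.
have := test_limit_test t0; congr (test_limit _ _).
by apply/funext => x; rewrite /dx /dy !derive_cst.
Qed.

Lemma tsum_limit s : all (fun p => 0 < p.2) s -> test_limit (tsum s) (rfield (wsum s)).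
Proof.
elim: s => [_|p s IH /= /andP[p0 /IH h]].
  have := test_limit0; congr (test_limit _ _); apply/funext => x.
    by rewrite /tsum big_nil.
  by rewrite /rfield /wsum big_nil !mul0r oppr0.
have := test_limitD (test_limitZ p.1 (trunc_limit p0)) h.
congr (test_limit _ _); apply/funext => x; first by rewrite /tsum big_cons.
by rewrite /rfield /wsum !big_cons/=; congr pair; ring.
Qed.

Lemma stepE (b : R) : (fun t : R => if t < b then 1 else 0 : R) = \1_(`]-oo, b[).
Proof. by apply/funext => t; rewrite indicE mem_setE in_itv/=; case: (t < b). Qed.

Lemma measurable_step (b : R) : measurable_fun setT (fun t : R => if t < b then 1 else 0 : R).
Proof.
rewrite stepE; apply: measurable_indic; exact: measurable_itv.
Qed.

Lemma measurable_wsum s : measurable_fun setT (wsum s).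
Proof.
by apply: measurable_sum => p; apply: measurable_funM => //; exact: measurable_step.
Qed.

Lemma sqint1E w : measurable_fun setT w -> sqint leb1 `]0, +oo[ w -> sqint1 w.
Proof.
move=> mw sw; split => //.
by rewrite (@integral_sqr_EFin _ _ _ leb1 _ _ _ sw)// ltry.
Qed.

Lemma sqint_step (b : R) : sqint leb1 `]0, +oo[ (fun t => if t < b then 1 else 0).
Proof.
have mb := measurable_step b.
split; first exact: measurable_funTS.
apply/integrableP; split.
  by apply/measurable_EFinP; apply: (@measurable_funX _ _ _ _ _ 2); exact: measurable_funTS.
rewrite (_ : (fun t => _) = fun t : R => (\1_(`]-oo, b[) t)%:E); last first.
  apply/funext => t; rewrite indicE mem_setE in_itv/=.
  by case: (t < b); rewrite /= ?expr1n ?normr1// expr0n normr0.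
rewrite integral_indic// setIC; apply: (@le_lt_trans _ _ (leb1 `]0%R, b[)).
  apply: le_measure; rewrite ?inE//; first exact: measurableI.
  by move=> t /=; rewrite !in_itv/= andbT => -[-> ->].
by rewrite lebesgue_measure_itv/= lte_fin; case: ifP => _; rewrite ltry.
Qed.

Lemma sqint1_wsum s : sqint1 (wsum s).
Proof.
apply: sqint1E; first exact: measurable_wsum.
elim: s => [|p s IH].
  under [X in sqint _ _ X]eq_fun do rewrite /wsum big_nil.
  split => //; rewrite (_ : (fun=> _) = cst 0%E); first exact: integrable0.
  by apply/funext => t; rewrite expr0n.
under [X in sqint _ _ X]eq_fun do rewrite /wsum big_cons.
by apply: sqintD => //; apply: sqintZ => //; exact: sqint_step.
Qed.

End RadialField.

(** * Integration by parts against a radial density *)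

Section Divergence.
Context {R : realType}.
Notation sq := (sqint (@leb2 R) B).
Notation ipB := (ip (@leb2 R) B).
Notation cvgLB := (cvgL2 (@leb2 R) B).
Variables (k : R -> R) (r1 k0 : R).
Hypothesis r10 : 0 < r1.
Hypothesis ck : continuous k.
Hypothesis kE : forall r, r <= r1 -> k r = k0.
Let K := primitive k.
(** The solution of 2 theta + 2 r theta' = k that is regular at 0: the field theta(|x|^2) x has
    divergence k(|x|^2). As [k] is constant near 0, so is [theta], which makes the field C^1 at the
    origin. *)
Definition theta (r : R) := if r < r1 then k0 / 2 else K r / (2 * r).
(** The numerator vanishes for r <= r1, so the maximum merely removes the singularity and one
    formula serves both cases. *)
Definition dtheta (r : R) := (k r * r - K r) / (2 * Num.max r r1 ^+ 2).

Lemma K_small r : r <= r1 -> K r = k0 * r.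
Proof.
move=> rr1.
have dl (c x : R) : is_derive x (1 : R) (fun t => c * t) c.
  by apply: (is_derive_eq (is_deriveZ c (is_derive_id x 1))); rewrite /GRing.scale/= mulr1.
have cst_int a b : a <= b -> b <= r1 -> Rintegral lebesgue_measure `[a, b] k = k0 * (b - a).
  move=> ab br; rewrite (@eq_Rintegral _ _ _ _ _ (fun=> k0)); last first.
    by move=> t; rewrite inE/= in_itv/= => /andP[_ tb]; rewrite kE// (le_trans tb).
  rewrite /Rintegral (FTC_continuous ab (@cst_continuous _ _ k0) (dl k0))/=; ring.
rewrite /K /primitive; case: ifPn => [r0|]; first by rewrite cst_int// subr0.
by rewrite -ltNge => r0; rewrite cst_int ?(ltW r0) ?(ltW r10)//; ring.
Qed.

Lemma is_derive_theta (r : R) : is_derive r (1 : R) theta (dtheta r).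
Proof.
have [rr1|rr1] := ltP r r1.
  have -> : dtheta r = 0 by rewrite /dtheta K_small ?kE ?(ltW rr1)// subrr mul0r.
  apply: near_eq_is_derive (is_derive_cst (k0 / 2) r 1).
  near=> t; rewrite /theta ifT//; near: t.
  exact: (@cvgr_lt _ _ (nbhs r) _ id r (@cvg_id _ _) _ rr1).
have r0 : 0 < r by exact: lt_le_trans rr1.
have d2 : is_derive r (1 : R) (fun t : R => 2 * t) 2.
  by apply: (is_derive_eq (is_deriveZ 2 (is_derive_id r 1))); rewrite /GRing.scale/= mulr1.
have r20 : 2 * r != 0 by rewrite mulf_neq0// gt_eqF.
have dV := @is_deriveV _ (fun t : R => 2 * t) r 2 1 r20 d2.
have dM := is_deriveM (is_derive_primitive r ck) dV.
apply: (@near_eq_is_derive _ _ _ (fun t => K t * (2 * t)^-1)).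
  near=> t; rewrite /theta; case: ifPn => // tr.
  have t0 : 0 < t by near: t; exact: (@cvgr_gt _ _ (nbhs r) _ id r (@cvg_id _ _) _ r0).
  by rewrite K_small ?(ltW tr)//; field; rewrite gt_eqF.
apply: (is_derive_eq dM); rewrite /GRing.scale/= /dtheta max_l// -/(K r).
by move: (K r) (k r) => a b; field; rewrite gt_eqF.
Unshelve. all: by end_near.
Qed.

Lemma dtheta_cont : continuous dtheta.
Proof.
have cK : continuous K by apply: continuous_is_derive => x; exact: is_derive_primitive.
move=> r; apply: cvgM.
  by apply: cvgB; [apply: cvgM; [exact: ck|exact: cvg_id]|exact: cK].
apply: cvgV.
  by rewrite mulf_neq0// expf_neq0// gt_eqF// lt_max r10 orbT.
apply: cvgMr; apply: (@continuous_comp _ _ _ (fun t => Num.max t r1) (fun t => t ^+ 2)).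
  by apply: (@continuous_max _ _ id (fun=> r1)); [move=> ?; exact: cvg_id|exact: cst_continuous].
exact: exprn_continuous.
Qed.

Lemma theta_cont : continuous theta.
Proof. exact: continuous_is_derive is_derive_theta. Qed.

Lemma theta_div r : 2 * theta r + 2 * r * dtheta r = k r.
Proof.
rewrite /theta /dtheta; case: ifPn => [rr1|].
  by rewrite K_small ?kE ?(ltW rr1)// subrr mul0r mulr0 addr0 mulrCA mulfV ?mulr1.
rewrite -leNgt => rr1; have r0 := lt_le_trans r10 rr1; rewrite max_l//.
by move: (K r) (k r) => a b; field; rewrite gt_eqF.
Qed.

Lemma divergence_test phi : test_fun phi ->
  ipB (fun x => k (rho x)) phi =
    - (ipB (fun x => theta (rho x) * x.1) (dx phi) + ipB (fun x => theta (rho x) * x.2) (dy phi)).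
Proof.
move=> tphi.
have cth : continuous (fun x : R * R => theta (rho x)).
  move=> x; apply: (@continuous_comp _ _ _ rho theta); [exact: continuous_rho|exact: theta_cont].
have cdth : continuous (fun x : R * R => dtheta (rho x)).
  move=> x; apply: (@continuous_comp _ _ _ rho dtheta); [exact: continuous_rho|exact: dtheta_cont].
have cfst : continuous (fun x : R * R => x.1) by move=> x; exact: cvg_fst.
have csnd : continuous (fun x : R * R => x.2) by move=> x; exact: cvg_snd.
have cphi := test_cont tphi; have cdx := test_cont (test_dx tphi).
have cdy := test_cont (test_dy tphi).
pose a1 (x : R * R) := theta (rho x) + x.1 * (dtheta (rho x) * (2 * x.1)).
pose a2 (x : R * R) := theta (rho x) + x.2 * (dtheta (rho x) * (2 * x.2)).
pose b1 (x : R * R) := theta (rho x) * x.1.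
pose b2 (x : R * R) := theta (rho x) * x.2.
have ca1 : continuous a1.
  move=> x; apply: cvgD; first exact: cth.
  by apply: cvgM; [exact: cfst|apply: cvgM; [exact: cdth|apply: cvgMr; exact: cfst]].
have ca2 : continuous a2.
  move=> x; apply: cvgD; first exact: cth.
  by apply: cvgM; [exact: csnd|apply: cvgM; [exact: cdth|apply: cvgMr; exact: csnd]].
have cb1 : continuous b1 by move=> x; apply: cvgM; [exact: cth|exact: cfst].
have cb2 : continuous b2 by move=> x; apply: cvgM; [exact: cth|exact: csnd].
have h1 : ipB a1 phi + ipB b1 (dx phi) = 0.
  rewrite /ip -RintegralD; first last.
  - by apply: bounded_B_integrable => x; apply: cvgM; [exact: cb1|exact: cdx].
  - by apply: bounded_B_integrable => x; apply: cvgM; [exact: ca1|exact: cphi].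
  - exact: measurable_B.
  apply: (@integral_partial1_eq0 _ (fun x => b1 x * phi x)).
  - by move=> x; apply: cvgD; apply: cvgM; [exact: ca1|exact: cphi|exact: cb1|exact: cdx].
  - move=> x; have e1 : is_derive x ((1, 0) : R * R) (fun x : R * R => x.1) 1.
      by case: x => x y; apply/is_derive_line1; exact: is_derive_id.
    have h := is_deriveM (is_derive_rho1 (is_derive_theta (rho x))) e1.
    apply: (is_derive_eq (is_deriveM h (test_derive1 tphi x))).
    change ((theta (rho x) * x.1) * dx phi x +
      phi x * (theta (rho x) * 1 + x.1 * (dtheta (rho x) * (2 * x.1))) = a1 x * phi x + b1 x * dx phi x).
    by rewrite /a1 /b1; ring.
  - by move=> x nB; rewrite (test_outB tphi nB) mulr0.
have h2 : ipB a2 phi + ipB b2 (dy phi) = 0.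
  rewrite /ip -RintegralD; first last.
  - by apply: bounded_B_integrable => x; apply: cvgM; [exact: cb2|exact: cdy].
  - by apply: bounded_B_integrable => x; apply: cvgM; [exact: ca2|exact: cphi].
  - exact: measurable_B.
  apply: (@integral_partial2_eq0 _ (fun x => b2 x * phi x)).
  - by move=> x; apply: cvgD; apply: cvgM; [exact: ca2|exact: cphi|exact: cb2|exact: cdy].
  - move=> x; have e1 : is_derive x ((0, 1) : R * R) (fun x : R * R => x.2) 1.
      by case: x => x y; apply/is_derive_line2; exact: is_derive_id.
    have h := is_deriveM (is_derive_rho2 (is_derive_theta (rho x))) e1.
    apply: (is_derive_eq (is_deriveM h (test_derive2 tphi x))).
    change ((theta (rho x) * x.2) * dy phi x +
      phi x * (theta (rho x) * 1 + x.2 * (dtheta (rho x) * (2 * x.2))) = a2 x * phi x + b2 x * dy phi x).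
    by rewrite /a2 /b2; ring.
  - by move=> x nB; rewrite (test_outB tphi nB) mulr0.
have -> : ipB (fun x => k (rho x)) phi = ipB a1 phi + ipB a2 phi.
  rewrite -(@ipDl _ _ _ (@leb2 R) B measurable_B _ _ _ (cont_sq ca1) (cont_sq ca2) (cont_sq cphi)).
  apply: eq_Rintegral => x _; congr (_ * _); rewrite -theta_div /a1 /a2 /rho.
  by move: (theta _) (dtheta _) => p q; ring.
by move: h1 h2; rewrite -/b1 -/b2; move: (ipB _ _) (ipB _ _) (ipB _ _) (ipB _ _) => p q r t; lra.
Qed.

(** The integral of k(|x|^2) over the disk |x| < exp(-t), divided by 2 pi: by the divergence
    theorem, the slope in t that a radial solution of - Laplace(u) = k must have. *)
Definition Hfun (t : R) := 2^-1 * K (expR (- (2 * t))).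

Lemma Hfield_eq x : fst_grad (rfield Hfun) x = - (theta (rho x) * x.1) /\
  snd_grad (rfield Hfun) x = - (theta (rho x) * x.2).
Proof.
rewrite /fst_grad/snd_grad/rfield/=; have [x0|x0] := eqVneq (rho x) 0.
  have : x.1 ^+ 2 + x.2 ^+ 2 == 0 by apply/eqP.
  rewrite paddr_eq0 ?sqr_ge0// !sqrf_eq0 => /andP[/eqP -> /eqP ->].
  by rewrite !mulr0 !mul0r.
have r0 : 0 < rho x by rewrite lt_neqAle eq_sym x0 rho_ge0.
have -> : Hfun (tt x) = rho x * theta (rho x).
  rewrite /Hfun /tt mulrN opprK mulrCA mulfV// mulr1 lnK// /theta.
  case: ifPn => [h|_]; last by field.
  by rewrite K_small ?(ltW h)//; field.
by split; congr (- _); field.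
Qed.

Lemma Hfield_sqG : sqG (rfield Hfun).
Proof.
have cth : continuous (fun x : R * R => theta (rho x)).
  by move=> x; apply: (@continuous_comp _ _ _ rho theta); [exact: continuous_rho|exact: theta_cont].
split.
  rewrite (_ : fst_grad _ = fun x => - (theta (rho x) * x.1)).
    by apply: cont_sq => x; apply: cvgN; apply: cvgM; [exact: cth|exact: cvg_fst].
  by apply/funext => x; have [] := Hfield_eq x.
rewrite (_ : snd_grad _ = fun x => - (theta (rho x) * x.2)).
  by apply: cont_sq => x; apply: cvgN; apply: cvgM; [exact: cth|exact: cvg_snd].
by apply/funext => x; have [] := Hfield_eq x.
Qed.

Lemma is_derive_H (t : R) : is_derive t (1 : R) Hfun (- (expR (- (2 * t)) * k (expR (- (2 * t))))).
Proof.
have d1 : is_derive t (1 : R) (fun t => - (2 * t)) (- 2).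
  apply: (is_derive_eq (is_deriveN (is_deriveZ 2 (is_derive_id t 1)))).
  by rewrite /GRing.scale/= mulr1.
have d2 := @is_derive1_comp _ expR (fun t => - (2 * t)) t _ _ (is_derive_expR _) d1.
have d3 := @is_derive1_comp _ K _ t _ _ (is_derive_primitive _ ck) d2.
apply: (is_derive_eq (is_deriveZ 2^-1 d3)).
by rewrite /GRing.scale/=; move: (expR _) (k _) => a b; field.
Qed.

(** Both sides are continuous along an approximating sequence of test functions, because k(rho) and
    theta(rho) x are continuous, hence square integrable on B. *)
Lemma divergence v : H10 v ->
  ipB (fun x => k (rho x)) v = ipG (rfield Hfun) (grad v).
Proof.
move=> Hv; have [sv s1 s2 [phi [tphi c0 c1 c2]]] := H10_test_limit Hv.
pose b1 (x : R * R) := theta (rho x) * x.1.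
pose b2 (x : R * R) := theta (rho x) * x.2.
have cth : continuous (fun x : R * R => theta (rho x)).
  by move=> x; apply: (@continuous_comp _ _ _ rho theta); [exact: continuous_rho|exact: theta_cont].
have ckr : continuous (fun x : R * R => k (rho x)).
  by move=> x; apply: (@continuous_comp _ _ _ rho k); [exact: continuous_rho|exact: ck].
have sb1 : sq b1 by apply: cont_sq => x; apply: cvgM; [exact: cth|exact: cvg_fst].
have sb2 : sq b2 by apply: cont_sq => x; apply: cvgM; [exact: cth|exact: cvg_snd].
have skr : sq (fun x => k (rho x)) by exact: cont_sq.
have eH := Hfield_eq.
have e1 : ipG (rfield Hfun) (grad v) = - (ipB b1 (fst_grad (grad v)) + ipB b2 (snd_grad (grad v))).
  rewrite opprD -[- ipB b1 _]mulN1r -[- ipB b2 _]mulN1r.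
  rewrite -(@ipZl _ _ _ (@leb2 R) B measurable_B _ _ _ sb1 s1).
  rewrite -(@ipZl _ _ _ (@leb2 R) B measurable_B _ _ _ sb2 s2).
  by congr (_ + _); apply: eq_Rintegral => x _; have [h1 h2] := eH x; rewrite ?h1 ?h2 mulN1r.
have l1 : ipB (fun x => k (rho x)) (phi n) @[n --> \oo] --> ipB (fun x => k (rho x)) v.
  rewrite ipC; under eq_fun do rewrite ipC.
  by apply: ipB_cvgl => // n; exact: test_sq.
have l2 : - (ipB b1 (dx (phi n)) + ipB b2 (dy (phi n))) @[n --> \oo] --> ipG (rfield Hfun) (grad v).
  rewrite e1; apply: cvgN; apply: cvgD.
    rewrite ipC; under eq_fun do rewrite ipC.
    by apply: ipB_cvgl => // n; exact: test_sq (test_dx (tphi n)).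
  rewrite ipC; under eq_fun do rewrite ipC.
  by apply: ipB_cvgl => // n; exact: test_sq (test_dy (tphi n)).
apply: seq_cvg_unique l1 _; apply: seq_eq_cvg l2 => n.
by rewrite divergence_test.
Qed.

End Divergence.

(** * Differentiability of J at bounded elements of H^1_0 *)

Section Frechet.
Context {R : realType}.
Notation sq := (sqint (@leb2 R) B).
Notation ipB := (ip (@leb2 R) B).

Lemma critical_growth_bound (f : R -> R) (dl : R) : continuous f -> critical_growth f -> 0 < dl ->
  exists2 C : R, 0 <= C & forall t, `|f t| <= C * expR ((4 * pi + dl) * t ^+ 2).
Proof.
move=> cf cg dl0; have [cp cn] := cg dl dl0.
have bnd (t : R) : `|gfun f t * expR (- dl * t ^+ 2)| < 1 ->
    `|f t| <= 8 * pi * expR ((4 * pi + dl) * t ^+ 2).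
  have p0 : 0 < 8 * pi :> R by rewrite mulr_gt0// pi_gt0.
  have -> : f t = 8 * pi * (gfun f t * expR (- dl * t ^+ 2)) * expR ((4 * pi + dl) * t ^+ 2).
    rewrite /gfun; have -> : (4 * pi + dl) * t ^+ 2 = 4 * pi * t ^+ 2 + dl * t ^+ 2 by ring.
    rewrite mulNr expRN expRD.
    move: (8 * pi) p0 (expR_gt0 (4 * pi * t ^+ 2)) (expR_gt0 (dl * t ^+ 2)) => c.
    by move: (expR _) (expR _) (f t) => E1 E2 y h0 h1 h2; field; rewrite !gt_eqF.
  rewrite !normrM => h; rewrite (ger0_norm (expR_ge0 ((4 * pi + dl) * _))).
  rewrite ler_wpM2r ?expR_ge0// -normrM (ger0_norm (ltW p0)) -[leRHS]mulr1 ler_wpM2l ?(ltW p0)//.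
  exact: ltW.
move: cp => /cvgr0_norm_lt /(_ 1 ltr01)[a [ra ha]].
move: cn => /cvgr0_norm_lt /(_ 1 ltr01)[b [rb hb]].
pose M := `|a| + `|b|.
have [c _ hc] : exists2 c, c \in `[- M, M] & forall t, t \in `[- M, M] -> `|f t| <= `|f c|.
  apply: (@EVT_max _ (fun t => `|f t|)); first by rewrite /M; have := normr_ge0 a; have := normr_ge0 b; lra.
  by apply: continuous_subspaceT => t; apply: continuous_comp; [exact: cf|exact: norm_continuous].
have p0 : 0 <= 8 * pi :> R by rewrite mulr_ge0// pi_ge0.
have q0 : 0 <= 4 * pi + dl :> R by rewrite addr_ge0 ?(ltW dl0)// mulr_ge0// pi_ge0.
exists (8 * pi + `|f c|) => [|t]; first by rewrite addr_ge0.
have [h|h] := boolP (t \in `[- M, M]).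
  apply: le_trans (hc t h) _; rewrite -[leLHS]mulr1.
  apply: ler_pM => //; first by rewrite lerDr.
  by apply: (le_trans _ (expR_ge1Dx _)); rewrite lerDl mulr_ge0// sqr_ge0.
apply: (@le_trans _ _ (8 * pi * expR ((4 * pi + dl) * t ^+ 2))); last first.
  by rewrite ler_wpM2r ?expR_ge0// lerDl.
apply: bnd; move: h; rewrite in_itv/= negb_and -!ltNge => /orP[h|h].
  by apply: hb; rewrite /M in h; have := ler_norm (- b); rewrite normrN; have := normr_ge0 a; lra.
by apply: ha; rewrite /M in h; have := ler_norm a; have := normr_ge0 b; lra.
Qed.

Lemma primitive_mvt (f : R -> R) (a b : R) : continuous f ->
  exists2 c, `|c - a| <= `|b| & primitive f (a + b) - primitive f a = f c * b.
Proof.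
move=> cf; have dF := fun x => is_derive_primitive x cf.
have cF : continuous (primitive f) by exact: continuous_is_derive dF.
have [b0|b0] := leP 0 b.
  have ab : a <= a + b by lra.
  have [c] := MVT_segment ab (fun x _ => dF x) (continuous_subspaceT cF).
  rewrite in_itv/= => /andP[c1 c2] e; exists c; last by rewrite e; congr (_ * _); ring.
  by rewrite (ger0_norm b0) ger0_norm; lra.
have ab : a + b <= a by lra.
have [c] := MVT_segment ab (fun x _ => dF x) (continuous_subspaceT cF).
rewrite in_itv/= => /andP[c1 c2] e; exists c; last by rewrite -opprB e; ring.
by rewrite (ltr0_norm b0) ler0_norm; lra.
Qed.

(** Counterexamples with gaps 1/(n+1) would cluster at a point of [-M, M], against continuity there.
    The second point b is allowed to leave [-M, M]. *)
Lemma uniform_continuity (f : R -> R) (M e : R) : continuous f -> 0 < e ->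
  exists2 d, 0 < d & forall a b, `|a| <= M -> `|b - a| <= d -> `|f b - f a| <= e.
Proof.
move=> cf e0; apply: contrapT => /forall2NP h.
have ex (n : nat) : exists p : R * R, [/\ `|p.1| <= M, `|p.2 - p.1| <= n.+1%:R^-1 & e < `|f p.2 - f p.1|].
  have := h n.+1%:R^-1 => -[/negP|]; first by rewrite invr_gt0 ltr0n.
  move=> /existsNP[a /existsNP[b /not_implyP[h1 /not_implyP[h2 /negP h3]]]].
  by exists (a, b); split => //; rewrite ltNge.
have [p hp] := choice ex.
have cpt : compact `[(- M)%R, M] by exact: segment_compact.
have [x [_ clx]] : `[(- M)%R, M] `&` cluster ((fun n => (p n).1) @ \oo) !=set0.
  have hF : \forall n \near \oo, `[(- M)%R, M]%classic (p n).1.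
    by near=> n; have [h1 _ _] := hp n; rewrite /= in_itv/= -ler_norml.
  exact: (cpt ((fun n => (p n).1) @ \oo) (fmap_proper_filter _ _) hF).
have := cf x => /cvgrPdist_lt /(_ (e / 2)); rewrite divr_gt0// => /(_ isT).
move=> /nbhs_ballP[r /= r0 hr].
have n0 : \forall n \near \oo, n.+1%:R^-1 < r / 2.
  have : (n.+1%:R^-1 : R) @[n --> \oo] --> 0 by exact: cvg_harmonic.
  by move/cvgr_lt; apply; rewrite divr_gt0.
have nb : nbhs x (ball x (r / 2)) by apply: nbhsx_ballx; rewrite divr_gt0.
have [y [[n [/= n1 n2]] hy]] := clx [set y | exists n, n.+1%:R^-1 < r / 2 /\ (p n).1 = y] (ball x (r / 2))
   (filterS (fun n hn => ex_intro _ n (conj hn erefl)) n0) nb.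
have [_ q2 q3] := hp n; rewrite n2 in q2 q3.
have b1 : ball x r y by apply: le_ball hy; lra.
have b2 : ball x r (p n).2.
  move: hy; rewrite -!ball_normE/= => hy.
  have := ler_normD (x - y) (y - (p n).2); rewrite addrA subrK [`|y - _|]distrC.
  by move: n1 q2 hy; move: (n.+1%:R^-1) => q; lra.
have := hr _ b1; have := hr _ b2; rewrite /= => h1 h2.
have := ler_normD (f (p n).2 - f x) (f x - f y); rewrite addrA subrK [`|f (p n).2 - f x|]distrC.
by move: q3 h1 h2; lra.
Unshelve. all: by end_near. Qed.

(** For small |b| uniform continuity gives eta |b|. For |b| >= 2 dl both values of f are estimated
    by the growth bound, and (M + |b|)^2 <= 2 M^2 + 2 b^2 produces the exponent 2 K. *)
Lemma remainder_bound (f : R -> R) (M eta C K : R) : continuous f -> 0 <= M -> 0 < eta ->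
  0 <= C -> 0 <= K -> (forall t, `|f t| <= C * expR (K * t ^+ 2)) ->
  exists C' dl, [/\ 0 <= C', 0 < dl & forall a b, `|a| <= M ->
    `|primitive f (a + b) - primitive f a - f a * b| <=
      eta * `|b| + C' * expsq (2 * K) dl b].
Proof.
move=> cf M0 e0 C0 K0 hf; have [d d0 hd] := uniform_continuity M cf e0.
exists (2 * C * expR (2 * K * M ^+ 2)), (d / 2).
have C'0 : 0 <= 2 * C * expR (2 * K * M ^+ 2) by rewrite !mulr_ge0// expR_ge0.
split => //; first by rewrite divr_gt0.
move=> a b aM; have [c ca ->] := primitive_mvt a b cf.
rewrite -mulrBl normrM /expsq (_ : 2 * (d / 2) = d); last by field.
case: ifPn => [db|]; last first.
  rewrite -ltNge => bd; rewrite mulr0 addr0 ler_wpM2r//.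
  by apply: hd => //; rewrite (le_trans ca)// ltW.
apply: (@le_trans _ _ (2 * C * expR (2 * K * M ^+ 2) * expR (2 * K * b ^+ 2) * `|b|)); last first.
  rewrite -mulrA [expR _ * `|b|]mulrC lerDr mulr_ge0//; exact: ltW.
rewrite ler_wpM2r// -mulrA -expRD.
have key t : `|t| <= M + `|b| -> `|f t| <= C * expR (2 * K * M ^+ 2 + 2 * K * b ^+ 2).
  move=> ht; apply: le_trans (hf t) _; rewrite ler_wpM2l// ler_expR.
  have -> : 2 * K * M ^+ 2 + 2 * K * b ^+ 2 = K * (2 * M ^+ 2 + 2 * `|b| ^+ 2).
    by rewrite real_normK ?num_real//; ring.
  rewrite ler_wpM2l// -(real_normK (num_real t)).
  apply: (@le_trans _ _ ((M + `|b|) ^+ 2)); first by rewrite lerXn2r ?nnegrE// addr_ge0.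
  by have := sqr_ge0 (M - `|b|); move: (`|b|) => x; nra.
have h1 : `|c| <= M + `|b|.
  have := ler_normD (c - a) a; rewrite subrK; lra.
have h2 : `|a| <= M + `|b| by rewrite (le_trans aM)// lerDl.
apply: le_trans (ler_normB _ _) _; have := key _ h1; have := key _ h2.
by move: (expR _) (`|f a|) (`|f c|) => x y z; lra.
Qed.

(** The arithmetic that ends the differentiability proof: N is the norm of the increment, D its
    Dirichlet integral and P the integrated remainder of the primitive of f. *)
Lemma final_bound (e N D A P a b cc : R) : 0 < e -> 0 <= N -> 0 <= a -> 0 <= b ->
  (2^-1 + cc * b) * N <= e / 2 -> cc * a <= e / 2 -> 0 <= cc ->
  D = N ^+ 2 -> `|P| <= a * N + b * D -> `|2^-1 * D - cc * P| <= e * N.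
Proof.
move=> e0 N0 a0 b0 h1 h2 c0 -> hP.
apply: le_trans (ler_normB _ _) _; rewrite [`|cc * P|]normrM (ger0_norm c0).
have -> : `|2^-1 * N ^+ 2| = 2^-1 * N ^+ 2 by rewrite ger0_norm// mulr_ge0// sqr_ge0.
have h3 : cc * `|P| <= cc * (a * N + b * N ^+ 2) by rewrite ler_wpM2l.
have h4 : (2^-1 + cc * b) * N * N <= e / 2 * N by rewrite ler_wpM2r.
have h5 : cc * a * N <= e / 2 * N by rewrite ler_wpM2r.
move: h3 h4 h5; rewrite expr2; lra.
Qed.

Variables (f : R -> R) (u : R * R -> R) (M C K : R).
Hypothesis cf : continuous f.
Hypothesis C0 : 0 <= C.
Hypothesis K0 : 0 <= K.
Hypothesis hf : forall t, `|f t| <= C * expR (K * t ^+ 2).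
Hypothesis Hu : H10 u.
Hypothesis uM : forall x, B x -> `|u x| <= M.

Let cc : R := (8 * pi)^-1.
Definition dJ (v : R * R -> R) : R := ipG (grad u) (grad v) - cc * ipB (fun x => f (u x)) v.

Let M0 : 0 <= M.
Proof. by apply: le_trans (uM (_ : B (0, 0))); rewrite // BE expr0n addr0. Qed.

Let cc0 : 0 <= cc. Proof. by rewrite invr_ge0 mulr_ge0// pi_ge0. Qed.

Lemma H10_sq v : H10 v -> sq v.
Proof. by move=> /H10_test_limit[]. Qed.

Let mu : measurable_fun B u. Proof. exact: sqB_meas (H10_sq Hu). Qed.

Lemma sq_fu : sq (fun x => f (u x)).
Proof.
apply: (@sqint_bounded _ _ _ (@leb2 R) B measurable_B (C * expR (K * M ^+ 2)) _ leb2_B_lty).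
  by apply: (measurableT_comp (continuous_measurable1D cf) mu).
move=> x Bx; apply: le_trans (hf _) _; rewrite ler_wpM2l// ler_expR ler_wpM2l//.
by rewrite -(real_normK (num_real (u x))) lerXn2r ?nnegrE// uM.
Qed.

Lemma dJ_linear (a : R) v w : H10 v -> H10 w -> dJ (a *: v + w) = a * dJ v + dJ w.
Proof.
move=> Hv Hw; have tv := H10_test_limit Hv; have tw := H10_test_limit Hw.
have tu := H10_test_limit Hu.
have h := test_limitD (test_limitZ a tv) tw.
have sv := H10_sqG Hv; have sw := H10_sqG Hw; have su := H10_sqG Hu.
have e1 : ipG (grad u) (grad (a *: v + w)) = a * ipG (grad u) (grad v) + ipG (grad u) (grad w).
  rewrite (ipG_grad tu h) (ipG_addr (sqG_scale a sv) sw su) (ipG_scaler a sv su).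
  done.
have e2 : ipB (fun x => f (u x)) (a *: v + w) =
    a * ipB (fun x => f (u x)) v + ipB (fun x => f (u x)) w.
  have s1 := H10_sq Hv; have s2 := H10_sq Hw.
  have s3 := @sqintZ _ _ _ (@leb2 R) B measurable_B a _ s1.
  rewrite (@ipDr _ _ _ (@leb2 R) B measurable_B _ _ _ s3 s2 sq_fu).
  by rewrite (@ipZr _ _ _ (@leb2 R) B measurable_B a _ _ s1 sq_fu).
rewrite /dJ e1 e2; move: (ipG _ _) (ipG _ _) (ipB _ _) (ipB _ _) => p q r t; ring.
Qed.

Lemma sqrt_poincare v : H10 v -> Num.sqrt (ipB v v) <= Num.sqrt areaB * dnorm v.
Proof.
move=> Hv; rewrite /dnorm -sqrtrM ?areaB_ge0// ler_wsqrtr//; exact: poincare.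
Qed.

Lemma dJ_bound : exists c, forall v, H10 v -> `|dJ v| <= c * dnorm v.
Proof.
exists (dnorm u + cc * (Num.sqrt (ipB (fun x => f (u x)) (fun x => f (u x))) * Num.sqrt areaB)) => v Hv.
have h1 := H10_CS Hu Hv.
have h2 := @ip_CS_sqrt _ _ _ (@leb2 R) B measurable_B _ _ sq_fu (H10_sq Hv).
have h3 := sqrt_poincare Hv.
have h4 : `|ipB (fun x => f (u x)) v| <=
    Num.sqrt (ipB (fun x => f (u x)) (fun x => f (u x))) * (Num.sqrt areaB * dnorm v).
  by apply: le_trans h2 _; rewrite ler_wpM2l// sqrtr_ge0.
apply: le_trans (ler_normB _ _) _; rewrite mulrDl lerD// normrM (ger0_norm cc0) -!mulrA.
by rewrite ler_wpM2l.
Qed.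

Let cF : continuous (primitive f).
Proof. by apply: continuous_is_derive => x; exact: is_derive_primitive. Qed.

Lemma mean_abs v : H10 v -> Rintegral (@leb2 R) B (fun x => `|v x|) <= areaB * dnorm v.
Proof.
move=> Hv; have sv := H10_sq Hv.
have h : Rintegral (@leb2 R) B (fun x => `|v x|) <= Num.sqrt (ipB (fun=> 1) (fun=> 1)) * Num.sqrt (ipB v v).
  rewrite -(ip_abs v); apply: (integral_abs_le (sq_cst 1) (sq_abs sv)); last exact: sqB_meas sv.
  by move=> x _; rewrite mul1r.
apply: le_trans h _; rewrite ip_cst1.
apply: le_trans (ler_wpM2l (sqrtr_ge0 _) (sqrt_poincare Hv)) _.
by rewrite mulrA -expr2 sqr_sqrtr// areaB_ge0.
Qed.

(** The part of the remainder linear in |v| has a small factor and is controlled by the Poincare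
    inequality; the part coming from large |v| is quadratic in the norm by [trudinger]. *)
Lemma frechet_J : frechet_H10 (J f) u dJ.
Proof.
split; [exact: dJ_linear|exact: dJ_bound|move=> e e0].
(* Half of e pays for the linear part, half for the quadratic terms; the 1 keeps the denominator
   positive. *)
pose eta := e / 2 / (cc * areaB + 1).
have den : 0 < cc * areaB + 1 by rewrite ltr_wpDl// mulr_ge0// areaB_ge0.
have eta0 : 0 < eta by rewrite divr_gt0// divr_gt0.
have [C' [dl [C'0 dl0 hR]]] := remainder_bound cf M0 eta0 C0 K0 hf.
have [C1 [d [C10 d0 hT]]] := @trudinger R (2 * K) dl (mulr_ge0 (ler0n _ 2) K0) dl0.
pose b := C' * C1; have b0 : 0 <= b by rewrite mulr_ge0.
have q0 : 0 < 2^-1 + cc * b by rewrite ltr_wpDr// mulr_ge0.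
exists (Num.min (Num.sqrt d) (e / 2 / (2^-1 + cc * b))).
  by rewrite lt_min sqrtr_gt0 d0 divr_gt0// divr_gt0.
move=> v Hv; rewrite lt_min => /andP[v1 v2].
have vd : dirichlet v < d.
  by rewrite -dnorm_sqr -(sqr_sqrtr (ltW d0)) ltrXn2r// ?nnegrE ?sqrtr_ge0.
have {}hT := hT v Hv vd.
pose P x := primitive f (u x + v x) - primitive f (u x) - f (u x) * v x.
have sv := H10_sq Hv; have mv := sqB_meas sv.
have mF (w : R * R -> R) : measurable_fun B w -> measurable_fun B (fun x => primitive f (w x)).
  by move=> mw; apply: (measurableT_comp (continuous_measurable1D cF) mw).
have mfu := sqB_meas sq_fu.
have mP : measurable_fun B P.
  apply: measurable_funB; last exact: measurable_funM.
  by apply: measurable_funB; apply: mF => //; exact: measurable_funD.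
have bnd x : B x -> `|P x| <= eta * `|v x| + C' * expsq (2 * K) dl (v x).
  by move=> Bx; apply: hR; exact: uM.
have iv : (@leb2 R).-integrable B (EFin \o (fun x => `|v x|)).
  exact: (@sqint_integrable _ _ _ (@leb2 R) B measurable_B _ leb2_B_lty (sq_abs sv)).
have ie : (@leb2 R).-integrable B (EFin \o (fun x => expsq (2 * K) dl (v x))).
  apply/integrableP; split; first by apply/measurable_EFinP; exact: measurable_expsq.
  apply: le_lt_trans (ltry (C1 * dirichlet v)); apply: le_trans hT.
  by under eq_integral => x _ do rewrite /= ger0_norm ?expsq_ge0//.
have ig1 : (@leb2 R).-integrable B (EFin \o (fun x => eta * `|v x|)).
  exact: (@integrableZl _ _ _ (@leb2 R) B measurable_B eta _ iv).
have ig2 : (@leb2 R).-integrable B (EFin \o (fun x => C' * expsq (2 * K) dl (v x))).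
  exact: (@integrableZl _ _ _ (@leb2 R) B measurable_B C' _ ie).
have ig : (@leb2 R).-integrable B (EFin \o (fun x => eta * `|v x| + C' * expsq (2 * K) dl (v x))).
  exact: (@integrableD _ _ _ (@leb2 R) B measurable_B _ _ ig1 ig2).
have iP : (@leb2 R).-integrable B (EFin \o P).
  exact: (@le_integrable_real _ _ _ (@leb2 R) B measurable_B _ _ mP ig bnd).
have iF : (@leb2 R).-integrable B (EFin \o (fun x => primitive f (u x))).
  have hb x : B x -> `|primitive f (u x)| <= `|primitive f 0| + C * expR (K * M ^+ 2) * M.
    move=> Bx; have [c hc e1] := primitive_mvt 0 (u x) cf.
    rewrite subr0 in hc; rewrite add0r in e1.
    have -> : primitive f (u x) = primitive f 0 + f c * u x by rewrite -e1; ring.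
    apply: le_trans (ler_normD _ _) _; rewrite lerD2l normrM ler_pM// ?uM//.
    apply: le_trans (hf _) _; rewrite ler_wpM2l// ler_expR ler_wpM2l//.
    by rewrite -(real_normK (num_real c)) lerXn2r ?nnegrE// (le_trans hc)// uM.
  have sF := @sqint_bounded _ _ _ (@leb2 R) B measurable_B _ _ leb2_B_lty (mF _ mu) hb.
  exact: (@sqint_integrable _ _ _ (@leb2 R) B measurable_B _ leb2_B_lty sF).
have ifv : (@leb2 R).-integrable B (EFin \o (fun x => f (u x) * v x)).
  exact: (@sqint_mul _ _ _ (@leb2 R) B measurable_B _ _ sq_fu sv).
have ifF : (@leb2 R).-integrable B (EFin \o (fun x => primitive f (u x) + f (u x) * v x)).
  exact: (@integrableD _ _ _ (@leb2 R) B measurable_B _ _ iF ifv).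
have eF : Rintegral (@leb2 R) B (fun x => primitive f ((u + v) x)) =
    Rintegral (@leb2 R) B P + (Rintegral (@leb2 R) B (fun x => primitive f (u x)) +
      ipB (fun x => f (u x)) v).
  rewrite /ip -(@RintegralD _ _ _ (@leb2 R) B _ _ measurable_B iF ifv) -(@RintegralD _ _ _ (@leb2 R) B _ _ measurable_B iP ifF).
  apply: eq_Rintegral => x _; rewrite /P; change ((u + v) x) with (u x + v x).
  by move: (primitive _ _) (primitive _ _) (f _ * _) => p q r; ring.
have hP : `|Rintegral (@leb2 R) B P| <= eta * areaB * dnorm v + b * dirichlet v.
  apply: le_trans (@le_normr_Rintegral _ _ _ (@leb2 R) B _ measurable_B iP) _.
  apply: (@le_trans _ _ (Rintegral (@leb2 R) B
      (fun x => eta * `|v x| + C' * expsq (2 * K) dl (v x)))).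
    apply: le_Rintegral => //; first exact: measurable_B.
    exact: (integrable_norm iP).
  rewrite (@RintegralD _ _ _ (@leb2 R) B _ _ measurable_B ig1 ig2) (@RintegralZl _ _ _ (@leb2 R) B _ _ measurable_B iv) (@RintegralZl _ _ _ (@leb2 R) B _ _ measurable_B ie).
  have h1 : eta * Rintegral (@leb2 R) B (fun x => `|v x|) <= eta * areaB * dnorm v.
    by rewrite -mulrA ler_wpM2l ?(ltW eta0)//; exact: mean_abs.
  have h2 : C' * Rintegral (@leb2 R) B (fun x => expsq (2 * K) dl (v x)) <= b * dirichlet v.
    rewrite /b -mulrA ler_wpM2l// -lee_fin EFin_Rintegral//; exact: measurable_B.
  exact: lerD.
have := @final_bound e (dnorm v) (dirichlet v) 0 (Rintegral (@leb2 R) B P) (eta * areaB) b cc e0 (dnorm_ge0 v).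
have -> : J f (u + v) - J f u - dJ v = 2^-1 * dirichlet v - cc * Rintegral (@leb2 R) B P.
  rewrite /J eF (dirichletD Hu Hv) /dJ -/cc.
  move: (dirichlet u) (dirichlet v) (ipG _ _) (ipB _ _) (Rintegral _ _ _) (Rintegral _ _ _) => q1 q2 q3 q4 q5 q6.
  by move: (cc) => c; field.
apply => //.
- by rewrite mulr_ge0 ?areaB_ge0// ltW.
- by rewrite mulrC -ler_pdivlMr// ltW.
- have h : cc * areaB / (cc * areaB + 1) <= 1.
    by rewrite ler_pdivrMr// mul1r lerDl.
  have -> : cc * (eta * areaB) = (e / 2) * (cc * areaB / (cc * areaB + 1)).
    by rewrite /eta; move: (cc * areaB + 1) => q; ring.
  by rewrite -[leRHS]mulr1 ler_wpM2l// ltW// divr_gt0.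
- by rewrite dnorm_sqr.
Qed.

End Frechet.

(** The asymptotic estimates hold for large indices only; dropping the first terms reduces to the
    usual form. *)
Lemma Rintegral_dominated_near d (T : measurableType d) (R : realType)
  (mu : {measure set T -> \bar R}) (D : set T) (mD : measurable D)
  (u_ : nat -> T -> R) (v g : T -> R) :
  (forall n, measurable_fun D (u_ n)) -> measurable_fun D v ->
  mu.-integrable D (EFin \o g) ->
  (\forall n \near \oo, forall x, D x -> `|u_ n x| <= g x) ->
  {ae mu, forall x, D x -> u_ n x @[n --> \oo] --> v x} ->
  Rintegral mu D (u_ n) @[n --> \oo] --> Rintegral mu D v.
Proof.
move=> mu_ mv ig [N _ hN] ae.
rewrite -(cvg_shiftn N).
apply: (@Rintegral_dominated _ _ _ mu D mD (fun n => u_ (n + N)%N) v g) => //.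
- by move=> n x Dx; apply: hN => //=; exact: leq_addl.
- apply: filterS ae => x hx Dx; have := hx Dx.
  by rewrite -(cvg_shiftn N).
Qed.

(** * Laplace asymptotics of the mass on one side of a kink *)

Section Asymptotics.
Context {R : realType}.
Notation leb1 := (@lebesgue_measure R).

Lemma exponential_integral (b : R) : 0 < b ->
  leb1.-integrable `[0, +oo[ (EFin \o (fun x => expR (- (b * x)))) /\
  Rintegral leb1 `[0, +oo[ (fun x => expR (- (b * x))) = b^-1.
Proof.
move=> b0.
have i1 : leb1.-integrable `[0, +oo[ (EFin \o exponential_pdf b).
  by apply: integrableS (integrable_exponential_pdf b0).
have e1 x : x \in `[(0:R), +oo[ -> exponential_pdf b x = b * expR (- (b * x)).
  by rewrite in_itv/= andbT => x0; rewrite exponential_pdfE// mulNr.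
have i2 : leb1.-integrable `[0, +oo[ (EFin \o (fun x => expR (- (b * x)))).
  have := @integrableZl _ _ _ leb1 _ (measurable_itv `[(0:R), +oo[) b^-1 _ i1.
  apply: eq_integrable => // x; rewrite inE/= => hx.
  by rewrite e1//; rewrite -EFinM mulrA mulVf ?mul1r// gt_eqF.
split => //.
have : Rintegral leb1 `[0, +oo[ (fun x => b * expR (- (b * x))) = 1.
  rewrite /Rintegral integral_mkcond.
  have -> : (fun x => (b * expR (- (b * x)))%:E) \_ `[0, +oo[ = fun x => (exponential_pdf b x)%:E.
    apply/funext => x; rewrite /patch; case: ifPn => hx.
      by rewrite e1//; move: hx; rewrite mem_setE.
    rewrite lt0_exponential_pdf//; move: hx; rewrite mem_setE in_itv/= andbT -ltNge; exact.
  by rewrite integral_exponential_pdf.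
rewrite RintegralZl//.
by move=> /(canRL (mulKf (lt0r_neq0 b0))) ->; rewrite mulr1.
Qed.

Lemma positive_at_infinity (f : R -> R) : g1 f -> exists2 T, 0 < T & forall t, T <= t -> 0 < gfun f t.
Proof.
move=> [T [T0 h _]]; exists T => // t Tt.
(* Without a lower bound [inf] would have its default value 0, against (g1). *)
have [hi|hi] := pselect (has_inf (gfun f @` `[T, +oo[)); last by move: h; rewrite inf_out// ltxx.
apply: lt_le_trans h _; apply: ge_inf; first by case: hi.
by exists t => //=; rewrite in_itv/= Tt.
Qed.

(** (g0) bounds the derivative of ln g by eta t in absolute value for large t; the mean value
    theorem concludes, since c (b - a) <= b^2 - a^2 for c between a and b. *)
Lemma log_growth (f : R -> R) : g0 f -> g1 f -> forall eta, 0 < eta ->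
  exists2 M, 0 < M & forall a b, M <= a -> M <= b ->
    `|ln (gfun f b) - ln (gfun f a)| <= eta * `|b ^+ 2 - a ^+ 2|.
Proof.
move=> [d1 _ [lim _]] /positive_at_infinity[T T0 hT] eta eta0.
move: lim => /cvgr0_norm_le /(_ eta eta0) => lim.
have [M1 [_ h1]] : \forall t \near +oo, derivable (gfun f) t 1 /\
    `|derive1 (gfun f) t / (gfun f t * t)| <= eta by near=> t; split; near: t.
pose M := Num.max T (`|M1| + 1).
have MT t : M <= t -> T <= t by apply: le_trans; rewrite le_max lexx.
have M1t t : M <= t -> M1 < t.
  move=> ht; apply: (@lt_le_trans _ _ (`|M1| + 1)); first by have := ler_norm M1; lra.
  by apply: le_trans ht; rewrite le_max lexx orbT.
have M0 : 0 < M by rewrite lt_max T0.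
have key a b : M <= a -> a <= b -> `|ln (gfun f b) - ln (gfun f a)| <= eta * (b ^+ 2 - a ^+ 2).
  move=> Ma ab.
  have dl t : M <= t -> is_derive t (1 : R) (fun t => ln (gfun f t)) (derive1 (gfun f) t / gfun f t).
    move=> Mt; have [dg _] := h1 _ (M1t _ Mt).
    have dg' : is_derive t (1 : R) (gfun f) (derive1 (gfun f) t) by rewrite derive1E; exact: DeriveDef.
    have := @is_derive1_comp _ (@ln R) (gfun f) t _ _ (is_derive1_ln (hT _ (MT _ Mt))) dg'.
    by rewrite mulrC.
  have dab t : t \in `]a, b[ -> is_derive t (1 : R) (fun t => ln (gfun f t)) (derive1 (gfun f) t / gfun f t).
    by rewrite in_itv/= => /andP[at_ _]; apply: dl; exact: le_trans Ma (ltW at_).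
  have cab : {within `[a, b], continuous (fun t => ln (gfun f t))}.
    apply: derivable_within_continuous => t; rewrite in_itv/= => /andP[at_ _].
    by have /@ex_derive := dl t (le_trans Ma at_).
  have [c] := MVT_segment ab dab cab.
  rewrite in_itv/= => /andP[ac cb] ->.
  have Mc := le_trans Ma ac; have [_ hc] := h1 _ (M1t _ Mc).
  have c0 : 0 < c by exact: lt_le_trans M0 Mc.
  have gc := hT _ (MT _ Mc).
  rewrite normrM (ger0_norm (_ : 0 <= b - a)) ?subr_ge0//.
  have e1 : derive1 (gfun f) c / gfun f c = derive1 (gfun f) c / (gfun f c * c) * c.
    by move: (derive1 _ _) => x; field; rewrite !gt_eqF.
  have h2 : `|derive1 (gfun f) c / gfun f c| <= eta * c.
    by rewrite e1 normrM (ger0_norm (ltW c0)) ler_wpM2r// ltW.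
  apply: (@le_trans _ _ (eta * c * (b - a))); first by rewrite ler_wpM2r// subr_ge0.
  rewrite -mulrA ler_wpM2l ?(ltW eta0)//.
  have a0 := lt_le_trans M0 Ma; clear -ab a0 ac cb c0; nra.
exists M => // a b Ma Mb; have [ab|ab] := leP a b.
  rewrite (ger0_norm (_ : 0 <= b ^+ 2 - a ^+ 2)); first exact: key.
  by rewrite subr_ge0 lerXn2r ?nnegrE// ltW// (lt_le_trans M0).
rewrite distrC [X in _ <= _ * X]distrC (ger0_norm (_ : 0 <= a ^+ 2 - b ^+ 2)).
  by apply: key => //; exact: ltW.
by rewrite subr_ge0 lerXn2r ?nnegrE// ?(ltW ab)// ltW// (lt_le_trans M0).
Unshelve. all: by end_near. Qed.

(** Here d is the distance to a kink of height y, p the signed slope in d, and e is 1 to the right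
    of the kink and -1 to its left. The exponent is 4 pi ((y + p d)^2 - y^2) - 2 e d plus the
    increment of lg = ln g. Its linear rate tends to 8 pi P - 2 e; the condition on D keeps the
    quadratic term from cancelling that rate anywhere on the window, and the increment of lg is o(d)
    uniformly. What is left is A times the integral of an exponential. *)
Lemma window (lg : R -> R) (Q : nat -> R -> R) (y p L : nat -> R) (A e P D c : R) :
  (forall eta, 0 < eta -> exists2 M, 0 < M & forall a b, M <= a -> M <= b ->
    `|lg b - lg a| <= eta * `|b ^+ 2 - a ^+ 2|) ->
  (forall k, measurable_fun setT (Q k)) -> 0 <= A -> 0 < c -> 0 <= D ->
  p @ \oo --> (0 : R) ->
  y @ \oo --> +oo -> y n * p n @[n --> \oo] --> P -> L @ \oo --> +oo ->
  p n ^+ 2 * L n @[n --> \oo] --> D -> 4 * pi * D < 2 * e - 8 * pi * P ->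
  (\forall k \near \oo, forall d, 0 <= d <= L k -> c * y k <= y k + p k * d) ->
  (\forall k \near \oo, forall d, 0 <= d <= L k ->
    Q k d = A * expR (lg (y k + p k * d) - lg (y k) +
      d * (8 * pi * (y k * p k) - 2 * e + 4 * pi * (p k ^+ 2 * d)))) ->
  Rintegral leb1 `[0, L k] (Q k) @[k --> \oo] --> A / (2 * e - 8 * pi * P).
Proof.
move=> LG mQ A0 c0 D0 cp cy cyp cL cpL hD hc hQ.
set al := 2 * e - 8 * pi * P in hD *.
(* A quarter of the available gap: the errors in y p, in p^2 L and in lg take at most b each, which
   leaves the majorant exp(- b d). *)
pose b := (al - 4 * pi * D) / 4.
have b0 : 0 < b by rewrite divr_gt0// subr_gt0.
(* For large k this bounds |2 y p + p^2 d| on the window, the factor of d in (y + p d)^2 - y^2. *)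
pose C1 := 2 * (`|P| + 1) + (`|D| + 1).
have C10 : 0 < C1 by rewrite /C1; have := normr_ge0 P; have := normr_ge0 D; lra.
have near_yp (eps : R) : 0 < eps -> \forall k \near \oo, `|y k * p k - P| < eps.
  by move=> eps0; move/cvgrPdist_lt : cyp => /(_ _ eps0); under eq_near do rewrite distrC.
have near_pL (eps : R) : 0 < eps -> \forall k \near \oo, `|p k ^+ 2 * L k - D| < eps.
  by move=> eps0; move/cvgrPdist_lt : cpL => /(_ _ eps0); under eq_near do rewrite distrC.
have near_lg (eta : R) : 0 < eta -> \forall k \near \oo, forall d, 0 <= d <= L k ->
    `|lg (y k + p k * d) - lg (y k)| <= eta * C1 * d.
  move=> eta0; have [M M0 hM] := LG eta eta0.
  near=> k => d /andP[d0 dL].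
  have yM : M / c <= y k by near: k; move/cvgryPge : cy; apply.
  have yM' : M <= y k by near: k; move/cvgryPge : cy; apply.
  have h1 : M <= y k + p k * d.
    apply: (@le_trans _ _ (c * y k)); first by rewrite mulrC -ler_pdivrMr.
    have hh : forall d, 0 <= d <= L k -> c * y k <= y k + p k * d by near: k.
    by apply: hh; rewrite d0.
  apply: le_trans (hM _ _ yM' h1) _; rewrite -mulrA ler_wpM2l ?(ltW eta0)//.
  have -> : (y k + p k * d) ^+ 2 - y k ^+ 2 = (2 * (y k * p k) + p k ^+ 2 * d) * d by ring.
  rewrite normrM (ger0_norm d0) ler_wpM2r// /C1.
  apply: le_trans (ler_normD _ _) _; apply: lerD.
    rewrite normrM ger0_norm// ler_pM2l//.
    have h2 : `|y k * p k - P| < 1 by near: k; exact: near_yp.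
    by have := ler_normD (y k * p k - P) P; rewrite subrK; move: h2; lra.
  have h2 : `|p k ^+ 2 * L k - D| < 1 by near: k; exact: near_pL.
  rewrite (ger0_norm (mulr_ge0 (sqr_ge0 _) d0)).
  apply: (@le_trans _ _ (p k ^+ 2 * L k)); first by rewrite ler_wpM2l// sqr_ge0.
  have := ler_norm (p k ^+ 2 * L k); have := ler_normD (p k ^+ 2 * L k - D) D; rewrite subrK.
  by move: h2; lra.
pose u k d := if d <= L k then Q k d else 0.
have eu k : Rintegral leb1 `[0, L k] (Q k) = Rintegral leb1 `[0, +oo[ (u k).
  rewrite Rintegral_mkcond [RHS]Rintegral_mkcond; apply: eq_Rintegral => d _.
  by rewrite /patch /u !mem_setE !in_itv/= andbT; case: (0 <= d); case: (d <= L k).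
have al0 : 0 < al by apply: le_lt_trans hD; rewrite !mulr_ge0// pi_ge0.
have [ial eal] := exponential_integral al0.
have [ib eb] := exponential_integral b0.
have hal : A / al = Rintegral leb1 `[0, +oo[ (fun d => A * expR (- (al * d))).
  by rewrite RintegralZl// eal.
rewrite hal; under eq_fun do rewrite eu.
apply: (@Rintegral_dominated_near _ _ _ leb1 _ _ u _ (fun d => A * expR (- (b * d)))) => //.
- move=> k; apply: measurable_funTS.
  rewrite (_ : u k = fun d => Q k d * \1_(`]-oo, L k]) d); last first.
    by apply/funext => d; rewrite /u indicE mem_setE in_itv/=; case: (d <= L k); rewrite ?mulr1 ?mulr0.
  by apply: measurable_funM; [exact: mQ|apply: measurable_indic; exact: measurable_itv].
- by apply: measurable_funM => //; apply/measurable_EFinP; exact: (measurable_int leb1 ial).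
- exact: (@integrableZl _ _ _ leb1 _ (measurable_itv `[(0:R), +oo[) A _ ib).
- pose eta := b / C1; have eta0 : 0 < eta by rewrite divr_gt0.
  near=> k => d; rewrite /= in_itv/= andbT => d0; rewrite /u; case: ifPn => [dL|_]; last first.
    by rewrite normr0 mulr_ge0// expR_ge0.
  have hQk : forall d, 0 <= d <= L k ->
    Q k d = A * expR (lg (y k + p k * d) - lg (y k) +
      d * (8 * pi * (y k * p k) - 2 * e + 4 * pi * (p k ^+ 2 * d))) by near: k.
  rewrite hQk ?d0// ger0_norm ?mulr_ge0 ?expR_ge0// ler_wpM2l// ler_expR.
  have h1 : forall d, 0 <= d <= L k ->
    `|lg (y k + p k * d) - lg (y k)| <= eta * C1 * d by near: k; exact: near_lg.
  have := le_trans (ler_norm _) (h1 d _); rewrite d0 dL => /(_ isT).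
  have -> : eta * C1 = b by rewrite /eta divfK// gt_eqF.
  have b4 : 4 * b = al - 4 * pi * D by rewrite /b; field.
  have p1 : 0 < pi :> R by exact: pi_gt0.
  have h2 : 8 * pi * `|y k * p k - P| <= b.
    rewrite mulrC -ler_pdivlMr ?mulr_gt0//; apply: ltW; near: k; apply: near_yp.
    by rewrite divr_gt0// mulr_gt0// pi_gt0.
  have h3 : 4 * pi * `|p k ^+ 2 * L k - D| <= b.
    rewrite mulrC -ler_pdivlMr ?mulr_gt0//; apply: ltW; near: k; apply: near_pL.
    by rewrite divr_gt0// mulr_gt0// pi_gt0.
  have h4 : 4 * pi * (p k ^+ 2 * d) <= 4 * pi * D + b.
    apply: (@le_trans _ _ (4 * pi * (p k ^+ 2 * L k))).
      by rewrite ler_wpM2l ?mulr_ge0 ?(ltW p1)// ler_wpM2l// sqr_ge0.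
    have := ler_norm (p k ^+ 2 * L k - D); rewrite -(@ler_pM2l _ (4 * pi)) ?mulr_gt0// mulrBr.
    by move: h3; lra.
  have h5 : 8 * pi * (y k * p k) - 2 * e <= - al + b.
    have := ler_norm (y k * p k - P); rewrite -(@ler_pM2l _ (8 * pi)) ?mulr_gt0// mulrBr.
    by rewrite /al; move: h2; lra.
  move: h4 h5 b4 d0; move: (8 * pi * (y k * p k) - 2 * e) (4 * pi * (p k ^+ 2 * d)) (4 * pi * D) (lg _ - lg _) => X Y Z W.
  clear; move=> h4 h5 b4 d0 h6.
  have : d * (X + Y) <= d * (- al + b + (Z + b)) by rewrite ler_wpM2l// lerD.
  by move: b4; nra.
- apply: nearW => d; rewrite /= in_itv/= andbT => d0.
  pose E k := lg (y k + p k * d) - lg (y k) +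
      d * (8 * pi * (y k * p k) - 2 * e + 4 * pi * (p k ^+ 2 * d)).
  have cE : E k @[k --> \oo] --> - (al * d).
    have -> : - (al * d) = 0 + d * (8 * pi * P - 2 * e + 4 * pi * (0 * 0 * d)) by rewrite /al; ring.
    apply: cvgD.
      apply/cvgrPdist_le => eps eps0.
      pose eta := eps / (C1 * (d + 1)).
      have q0 : 0 < C1 * (d + 1) by rewrite mulr_gt0// ltr_wpDl.
      have eta0 : 0 < eta by rewrite divr_gt0.
      near=> k; rewrite sub0r normrN.
      have h1 : forall d, 0 <= d <= L k ->
        `|lg (y k + p k * d) - lg (y k)| <= eta * C1 * d by near: k; exact: near_lg.
      have dL : d <= L k by near: k; move/cvgryPge : cL; apply.
      apply: (le_trans (h1 d _)); first by rewrite d0.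
      have -> : eps = eta * (C1 * (d + 1)) by rewrite /eta divfK// gt_eqF.
      by rewrite -mulrA ler_wpM2l ?(ltW eta0)// ler_wpM2l ?(ltW C10)// lerDl.
    apply: cvgMr; apply: cvgD; first by apply: cvgB; [exact: cvgMr|exact: cvg_cst].
    by apply: cvgMr; apply: cvgMl; apply: cvgM.
  have cEE : A * expR (E k) @[k --> \oo] --> A * expR (- (al * d)).
    by apply: cvgMr; exact: (continuous_cvg _ (@continuous_expR R _) cE).
  apply: cvg_trans cEE; apply: near_eq_cvg; near=> k.
  have dL : d <= L k by near: k; move/cvgryPge : cL; apply.
  have hQk : forall d, 0 <= d <= L k ->
    Q k d = A * expR (lg (y k + p k * d) - lg (y k) +
      d * (8 * pi * (y k * p k) - 2 * e + 4 * pi * (p k ^+ 2 * d))) by near: k.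
  by rewrite /u dL hQk// d0.
Unshelve. all: by end_near. Qed.

End Asymptotics.

(** Together with the next bound, this puts quantities that are bounded up to X and decay or vanish
    afterwards into the single form C exp(-x), the majorant used in [L2_cvg0]. *)
Lemma exp_bound_left (R : realType) (a b x X : R) : 0 <= b -> a <= b -> x <= X ->
  a <= b * expR X * expR (- x).
Proof.
move=> b0 ab xX; apply: (le_trans ab); rewrite -mulrA -expRD -[leLHS]mulr1 ler_wpM2l//.
by apply: (le_trans _ (expR_ge1Dx _)); rewrite lerDl subr_ge0.
Qed.

Lemma exp_bound_right (R : realType) (a b x X : R) : 0 <= a -> a <= b -> X <= x ->
  a * expR (- (2 * (x - X))) <= b * expR X * expR (- x).
Proof.
move=> a0 ab Xx; rewrite -mulrA -expRD; apply: ler_pM => //.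
by rewrite ler_expR; move: Xx; lra.
Qed.

Lemma seq_near_cvg {T : topologicalType} (u v : nat -> T) (l : T) :
  (\forall n \near \oo, u n = v n) -> u @ \oo --> l -> v @ \oo --> l.
Proof. by move=> h; apply: cvg_trans; exact: near_eq_cvg. Qed.

Lemma near_forall_lt (P : nat -> nat -> Prop) m :
  (forall i, (i < m)%N -> \forall k \near \oo, P i k) ->
  \forall k \near \oo, forall i, (i < m)%N -> P i k.
Proof.
elim: m => [|m IH] h; first exact: nearW.
have h1 := IH (fun i im => h i (ltnW im)); have h2 := h m (ltnSn m).
near=> k => i; rewrite ltnS leq_eqVlt => /orP[/eqP ->|im]; first by near: k.
have h3 : forall i, (i < m)%N -> P i k by near: k.
exact: h3.
Unshelve. all: by end_near. Qed.

Lemma ln_frac (R : realType) (a b c : R) : 0 < a -> 0 < b -> 0 < c ->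
  ln (a * b / c) = ln a + ln b - ln c.
Proof.
move=> a0 b0 c0; have ab : 0 < a * b by rewrite mulr_gt0.
have c1 : 0 < c^-1 by rewrite invr_gt0.
by rewrite (lnM (ab : _ \is Num.pos) (c1 : _ \is Num.pos)) (lnM (a0 : _ \is Num.pos) (b0 : _ \is Num.pos)) lnV.
Qed.

Lemma affine_div (R : realType) (t a b c s : R) : s != 0 ->
  t + 2^-1 * (a / s + b / s - c / s) = (s * t + (a + b - c) / 2) / s.
Proof. by move=> h; field. Qed.

Lemma slope_left (R : realType) (a b p : R) : b + a != 0 -> p != 0 ->
  2 * (b - a) / (b + a) = 8 * p * (b * (2 * p * (b + a))^-1) - 2.
Proof. by move=> h p0; field; rewrite h p0. Qed.

Lemma slope_right (R : realType) (a b p : R) : b + a != 0 -> p != 0 ->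
  2 * (b - a) / (b + a) = 2 - 8 * p * (a * (2 * p * (b + a))^-1).
Proof. by move=> h p0; field; rewrite h p0. Qed.

Lemma slope_sq (R : realType) (a b p : R) : b + a != 0 -> p != 0 ->
  2 * (b - a) / (b + a) =
    4 * p * ((2 * p * (b + a))^-1 ^+ 2 * (2 * p * b ^+ 2 - 2 * p * a ^+ 2)).
Proof. by move=> h p0; field; rewrite h p0. Qed.

(** * Broken lines as combinations of min(t, b) *)

Section PiecewiseLinear.
Context {R : realType}.
Variables (tau c : nat -> R).

(** Abel summation: c j is the slope between nodes j and j + 1, so the coefficient of min(t, tau
    j.+1) is the drop of the slope there. The final slope c m is not recorded and reappears as the
    term c m * t below. *)
Definition pieces (m : nat) : seq (R * R) := [seq (c j - c j.+1, tau j.+1) | j <- iota 0 m].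
Definition minsum (s : seq (R * R)) (t : R) : R := \sum_(p <- s) p.1 * Num.min t p.2.

Lemma pieces_rcons m : pieces m.+1 = rcons (pieces m) (c m - c m.+1, tau m.+1).
Proof. by rewrite /pieces -{1}[m.+1]addn1 iotaD map_cat cats1. Qed.

Lemma chain_le (u : nat -> R) n a b : (forall j, (j < n)%N -> u j <= u j.+1) ->
  (a <= b)%N -> (b <= n)%N -> u a <= u b.
Proof.
move=> hu; elim: b => [|b IH]; first by rewrite leqn0 => /eqP ->.
rewrite leq_eqVlt => /orP[/eqP ->//|ab] bn.
by apply: le_trans (hu b bn); apply: IH => //; exact: ltnW.
Qed.

(** Before the new last node min(t, tau) is t, so the added term just changes the final slope;
    beyond it, the value at the node comes from the previous piece. *)
Lemma minsum_pieces m (Y : nat -> R) : tau 0%N = 0 -> Y 0%N = 0 ->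
  (forall j, (j < m)%N -> tau j <= tau j.+1) ->
  (forall j, (j < m)%N -> Y j.+1 = Y j + c j * (tau j.+1 - tau j)) ->
  forall i t, (i <= m)%N -> tau i <= t -> ((i < m)%N -> t <= tau i.+1) ->
  minsum (pieces m) t + c m * t = Y i + c i * (t - tau i).
Proof.
move=> tau0 Y0; elim: m => [|m IH] ht hY i t im ti tm.
  move: im; rewrite leqn0 => /eqP ->; rewrite /minsum /pieces big_nil tau0 Y0; ring.
have ht' j : (j < m)%N -> tau j <= tau j.+1 by move=> jm; apply: ht; exact: ltnW.
have hY' j : (j < m)%N -> Y j.+1 = Y j + c j * (tau j.+1 - tau j) by move=> jm; apply: hY; exact: ltnW.
rewrite /minsum pieces_rcons big_rcons/= -/(minsum _ _).
have [im'|mi] := leqP i m.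
  have tm1 : t <= tau m.+1.
    apply: (@le_trans _ _ (tau i.+1)); first exact: tm.
    exact: chain_le ht _ _.
  rewrite min_l// -(IH ht' hY' i t im' ti) => [|im2]; last by apply: tm; exact: ltnW.
  by ring.
have ei : i = m.+1 by apply/eqP; rewrite eqn_leq im mi.
rewrite ei in ti *; rewrite min_r// hY//.
have h := IH ht' hY' m t (leqnn m) (le_trans (ht m (ltnSn m)) ti).
rewrite ltnn in h; have {}h := h (fun e => False_ind _ (Bool.diff_false_true e)).
by rewrite -[minsum _ _](addrK (c m * t)) h; ring.
Qed.

Lemma wsum_pieces m : (forall j, (j < m)%N -> tau j <= tau j.+1) ->
  forall i t, (i <= m)%N -> tau i <= t -> ((i < m)%N -> t < tau i.+1) ->
  wsum (pieces m) t + c m = c i.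
Proof.
elim: m => [|m IH] ht i t im ti tm.
  by move: im; rewrite leqn0 => /eqP ->; rewrite /wsum /pieces big_nil add0r.
have ht' j : (j < m)%N -> tau j <= tau j.+1 by move=> jm; apply: ht; exact: ltnW.
rewrite /wsum pieces_rcons big_rcons/= -/(wsum _ _).
have [im'|mi] := leqP i m.
  have tm1 : t < tau m.+1.
    apply: (@lt_le_trans _ _ (tau i.+1)); first exact: tm.
    exact: chain_le ht _ _.
  rewrite tm1 mulr1 -(IH ht' i t im' ti) => [|im2]; last by apply: tm; exact: ltnW.
  by ring.
have ei : i = m.+1 by apply/eqP; rewrite eqn_leq im mi.
rewrite ei in ti *; rewrite ltNge ti/= mulr0 addr0.
have h := IH ht' m t (leqnn m) (le_trans (ht m (ltnSn m)) ti).
rewrite ltnn in h; have {}h := h (fun e => False_ind _ (Bool.diff_false_true e)).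
by rewrite -[wsum _ _](addrK (c m)) h subrr add0r.
Qed.

Lemma wsum_bound m t : (forall j, (j < m)%N -> c j.+1 <= c j) -> 0 <= t ->
  0 <= wsum (pieces m) t <= wsum (pieces m) 0.
Proof.
move=> h t0; rewrite /wsum /pieces !big_map; apply/andP; split; rewrite big_seq.
  apply: sumr_ge0 => j; rewrite mem_iota add0n => /andP[_ jm] /=.
  by rewrite mulr_ge0 ?subr_ge0 ?h//; case: ifP.
rewrite [leRHS]big_seq; apply: ler_sum => j; rewrite mem_iota add0n => /andP[_ jm] /=.
rewrite ler_wpM2l ?subr_ge0 ?h//.
by case: ifPn => tj; [rewrite (le_lt_trans t0 tj)|case: ifP].
Qed.

End PiecewiseLinear.

(** * Towers with finitely many nodes: constants, nodes and slopes *)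

Section Tower.
Context {R : realType}.
Notation leb1 := (@lebesgue_measure R).
Variables (f : R -> R) (S : nat -> R) (m : nat).
Hypothesis cf : continuous f.
Hypothesis f0 : f 0 = 0.
Hypothesis fcrit : critical_growth f.
Hypothesis fg0 : g0 f.
Hypothesis fg1 : g1 f.
Hypothesis fg2 : g2 f.
Hypothesis S0 : S 0%N = 0.
Hypothesis Slt : forall i, (i < m)%N -> S i < S i.+1.
Hypothesis m0 : (0 < m)%N.

(** The node heights S are the primary data: sqrt(t / (2 pi)) equals S i at t = tn i. *)
Definition tn i : R := 2 * pi * S i ^+ 2.
Definition sig i : R := if (i < m)%N then (S i.+1 - S i) / (tn i.+1 - tn i) else 0.
(** The exponential rate at which the mass decays along piece i. It is the same at the two ends, by
    [alE_left] and [alE_right], since 8 pi (S i.+1 + S i) sig i = 4; beyond the last node u is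
    constant and the factor exp(-2 t) alone gives the rate 2. *)
Definition al i : R := if (i < m)%N then 2 * (S i.+1 - S i) / (S i.+1 + S i) else 2.
(** The density required at node i: a kink of density A carries the mass A / al on each of its
    sides, and the sum has to be the drop of the slope. *)
Definition Am i : R := (sig i.-1 - sig i) / ((al i.-1)^-1 + (al i)^-1).
Definition sk k : R := k.+1%:R.
Definition rk k : R := Num.sqrt (sk k).
Definition yk k i : R := rk k * S i.
(** The dilated node is shifted so that sqrt(s) times the density of the mass equals [Am i] exactly
    at the new node, as [hh_ref] shows. Node 0 is the boundary r = 1 and stays in place. *)
Definition tauk k i : R := if i is 0%N then 0 else
  sk k * tn i + ln (gfun f (yk k i) * rk k / Am i) / 2.
Definition sgk k i : R := if (i < m)%N then (yk k i.+1 - yk k i) / (tauk k i.+1 - tauk k i) else 0.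

Lemma S_ge0 i : (i <= m)%N -> 0 <= S i.
Proof.
elim: i => [|i IH] im; first by rewrite S0.
by apply: (@le_trans _ _ (S i)); [exact: IH (ltnW im)|exact: ltW (Slt im)].
Qed.

Lemma S_gt0 i : (0 < i)%N -> (i <= m)%N -> 0 < S i.
Proof. by case: i => // i _ im; apply: le_lt_trans (Slt im); exact: S_ge0 (ltnW im). Qed.

Lemma tn_lt i : (i < m)%N -> tn i < tn i.+1.
Proof.
move=> im; rewrite /tn ltr_pM2l ?mulr_gt0 ?pi_gt0//.
by rewrite ltrXn2r ?nnegrE ?S_ge0 ?Slt// ltnW.
Qed.

Lemma sigE i : (i < m)%N -> sig i = (2 * pi * (S i.+1 + S i))^-1.
Proof.
move=> im; rewrite /sig im /tn.
have h := Slt im; have h1 : 0 < S i.+1 + S i by rewrite ltr_wpDr ?S_gt0 ?S_ge0// ltnW.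
have p0 := @pi_gt0 R.
have d : S i.+1 - S i != 0 by rewrite subr_eq0 gt_eqF.
have e : 2 * pi * S i.+1 ^+ 2 - 2 * pi * S i ^+ 2 = 2 * pi * (S i.+1 + S i) * (S i.+1 - S i) by ring.
rewrite e; move: (S i.+1 - S i) d (S i.+1 + S i) h1 => a a0 b b0.
by rewrite invfM mulrCA mulfV// mulr1.
Qed.

Lemma sig_gt0 i : (i < m)%N -> 0 < sig i.
Proof.
move=> im; rewrite sigE// invr_gt0 !mulr_gt0 ?pi_gt0//.
by rewrite ltr_wpDr ?S_gt0 ?S_ge0// ltnW.
Qed.

Lemma sig_dec i : (i < m)%N -> sig i.+1 < sig i.
Proof.
move=> im; have [i1m|mi1] := ltnP i.+1 m; last by rewrite {1}/sig ltnNge mi1 sig_gt0.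
rewrite !sigE// ltf_pV2 ?posrE ?mulr_gt0 ?pi_gt0 ?ltr_wpDr ?S_gt0 ?S_ge0 ?(ltnW im) ?(ltnW i1m)//.
rewrite ltr_pM2l ?mulr_gt0 ?pi_gt0//.
by have := Slt im; have := Slt i1m; lra.
Qed.

Lemma al_gt0 i : 0 < al i.
Proof.
rewrite /al; case: ifP => // im; rewrite divr_gt0 ?mulr_gt0 ?subr_gt0 ?Slt//.
by rewrite ltr_wpDr ?S_gt0 ?S_ge0// ltnW.
Qed.

Lemma Am_gt0 i : (0 < i)%N -> (i <= m)%N -> 0 < Am i.
Proof.
case: i => // i _ im; rewrite /Am divr_gt0 ?subr_gt0 ?sig_dec//.
by rewrite addr_gt0// invr_gt0 al_gt0.
Qed.

Lemma Am_split i : (0 < i)%N -> (i <= m)%N -> Am i / al i.-1 + Am i / al i = sig i.-1 - sig i.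
Proof.
move=> i0 im; rewrite /Am; have a1 := al_gt0 i.-1; have a2 := al_gt0 i.
move: (al _) (al _) a1 a2 (sig _ - sig _) => a b a1 a2 c.
by field; rewrite !gt_eqF// addr_gt0.
Qed.

Lemma alE_left i : (i < m)%N -> al i = 8 * pi * (S i.+1 * sig i) - 2.
Proof.
move=> im; rewrite /al im sigE//.
have h1 : 0 < S i.+1 + S i by rewrite ltr_wpDr ?S_gt0 ?S_ge0// ltnW.
by apply: slope_left; rewrite gt_eqF// pi_gt0.
Qed.

Lemma alE_right i : (i < m)%N -> al i = 2 - 8 * pi * (S i * sig i).
Proof.
move=> im; rewrite /al im sigE//.
have h1 : 0 < S i.+1 + S i by rewrite ltr_wpDr ?S_gt0 ?S_ge0// ltnW.
by apply: slope_right; rewrite gt_eqF// pi_gt0.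
Qed.

(** Along piece i the exponent is a quadratic vanishing at both ends, so its linear rate is the
    quadratic coefficient times the length. Hence the condition of [window] holds on every window
    that stops strictly before the next node. *)
Lemma alE_sq i : (i < m)%N -> al i = 4 * pi * (sig i ^+ 2 * (tn i.+1 - tn i)).
Proof.
move=> im; rewrite /al im sigE// /tn.
have h1 : 0 < S i.+1 + S i by rewrite ltr_wpDr ?S_gt0 ?S_ge0// ltnW.
by apply: slope_sq; rewrite gt_eqF// pi_gt0.
Qed.

(** * Asymptotics of the shifted nodes and of the slopes *)

Lemma sk_gt0 k : 0 < sk k. Proof. by rewrite ltr0n. Qed.

Lemma rk_gt0 k : 0 < rk k. Proof. by rewrite sqrtr_gt0 sk_gt0. Qed.

Lemma rk_sqr k : rk k ^+ 2 = sk k. Proof. by rewrite sqr_sqrtr// ltW// sk_gt0. Qed.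

Lemma cvg_skV : (sk k)^-1 @[k --> \oo] --> (0 : R).
Proof. exact: cvg_harmonic. Qed.

Lemma cvg_rkV : (rk k)^-1 @[k --> \oo] --> (0 : R).
Proof.
have -> : (fun k => (rk k)^-1) = (fun k => Num.sqrt ((sk k)^-1)).
  by apply/funext => k; rewrite /rk sqrtrV// ltW// sk_gt0.
rewrite -[X in _ --> X](@sqrtr0 R).
exact: (continuous_cvg _ (@sqrt_continuous R 0) cvg_skV).
Qed.

Lemma cvg_rk : rk @ \oo --> +oo.
Proof.
by apply/gtr0_cvgV0; [near=> k; exact: rk_gt0|exact: cvg_rkV].
Unshelve. all: by end_near. Qed.

Lemma cvg_yk i : (0 < i)%N -> (i <= m)%N -> yk k i @[k --> \oo] --> +oo.
Proof. by move=> i0 im; apply: cvgy_mulr cvg_rk; exact: S_gt0. Qed.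

Lemma cvg_tauk i : (i <= m)%N -> tauk k i / sk k @[k --> \oo] --> tn i.
Proof.
case: i => [_|i im].
  by rewrite /tauk /tn S0 expr0n mulr0; under eq_fun do rewrite mul0r; exact: cvg_cst.
have [T T0 hT] := positive_at_infinity fg1.
have ey := cvg_yk (ltn0Sn i) im.
have A0 := Am_gt0 (ltn0Sn i) im.
have e1 : \forall k \near \oo, tn i.+1 + 2^-1 * (ln (gfun f (yk k i.+1)) / sk k + ln (rk k) / sk k
    - ln (Am i.+1) / sk k) = tauk k i.+1 / sk k.
  near=> k; have yT : T <= yk k i.+1 by near: k; move/cvgryPge : ey; apply.
  by rewrite /tauk ln_frac ?rk_gt0 ?hT// affine_div// gt_eqF// sk_gt0.
have l1 : ln (gfun f (yk k i.+1)) / sk k @[k --> \oo] --> (0 : R).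
  apply/cvgrPdist_le => e e0.
  pose eta := e / 2 / (S i.+1 ^+ 2 + 1).
  have q0 : 0 < S i.+1 ^+ 2 + 1 by rewrite ltr_wpDl// sqr_ge0.
  have eta0 : 0 < eta by rewrite divr_gt0// divr_gt0.
  have [M M0 hM] := log_growth fg0 fg1 eta0.
  pose c0 := `|ln (gfun f M)| + eta * M ^+ 2.
  have c00 : 0 <= c0 by rewrite addr_ge0// mulr_ge0 ?sqr_ge0// ltW.
  near=> k; rewrite sub0r normrN normrM (ger0_norm (_ : 0 <= (sk k)^-1)) ?invr_ge0 ?(ltW (sk_gt0 k))//.
  have yM : M <= yk k i.+1 by near: k; move/cvgryPge : ey; apply.
  have hs : c0 / sk k <= e / 2.
    near: k; have h : c0 * (sk k)^-1 @[k --> \oo] --> c0 * 0 by apply: cvgMr; exact: cvg_skV.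
    rewrite mulr0 in h.
    by have := cvgr_le 0 h (e / 2); apply; rewrite divr_gt0.
  have h1 := hM M (yk k i.+1) (lexx M) yM.
  have h2 : `|ln (gfun f (yk k i.+1))| <= eta * (sk k * S i.+1 ^+ 2) + c0.
    have := ler_normD (ln (gfun f (yk k i.+1)) - ln (gfun f M)) (ln (gfun f M)); rewrite subrK.
    have : `|yk k i.+1 ^+ 2 - M ^+ 2| <= sk k * S i.+1 ^+ 2 + M ^+ 2.
      apply: le_trans (ler_normB _ _) _; rewrite !ger0_norm ?sqr_ge0//.
      by rewrite /yk exprMn rk_sqr.
    rewrite -(ler_pM2l eta0) mulrDr /c0; move: h1; lra.
  have s0 := sk_gt0 k.
  rewrite ler_pdivrMr//; apply: le_trans h2 _.
  move: hs; rewrite ler_pdivrMr// => hs.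
  have : eta * (sk k * S i.+1 ^+ 2) <= e / 2 * sk k.
    have -> : e / 2 = eta * (S i.+1 ^+ 2 + 1) by rewrite /eta divfK// gt_eqF.
    rewrite -mulrA ler_wpM2l ?(ltW eta0)// mulrC ler_wpM2r ?(ltW s0)//.
    by rewrite lerDl.
  by move: hs; lra.
have l2 : ln (rk k) / sk k @[k --> \oo] --> (0 : R).
  apply: norm_squeeze0 cvg_rkV => k.
  have r1 : 1 <= rk k by rewrite -[leLHS]sqrtr1 ler_wsqrtr// /sk ler1n.
  rewrite ger0_norm ?divr_ge0 ?ln_ge0 ?(ltW (sk_gt0 k))//.
  rewrite ler_pdivrMr ?sk_gt0// -rk_sqr expr2 mulrA mulVf ?mul1r ?gt_eqF ?rk_gt0//.
  exact: ltW (ln_sublinear (rk_gt0 k)).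
apply: (seq_near_cvg e1).
rewrite [X in _ --> X](_ : _ = tn i.+1 + 2^-1 * (0 + 0 - ln (Am i.+1) * 0)); last by ring.
apply: cvgD; first exact: cvg_cst.
apply: cvgMr; apply: cvgB; first exact: cvgD.
by apply: cvgMr; exact: cvg_skV.
Unshelve. all: by end_near. Qed.

Lemma cvg_slope i : rk k * sgk k i @[k --> \oo] --> sig i.
Proof.
rewrite /sgk /sig; case: ifP => im; last by under eq_fun do rewrite mulr0; exact: cvg_cst.
have e1 k : (S i.+1 - S i) * (tauk k i.+1 / sk k - tauk k i / sk k)^-1 =
    rk k * ((yk k i.+1 - yk k i) / (tauk k i.+1 - tauk k i)).
  have -> : rk k * ((yk k i.+1 - yk k i) / (tauk k i.+1 - tauk k i)) =
      rk k ^+ 2 * (S i.+1 - S i) / (tauk k i.+1 - tauk k i).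
    by rewrite /yk; move: (_^-1) => q; ring.
  by rewrite rk_sqr -mulrBl invf_div mulrA [_ * sk k]mulrC.
apply: (seq_eq_cvg e1).
apply: cvgMr; apply: cvgV; first by rewrite subr_eq0 gt_eqF// tn_lt.
by apply: cvgB; apply: cvg_tauk => //; exact: ltnW.
Qed.

Lemma sgk_m k : sgk k m = 0. Proof. by rewrite /sgk ltnn. Qed.

Lemma cvg_sgk i : sgk k i @[k --> \oo] --> (0 : R).
Proof.
have h : (rk k)^-1 * (rk k * sgk k i) @[k --> \oo] --> 0 * sig i.
  by apply: cvgM; [exact: cvg_rkV|exact: cvg_slope].
rewrite mul0r in h; apply: seq_eq_cvg h => k.
by rewrite mulrA mulVf ?mul1r// gt_eqF// rk_gt0.
Qed.

Lemma near_tau_lt : \forall k \near \oo, forall i, (i < m)%N -> tauk k i < tauk k i.+1.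
Proof.
apply: near_forall_lt => i im.
have h : tauk k i.+1 / sk k - tauk k i / sk k @[k --> \oo] --> tn i.+1 - tn i.
  by apply: cvgB; apply: cvg_tauk => //; exact: ltnW.
have hp : 0 < tn i.+1 - tn i by rewrite subr_gt0 tn_lt.
apply: filterS (cvgr_gt _ h _ hp) => k.
by rewrite -mulrBl pmulr_lgt0 ?invr_gt0 ?sk_gt0// subr_gt0.
Qed.

Lemma near_sg_dec : \forall k \near \oo, forall i, (i < m)%N -> sgk k i.+1 < sgk k i.
Proof.
apply: near_forall_lt => i im.
have h : rk k * sgk k i - rk k * sgk k i.+1 @[k --> \oo] --> sig i - sig i.+1.
  by apply: cvgB; exact: cvg_slope.
have hp : 0 < sig i - sig i.+1 by rewrite subr_gt0 sig_dec.
apply: filterS (cvgr_gt _ h _ hp) => k.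
by rewrite -mulrBr pmulr_rgt0 ?rk_gt0// subr_gt0.
Qed.

(** The shifts may disorder the nodes for small k. For a good k, [Vk k] is the concave broken line
    through the points (tauk k i, yk k i). *)
Definition good k := (forall i, (i < m)%N -> tauk k i < tauk k i.+1) /\
  (forall i, (i < m)%N -> sgk k i.+1 < sgk k i).

Lemma near_good : \forall k \near \oo, good k.
Proof. by near=> k; split; near: k; [exact: near_tau_lt|exact: near_sg_dec]. Unshelve. all: by end_near. Qed.

(** * The broken lines and the mass they accumulate *)

Definition pk k := pieces (tauk k) (sgk k) m.
Definition Vk k t : R := minsum (pk k) t.

Lemma tau_mono k i j : good k -> (i <= j)%N -> (j <= m)%N -> tauk k i <= tauk k j.
Proof. by move=> [h _]; apply: chain_le => l lm; exact: ltW (h l lm). Qed.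

Lemma VkE k i t : good k -> (i <= m)%N -> tauk k i <= t -> ((i < m)%N -> t <= tauk k i.+1) ->
  Vk k t = yk k i + sgk k i * (t - tauk k i).
Proof.
move=> [h1 h2] im t1 t2.
have := @minsum_pieces _ (tauk k) (sgk k) m (yk k) erefl _ _ _ i t im t1 t2.
rewrite sgk_m mul0r addr0; apply.
- by rewrite /yk S0 mulr0.
- by move=> j jm; exact: ltW (h1 j jm).
- move=> j jm; rewrite /sgk jm divfK ?subr_eq0 ?gt_eqF ?h1//; ring.
Qed.

Lemma wkE k i t : good k -> (i <= m)%N -> tauk k i <= t -> ((i < m)%N -> t < tauk k i.+1) ->
  wsum (pk k) t = sgk k i.
Proof.
move=> [h1 h2] im t1 t2.
have := @wsum_pieces _ (tauk k) (sgk k) m _ i t im t1 t2; rewrite sgk_m addr0; apply.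
by move=> j jm; exact: ltW (h1 j jm).
Qed.

(** f(V) / (8 pi) as a function of r = exp(-2 t). Truncated logarithms make it continuous on the
    whole line and, for a good k, constant near 0, as the divergence formula requires. *)
Definition kk k (r : R) : R :=
  (8 * pi)^-1 * f (\sum_(p <- pk k) p.1 * - (ln (Num.max r (expR (- (2 * p.2)))) / 2)).

Lemma kk_cont k : continuous (kk k).
Proof.
have cs (s : seq (R * R)) : continuous (fun r : R => \sum_(p <- s) p.1 * - (ln (Num.max r (expR (- (2 * p.2)))) / 2)).
  elim: s => [|p s IH]; first by under eq_fun do rewrite big_nil; exact: cst_continuous.
  under eq_fun do rewrite big_cons; move=> r; apply: cvgD; last exact: IH.
  apply: cvgMr; apply: cvgN; apply: cvgMl.
  apply: (@continuous_comp _ _ _ (fun r => Num.max r (expR (- (2 * p.2)))) (@ln R)).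
    by apply: (@continuous_max _ _ id (fun=> _)); [move=> ?; exact: cvg_id|exact: cst_continuous].
  by apply: continuous_ln; rewrite lt_max expR_gt0 orbT.
move=> r; apply: cvgMr.
by apply: (@continuous_comp _ _ _ _ f); [exact: cs|exact: cf].
Qed.

Lemma ln_max_exp (t b : R) : - (ln (Num.max (expR (- (2 * t))) (expR (- (2 * b)))) / 2) = Num.min t b.
Proof.
have [h|h] := leP t b.
  by rewrite max_l ?expRK; [field|rewrite ler_expR lerN2 ler_pM2l].
by rewrite max_r ?expRK; [field|rewrite ler_expR lerN2 ler_pM2l// ltW].
Qed.

Lemma kk_exp k t : kk k (expR (- (2 * t))) = (8 * pi)^-1 * f (Vk k t).
Proof.
congr (_ * f _); apply: eq_bigr => p _; congr (_ * _); exact: ln_max_exp.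
Qed.

Lemma f_tsum k x : (8 * pi)^-1 * f (tsum (pk k) x) = kk k (rho x).
Proof. by congr (_ * f _); apply: eq_bigr => p _; rewrite truncE. Qed.

Lemma kk_small k r : good k -> r <= expR (- (2 * tauk k m)) ->
  kk k r = kk k (expR (- (2 * tauk k m))).
Proof.
move=> gk hr; congr (_ * f _); apply: eq_big_seq => p /mapP[j].
rewrite mem_iota add0n => /andP[_ jm] ->; rewrite /=; congr (_ * - (ln _ / 2)).
have h : expR (- (2 * tauk k m)) <= expR (- (2 * tauk k j.+1)).
  by rewrite ler_expR lerN2 ler_pM2l//; exact: tau_mono.
by rewrite !max_r// (le_trans hr).
Qed.

(** [HH k] is the accumulated mass, to be compared with the slope of [Vk k]; [hh k] is its density,
    that is minus its derivative. *)
Definition HH k := Hfun (kk k).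
Definition hh k t := expR (- (2 * t)) * kk k (expR (- (2 * t))).

Lemma hh_cont k : continuous (hh k).
Proof.
have ce : continuous (fun t : R => expR (- (2 * t))).
  move=> t; apply: (@continuous_comp R R R (fun t : R => - (2 * t)) (@expR R)); last exact: continuous_expR.
  by apply: cvgN; apply: cvgMr; exact: cvg_id.
move=> t; apply: cvgM; first exact: ce.
by apply: (@continuous_comp R R R (fun t : R => expR (- (2 * t))) (kk k)); [exact: ce|exact: kk_cont].
Qed.

Lemma is_derive_HH k t : is_derive t (1 : R) (HH k) (- hh k t).
Proof. exact: is_derive_H (@kk_cont k) t. Qed.

Lemma HH_left k a L : 0 <= L -> Rintegral leb1 `[0, L] (fun d => hh k (a - d)) = HH k (a - L) - HH k a.
Proof.
move=> L0; have ch : continuous (fun d => hh k (a - d)).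
  move=> d; apply: (@continuous_comp R R R (fun d : R => a - d) (hh k)); last exact: hh_cont.
  by apply: cvgB; [exact: cvg_cst|exact: cvg_id].
have dd d : is_derive d (1 : R) (fun d : R => HH k (a - d)) (hh k (a - d)).
  have d1 : is_derive d (1 : R) (fun d : R => a - d) (- 1).
    by apply: (is_derive_eq (is_deriveB (is_derive_cst a d 1) (is_derive_id d 1))); rewrite sub0r.
  apply: (is_derive_eq (@is_derive1_comp _ (HH k) (fun d : R => a - d) d _ _ (is_derive_HH k (a - d)) d1)).
  by rewrite mulrN1 opprK.
by rewrite /Rintegral (FTC_continuous L0 ch dd)/= subr0.
Qed.

Lemma HH_right k a L : 0 <= L -> Rintegral leb1 `[0, L] (fun d => hh k (a + d)) = HH k a - HH k (a + L).
Proof.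
move=> L0; have ch : continuous (fun d => hh k (a + d)).
  move=> d; apply: (@continuous_comp R R R (fun d : R => a + d) (hh k)); last exact: hh_cont.
  by apply: cvgD; [exact: cvg_cst|exact: cvg_id].
have dd d : is_derive d (1 : R) (fun d : R => - HH k (a + d)) (hh k (a + d)).
  have d1 : is_derive d (1 : R) (fun d : R => a + d) 1.
    by apply: (is_derive_eq (is_deriveD (is_derive_cst a d 1) (is_derive_id d 1))); rewrite add0r.
  have d2 := @is_derive1_comp _ (HH k) (fun d : R => a + d) d _ _ (is_derive_HH k (a + d)) d1.
  by apply: (is_derive_eq (is_deriveN d2)); rewrite mulr1 opprK.
by rewrite /Rintegral (FTC_continuous L0 ch dd)/= addr0 opprK addrC.
Qed.

(** * The mass carried by each kink *)

Lemma f_gfun (u : R) : (8 * pi)^-1 * f u = gfun f u * expR (4 * pi * u ^+ 2).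
Proof. by rewrite /gfun divfK// gt_eqF// expR_gt0. Qed.

(** The definition of [tauk] absorbs g(y) and sqrt(s), so that only the ratio g(V) / g(y)
    remains. *)
Lemma hh_ref k i t : (0 < i)%N -> (i <= m)%N -> 0 < gfun f (yk k i) -> 0 < gfun f (Vk k t) ->
  rk k * hh k t = Am i * expR (ln (gfun f (Vk k t)) - ln (gfun f (yk k i)) +
    (4 * pi * (Vk k t ^+ 2 - yk k i ^+ 2) - 2 * (t - tauk k i))).
Proof.
case: i => // i _ im g1_ g2_; have A0 := Am_gt0 (ltn0Sn i) im; have r0 := rk_gt0 k.
rewrite /hh kk_exp f_gfun; set V := Vk k t in g2_ *; set y := yk k i.+1 in g1_ *.
have e1 : 2 * tauk k i.+1 = 4 * pi * y ^+ 2 + ln (gfun f y * rk k / Am i.+1).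
  by rewrite /tauk /y /yk exprMn rk_sqr /tn; field.
have e2 : Am i.+1 = expR (ln (Am i.+1)) by rewrite lnK.
have e3 : rk k = expR (ln (rk k)) by rewrite lnK.
have e4 : gfun f V = expR (ln (gfun f V)) by rewrite lnK.
rewrite [in LHS]e4 [in LHS]e3 [X in _ = X * _]e2 -!expRD; congr expR.
have -> : 2 * (t - tauk k i.+1) = 2 * t - (4 * pi * y ^+ 2 + (ln (gfun f y) + ln (rk k) - ln (Am i.+1))).
  by rewrite mulrBr e1 ln_frac.
by move: (ln _) (ln _) (ln _) (ln _) => a b c d; ring.
Qed.

Lemma near_g i : (0 < i)%N -> (i <= m)%N -> \forall k \near \oo, 0 < gfun f (yk k i).
Proof.
move=> i0 im; have [T T0 hT] := positive_at_infinity fg1.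
near=> k; apply: hT; near: k; move/cvgryPge : (cvg_yk i0 im); apply.
Unshelve. all: by end_near. Qed.

Lemma cvgy_mul_pos (u v : nat -> R) (l : R) : u @ \oo --> +oo -> v @ \oo --> l -> 0 < l ->
  u n * v n @[n --> \oo] --> +oo.
Proof.
move=> cu cv l0; apply/cvgryPge => A.
have hl : l / 2 < l by lra.
near=> n; have h1 : `|2 * A / l| <= u n by near: n; move/cvgryPge : cu; apply.
have h2 : l / 2 < v n by near: n; exact: cvgr_gt cv _ hl.
apply: (@le_trans _ _ (`|2 * A / l| * (l / 2))).
  rewrite normrM normrM (ger0_norm (_ : 0 <= 2)) // normfV (gtr0_norm l0).
  have -> : 2 * `|A| / l * (l / 2) = `|A| by field; rewrite gt_eqF.
  exact: ler_norm.
by apply: ler_pM => //; [rewrite divr_ge0 ?(ltW l0)|exact: ltW].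
Unshelve. all: by end_near. Qed.

Lemma cvg_sk : sk @ \oo --> +oo.
Proof.
by apply/gtr0_cvgV0; [near=> k; exact: sk_gt0|exact: cvg_skV].
Unshelve. all: by end_near. Qed.

Lemma near_sk_lt i x : (i <= m)%N -> tn i < x -> \forall k \near \oo, tauk k i < sk k * x.
Proof.
move=> im ix; apply: filterS (cvgr_lt _ (cvg_tauk im) _ ix) => k.
by rewrite ltr_pdivrMr ?sk_gt0// mulrC.
Qed.

Lemma near_sk_gt i x : (i <= m)%N -> x < tn i -> \forall k \near \oo, sk k * x < tauk k i.
Proof.
move=> im ix; apply: filterS (cvgr_gt _ (cvg_tauk im) _ ix) => k.
by rewrite ltr_pdivlMr ?sk_gt0// mulrC.
Qed.

Lemma near_sg_gt0 i : (i < m)%N -> \forall k \near \oo, 0 < sgk k i.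
Proof.
move=> im; near=> k; rewrite -(pmulr_rgt0 _ (rk_gt0 k)); near: k.
exact: (cvgr_gt _ (@cvg_slope i) _ (sig_gt0 im)).
Unshelve. all: by end_near.
Qed.

Lemma Vk_left k i d : good k -> (i < m)%N -> 0 <= d -> tauk k i <= tauk k i.+1 - d ->
  Vk k (tauk k i.+1 - d) = yk k i.+1 - sgk k i * d.
Proof.
move=> gk im d0 h; rewrite (VkE gk (ltnW im) h) => [|_]; last by rewrite gerBl.
have [h1 _] := gk; have tt0 := h1 i im.
rewrite /sgk im; have e : tauk k i.+1 - tauk k i != 0 by rewrite subr_eq0 gt_eqF.
have -> : tauk k i.+1 - d - tauk k i = (tauk k i.+1 - tauk k i) - d by ring.
by rewrite mulrBr divfK//; ring.
Qed.

Let lg (t : R) := ln (gfun f t).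

(** The left half of kink i + 1. At the far end of the window V / sqrt(s) tends to W > 0, also when
    i = 0, so g is evaluated at large arguments only. *)
Lemma left_window i x : (i < m)%N -> tn i < x -> x < tn i.+1 ->
  rk k * (HH k (sk k * x) - HH k (tauk k i.+1)) @[k --> \oo] --> Am i.+1 / al i.
Proof.
move=> im xi xi1; have i1 := ltn0Sn i.
pose L k := tauk k i.+1 - sk k * x.
have cLs : tauk k i.+1 / sk k - x @[k --> \oo] --> tn i.+1 - x.
  by apply: cvgB; [exact: cvg_tauk|exact: cvg_cst].
have eL k : L k = sk k * (tauk k i.+1 / sk k - x).
  by rewrite /L mulrBr mulrCA mulfV ?mulr1// gt_eqF// sk_gt0.
have cL : L @ \oo --> +oo.
  have -> : L = fun k => sk k * (tauk k i.+1 / sk k - x) by apply/funext.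
  by apply: cvgy_mul_pos cvg_sk cLs _; rewrite subr_gt0.
pose W := S i.+1 - sig i * (tn i.+1 - x).
have W0 : 0 < W.
  rewrite /W subr_gt0; apply: (@lt_le_trans _ _ (sig i * (tn i.+1 - tn i))).
    by rewrite ltr_pM2l ?sig_gt0// ltrD2l ltrN2.
  rewrite /sig im divfK; last by rewrite subr_eq0 gt_eqF// tn_lt.
  by rewrite gerBl S_ge0// ltnW.
have S1 : 0 < S i.+1 by exact: S_gt0.
have nearW2 : \forall k \near \oo, W / 2 < S i.+1 - rk k * sgk k i * (tauk k i.+1 / sk k - x).
  have h : S i.+1 - rk k * sgk k i * (tauk k i.+1 / sk k - x) @[k --> \oo] --> W.
    by apply: cvgB; [exact: cvg_cst|apply: cvgM; [exact: cvg_slope|exact: cLs]].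
  by apply: cvgr_gt h _ _; lra.
have hc : \forall k \near \oo, forall d, 0 <= d <= L k ->
    W / (2 * S i.+1) * yk k i.+1 <= yk k i.+1 + - sgk k i * d.
  near=> k => d /andP[d0 dL].
  have sg0 : 0 < sgk k i by near: k; exact: near_sg_gt0.
  have hW : W / 2 < S i.+1 - rk k * sgk k i * (tauk k i.+1 / sk k - x) by near: k.
  apply: (@le_trans _ _ (yk k i.+1 - sgk k i * L k)); last first.
    by rewrite mulNr lerD2l lerN2 ler_pM2l.
  have -> : yk k i.+1 - sgk k i * L k = rk k * (S i.+1 - rk k * sgk k i * (tauk k i.+1 / sk k - x)).
    by rewrite eL -rk_sqr /yk; ring.
  have -> : W / (2 * S i.+1) * yk k i.+1 = rk k * (W / 2).
    by rewrite /yk; move: (rk k) (S i.+1) S1 => a b b0; field; rewrite gt_eqF.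
  by rewrite ler_pM2l ?rk_gt0// ltW.
have hQ : \forall k \near \oo, forall d, 0 <= d <= L k ->
    rk k * hh k (tauk k i.+1 - d) = Am i.+1 * expR (lg (yk k i.+1 + - sgk k i * d) - lg (yk k i.+1) +
      d * (8 * pi * (yk k i.+1 * - sgk k i) - 2 * (-1) + 4 * pi * ((- sgk k i) ^+ 2 * d))).
  have [T T0 hT] := positive_at_infinity fg1.
  have Wc : 0 < W / (2 * S i.+1) by rewrite divr_gt0// mulr_gt0.
  near=> k => d /[dup] dd /andP[d0 dL].
  have gk : good k by near: k; exact: near_good.
  have xs : tauk k i < sk k * x by near: k; apply: near_sk_lt => //; exact: ltnW.
  have g1_ : 0 < gfun f (yk k i.+1) by near: k; exact: near_g.
  have h1 : tauk k i <= tauk k i.+1 - d.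
    by apply: ltW; apply: lt_le_trans xs _; rewrite lerBrDl -lerBrDr.
  have eV := Vk_left gk im d0 h1.
  have hck : forall d, 0 <= d <= L k ->
    W / (2 * S i.+1) * yk k i.+1 <= yk k i.+1 + - sgk k i * d by near: k.
  have yT : T / (W / (2 * S i.+1)) <= yk k i.+1 by near: k; move/cvgryPge : (cvg_yk i1 im); apply.
  have g2_ : 0 < gfun f (Vk k (tauk k i.+1 - d)).
    apply: hT; rewrite eV -mulNr; apply: le_trans (hck d dd).
    by rewrite mulrC -ler_pdivrMr.
  rewrite (hh_ref i1 im g1_ g2_) eV /lg mulNr; congr (_ * expR (_ + _)).
  by move: (yk _ _) (sgk _ _) (tauk _ _) => a b c; ring.
have w := @window R lg (fun k d => rk k * hh k (tauk k i.+1 - d)) (fun k => yk k i.+1)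
  (fun k => - sgk k i) L (Am i.+1) (-1) (- (S i.+1 * sig i)) (sig i ^+ 2 * (tn i.+1 - x))
  (W / (2 * S i.+1)).
have {w} : Rintegral leb1 `[0, L k] (fun d => rk k * hh k (tauk k i.+1 - d)) @[k --> \oo] -->
    Am i.+1 / (2 * (-1) - 8 * pi * - (S i.+1 * sig i)).
  apply: w hc hQ.
  - by move=> eta e0; exact: log_growth.
  - move=> k; apply: continuous_measurable1D => d; apply: cvgMr.
    apply: (@continuous_comp R R R (fun d : R => tauk k i.+1 - d) (hh k)); last exact: hh_cont.
    by apply: cvgB; [exact: cvg_cst|exact: cvg_id].
  - by rewrite ltW// Am_gt0.
  - by rewrite divr_gt0// mulr_gt0.
  - by rewrite mulr_ge0 ?sqr_ge0// subr_ge0 ltW.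
  - by rewrite -oppr0; apply: cvgN; exact: cvg_sgk.
  - exact: cvg_yk.
  - apply: (@seq_eq_cvg _ (fun k => - (S i.+1 * (rk k * sgk k i)))) => [k|].
      by rewrite /yk; ring.
    by apply: cvgN; apply: cvgMr; exact: cvg_slope.
  - exact: cL.
  - apply: (@seq_eq_cvg _ (fun k => (rk k * sgk k i) ^+ 2 * (tauk k i.+1 / sk k - x))) => [k|].
      by rewrite eL -rk_sqr; ring.
    by apply: cvgM => //; rewrite expr2; under eq_fun do rewrite expr2; apply: cvgM; exact: cvg_slope.
  - rewrite (_ : 2 * -1 - _ = al i); last by rewrite alE_left//; ring.
    rewrite alE_sq// !ltr_pM2l ?mulr_gt0 ?exprn_gt0 ?sig_gt0 ?pi_gt0//.
    by rewrite ltrD2l ltrN2.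
rewrite (_ : 2 * -1 - _ = al i); last by rewrite alE_left//; ring.
apply: seq_near_cvg; near=> k.
have L0 : 0 <= L k by near: k; move/cvgryPge : cL; apply.
rewrite RintegralZl//; last first.
  apply: integrable_continuous => d.
  apply: (@continuous_comp R R R (fun d : R => tauk k i.+1 - d) (hh k)); last exact: hh_cont.
  by apply: cvgB; [exact: cvg_cst|exact: cvg_id].
have e : tauk k i.+1 - L k = sk k * x by rewrite /L; ring.
rewrite (HH_left k (tauk k i.+1) L0) e; reflexivity.
Unshelve. all: by end_near. Qed.

(** The right half of kink i. Here V increases away from the kink, so the lower bound asked by
    [window] holds with c = 1. *)
Lemma right_window i x : (0 < i)%N -> (i < m)%N -> tn i < x -> x < tn i.+1 ->
  rk k * (HH k (tauk k i) - HH k (sk k * x)) @[k --> \oo] --> Am i / al i.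
Proof.
move=> i0 im xi xi1; have im' := ltnW im.
pose L k := sk k * x - tauk k i.
have cLs : x - tauk k i / sk k @[k --> \oo] --> x - tn i.
  by apply: cvgB; [exact: cvg_cst|exact: cvg_tauk].
have eL k : L k = sk k * (x - tauk k i / sk k).
  by rewrite /L mulrBr [sk k * (_ / _)]mulrCA mulfV ?mulr1// gt_eqF// sk_gt0.
have cL : L @ \oo --> +oo.
  have -> : L = fun k => sk k * (x - tauk k i / sk k) by apply/funext.
  by apply: cvgy_mul_pos cvg_sk cLs _; rewrite subr_gt0.
have hc : \forall k \near \oo, forall d, 0 <= d <= L k ->
    1 * yk k i <= yk k i + sgk k i * d.
  near=> k => d /andP[d0 dL].
  have sg0 : 0 < sgk k i by near: k; exact: near_sg_gt0.
  by rewrite mul1r lerDl mulr_ge0// ltW.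
have hQ : \forall k \near \oo, forall d, 0 <= d <= L k ->
    rk k * hh k (tauk k i + d) = Am i * expR (lg (yk k i + sgk k i * d) - lg (yk k i) +
      d * (8 * pi * (yk k i * sgk k i) - 2 * 1 + 4 * pi * (sgk k i ^+ 2 * d))).
  have [T T0 hT] := positive_at_infinity fg1.
  near=> k => d /[dup] dd /andP[d0 dL].
  have gk : good k by near: k; exact: near_good.
  have xs : sk k * x < tauk k i.+1 by near: k; exact: near_sk_gt.
  have g1_ : 0 < gfun f (yk k i) by near: k; exact: near_g.
  have eV : Vk k (tauk k i + d) = yk k i + sgk k i * d.
    rewrite (VkE gk im') ?lerDl// => [|_]; first by rewrite addrAC subrr add0r.
    by apply: ltW; apply: le_lt_trans xs; rewrite addrC -lerBrDr.
  have hck : forall d, 0 <= d <= L k -> 1 * yk k i <= yk k i + sgk k i * d by near: k.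
  have yT : T <= yk k i by near: k; move/cvgryPge : (cvg_yk i0 im'); apply.
  have g2_ : 0 < gfun f (Vk k (tauk k i + d)).
    by apply: hT; rewrite eV; apply: le_trans (hck d dd); rewrite mul1r.
  rewrite (hh_ref i0 im' g1_ g2_) eV /lg; congr (_ * expR (_ + _)).
  by move: (yk _ _) (sgk _ _) (tauk _ _) => a b c; ring.
have ch k : continuous (fun d => hh k (tauk k i + d)).
  move=> d; apply: (@continuous_comp R R R (fun d : R => tauk k i + d) (hh k)); last exact: hh_cont.
  by apply: cvgD; [exact: cvg_cst|exact: cvg_id].
have w := @window R lg (fun k d => rk k * hh k (tauk k i + d)) (fun k => yk k i)
  (fun k => sgk k i) L (Am i) 1 (S i * sig i) (sig i ^+ 2 * (x - tn i)) 1.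
have {w} : Rintegral leb1 `[0, L k] (fun d => rk k * hh k (tauk k i + d)) @[k --> \oo] -->
    Am i / (2 * 1 - 8 * pi * (S i * sig i)).
  apply: w hc hQ => //.
  - by move=> eta e0; exact: log_growth.
  - by move=> k; apply: continuous_measurable1D => d; apply: cvgMr; exact: ch.
  - by rewrite ltW// Am_gt0.
  - by rewrite mulr_ge0 ?sqr_ge0// subr_ge0 ltW.
  - exact: cvg_sgk.
  - exact: cvg_yk.
  - apply: (@seq_eq_cvg _ (fun k => S i * (rk k * sgk k i))) => [k|].
      by rewrite /yk; ring.
    by apply: cvgMr; exact: cvg_slope.
  - apply: (@seq_eq_cvg _ (fun k => (rk k * sgk k i) ^+ 2 * (x - tauk k i / sk k))) => [k|].
      by rewrite eL -rk_sqr; ring.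
    by apply: cvgM => //; rewrite expr2; under eq_fun do rewrite expr2; apply: cvgM; exact: cvg_slope.
  - rewrite (_ : 2 * 1 - _ = al i); last by rewrite alE_right// mulr1.
    rewrite alE_sq// !ltr_pM2l ?mulr_gt0 ?exprn_gt0 ?sig_gt0 ?pi_gt0//.
    by rewrite ltrD2r.
rewrite (_ : 2 * 1 - _ = al i); last by rewrite alE_right// mulr1.
apply: seq_near_cvg; near=> k.
have L0 : 0 <= L k by near: k; move/cvgryPge : cL; apply.
rewrite RintegralZl//; last exact: integrable_continuous.
have e : tauk k i + L k = sk k * x by rewrite /L; ring.
rewrite (HH_right k (tauk k i) L0) e; reflexivity.
Unshelve. all: by end_near. Qed.

Lemma kk_E k : good k -> forall r, r <= expR (- (2 * tauk k m)) ->
  primitive (kk k) r = kk k (expR (- (2 * tauk k m))) * r.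
Proof.
move=> gk r hr.
exact: (@K_small _ (kk k) (expR (- (2 * tauk k m))) _ (expR_gt0 _) (fun r => @kk_small k r gk) r hr).
Qed.

Lemma HH_tail k t : good k -> tauk k m <= t -> HH k t = expR (- (2 * (t - tauk k m))) * HH k (tauk k m).
Proof.
move=> gk ht; rewrite /HH /Hfun !(kk_E gk)//; last by rewrite ler_expR lerN2 ler_pM2l.
have -> : - (2 * t) = - (2 * (t - tauk k m)) + - (2 * tauk k m) by ring.
by rewrite expRD; ring.
Qed.

(** Beyond the last node f(V) is constant, so the mass is exactly the density at the node times the
    integral of exp(-2 d). *)
Lemma near_top : \forall k \near \oo, rk k * HH k (tauk k m) = Am m / 2.
Proof.
near=> k; have gk : good k by near: k; exact: near_good.
have gm : 0 < gfun f (yk k m) by near: k; exact: near_g.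
have eV : Vk k (tauk k m) = yk k m.
  by rewrite (VkE gk (leqnn m)) ?ltnn// subrr mulr0 addr0.
have := @hh_ref k m (tauk k m) m0 (leqnn m) gm; rewrite eV => /(_ gm).
rewrite !subrr !mulr0 !subr0 addr0 expR0 mulr1 => <-.
by rewrite /HH /Hfun (kk_E gk)// /hh; field.
Unshelve. all: by end_near. Qed.

(** Descending induction from the last node: the masses of the kinks after node i are the drops of
    the slope, which telescope to [sig i]; the other term is the right half of kink i itself. *)
Lemma cvg_HH_tau i : (0 < i)%N -> (i <= m)%N ->
  rk k * HH k (tauk k i) @[k --> \oo] --> sig i + Am i / al i.
Proof.
move=> i0 im; have -> : i = (m - (m - i))%N by rewrite subKn.
have : (m - i < m)%N by rewrite ltn_subrL i0 m0.
elim: (m - i)%N => [|j IH] jm.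
  rewrite subn0 /sig /al ltnn add0r; apply: seq_near_cvg (cvg_cst _).
  by near=> k; apply/esym; near: k; exact: near_top.
have {}IH := IH (ltnW jm); set l := (m - j.+1)%N.
have el : (m - j)%N = l.+1 by rewrite /l subnSK// ltnW.
have lm : (l < m)%N by rewrite /l ltn_subrL m0.
have l0 : (0 < l)%N by rewrite subn_gt0.
(* Any point strictly between the two nodes separates their masses; the midpoint is taken. *)
rewrite el in IH; pose x := (tn l + tn l.+1) / 2; have tl := tn_lt lm.
have x1 : tn l < x by rewrite /x; lra.
have x2 : x < tn l.+1 by rewrite /x; lra.
have h : rk k * (HH k (tauk k l) - HH k (sk k * x)) + rk k * (HH k (sk k * x) - HH k (tauk k l.+1)) +
    rk k * HH k (tauk k l.+1) @[k --> \oo] --> Am l / al l + Am l.+1 / al l + (sig l.+1 + Am l.+1 / al l.+1).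
  by apply: cvgD; [apply: cvgD; [exact: right_window|exact: left_window]|exact: IH].
have -> : sig l + Am l / al l = Am l / al l + Am l.+1 / al l + (sig l.+1 + Am l.+1 / al l.+1).
  have := Am_split (ltn0Sn l) lm; rewrite /=.
  by move: (Am l.+1 / al l) (Am l.+1 / al l.+1) => a b; lra.
apply: (seq_near_cvg _ h); apply: nearW => k; move: (HH k _) (HH k _) (HH k _) => p q r; ring.
Unshelve. all: by end_near. Qed.

(** The left half of kink i + 1 completes its mass, so the accumulated mass and the slope of u have
    the same limit on each piece. *)
Lemma cvg_HH i x : (i < m)%N -> tn i < x -> x < tn i.+1 ->
  rk k * HH k (sk k * x) @[k --> \oo] --> sig i.
Proof.
move=> im x1 x2.
have h : rk k * (HH k (sk k * x) - HH k (tauk k i.+1)) +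
    rk k * HH k (tauk k i.+1) @[k --> \oo] --> Am i.+1 / al i + (sig i.+1 + Am i.+1 / al i.+1).
  by apply: cvgD; [exact: left_window|exact: cvg_HH_tau].
have -> : sig i = Am i.+1 / al i + (sig i.+1 + Am i.+1 / al i.+1).
  have := Am_split (ltn0Sn i) im; rewrite /=.
  by move: (Am i.+1 / al i) (Am i.+1 / al i.+1) => a b; lra.
apply: (seq_near_cvg _ h); apply: nearW => k; move: (HH k _) (HH k _) => p q; ring.
Qed.

Lemma cvg_HH_tail x : tn m < x -> rk k * HH k (sk k * x) @[k --> \oo] --> (0 : R).
Proof.
move=> mx.
have cL : 2 * (sk k * x - tauk k m) @[k --> \oo] --> +oo.
  have -> : (fun k => 2 * (sk k * x - tauk k m)) = (fun k => sk k * (2 * (x - tauk k m / sk k))).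
    by apply/funext => k; have s0 := sk_gt0 k; field; rewrite gt_eqF.
  apply: (@cvgy_mul_pos _ _ (2 * (x - tn m)) cvg_sk).
    by apply: cvgMr; apply: cvgB; [exact: cvg_cst|exact: cvg_tauk].
  by rewrite mulr_gt0// subr_gt0.
have h : expR (- (2 * (sk k * x - tauk k m))) * (Am m / 2) @[k --> \oo] --> 0 * (Am m / 2).
  by apply: cvgMl; exact: (cvg_comp _ _ cL (@cvgr_expR R)).
rewrite mul0r in h; apply: seq_near_cvg h; near=> k.
have gk : good k by near: k; exact: near_good.
have e1 : rk k * HH k (tauk k m) = Am m / 2 by near: k; exact: near_top.
have xs : tauk k m < sk k * x by near: k; exact: near_sk_lt.
by rewrite (HH_tail gk (ltW xs)) -e1 mulrCA.
Unshelve. all: by end_near. Qed.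

(* Slope and mass compared in L^2 away from the boundary *)
Opaque HH.

Lemma Vk_mono k a b : good k -> a <= b -> Vk k a <= Vk k b.
Proof.
move=> [_ h] ab; rewrite /Vk /minsum /pk /pieces !big_map big_seq [leRHS]big_seq.
apply: ler_sum => j; rewrite mem_iota add0n => /andP[_ jm] /=.
rewrite ler_wpM2l ?subr_ge0 ?(ltW (h j jm))//.
by rewrite le_min !ge_min ab lexx orbT.
Qed.

Lemma wk_bound k t : good k -> 0 <= t -> 0 <= wsum (pk k) t <= sgk k 0.
Proof.
move=> gk t0; have [h1 h] := gk.
have <- : wsum (pk k) 0 = sgk k 0 by apply: (wkE gk) => // m1; exact: h1 m1.
by apply: wsum_bound t0 => j jm; exact: ltW (h j jm).
Qed.

(** Before s x0 the values of u need not be large and the asymptotics of g give nothing; that region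
    is treated apart. *)
Let x0 : R := tn 1 / 2.
Let X : R := tn m + 1.

Lemma tn0 : tn 0 = 0. Proof. by rewrite /tn S0 expr0n mulr0. Qed.

Lemma tn1_gt0 : 0 < tn 1. Proof. by rewrite -tn0; exact: tn_lt. Qed.

Lemma x0_gt0 : 0 < x0. Proof. by rewrite divr_gt0// tn1_gt0. Qed.

Lemma x0_lt : x0 < tn 1. Proof. by have := tn1_gt0; rewrite /x0; lra. Qed.

Lemma near_x0 : \forall k \near \oo, sk k * x0 < tauk k 1.
Proof. by apply: near_sk_gt x0_lt. Qed.

Lemma cvg_x0 : rk k * HH k (sk k * x0) @[k --> \oo] --> sig 0.
Proof. by apply: cvg_HH => //; [rewrite tn0 x0_gt0|exact: x0_lt]. Qed.

Lemma near_sg0 : \forall k \near \oo, 0 < sgk k 0 /\ rk k * sgk k 0 < sig 0 + 1.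
Proof.
have h : sig 0 < sig 0 + 1 by rewrite ltrDl.
near=> k; split; near: k; first exact: near_sg_gt0.
exact: (cvgr_lt _ (@cvg_slope 0) _ h).
Unshelve. all: by end_near. Qed.

Lemma V_start k t : good k -> 0 <= t -> t <= tauk k 1 -> Vk k t = sgk k 0 * t.
Proof.
move=> gk t0 t1; rewrite (@VkE k 0 t gk) => [||//|//] //.
by rewrite /yk S0 mulr0 add0r subr0.
Qed.

Lemma HH_seg k a b : a <= b -> Rintegral leb1 `[a, b] (hh k) = HH k a - HH k b.
Proof.
move=> ab; have dd t : is_derive t (1 : R) (fun t : R => - HH k t) (hh k t).
  by apply: (is_derive_eq (is_deriveN (is_derive_HH k t))); rewrite opprK.
by rewrite /Rintegral (FTC_continuous ab (@hh_cont k) dd)/= opprK addrC.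
Qed.

Lemma near_hh_ge0 : \forall k \near \oo, forall t, sk k * x0 <= t -> 0 <= hh k t.
Proof.
have [T T0 hT] := positive_at_infinity fg1.
have cV : rk k * (rk k * sgk k 0 * x0) @[k --> \oo] --> +oo.
  apply: (@cvgy_mul_pos _ _ (sig 0 * x0) cvg_rk); first by apply: cvgMl; exact: cvg_slope.
  by rewrite mulr_gt0 ?x0_gt0 ?sig_gt0.
near=> k => t ht; have gk : good k by near: k; exact: near_good.
have x1 : sk k * x0 < tauk k 1 by near: k; exact: near_x0.
have hT2 : T <= rk k * (rk k * sgk k 0 * x0) by near: k; move/cvgryPge : cV; apply.
have VT : T <= Vk k t.
  apply: le_trans hT2 _; apply: le_trans (Vk_mono gk ht).
  rewrite (V_start gk (mulr_ge0 (ltW (sk_gt0 k)) (ltW x0_gt0)) (ltW x1)).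
  by rewrite -rk_sqr le_eqVlt; apply/orP; left; apply/eqP; ring.
by rewrite /hh kk_exp f_gfun mulr_ge0 ?expR_ge0// mulr_ge0 ?expR_ge0// ltW// hT.
Unshelve. all: by end_near. Qed.

(** The density is nonnegative beyond s x0, so [HH] decreases there from a value whose rescaling
    converges; past the last node it decays like exp(-2 t). *)
Lemma near_HH_bound : exists2 C, 0 <= C & \forall k \near \oo,
  forall x, x0 <= x -> `|rk k * HH k (sk k * x)| <= C * expR (- x).
Proof.
pose B0 := sig 0 + 1; have s0 := sig_gt0 m0.
have A0 : 0 < Am m by exact: Am_gt0.
have A2 : 0 <= Am m / 2 by rewrite divr_ge0// ltW.
have B0_ge0 : 0 <= B0 by rewrite addr_ge0// ltW.
have BA : 0 <= B0 + Am m by rewrite addr_ge0// ltW.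
have A2B : Am m / 2 <= B0 + Am m.
  apply: (@le_trans _ _ (Am m)); last by rewrite lerDr.
  by rewrite ler_pdivrMr// ler_peMr ?(ltW A0)// ler1n.
exists ((B0 + Am m) * expR X); first by rewrite mulr_ge0 ?expR_ge0.
have mX : tn m < tn m + 2^-1 by rewrite ltrDl.
near=> k => x hx; have gk : good k by near: k; exact: near_good.
have hp : forall t, sk k * x0 <= t -> 0 <= hh k t by near: k; exact: near_hh_ge0.
have hm a b : sk k * x0 <= a -> a <= b -> HH k b <= HH k a.
  move=> ha ab; rewrite -subr_ge0 -HH_seg//; apply: Rintegral_ge0 => t /=.
  by rewrite in_itv/= => /andP[at_ _]; apply: hp; exact: le_trans ha at_.
have k0 := sk_gt0 k; have r0 := rk_gt0 k.
have hm2 y z : x0 <= y -> y <= z -> rk k * HH k (sk k * z) <= rk k * HH k (sk k * y).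
  move=> hy yz; apply: (ler_wpM2l (ltW r0)); apply: hm; exact: (ler_wpM2l (ltW k0)).
have top : rk k * HH k (tauk k m) = Am m / 2 by near: k; exact: near_top.
have tx : tauk k m < sk k * (tn m + 2^-1) by near: k; exact: near_sk_lt.
have sk1 : 1 <= sk k by rewrite ler1n.
have tail y : X <= y -> 0 <= rk k * HH k (sk k * y) <= Am m / 2 * expR (- (2 * (y - X))).
  move=> Xy; have h1 : y - X <= sk k * y - tauk k m.
    have : 1 * (y - (tn m + 2^-1)) <= sk k * (y - (tn m + 2^-1)).
      by rewrite ler_wpM2r// subr_ge0; move: Xy; rewrite /X; lra.
    by move: tx Xy; rewrite /X mul1r mulrBr; lra.
  have h2 : tauk k m <= sk k * y by move: h1 Xy; lra.
  rewrite (HH_tail gk h2) mulrCA top mulrC; apply/andP; split.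
    by rewrite mulr_ge0 ?expR_ge0.
  by apply: ler_wpM2l => //; rewrite ler_expR lerN2 ler_pM2l.
have h0 : rk k * HH k (sk k * x0) <= B0.
  near: k; apply: (cvgr_le _ cvg_x0); by rewrite /B0 ltrDl.
have [xX|Xx] := leP x X.
  have hge : 0 <= rk k * HH k (sk k * x).
    have /andP[t1 _] := tail X (lexx _); exact: le_trans t1 (hm2 _ _ hx xX).
  rewrite (ger0_norm hge).
  have hB : rk k * HH k (sk k * x) <= B0 + Am m.
    by apply: (le_trans (le_trans (hm2 _ _ (lexx _) hx) h0)); rewrite lerDl ltW.
  exact: exp_bound_left BA hB xX.
have /andP[t1 t2] := tail x (ltW Xx); rewrite (ger0_norm t1); apply: (le_trans t2).
exact: exp_bound_right A2 A2B (ltW Xx).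
Unshelve. all: by end_near. Qed.

Lemma near_w_bound : exists2 C, 0 <= C & \forall k \near \oo,
  forall x, 0 <= x -> `|rk k * wsum (pk k) (sk k * x)| <= C * expR (- x).
Proof.
have s0 := sig_gt0 m0.
have s1 : 0 <= sig 0 + 1 by rewrite addr_ge0// ltW.
exists ((sig 0 + 1) * expR X); first by rewrite mulr_ge0 ?expR_ge0.
have mX : tn m < X by rewrite /X ltrDl.
near=> k => x hx; have gk : good k by near: k; exact: near_good.
have k0 := sk_gt0 k; have r0 := rk_gt0 k.
have tx : tauk k m < sk k * X by near: k; exact: near_sk_lt.
have [sg0 rs] : 0 < sgk k 0 /\ rk k * sgk k 0 < sig 0 + 1 by near: k; exact: near_sg0.
have [xX|Xx] := leP x X; last first.
  have h2 : tauk k m <= sk k * x by apply: (le_trans (ltW tx)); rewrite ler_pM2l// ltW.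
  rewrite (wkE gk (leqnn m) h2) ?ltnn// sgk_m mulr0 normr0; apply: mulr_ge0 (expR_ge0 _); exact: mulr_ge0 s1 (expR_ge0 _).
have /andP[w1 w2] := wk_bound gk (mulr_ge0 (ltW k0) hx).
have hB : rk k * wsum (pk k) (sk k * x) <= sig 0 + 1.
  by apply: (le_trans _ (ltW rs)); exact: (ler_wpM2l (ltW r0)).
rewrite (ger0_norm (mulr_ge0 (ltW r0) w1)).
exact: exp_bound_left s1 hB xX.
Unshelve. all: by end_near. Qed.

(** The slope in t of the undilated finite tower, the common limit of the rescaled slopes and
    masses. *)
Definition om : R -> R := wsum (pieces tn sig m).

Lemma om_E i x : (i <= m)%N -> tn i <= x -> ((i < m)%N -> x < tn i.+1) -> om x = sig i.
Proof.
move=> im h1 h2; have := @wsum_pieces _ tn sig m _ i x im h1 h2.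
by rewrite {2}/sig ltnn addr0; apply => j jm; exact: ltW (tn_lt jm).
Qed.

Lemma find_piece x : 0 < x -> (forall i, (i <= m)%N -> x != tn i) ->
  (exists i, [/\ (i < m)%N, tn i < x & x < tn i.+1]) \/ tn m < x.
Proof.
move=> xp hx; have [h|h] := leP x (tn m); last by right.
left; have {h} : x < tn m by rewrite lt_neqAle hx.
elim: {1 3 4}m (leqnn m) => [_|j IH jm xj]; first by rewrite tn0 ltNge (ltW xp).
have [h|h] := ltP x (tn j).
  by have [i [i1 i2 i3]] := IH (ltnW jm) h; exists i; split => //; exact: ltnW.
by exists j; split => //; rewrite lt_neqAle eq_sym hx ?(ltnW jm).
Qed.

Lemma ae_nodes : {ae leb1, forall x, forall i, (i <= m)%N -> x != tn i}.
Proof.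
have h n : leb1.-negligible [set x : R | exists2 i, (i < n)%N & x = tn i].
  elim: n => [|n IH].
    by apply: negligibleS (negligible_set0 _) => x [].
  have h1 : leb1.-negligible [set tn n].
    by exists [set tn n]; split => //; exact: lebesgue_measure_set1.
  apply: negligibleS (negligibleU IH h1) => x [i]; rewrite ltnS leq_eqVlt => /orP[/eqP -> ->|im ->].
    by right.
  by left; exists i.
apply: negligibleS (h m.+1) => x /= /existsNP[i /not_implyP[im /negP]].
by rewrite negbK => /eqP ->; exists i.
Qed.

Lemma cvg_w x : 0 < x -> (forall i, (i <= m)%N -> x != tn i) ->
  rk k * wsum (pk k) (sk k * x) @[k --> \oo] --> om x.
Proof.
move=> xp hx; have [[i [im i1 i2]]|mx] := find_piece xp hx.
  rewrite (om_E (ltnW im) (ltW i1)) => [|_//].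
  apply: seq_near_cvg (@cvg_slope i); near=> k; have gk : good k by near: k; exact: near_good.
  rewrite (wkE gk (ltnW im)) => [//||_]; last by near: k; exact: near_sk_gt.
  by apply: ltW; near: k; apply: near_sk_lt => //; exact: ltnW.
rewrite (om_E (leqnn m) (ltW mx)) ?ltnn// /sig ltnn.
apply: seq_near_cvg (cvg_cst _); near=> k; have gk : good k by near: k; exact: near_good.
rewrite (wkE gk (leqnn m)) ?ltnn// ?sgk_m ?mulr0//.
by apply: ltW; near: k; exact: near_sk_lt.
Unshelve. all: by end_near. Qed.

Lemma cvg_H x : 0 < x -> (forall i, (i <= m)%N -> x != tn i) ->
  rk k * HH k (sk k * x) @[k --> \oo] --> om x.
Proof.
move=> xp hx; have [[i [im i1 i2]]|mx] := find_piece xp hx.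
  by rewrite (om_E (ltnW im) (ltW i1)) => [|_//]; exact: cvg_HH.
rewrite (om_E (leqnn m) (ltW mx)) ?ltnn// /sig ltnn; exact: cvg_HH_tail.
Qed.

Lemma exp2_integrable (C : R) (D : set R) : measurable D -> D `<=` `[0, +oo[ ->
  leb1.-integrable D (EFin \o (fun x => (C * expR (- x)) ^+ 2)).
Proof.
move=> mD D0; have [i _] := exponential_integral (ltr0n R 2).
have i2 : leb1.-integrable D (EFin \o (fun x => C ^+ 2 * expR (- (2 * x)))).
  have i1 : leb1.-integrable D (EFin \o (fun x => expR (- (2 * x)))) by apply: integrableS i.
  exact: (@integrableZl _ _ _ leb1 _ mD (C ^+ 2) _ i1).
rewrite (_ : (fun x => _) = fun x => C ^+ 2 * expR (- (2 * x))) //.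
by apply/funext => x; rewrite exprMn [in LHS]expr2 -[expR _ ^+ 2]expRM_natl; congr (_ * expR _); rewrite ?expr2 //; ring.
Qed.

Lemma measurable_wk (s r : R) k : measurable_fun setT (fun x => r * wsum (pk k) (s * x)).
Proof.
apply: measurable_funM => //; apply: (measurableT_comp (@measurable_wsum _ (pk k))).
by apply: measurable_funM => //; exact: measurable_id.
Qed.

Lemma measurable_HH (s r : R) k : measurable_fun setT (fun x => r * HH k (s * x)).
Proof.
have cH : continuous (HH k).
  by apply: (@continuous_is_derive _ (fun t => - hh k t)) => t; exact: is_derive_HH.
apply: measurable_funM => //; apply: (measurableT_comp (continuous_measurable1D cH)).
by apply: measurable_funM => //; exact: measurable_id.
Qed.

Lemma measurable_sqr (g : R -> R) : measurable_fun setT g -> measurable_fun setT (fun x => g x ^+ 2).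
Proof. by move=> mg; apply: (@measurable_funX _ _ _ _ _ 2). Qed.

(** The majorant is the square of 2 C exp(-x). The conclusion is phrased with a real sequence
    because the integrals are extended reals, and their finiteness is obtained for large k. *)
Lemma L2_cvg0 (D : set R) (u_ v_ : nat -> R -> R) (C : R) : measurable D -> D `<=` `[0, +oo[ ->
  (forall k, measurable_fun setT (u_ k)) -> (forall k, measurable_fun setT (v_ k)) ->
  (\forall k \near \oo, forall x, D x -> `|u_ k x| <= C * expR (- x)) ->
  (\forall k \near \oo, forall x, D x -> `|v_ k x| <= C * expR (- x)) ->
  {ae leb1, forall x, D x -> u_ k x - v_ k x @[k --> \oo] --> (0 : R)} ->
  exists2 dl : nat -> R, dl @ \oo --> (0 : R) & \forall k \near \oo,
    (\int[leb1]_(x in D) ((u_ k x - v_ k x) ^+ 2)%:E <= (dl k)%:E)%E.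
Proof.
move=> mD D0 mu_ mv_ hu hv hae.
have ig := exp2_integrable (2 * C) mD D0.
have md k : measurable_fun D (fun x => (u_ k x - v_ k x) ^+ 2).
  by apply: measurable_funTS; apply: measurable_sqr; exact: measurable_funB.
have bnd : \forall k \near \oo, forall x, D x -> `|(u_ k x - v_ k x) ^+ 2| <= (2 * C * expR (- x)) ^+ 2.
  near=> k => x Dx.
  have h1 : forall x, D x -> `|u_ k x| <= C * expR (- x) by near: k.
  have h2 : forall x, D x -> `|v_ k x| <= C * expR (- x) by near: k.
  rewrite normrX; have h3 : `|u_ k x - v_ k x| <= 2 * C * expR (- x).
    apply: le_trans (ler_normB _ _) _.
    by rewrite -mulrA mulr2n mulrDl mul1r; exact: lerD (h1 x Dx) (h2 x Dx).
  by rewrite lerXn2r ?nnegrE// (le_trans _ h3).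
exists (fun k => Rintegral leb1 D (fun x => (u_ k x - v_ k x) ^+ 2)).
  have h := @Rintegral_dominated_near _ _ R leb1 D mD (fun k x => (u_ k x - v_ k x) ^+ 2)
    (fun=> 0) _ md (measurable_cst _) ig bnd.
  rewrite /Rintegral integral0 in h; apply: h.
  apply: negligibleS hae => x nx h; apply: nx => Dx.
  have := h Dx => {}h; rewrite -[X in _ --> X](mulr0 (0:R)).
  by under eq_fun do rewrite expr2; exact: cvgM.
near=> k; rewrite EFin_Rintegral//.
have hb : forall x, D x -> `|(u_ k x - v_ k x) ^+ 2| <= (2 * C * expR (- x)) ^+ 2 by near: k.
exact: (@le_integrable_real _ _ _ leb1 D mD _ _ (md k) ig hb).
Unshelve. all: by end_near. Qed.

(** In terms of energies: the shifted broken line is close to the dilation of the finite tower. *)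
Lemma w_small : exists2 dl : nat -> R, dl @ \oo --> (0 : R) & \forall k \near \oo,
  (\int[leb1]_(x in `]0%R, +oo[) ((rk k * wsum (pk k) (sk k * x) - om x) ^+ 2)%:E <= (dl k)%:E)%E.
Proof.
have [C C0 hC] := near_w_bound.
pose C2 := (sig 0 + 1) * expR X.
have s1 : 0 <= sig 0 + 1 by rewrite addr_ge0// ltW// sig_gt0.
have C20 : 0 <= C2 by rewrite mulr_ge0 ?expR_ge0.
apply: (@L2_cvg0 _ _ (fun=> om) (C + C2)) => //.
- by move=> x /=; rewrite !in_itv/= !andbT; exact: ltW.
- by move=> k; exact: measurable_wk.
- by move=> k; exact: measurable_wsum.
- apply: filterS hC => k h x /=; rewrite in_itv/= andbT => hx.
  apply: le_trans (h x (ltW hx)) _.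
  by rewrite ler_wpM2r ?expR_ge0// lerDl.
- apply: nearW => k x /=; rewrite in_itv/= andbT => hx.
  apply: (@le_trans _ _ (C2 * expR (- x))); last by rewrite ler_wpM2r ?expR_ge0// lerDr.
  have hd j : (j < m)%N -> sig j.+1 <= sig j by move=> jm; exact: ltW (sig_dec jm).
  have /andP[w1 w2] := wsum_bound tn hd (ltW hx).
  have e0 : wsum (pieces tn sig m) 0 = sig 0.
    by apply: (@om_E 0) => //; [rewrite tn0|move=> _; exact: tn1_gt0].
  rewrite ger0_norm//; have [xX|Xx] := leP x X.
    by apply: exp_bound_left => //; apply: le_trans w2 _; rewrite e0 lerDl.
  have mx : tn m <= x by apply: le_trans (ltW Xx); rewrite /X lerDl.
  by rewrite (om_E (leqnn m) mx) ?ltnn// /sig ltnn mulr_ge0 ?expR_ge0.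
- apply: negligibleS ae_nodes => x nx hx; apply: nx; rewrite /= in_itv/= andbT => hx0.
  by rewrite -(subrr (om x)); apply: cvgB; [exact: cvg_w|exact: cvg_cst].
Qed.

Lemma D_small : exists2 dl : nat -> R, dl @ \oo --> (0 : R) & \forall k \near \oo,
  (\int[leb1]_(x in `[x0, +oo[) ((rk k * wsum (pk k) (sk k * x) - rk k * HH k (sk k * x)) ^+ 2)%:E <= (dl k)%:E)%E.
Proof.
have [C1 C10 h1] := near_w_bound; have [C2 C20 h2] := near_HH_bound.
have xx := x0_gt0.
apply: (@L2_cvg0 _ _ _ (C1 + C2)) => //.
- by move=> x /=; rewrite !in_itv/= !andbT => h; apply: le_trans h; exact: ltW.
- by move=> k; exact: measurable_wk.
- by move=> k; exact: measurable_HH.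
- apply: filterS h1 => k h x /=; rewrite in_itv/= andbT => hx.
  apply: le_trans (h x (le_trans (ltW xx) hx)) _.
  by rewrite ler_wpM2r ?expR_ge0// lerDl.
- apply: filterS h2 => k h x /=; rewrite in_itv/= andbT => hx.
  apply: le_trans (h x hx) _.
  by rewrite ler_wpM2r ?expR_ge0// lerDr.
- apply: negligibleS ae_nodes => x nx hx; apply: nx; rewrite /= in_itv/= andbT => hx0.
  rewrite -(subrr (om x)); apply: cvgB; [apply: cvg_w => //|apply: cvg_H => //]; exact: lt_le_trans xx hx0.
Qed.

(** * The region near the boundary of the disk, where u is small *)

Lemma Vk_cvg0 t : 0 <= t -> Vk k t @[k --> \oo] --> (0 : R).
Proof.
move=> t0; have hs : sgk k 0 * t @[k --> \oo] --> 0 * t by apply: cvgMl; exact: cvg_sgk.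
rewrite mul0r in hs; apply: seq_near_cvg hs; near=> k.
have gk : good k by near: k; exact: near_good.
rewrite V_start//; apply: ltW; apply: le_lt_trans (_ : t <= sk k * x0) _.
  by rewrite mulrC -ler_pdivrMl ?x0_gt0//; near: k; move/cvgryPge : cvg_sk; apply.
by near: k; exact: near_x0.
Unshelve. all: by end_near. Qed.

Lemma fVk_cvg0 (t : R) : 0 <= t -> f (Vk k t) @[k --> \oo] --> (0 : R).
Proof.
move=> t0; have h : f x @[x --> (0 : R)] --> (0 : R) by rewrite -{2}f0; exact: cf.
exact: (cvg_comp _ _ (Vk_cvg0 t0) h).
Qed.

(** On the first piece V = sgk k 0 * t with t <= s x0. With growth exponent 4 pi + pi and x0 = tn 1
    / 2 one has 5 pi sig(0)^2 x0 = 5/4, so the exponent is at most 3 t / 2 for large k and exp(-2 t)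
    still leaves exp(- t / 2). *)
Lemma near_hh_bound : exists2 C, 0 <= C & \forall k \near \oo,
  forall t, 0 <= t -> t <= sk k * x0 -> `|hh k t| <= C * expR (- (t / 2)).
Proof.
have p0 := @pi_gt0 R.
have [C C0 hC] := critical_growth_bound cf fcrit p0.
exists ((8 * pi)^-1 * C); first by rewrite mulr_ge0// invr_ge0 mulr_ge0// ltW.
have cE : (4 * pi + pi) * ((rk k * sgk k 0) ^+ 2 * x0) @[k --> \oo] --> (4 * pi + pi) * (sig 0 ^+ 2 * x0).
  apply: cvgMr; apply: cvgMl; rewrite expr2; under eq_fun do rewrite expr2; apply: cvgM; exact: cvg_slope.
have lE : (4 * pi + pi) * (sig 0 ^+ 2 * x0) < 3 / 2.
  have -> : (4 * pi + pi) * (sig 0 ^+ 2 * x0) = 5 / 4.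
    rewrite /x0 sigE// S0 addr0 /tn; have S1 : 0 < S 1 by exact: S_gt0.
    by move: (S 1) (pi : R) p0 S1 => a p p1 a1; field; rewrite !gt_eqF.
  lra.
near=> k => t t0 tx; have gk : good k by near: k; exact: near_good.
have x1 : sk k * x0 < tauk k 1 by near: k; exact: near_x0.
have hE : (4 * pi + pi) * ((rk k * sgk k 0) ^+ 2 * x0) < 3 / 2.
  by near: k; exact: (cvgr_lt _ cE _ lE).
have eV := V_start gk t0 (le_trans tx (ltW x1)).
rewrite /hh kk_exp eV !normrM (ger0_norm (expR_ge0 _)) ger0_norm ?invr_ge0 ?mulr_ge0 ?(ltW p0)//.
rewrite mulrCA -mulrA ler_wpM2l ?invr_ge0 ?mulr_ge0 ?(ltW p0)//.
apply: (@le_trans _ _ (expR (- (2 * t)) * (C * expR ((4 * pi + pi) * (sgk k 0 * t) ^+ 2)))).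
  by rewrite ler_wpM2l ?expR_ge0.
rewrite mulrCA ler_wpM2l// -expRD ler_expR.
have e1 : (4 * pi + pi) * (sgk k 0 * t) ^+ 2 <= 3 / 2 * t.
  apply: (@le_trans _ _ ((4 * pi + pi) * ((rk k * sgk k 0) ^+ 2 * x0) * t)); last first.
    by rewrite ler_wpM2r// ltW.
  have -> : (4 * pi + pi) * ((rk k * sgk k 0) ^+ 2 * x0) * t = (4 * pi + pi) * (sgk k 0 ^+ 2 * (sk k * x0) * t).
    by rewrite exprMn rk_sqr; ring.
  have pp : 0 <= 4 * pi + pi :> R by rewrite addr_ge0 ?mulr_ge0// ltW.
  have h : t ^+ 2 <= sk k * x0 * t by rewrite expr2 ler_wpM2r.
  have h' := ler_wpM2l (sqr_ge0 (sgk k 0)) h.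
  by apply: (ler_wpM2l pp); rewrite exprMn -[leRHS]mulrA.
by move: e1; lra.
Unshelve. all: by end_near. Qed.

(** The weight spends half of the decay found in [near_hh_bound]; [HH_start] returns it as the
    factor exp(- t / 4). *)
Definition epsk k : R := Rintegral leb1 `[0, sk k * x0] (fun r => `|hh k r| * expR (r / 4)).

(** Dominated convergence: for fixed r the first slope tends to 0, so V(r) tends to 0, and f is
    continuous with f(0) = 0. *)
Lemma cvg_epsk : epsk @ \oo --> (0 : R).
Proof.
have [C C0 hC] := near_hh_bound.
pose u k r := (`|hh k r| * expR (r / 4)) * \1_(`]-oo, (sk k * x0)]) r.
have eu k : epsk k = Rintegral leb1 `[0, +oo[ (u k).
  rewrite /epsk Rintegral_mkcond [RHS]Rintegral_mkcond; apply: eq_Rintegral => d _.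
  rewrite /patch /u indicE !mem_setE !in_itv/= andbT.
  by case: (0 <= d); case: (d <= _); rewrite ?mulr1 ?mulr0.
have i4 : 0 < 4^-1 :> R by rewrite invr_gt0.
have [ib _] := exponential_integral i4.
have ce k : continuous (fun r : R => `|hh k r| * expR (r / 4)).
  move=> r; apply: cvgM; first by apply: cvg_norm; exact: hh_cont.
  apply: (@continuous_comp R R R (fun r : R => r / 4) (@expR R)); last exact: continuous_expR.
  by apply: cvgMl; exact: cvg_id.
have h := @Rintegral_dominated_near _ _ R leb1 `[0, +oo[ (measurable_itv _) u (fun=> 0) (fun r => C * expR (- (4^-1 * r))).
rewrite /Rintegral integral0 in h.
apply: (seq_eq_cvg (fun k => esym (eu k))); apply: h => //.
- move=> k; apply: measurable_funTS; apply: measurable_funM; first exact: continuous_measurable1D (ce k).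
  by apply: measurable_indic; exact: measurable_itv.
- exact: (@integrableZl _ _ _ leb1 _ (measurable_itv `[(0:R), +oo[) C _ ib).
- near=> k => r /=; rewrite in_itv/= andbT => r0; rewrite /u indicE mem_setE in_itv/=.
  case: (leP r (sk k * x0)) => h; last by rewrite mulr0 normr0 mulr_ge0 ?expR_ge0.
  rewrite mulr1.
  rewrite ger0_norm ?mulr_ge0 ?expR_ge0//.
  have hk : forall t, 0 <= t -> t <= sk k * x0 -> `|hh k t| <= C * expR (- (t / 2)) by near: k.
  have -> : C * expR (- (4^-1 * r)) = C * expR (- (r / 2)) * expR (r / 4).
    by rewrite -mulrA -expRD; congr (_ * expR _); field.
  by rewrite ler_wpM2r ?expR_ge0// hk.
- apply: nearW => r /=; rewrite in_itv/= andbT => r0.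
  have ch : `|hh k r| * expR (r / 4) @[k --> \oo] --> `|expR (- (2 * r)) * ((8 * pi)^-1 * 0)| * expR (r / 4).
    apply: cvgMl; apply: cvg_norm; under eq_fun do rewrite /hh kk_exp.
    by apply: cvgMr; apply: cvgMr; exact: fVk_cvg0.
  rewrite !mulr0 normr0 mul0r in ch.
  apply: norm_squeeze0 ch => k; rewrite /u indicE.
  have h0 : 0 <= `|hh k r| * expR (r / 4) by rewrite mulr_ge0 ?expR_ge0.
  by rewrite normrM (ger0_norm h0) ger0_norm// ler_piMr// lern1 leq_b1.
Unshelve. all: by end_near. Qed.

Lemma epsk_ge0 k : 0 <= epsk k.
Proof. by apply: Rintegral_ge0 => r _; rewrite mulr_ge0 ?expR_ge0. Qed.

Lemma HH_start k t : 0 <= t -> t <= sk k * x0 ->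
  `|HH k t - HH k (sk k * x0)| <= expR (- (t / 4)) * epsk k.
Proof.
move=> t0 tx; rewrite -HH_seg//.
have ch := @hh_cont k; have cn : continuous (fun r => `|hh k r|) by move=> r; apply: cvg_norm; exact: ch.
have ce : continuous (fun r : R => expR (r / 4)).
  move=> r; apply: (@continuous_comp R R R (fun r : R => r / 4) (@expR R)); last exact: continuous_expR.
  by apply: cvgMl; exact: cvg_id.
have cne : continuous (fun r : R => `|hh k r| * expR (r / 4)) by move=> r; apply: cvgM; [exact: cn|exact: ce].
have i1 a b : leb1.-integrable `[a, b] (EFin \o hh k) by exact: integrable_continuous.
have i2 a b : leb1.-integrable `[a, b] (EFin \o (fun r => `|hh k r| * expR (r / 4))) by exact: integrable_continuous.
apply: le_trans (@le_normr_Rintegral _ _ _ leb1 _ _ (measurable_itv _) (i1 _ _)) _.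
apply: (@le_trans _ _ (expR (- (t / 4)) * Rintegral leb1 `[t, sk k * x0] (fun r => `|hh k r| * expR (r / 4)))).
  rewrite -RintegralZl//; apply: le_Rintegral => //.
  - exact: integrable_continuous.
  - exact: (@integrableZl _ _ _ leb1 _ (measurable_itv _) (expR (- (t / 4))) _ (i2 _ _)).
  - move=> r /=; rewrite in_itv/= => /andP[tr _].
    rewrite mulrCA -[leLHS]mulr1 ler_wpM2l// -expRD.
    apply: (le_trans _ (expR_ge1Dx _)); rewrite lerDl addrC subr_ge0.
    by rewrite ler_pM2r ?invr_gt0.
rewrite ler_wpM2l ?expR_ge0// /epsk (Rintegral_itv_split cne t0 tx) lerDr.
by apply: Rintegral_ge0 => r _; rewrite mulr_ge0 ?expR_ge0.
Qed.

(** The slope is constant on the first piece, so the difference at s x is a, its value at s x0,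
    corrected by the mass in between. Squaring brings out a factor s, but exp(- s x / 2) has an
    integral of at most 2 / s. *)
Lemma start_bound k x (a := rk k * sgk k 0 - rk k * HH k (sk k * x0)) : good k ->
  sk k * x0 < tauk k 1 -> 0 <= x -> x <= x0 ->
  (rk k * wsum (pk k) (sk k * x) - rk k * HH k (sk k * x)) ^+ 2 <=
    2 * a ^+ 2 + 2 * epsk k ^+ 2 * (sk k * expR (- (sk k * x / 2))).
Proof.
move=> gk h1 hx hx0; have k0 := sk_gt0 k.
have sx : sk k * x <= sk k * x0 by exact: (ler_wpM2l (ltW k0)).
have sx0 : 0 <= sk k * x by exact: mulr_ge0 (ltW k0) hx.
have -> : wsum (pk k) (sk k * x) = sgk k 0.
  exact: (@wkE k 0 _ gk (leq0n m) sx0 (fun _ => le_lt_trans sx h1)).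
pose b := HH k (sk k * x) - HH k (sk k * x0).
have hb : `|b| <= expR (- (sk k * x / 4)) * epsk k := HH_start sx0 sx.
have -> : rk k * sgk k 0 - rk k * HH k (sk k * x) = a - rk k * b.
  by rewrite /a /b [rk k * (_ - _)]mulrBr opprB addrA subrK.
have b2 : b ^+ 2 <= expR (- (sk k * x / 2)) * epsk k ^+ 2.
  have -> : expR (- (sk k * x / 2)) = expR (- (sk k * x / 4)) ^+ 2.
    by rewrite -expRM_natl; congr expR; field.
  rewrite -exprMn -(real_normK (num_real b)) lerXn2r ?nnegrE// mulr_ge0 ?expR_ge0//.
  exact: epsk_ge0.
have : sk k * b ^+ 2 <= sk k * (expR (- (sk k * x / 2)) * epsk k ^+ 2) by exact: (ler_wpM2l (ltW k0)).
have : (a - rk k * b) ^+ 2 <= 2 * a ^+ 2 + 2 * (sk k * b ^+ 2).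
  rewrite -rk_sqr -subr_ge0.
  have -> : 2 * a ^+ 2 + 2 * (rk k ^+ 2 * b ^+ 2) - (a - rk k * b) ^+ 2 = (a + rk k * b) ^+ 2 by ring.
  exact: sqr_ge0.
move=> h3 h4; apply: (le_trans h3); rewrite lerD2l.
have -> : 2 * epsk k ^+ 2 * (sk k * expR (- (sk k * x / 2))) =
  2 * (sk k * (expR (- (sk k * x / 2)) * epsk k ^+ 2)) by ring.
by rewrite ler_pM2l.
Qed.

Lemma start_small : exists2 dl : nat -> R, dl @ \oo --> (0 : R) & \forall k \near \oo,
  (\int[leb1]_(x in `[0%R, x0]) ((rk k * wsum (pk k) (sk k * x) - rk k * HH k (sk k * x)) ^+ 2)%:E <= (dl k)%:E)%E.
Proof.
pose a k := rk k * sgk k 0 - rk k * HH k (sk k * x0).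
exists (fun k => 2 * a k ^+ 2 * x0 + 4 * epsk k ^+ 2).
  have ca : a @ \oo --> (0 : R) by rewrite -(subrr (sig 0)); apply: cvgB; [exact: cvg_slope|exact: cvg_x0].
  have -> : (0 : R) = 2 * (0 * 0) * x0 + 4 * (0 * 0) by ring.
  apply: cvgD; [apply: cvgMl; apply: cvgMr|apply: cvgMr]; under eq_fun do rewrite expr2;
    by apply: cvgM => //; exact: cvg_epsk.
near=> k; have gk : good k by near: k; exact: near_good.
have h1 : sk k * x0 < tauk k 1 by near: k; exact: near_x0.
have k0 := sk_gt0 k.
pose G (x : R) := 2 * a k ^+ 2 + 2 * epsk k ^+ 2 * (sk k * expR (- (sk k * x / 2))).
pose F (x : R) := 2 * a k ^+ 2 * x - 4 * epsk k ^+ 2 * expR (- (sk k * x / 2)).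
have ce : continuous (fun x : R => expR (- (sk k * x / 2))).
  move=> x; apply: (@continuous_comp R R R (fun x : R => - (sk k * x / 2)) (@expR R)); last exact: continuous_expR.
  by apply: cvgN; apply: cvgMl; apply: cvgMr; exact: cvg_id.
have cG : continuous G by move=> x; apply: cvgD; [exact: cvg_cst|apply: cvgMr; apply: cvgMr; exact: ce].
have dF x : is_derive x (1 : R) F (G x).
  have d1 : is_derive x (1 : R) (fun x : R => - (sk k / 2 * x)) (- (sk k / 2)).
    by apply: (is_derive_eq (is_deriveN (is_deriveZ (sk k / 2) (is_derive_id x 1)))); rewrite /GRing.scale/= mulr1.
  have d2 := @is_derive1_comp _ expR (fun x : R => - (sk k / 2 * x)) x _ _ (is_derive_expR _) d1.
  have -> : F = fun x => 2 * a k ^+ 2 * x - 4 * epsk k ^+ 2 * expR (- (sk k / 2 * x)).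
    by apply/funext => y; rewrite /F; congr (_ - _ * expR (- _)); rewrite mulrAC.
  apply: (is_derive_eq (is_deriveB (is_deriveZ (2 * a k ^+ 2) (is_derive_id x 1)) (is_deriveZ (4 * epsk k ^+ 2) d2))).
  rewrite /GRing.scale/= /G [sk k * x / 2]mulrAC.
  by field.
have xx := x0_gt0.
apply: (@le_trans _ _ (\int[leb1]_(x in `[0%R, x0]) (G x)%:E)%E).
  apply: ge0_le_integral => //.
  - by move=> x _; rewrite lee_fin sqr_ge0.
  - apply/measurable_EFinP; apply: measurable_funTS; apply: measurable_sqr.
    by apply: measurable_funB; [exact: measurable_wk|exact: measurable_HH].
  - by apply/measurable_EFinP; exact: continuous_measurable1D.
  - by move=> x /=; rewrite in_itv/= => /andP[hx hx0]; rewrite lee_fin; exact: start_bound.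
rewrite (FTC_continuous (ltW xx) cG dF) lee_fin /F !(mulr0, mul0r) oppr0 expR0 mulr1 sub0r opprK.
have : 0 <= 4 * epsk k ^+ 2 * expR (- (sk k * x0 / 2)) by rewrite mulr_ge0 ?expR_ge0// mulr_ge0// sqr_ge0.
by move: (_ * expR _) => q; lra.
Unshelve. all: by end_near. Qed.

Lemma E_small : exists2 dl : nat -> R, dl @ \oo --> (0 : R) & \forall k \near \oo,
  (\int[leb1]_(x in `]0%R, +oo[) ((rk k * (wsum (pk k) (sk k * x) - HH k (sk k * x))) ^+ 2)%:E <= (dl k)%:E)%E.
Proof.
have [d1 c1 h1] := start_small; have [d2 c2 h2] := D_small.
exists (fun k => d1 k + d2 k); first by rewrite -(addr0 0); apply: cvgD.
near=> k.
have i1 : (\int[leb1]_(x in `[0%R, x0]) ((rk k * wsum (pk k) (sk k * x) - rk k * HH k (sk k * x)) ^+ 2)%:E <= (d1 k)%:E)%E by near: k.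
have i2 : (\int[leb1]_(x in `[x0, +oo[) ((rk k * wsum (pk k) (sk k * x) - rk k * HH k (sk k * x)) ^+ 2)%:E <= (d2 k)%:E)%E by near: k.
pose G x := ((rk k * wsum (pk k) (sk k * x) - rk k * HH k (sk k * x)) ^+ 2)%:E.
have mG (D : set R) : measurable D -> measurable_fun setT (G \_ D).
  move=> mD; apply/(measurable_restrictT _ _).1 => //.
  apply/measurable_EFinP; apply: measurable_funTS; apply: measurable_sqr.
  by apply: measurable_funB; [exact: measurable_wk|exact: measurable_HH].
have G0 (D : set R) x : (0 <= (G \_ D) x)%E by rewrite /patch; case: ifP => // _; rewrite lee_fin sqr_ge0.
under eq_integral => x _ do rewrite mulrBr.
rewrite -/G integral_mkcond EFinD.
apply: le_trans (leeD i1 i2).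
rewrite -/G [X in (_ <= X + _)%E]integral_mkcond [X in (_ <= _ + X)%E]integral_mkcond.
rewrite -ge0_integralD//; [|exact: mG|exact: mG].
apply: ge0_le_integral => //; first exact: mG.
  by apply: emeasurable_funD; exact: mG.
move=> x _; have := G0 `[0, x0]%classic x; have := G0 `[x0, +oo[%classic x.
rewrite /patch !mem_setE !in_itv/= !andbT.
have [xp|xp] := ltP 0 x; last by move=> p q; exact: adde_ge0.
rewrite (ltW xp)/=; have [xx|xx] := leP x x0; first by move=> p _; rewrite leeDl.
by rewrite (ltW xx) add0e.
Unshelve. all: by end_near. Qed.

(** * The functions u_k on the disk: J' is small and the integral of F vanishes in the limit *)

Notation sq := (sqint (@leb2 R) B).
Notation ipB := (ip (@leb2 R) B).
Definition uk k : R * R -> R := tsum (pk k).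

Lemma pk_pos k : good k -> all (fun p => 0 < p.2) (pk k).
Proof.
move=> gk; apply/allP => p /mapP[j]; rewrite mem_iota add0n => /andP[_ jm] -> /=.
have [h _] := gk; apply: le_lt_trans (h j jm).
exact: (@tau_mono k 0 j gk (leq0n j) (ltnW jm)).
Qed.

Lemma uk_limit k : good k -> test_limit (uk k) (rfield (wsum (pk k))).
Proof. by move=> gk; apply: tsum_limit; exact: pk_pos. Qed.

Lemma uk_H10 k : good k -> H10 (uk k).
Proof. by move=> gk; have [] := test_limit_H10 (uk_limit gk). Qed.

Lemma tsum_cont (s : seq (R * R)) : all (fun p => 0 < p.2) s -> continuous (tsum s).
Proof.
elim: s => [_|p s IH /= /andP[p0 /IH h]].
  rewrite (_ : tsum [::] = (fun _ : R * R => 0 : R)); first exact: cst_continuous.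
  by apply/funext => x; rewrite /tsum big_nil.
have -> : tsum (p :: s) = fun x => p.1 * trunc p.2 x + tsum s x.
  by apply/funext => x; rewrite /tsum big_cons.
by move=> x; apply: cvgD; [apply: cvgMr; exact: trunc_cont|exact: h].
Qed.

Lemma uk_cont k : good k -> continuous (uk k).
Proof. by move=> gk; apply: tsum_cont; exact: pk_pos. Qed.

Lemma uk_bounded k : good k -> exists M, forall x, B x -> `|uk k x| <= M.
Proof. by move=> gk; apply: continuous_bounded_B; exact: uk_cont. Qed.

Lemma fuk_sq k : good k -> sq (fun x => f (uk k x)).
Proof.
move=> gk; apply: cont_sq => x.
by apply: (@continuous_comp _ _ _ (uk k) f); [exact: uk_cont|exact: cf].
Qed.

Lemma f_divergence k v : good k -> H10 v ->
  (8 * pi)^-1 * ipB (fun x => f (uk k x)) v = ipG (rfield (HH k)) (grad v).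
Proof.
move=> gk Hv.
rewrite -(divergence (expR_gt0 _) (@kk_cont k) (fun r => @kk_small k r gk) Hv).
rewrite -(@ipZl _ _ _ (@leb2 R) B measurable_B _ _ _ (fuk_sq gk) (H10_sq Hv)).
by apply: eq_Rintegral => x _; rewrite f_tsum.
Qed.

Definition Dk k t := wsum (pk k) t - HH k t.

Lemma rfieldB (w h : R -> R) : rfield (fun t => w t - h t) = addG (rfield w) (scaleG (-1) (rfield h)).
Proof. by apply/funext => x; rewrite /rfield /addG /scaleG/=; congr pair; ring. Qed.

Lemma HH_sqG k : good k -> sqG (rfield (HH k)).
Proof.
move=> gk; exact: (Hfield_sqG (expR_gt0 _) (@kk_cont k) (fun r => @kk_small k r gk)).
Qed.

Lemma uk_sqG k : sqG (rfield (wsum (pk k))).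
Proof. exact: rfield_sqG (sqint1_wsum _). Qed.

Lemma dJ_uk k v : good k -> H10 v -> dJ f (uk k) v = ipG (rfield (Dk k)) (grad v).
Proof.
move=> gk Hv; rewrite /dJ (f_divergence gk Hv) rfieldB.
have tv := H10_test_limit Hv; have sv := H10_sqG Hv.
rewrite (ipG_grad (uk_limit gk) tv).
have sH := HH_sqG gk; have sw := uk_sqG k.
rewrite [RHS]ipGC (ipG_addr sw (sqG_scale (-1) sH) sv) (ipG_scaler (-1) sH sv).
by rewrite [ipG (grad v) (rfield (wsum _))]ipGC [ipG (grad v) _]ipGC mulN1r.
Qed.

Lemma Dk_energy k : good k -> (ipG (rfield (Dk k)) (rfield (Dk k)))%:E =
  ((2 * @disc1 R)%:E * \int[leb1]_(t in `]0%R, +oo[) ((rk k * (wsum (pk k) (sk k * t) - HH k (sk k * t))) ^+ 2)%:E)%E.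
Proof.
move=> gk; have sD : sqG (rfield (Dk k)).
  by rewrite /Dk rfieldB; apply: sqG_add (uk_sqG k) (sqG_scale (-1) (HH_sqG gk)).
rewrite (ipG_EFin sD) (rfield_energy (sk_gt0 k))//.
apply: measurable_funB; first exact: measurable_wsum.
apply: continuous_measurable1D.
by apply: (@continuous_is_derive _ (fun t => - hh k t)) => t; exact: is_derive_HH.
Qed.

Lemma dJ_small : exists2 eta : nat -> R, eta @ \oo --> (0 : R) & \forall k \near \oo,
  0 <= eta k /\ forall v, H10 v -> `|dJ f (uk k) v| <= eta k * dnorm v.
Proof.
have [dl cdl hdl] := E_small.
exists (fun k => Num.sqrt (2 * @disc1 R * dl k)).
  have h : 2 * @disc1 R * dl k @[k --> \oo] --> (0 : R).
    by rewrite -(mulr0 (2 * @disc1 R)); apply: cvgMr.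
  by rewrite -(@sqrtr0 R); exact: (continuous_cvg _ (@sqrt_continuous R 0) h).
near=> k; split; first exact: sqrtr_ge0.
move=> v Hv; have gk : good k by near: k; exact: near_good.
rewrite (dJ_uk gk Hv).
have sD : sqG (rfield (Dk k)).
  by rewrite /Dk rfieldB; apply: sqG_add (uk_sqG k) (sqG_scale (-1) (HH_sqG gk)).
apply: le_trans (ipG_CS sD (H10_sqG Hv)) _.
rewrite /dnorm (dirichletE Hv) ler_wpM2r ?sqrtr_ge0// ler_wsqrtr//.
rewrite -lee_fin (Dk_energy gk) [leRHS]EFinM.
apply: lee_wpmul2l; first by rewrite lee_fin mulr_ge0// disc1_ge0.
by near: k.
Unshelve. all: by end_near. Qed.

Lemma dirichlet_uk k : good k -> (dirichlet (uk k))%:E =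
  ((2 * @disc1 R)%:E * \int[leb1]_(t in `]0%R, +oo[) ((rk k * wsum (pk k) (sk k * t)) ^+ 2)%:E)%E.
Proof.
by move=> gk; rewrite (dirichlet_test_limit (uk_limit gk)) (ipG_rfield (sk_gt0 k) (sqint1_wsum _)).
Qed.

Lemma dirichlet_bounded : exists2 D0 : R, 0 <= D0 & \forall k \near \oo, dirichlet (uk k) <= D0.
Proof.
have [C C0 hC] := near_w_bound.
have sub : `]0%R, +oo[ `<=` `[(0:R), +oo[ by move=> x /=; rewrite !in_itv/= !andbT; exact: ltW.
have ig := exp2_integrable C (measurable_itv `]0%R, +oo[) sub.
exists (2 * @disc1 R * Rintegral leb1 `]0, +oo[ (fun x => (C * expR (- x)) ^+ 2)).
  by rewrite mulr_ge0 ?mulr_ge0 ?disc1_ge0//; apply: Rintegral_ge0 => x _; exact: sqr_ge0.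
near=> k; have gk : good k by near: k; exact: near_good.
rewrite -lee_fin (dirichlet_uk gk) [leRHS]EFinM; apply: lee_wpmul2l; first by rewrite lee_fin mulr_ge0// disc1_ge0.
rewrite EFin_Rintegral//; apply: ge0_le_integral => //.
- by move=> x _; rewrite lee_fin sqr_ge0.
- by apply/measurable_EFinP; apply: measurable_funTS; apply: measurable_sqr; exact: measurable_wk.
- exact: (measurable_int leb1 ig).
- move=> x /=; rewrite in_itv/= andbT => xp; rewrite lee_fin.
  have hk : forall x, 0 <= x -> `|rk k * wsum (pk k) (sk k * x)| <= C * expR (- x) by near: k.
  rewrite -(real_normK (num_real (rk k * _))) lerXn2r ?nnegrE ?hk ?(ltW xp)//.
  by rewrite mulr_ge0 ?expR_ge0.
Unshelve. all: by end_near. Qed.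

Lemma uk_ge0 k x : good k -> B x -> 0 <= uk k x.
Proof.
move=> gk /rhoB r1; have [h1 h2] := gk.
rewrite /uk /tsum /pk /pieces big_map big_seq; apply: sumr_ge0 => j; rewrite mem_iota add0n => /andP[_ jm] /=.
rewrite mulr_ge0 ?subr_ge0 ?(ltW (h2 j jm))// truncE oppr_ge0 mulr_le0_ge0 ?invr_ge0//.
have t0 : 0 < tauk k j.+1.
  by apply: le_lt_trans (h1 j jm); exact: (@tau_mono k 0 j gk (leq0n j) (ltnW jm)).
by apply: ln_le0; rewrite ge_max (ltW r1)/= ltW// expR_lt1 oppr_lt0 mulr_gt0.
Qed.

Lemma uk_tt k x : 0 < rho x -> uk k x = Vk k (tt x).
Proof.
move=> r0; apply: eq_bigr => p _; congr (_ * _); rewrite truncE -ln_max_exp.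
by rewrite /tt mulrN opprK mulrCA mulfV// mulr1 lnK.
Qed.

(** Energies and J'(u_k) being bounded, testing with u_k itself bounds the integral of f(u_k) u_k
    from above. By (g2) the primitive is a small multiple of f(t) t for large t; on the remaining
    values it is bounded, and u_k tends to 0 off the origin. *)
Lemma F_small : Rintegral (@leb2 R) B (fun x => primitive f (uk k x)) @[k --> \oo] --> (0 : R).
Proof.
have cF : continuous (primitive f) by apply: continuous_is_derive => x; exact: is_derive_primitive.
have pf0 : primitive f 0 = 0 by rewrite /primitive lexx /Rintegral set_itv1 integral_set1.
have [D0 D00 hD0] := dirichlet_bounded; have [eta ceta heta] := dJ_small.
have p0 := @pi_gt0 R; have cc0 : 0 < 8 * pi :> R by rewrite mulr_gt0.
pose D1 := D0 + Num.sqrt D0.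
have hD1 : \forall k \near \oo, ipB (fun x => f (uk k x)) (uk k) <= 8 * pi * D1.
  near=> k; have gk : good k by near: k; exact: near_good.
  have Hu := uk_H10 gk; have [e0 he] : 0 <= eta k /\ forall v, H10 v -> `|dJ f (uk k) v| <= eta k * dnorm v by near: k.
  have := he _ Hu; rewrite /dJ -(dirichletE Hu) => h.
  have e1 : eta k <= 1 by near: k; exact: (cvgr_le _ ceta).
  have d1 : dirichlet (uk k) <= D0 by near: k.
  have dn : dnorm (uk k) <= Num.sqrt D0 by rewrite /dnorm ler_wsqrtr.
  have h2 : eta k * dnorm (uk k) <= Num.sqrt D0.
    by rewrite -[leRHS]mul1r ler_pM// dnorm_ge0.
  move: h; rewrite ler_norml => /andP[h3 _]; rewrite -ler_pdivrMl// /D1.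
  by move: d1 h2 h3; move: (_^-1 * _) (dirichlet _) (eta k * _) (Num.sqrt _) => q1 q2 q3 q4; lra.
have bdd (g : R -> R) (M : R) : continuous g -> 0 <= M ->
    exists2 c, 0 <= c & forall t, 0 <= t <= M -> `|g t| <= c.
  move=> cg M0; have [c _ hc] := @EVT_max R (fun t => `|g t|) 0 M M0
    (continuous_subspaceT (fun t => cvg_norm (cg t))).
  by exists `|g c| => // t ht; apply: hc; rewrite in_itv.
have [T T0 hT] := positive_at_infinity fg1.
(* On [0, T] the sign of f is not controlled; adding C3 makes f(t) t + C3 nonnegative for all t >=
   0. *)
have [C3 C30 hC3] : exists2 c, 0 <= c & forall t, 0 <= t <= T -> `|f t * t| <= c.
  by apply: (bdd (fun t => f t * t)) (ltW T0) => t; apply: cvgM; [exact: cf|exact: cvg_id].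
have fpos t : T <= t -> 0 < f t * t.
  move=> Tt; have t0 := lt_le_trans T0 Tt; have := hT t Tt; rewrite /gfun.
  rewrite pmulr_lgt0 ?invr_gt0 ?expR_gt0// pmulr_rgt0 ?invr_gt0// => h.
  by rewrite mulr_gt0.
have flow t : 0 <= t -> 0 <= f t * t + C3.
  move=> t0; have [h|h] := leP t T; last by rewrite addr_ge0// ltW// fpos// ltW.
  have := hC3 t; rewrite t0 h => /(_ isT); rewrite ler_norml => /andP[h1 _].
  by rewrite -lerBlDr sub0r.
apply/cvgrPdist_le => e e0.
pose C4 := 8 * pi * D1 + C3 * areaB + 1.
have C40 : 0 < C4.
  by rewrite ltr_wpDl// addr_ge0 ?mulr_ge0 ?areaB_ge0 ?(ltW p0)// addr_ge0 ?sqrtr_ge0.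
pose ep := e / 2 / C4; have ep0 : 0 < ep by rewrite divr_gt0// divr_gt0.
have [G1 _] := fg2; move: G1 => /cvgr0_norm_le /(_ ep ep0)[M1 [_ hM1]].
pose M := Num.max T (`|M1| + 1).
have TM : T <= M by rewrite /M le_max lexx.
have M1M : M1 < M.
  rewrite /M lt_max; apply/orP; right; apply: le_lt_trans (ler_norm M1) _.
  by rewrite ltrDl.
have M0 : 0 <= M by rewrite (le_trans (ltW T0)).
have [CF CF0 hCF] := bdd _ M cF M0.
pose W (t : R) := if t < M then `|primitive f t| else 0.
have key t : 0 <= t -> `|primitive f t| <= ep * (f t * t + C3) + W t.
  move=> t0; rewrite /W; have [h|h] := ltP t M.
    by rewrite lerDr mulr_ge0 ?flow// ltW.
  have ft := fpos _ (le_trans TM h); have := hM1 _ (lt_le_trans M1M h).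
  rewrite normrM normfV (gtr0_norm ft) ler_pdivrMr// => h1.
  by rewrite addr0; apply: le_trans h1 _; rewrite ler_wpM2l ?(ltW ep0)// lerDl.
have mu_ k : good k -> measurable_fun B (uk k).
  by move=> gk; apply: continuous_measurable2D; exact: uk_cont.
have mabsF (k : nat) : good k -> measurable_fun B (fun x => `|primitive f (uk k x)|).
  move=> gk; apply: continuous_measurable2D => x; apply: cvg_norm.
  by apply: (@continuous_comp _ _ _ (uk k) (primitive f)); [exact: uk_cont|exact: cF].
have mW k : good k -> measurable_fun B (fun x => W (uk k x)).
  move=> gk; apply: measurable_if; [|exact: mabsF|exact: measurable_cst].
  by apply: measurable_fun_ltr; [exact: mu_|exact: measurable_cst].
have Wb k x : good k -> B x -> `|W (uk k x)| <= CF.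
  move=> gk Bx; rewrite /W; case: ifPn => h; last by rewrite normr0.
  by rewrite normr_id hCF// (uk_ge0 gk Bx) ltW.
(* Measurability and bounds are available for good k; the value 0 elsewhere gives a sequence to
   which dominated convergence applies. *)
pose w k (x : R * R) := if `[< good k >] then W (uk k x) else 0.
have cW : Rintegral (@leb2 R) B (w k) @[k --> \oo] --> (0 : R).
  have h := @Rintegral_dominated_near _ _ R (@leb2 R) B measurable_B w (fun=> 0) (fun=> CF).
  rewrite {2}/Rintegral integral0 in h; apply: h.
  - move=> k; rewrite /w; case: asboolP => gk; [exact: mW|exact: measurable_cst].
  - exact: measurable_cst.
  - by apply: integrable_cst_fin; [exact: measurable_B|exact: leb2_B_lty].
  - apply: nearW => k x Bx; rewrite /w; case: asboolP => gk; [exact: Wb|by rewrite normr0].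
  - exists ([set 0] `*` [set 0]); split.
    + by apply: measurableX; exact: measurable_set1.
    + by rewrite leb2X; [rewrite lebesgue_measure_set1 mul0e|exact: measurable_set1|exact: measurable_set1].
    + move=> [a b] /= nh; apply: contrapT => nab; apply: nh => Bx.
      have r0 : 0 < rho (a, b).
        rewrite lt_neqAle rho_ge0 andbT eq_sym; apply/eqP => /eqP.
        rewrite /rho/= paddr_eq0 ?sqr_ge0// !sqrf_eq0 => /andP[/eqP a0 /eqP b0].
        by apply: nab; rewrite a0 b0.
      have t0 : 0 <= tt (a, b) by rewrite ltW// tt_gt0//; exact/rhoB.
      have cFV : `|primitive f (Vk k (tt (a, b)))| @[k --> \oo] --> (0 : R).
        rewrite -(normr0 R) -[in X in _ --> X]pf0; apply: cvg_norm.
        exact: (continuous_cvg _ (cF 0) (Vk_cvg0 t0)).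
      apply: norm_squeeze0 cFV => k; rewrite /w; case: asboolP => gk; last by rewrite normr0.
      rewrite /W -(uk_tt k r0); case: ifP => _; rewrite ?normr_id// normr0; exact: normr_ge0.
have e2 : 0 < e / 2 by rewrite divr_gt0.
near=> k; rewrite sub0r normrN; have gk : good k by near: k; exact: near_good.
have hw : Rintegral (@leb2 R) B (w k) <= e / 2 by near: k; exact: (cvgr_le _ cW).
have hI : ipB (fun x => f (uk k x)) (uk k) <= 8 * pi * D1 by near: k.
have ewk : w k = fun x => W (uk k x) by apply/funext => x; rewrite /w asboolT.
have su : sq (uk k) by apply: cont_sq; exact: uk_cont.
have iF : (@leb2 R).-integrable B (EFin \o (fun x => primitive f (uk k x))).
  apply: bounded_B_integrable => x.
  by apply: (@continuous_comp _ _ _ (uk k) (primitive f)); [exact: uk_cont|exact: cF].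
have iA : (@leb2 R).-integrable B (EFin \o (fun x => `|primitive f (uk k x)|)).
  apply: bounded_B_integrable => x; apply: cvg_norm.
  by apply: (@continuous_comp _ _ _ (uk k) (primitive f)); [exact: uk_cont|exact: cF].
have ifu : (@leb2 R).-integrable B (EFin \o (fun x => f (uk k x) * uk k x)).
  exact: (@sqint_mul _ _ _ (@leb2 R) B measurable_B _ _ (fuk_sq gk) su).
have ic : (@leb2 R).-integrable B (EFin \o (fun=> C3)).
  by apply: integrable_cst_fin; [exact: measurable_B|exact: leb2_B_lty].
have ifc : (@leb2 R).-integrable B (EFin \o (fun x => f (uk k x) * uk k x + C3)).
  exact: (@integrableD _ _ _ (@leb2 R) B measurable_B _ _ ifu ic).
have iefc : (@leb2 R).-integrable B (EFin \o (fun x => ep * (f (uk k x) * uk k x + C3))).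
  exact: (@integrableZl _ _ _ (@leb2 R) B measurable_B ep _ ifc).
have iW : (@leb2 R).-integrable B (EFin \o (fun x => W (uk k x))).
  apply: (@le_integrable_real _ _ _ (@leb2 R) B measurable_B _ (fun=> CF)); first exact: mW.
    by apply: integrable_cst_fin; [exact: measurable_B|exact: leb2_B_lty].
  by move=> x Bx; exact: Wb.
apply: le_trans (@le_normr_Rintegral _ _ _ (@leb2 R) B _ measurable_B iF) _.
apply: (@le_trans _ _ (Rintegral (@leb2 R) B (fun x => ep * (f (uk k x) * uk k x + C3) + W (uk k x)))).
  apply: le_Rintegral => //; first exact: measurable_B.
    exact: (@integrableD _ _ _ (@leb2 R) B measurable_B _ _ iefc iW).
  by move=> x Bx; apply: key; exact: uk_ge0.
rewrite (@RintegralD _ _ _ (@leb2 R) B _ _ measurable_B iefc iW).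
rewrite (@RintegralZl _ _ _ (@leb2 R) B _ _ measurable_B ifc).
rewrite (@RintegralD _ _ _ (@leb2 R) B _ _ measurable_B ifu ic).
have -> : Rintegral (@leb2 R) B (fun=> C3) = C3 * areaB.
  by rewrite (@Rintegral_cst _ _ _ (@leb2 R) B measurable_B).
rewrite ewk in hw; have -> : e = e / 2 + e / 2 by field.
apply: lerD => //.
have -> : e / 2 = ep * C4 by rewrite /ep divfK// gt_eqF.
rewrite ler_wpM2l ?(ltW ep0)// /C4; move: hI; rewrite /ip.
by move: (Rintegral _ _ _) (8 * pi * D1) (C3 * areaB) => q1 q2 q3; lra.
Unshelve. all: by end_near. Qed.

End Tower.

(** * Exhaustion of a closed set by finitely many nodes *)

Section Nodes.
Context {R : realType}.
Variable K : set R.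
Hypothesis K0 : forall c, K c -> 0 < c.

Definition islo (q : R) := [set c | [/\ K c, c <= q & forall d, K d -> d <= q -> d <= c]].
Definition ishi (q : R) := [set c | [/\ K c, q <= c & forall d, K d -> q <= d -> c <= d]].

Hypothesis ex_lo : forall q, (exists2 c, K c & c <= q) -> exists c, islo q c.
Hypothesis ex_hi : forall q, (exists2 c, K c & q <= c) -> exists c, ishi q c.

(** The default 0 is intended: with no point of [K] below q, the gap starts at t = 0, that is at the
    boundary r = 1. The filter 0 < y in [nodes] discards this value. *)
Definition lo (q : R) : R := xget 0 (islo q).
Definition hi (q : R) : R := xget 0 (ishi q).

Lemma lo_eq q c : islo q c -> lo q = c.
Proof.
move=> h; have [k1 k2 k3] := h; have [h1 h2 h3] : islo q (lo q) by apply: xgetPex; exists c.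
by apply/eqP; rewrite eq_le k3//= h3.
Qed.

Lemma hi_eq q c : ishi q c -> hi q = c.
Proof.
move=> h; have [k1 k2 k3] := h; have [h1 h2 h3] : ishi q (hi q) by apply: xgetPex; exists c.
by apply/eqP; rewrite eq_le h3//= k3.
Qed.

(* The nodes at stage [n] are the endpoints of the gaps of [K] containing one
   of the first [n] rationals. *)
Definition nodes n : seq R := sort <=%R (undup [seq y <-
  [seq lo (ratr q) | q <- pmap unpickle (iota 0 n)] ++
  [seq hi (ratr q) | q <- pmap unpickle (iota 0 n)] | 0 < y]).
Definition nodeS n (i : nat) : R :=
  if i is j.+1 then Num.sqrt ((2 * pi)^-1 * nth 0 (nodes n) j) else 0.

Lemma nodes_K n y : y \in nodes n -> K y.
Proof.
rewrite mem_sort mem_undup mem_filter mem_cat => /andP[y0 /orP[] /mapP[q _ yE]]; move: y0; rewrite yE.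
  by rewrite /lo; case: xgetP => [z _ []//|_]; rewrite ltxx.
by rewrite /hi; case: xgetP => [z _ []//|_]; rewrite ltxx.
Qed.

Lemma unpickle_iota (q : rat) n : (pickle q < n)%N -> q \in pmap unpickle (iota 0 n).
Proof. by move=> qn; rewrite mem_pmap; apply/mapP; exists (pickle q); rewrite ?mem_iota// pickleK. Qed.

(** A rational strictly between [lo t] and t has the same nearest point of [K] below it, and is
    enumerated at some stage. *)
Lemma near_lo t : ~ K t -> (exists2 c, K c & c <= t) -> \forall n \near \oo, lo t \in nodes n.
Proof.
move=> Kt /ex_lo[c hc]; rewrite (lo_eq hc); have [kc ct hd] := hc.
have ct' : c < t by rewrite lt_neqAle ct andbT; apply/eqP => e; apply: Kt; rewrite -e.
have [q] := rat_in_itvoo ct'; rewrite in_itv/= => /andP[q1 q2].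
near=> n; rewrite mem_sort mem_undup mem_filter K0//= mem_cat; apply/orP; left.
apply/mapP; exists q; first by apply: unpickle_iota; near: n; exact: nbhs_infty_gt.
rewrite (@lo_eq _ c)//; split => //; first exact: ltW.
by move=> d kd dq; apply: hd => //; apply: le_trans dq (ltW q2).
Unshelve. all: by end_near. Qed.

Lemma near_hi t : ~ K t -> (exists2 c, K c & t <= c) -> \forall n \near \oo, hi t \in nodes n.
Proof.
move=> Kt /ex_hi[c hc]; rewrite (hi_eq hc); have [kc ct hd] := hc.
have ct' : t < c by rewrite lt_neqAle ct andbT; apply/eqP => e; apply: Kt; rewrite e.
have [q] := rat_in_itvoo ct'; rewrite in_itv/= => /andP[q1 q2].
near=> n; rewrite mem_sort mem_undup mem_filter K0//= mem_cat; apply/orP; right.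
apply/mapP; exists q; first by apply: unpickle_iota; near: n; exact: nbhs_infty_gt.
rewrite (@hi_eq _ c)//; split => //; first exact: ltW.
by move=> d kd dq; apply: hd => //; apply: le_trans (ltW q1) dq.
Unshelve. all: by end_near. Qed.

Lemma nodes_sorted n : sorted <%R (0 :: nodes n).
Proof.
rewrite /= path_sortedE; last exact: lt_trans.
apply/andP; split; first by apply/allP => y /nodes_K /K0.
by rewrite lt_sorted_uniq_le sort_uniq undup_uniq/= sort_le_sorted.
Qed.

Lemma nodes_ge0 n i : 0 <= nth 0 (nodes n) i.
Proof.
have [h|h] := ltnP i (size (nodes n)); last by rewrite nth_default.
by apply/ltW/K0/(@nodes_K n)/mem_nth.
Qed.

Lemma tn_nodes n i : tn (nodeS n) i = nth 0 (0 :: nodes n) i.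
Proof.
case: i => [|i]; first by rewrite /tn expr0n mulr0.
have p2 : 0 < 2 * pi :> R by rewrite mulr_gt0// pi_gt0.
rewrite /tn /= sqr_sqrtr ?mulrA ?mulfV ?mul1r ?gt_eqF//.
by rewrite mulr_ge0 ?nodes_ge0// invr_ge0 ltW.
Qed.

Lemma nodeS_sqrt n i : nodeS n i = Num.sqrt ((2 * pi)^-1 * tn (nodeS n) i).
Proof. by rewrite tn_nodes; case: i => [|i] //=; rewrite mulr0 sqrtr0. Qed.

Lemma nodes_lt n i j : (i <= size (nodes n))%N -> (j <= size (nodes n))%N ->
  (tn (nodeS n) i < tn (nodeS n) j) = (i < j)%N.
Proof. by move=> hi hj; rewrite !tn_nodes (lt_sorted_ltn_nth _ (nodes_sorted n))//. Qed.

Lemma nodeS_lt n i : (i < size (nodes n))%N -> nodeS n i < nodeS n i.+1.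
Proof.
move=> im; rewrite !nodeS_sqrt ltr_sqrt.
  by rewrite ltr_pM2l ?nodes_lt ?(ltnW im)// invr_gt0 mulr_gt0// pi_gt0.
rewrite tn_nodes/= mulr_gt0//; last by apply/K0/(@nodes_K n)/mem_nth.
by rewrite invr_gt0 mulr_gt0// pi_gt0.
Qed.

Lemma mem_tn n y : y \in nodes n -> exists2 i, (0 < i <= size (nodes n))%N & tn (nodeS n) i = y.
Proof.
move=> yn; exists (index y (nodes n)).+1; first by rewrite /= index_mem.
by rewrite tn_nodes/= nth_index.
Qed.

Lemma tn_K n i : (0 < i <= size (nodes n))%N -> K (tn (nodeS n) i).
Proof. by case: i => [|i]//= im; rewrite tn_nodes/=; apply/(@nodes_K n)/mem_nth. Qed.

Definition above t := `[< exists2 c, K c & t <= c >].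
Definition below t := `[< exists2 c, K c & c <= t >].
Definition nroot (t : R) : R := Num.sqrt ((2 * pi)^-1 * t).
(** The slope of the chord over the gap that contains t. On the last, unbounded gap, which is the
    component of the radii next to 0, the tower is constant. *)
Definition omK t : R := if above t then (nroot (hi t) - nroot (lo t)) / (hi t - lo t) else 0.
Definition WK t : R := nroot (lo t) + omK t * (t - lo t).

Lemma lo_none t : below t = false -> lo t = 0.
Proof.
move=> /asboolP h; rewrite /lo; case: xgetP => // z _ [z1 z2 _]; case: h.
by exists z.
Qed.

Lemma lo_bounds t : 0 < t -> ~ K t -> lo t < t.
Proof.
move=> t0 kt; case: (boolP (below t)) => [/asboolP/ex_lo[c hc]|/negbTE/lo_none -> //].
rewrite (lo_eq hc); have [kc ct _] := hc.
by rewrite lt_neqAle ct andbT; apply/eqP => e; apply: kt; rewrite -e.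
Qed.

Lemma lo_ge0 t : 0 <= lo t.
Proof.
case: (boolP (below t)) => [/asboolP/ex_lo[c hc]|/negbTE/lo_none -> //].
by rewrite (lo_eq hc); have [kc ct _] := hc; exact: ltW (K0 kc).
Qed.

(** Positive nodes belong to [K], so none is interior to the gap of t; once the existing ends of the
    gap are nodes, they are consecutive. *)
Lemma near_piece t : 0 < t -> ~ K t -> \forall n \near \oo,
  exists i, [/\ (i <= size (nodes n))%N, tn (nodeS n) i = lo t, (i < size (nodes n))%N = above t &
    above t -> tn (nodeS n) i.+1 = hi t].
Proof.
move=> t0 kt.
have H1 : \forall n \near \oo, below t -> lo t \in nodes n.
  case: (boolP (below t)) => [/asboolP h|_]; last by near=> n.
  by apply: filterS (near_lo kt h) => n.
have H2 : \forall n \near \oo, above t -> hi t \in nodes n.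
  case: (boolP (above t)) => [/asboolP h|_]; last by near=> n.
  by apply: filterS (near_hi kt h) => n.
near=> n; have h1 : below t -> lo t \in nodes n by near: n.
have h2 : above t -> hi t \in nodes n by near: n.
set m := size (nodes n) in h1 h2 *.
have tnot i : (i <= m)%N -> t != tn (nodeS n) i.
  move=> im; apply/eqP => e; case: i im e => [_|i im] e.
    by move: t0; rewrite e tn_nodes/= ltxx.
  by apply: kt; rewrite e; apply: tn_K.
have [i [im ti tm]] : exists i, [/\ (i <= m)%N, tn (nodeS n) i < t & (i < m)%N -> t < tn (nodeS n) i.+1].
  have [[i [i1 i2 i3]]|h] : (exists i, [/\ (i < m)%N, tn (nodeS n) i < t & t < tn (nodeS n) i.+1]) \/
      tn (nodeS n) m < t.
    by apply: find_piece => // i im; exact: nodeS_lt.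
    by exists i; split => //; exact: ltnW.
  by exists m; split => //; rewrite ltnn.
have jle j : (j <= m)%N -> tn (nodeS n) j <= t -> (j <= i)%N.
  move=> jm jt; rewrite leqNgt; apply/negP => ij.
  have i1 : (i < m)%N by apply: leq_trans ij jm.
  have h : tn (nodeS n) i.+1 <= tn (nodeS n) j by rewrite leNgt nodes_lt// -leqNgt.
  by have := lt_le_trans (tm i1) (le_trans h jt); rewrite ltxx.
have loE : tn (nodeS n) i = lo t.
  apply/eqP; rewrite eq_le; apply/andP; split.
    case: i im ti {tm jle} => [|i] im ti; first by rewrite tn_nodes/= lo_ge0.
    have kk : K (tn (nodeS n) i.+1) by apply: tn_K.
    have [|c hc] := @ex_lo t; first by exists (tn (nodeS n) i.+1) => //; exact: ltW.
    by rewrite (lo_eq hc); have [_ _ ->//] := hc; exact: ltW.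
  case: (boolP (below t)) => [bt|/negbTE/lo_none ->].
    have [j /andP[j0 jm] jE] := mem_tn (h1 bt).
    have jt : tn (nodeS n) j <= t by rewrite jE ltW// lo_bounds.
    by rewrite -jE leNgt nodes_lt// -leqNgt jle.
  by rewrite tn_nodes; case: (i) => //= i'; exact: nodes_ge0.
have ab : above t -> exists2 j, (0 < j <= m)%N & tn (nodeS n) j = hi t /\ t < hi t.
  move=> at_; have [j jm jE] := mem_tn (h2 at_); exists j => //; split => //.
  move/asboolP/ex_hi : at_ => [c hc]; rewrite (hi_eq hc); have [kc ct _] := hc.
  by rewrite lt_neqAle ct andbT; apply/eqP => e; apply: kt; rewrite e.
have aE : (i < m)%N = above t.
  apply/idP/idP => [im1|/ab [j /andP[j0 jm] [jE jt]]].
    by apply/asboolP; exists (tn (nodeS n) i.+1); [exact: tn_K|exact/ltW/tm].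
  apply: leq_trans jm; have h : tn (nodeS n) i < tn (nodeS n) j by rewrite jE (lt_trans ti).
  rewrite ltnNge; apply/negP => ji; move: h; apply/negP; rewrite -leNgt !tn_nodes.
  by rewrite (lt_sorted_leq_nth _ (nodes_sorted n)) ?inE//= ltnS (leq_trans ji).
exists i; split => // at_; have [j /andP[j0 jm] [jE jt]] := ab at_.
have im1 : (i < m)%N by rewrite aE.
apply/eqP; rewrite eq_le; apply/andP; split.
  by rewrite -jE leNgt nodes_lt// -leqNgt -(@nodes_lt n)// jE (lt_trans ti).
have [c hc] : exists c, ishi t c by apply: ex_hi; exact/asboolP.
rewrite (hi_eq hc); have [_ _ ->//] := hc; first exact: tn_K.
exact/ltW/tm.
Unshelve. all: by end_near. Qed.

Definition nlist n := pieces (tn (nodeS n)) (sig (nodeS n) (size (nodes n))) (size (nodes n)).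

(** Once the gap of t is a piece of the finite tower, both towers are the same chord there:
    convergence off [K] is eventual equality. *)
Lemma near_exact t : 0 < t -> ~ K t -> \forall n \near \oo,
  wsum (nlist n) t = omK t /\ minsum (nlist n) t = WK t.
Proof.
move=> t0 kt; have := near_piece t0 kt; apply: filterS => n [i [im loE aE hiE]].
set m := size (nodes n) in im aE *.
have lot := lo_bounds t0 kt.
have tm : (i < m)%N -> t < tn (nodeS n) i.+1.
  rewrite aE => at_; rewrite hiE//; move/asboolP/ex_hi : at_ => [c hc]; rewrite (hi_eq hc).
  have [kc ct _] := hc.
  by rewrite lt_neqAle ct andbT; apply/eqP => e; apply: kt; rewrite e.
have sE : sig (nodeS n) m i = omK t.
  by rewrite /sig /omK aE; case: ifPn => // h; rewrite !nodeS_sqrt hiE// loE.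
have ti : tn (nodeS n) i <= t by rewrite loE ltW.
have lt' j : (j < m)%N -> nodeS n j < nodeS n j.+1 by exact: nodeS_lt.
split; first by rewrite -sE; apply: om_E.
have tl j : (j < m)%N -> tn (nodeS n) j < tn (nodeS n) j.+1.
  by move=> jm; rewrite nodes_lt ?(ltnW jm).
have smm : sig (nodeS n) m m = 0 by rewrite /sig ltnn.
have e : minsum (nlist n) t + sig (nodeS n) m m * t =
    nodeS n i + sig (nodeS n) m i * (t - tn (nodeS n) i).
  apply: minsum_pieces => //.
  - by rewrite tn_nodes.
  - by move=> j jm; exact: ltW (tl j jm).
  - move=> j jm; rewrite /sig jm divfK; first by rewrite addrC subrK.
    by rewrite subr_eq0 gt_eqF// tl.
  - by move=> im'; apply/ltW/tm.
by move: e; rewrite smm mul0r addr0 sE nodeS_sqrt loE.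
Qed.

Hypothesis Kne : K !=set0.
Variables (k0 k1 : R).
Hypothesis k0_gt0 : 0 < k0.
Hypothesis Kk0 : forall c, K c -> k0 <= c <= k1.

Lemma near_size : \forall n \near \oo, (0 < size (nodes n))%N.
Proof.
have [c kc] := Kne; have cp := K0 kc.
have nk : ~ K (k1 + 1) by move/Kk0 => /andP[_]; rewrite gerDl ler10.
have : \forall n \near \oo, lo (k1 + 1) \in nodes n.
  apply: near_lo => //; exists c => //; have /andP[_ h] := Kk0 kc.
  by rewrite (le_trans h)// lerDl.
by apply: filterS => n; case: (nodes n).
Qed.

Lemma nodeS_bound n i : (0 < i <= size (nodes n))%N -> nroot k0 <= nodeS n i <= nroot k1.
Proof.
move=> im; have /andP[h1 h2] := Kk0 (tn_K im).
have p2 : 0 <= (2 * pi)^-1 :> R by rewrite invr_ge0 mulr_ge0// pi_ge0.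
by rewrite nodeS_sqrt /nroot !ler_wsqrtr// ler_wpM2l.
Qed.

(** The slopes decrease, and the first one is the inverse of 2 pi times the height of the first
    node, which is at least nroot k0. The bound does not depend on n. *)
Lemma wsum_nlist n t : 0 <= t -> 0 <= wsum (nlist n) t <= (2 * pi * nroot k0)^-1.
Proof.
move=> t0; set m := size (nodes n).
have lt' j : (j < m)%N -> nodeS n j < nodeS n j.+1 by exact: nodeS_lt.
have r0 : 0 < nroot k0 by rewrite sqrtr_gt0 mulr_gt0// invr_gt0 mulr_gt0// pi_gt0.
have C0 : 0 <= (2 * pi * nroot k0)^-1 by rewrite invr_ge0 !mulr_ge0 ?pi_ge0 ?(ltW r0).
have [m0|m0] := posnP m.
  by rewrite /nlist -/m m0 /wsum /pieces big_nil lexx C0.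
have := @wsum_bound _ (tn (nodeS n)) (sig (nodeS n) m) m t _ t0.
have om0 : wsum (pieces (tn (nodeS n)) (sig (nodeS n) m) m) 0 = sig (nodeS n) m 0.
  apply: om_E => //; first by rewrite tn_nodes.
  by move=> _; exact: K0 (@tn_K n 1 m0).
rewrite om0; have sd j : (j < m)%N -> sig (nodeS n) m j.+1 <= sig (nodeS n) m j.
  by move=> jm; apply/ltW/sig_dec.
move=> /(_ sd) => /andP[-> h]/=; apply: le_trans h _.
rewrite sigE// /= addr0 lef_pV2 ?posrE.
- by rewrite ler_wpM2l ?mulr_ge0 ?pi_ge0//; have /andP[] := @nodeS_bound n 1 m0.
- by have /andP[h _] := @nodeS_bound n 1 m0; rewrite !mulr_gt0 ?pi_gt0// (lt_le_trans r0 h).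
- by rewrite !mulr_gt0 ?pi_gt0.
Qed.

Lemma wsum_nlist_tail n t : k1 < t -> wsum (nlist n) t = 0.
Proof.
move=> h; rewrite /wsum big_seq big1// => p /mapP[j]; rewrite mem_iota/= add0n => jm ->/=.
have /andP[_ h1] := Kk0 (@tn_K n j.+1 jm).
by rewrite ltNge (ltW (le_lt_trans h1 h)) mulr0.
Qed.

Lemma minsum_nlist n t : 0 <= t -> 0 <= minsum (nlist n) t <= nroot k1.
Proof.
move=> t0; set m := size (nodes n).
have lt' j : (j < m)%N -> nodeS n j < nodeS n j.+1 by exact: nodeS_lt.
have tl j : (j < m)%N -> tn (nodeS n) j < tn (nodeS n) j.+1.
  by move=> jm; rewrite nodes_lt ?(ltnW jm).
have [m0|m0] := posnP m.
  by rewrite /nlist -/m m0 /minsum /pieces big_nil lexx sqrtr_ge0.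
have P p : p \in nlist n -> 0 <= p.1 /\ 0 < p.2.
  move=> /mapP[j]; rewrite mem_iota/= add0n => jm ->/=; split.
    by rewrite subr_ge0; apply/ltW/sig_dec.
  exact: (K0 (@tn_K n j.+1 jm)).
apply/andP; split.
  rewrite /minsum big_seq sumr_ge0// => p /P[p1 p2].
  by rewrite mulr_ge0// le_min t0 ltW.
have mono x y : x <= y -> minsum (nlist n) x <= minsum (nlist n) y.
  move=> xy; rewrite /minsum big_seq [leRHS]big_seq ler_sum// => p /P[p1 p2].
  by rewrite ler_wpM2l// le_min !ge_min xy lexx orbT.
pose y := Num.max t (tn (nodeS n) m).
apply: le_trans (mono t y _) _; first by rewrite le_max lexx.
have smm : sig (nodeS n) m m = 0 by rewrite /sig ltnn.
have e : minsum (nlist n) y + sig (nodeS n) m m * y =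
    nodeS n m + sig (nodeS n) m m * (y - tn (nodeS n) m).
  apply: minsum_pieces => //.
  - by rewrite tn_nodes.
  - by move=> j jm; exact: ltW (tl j jm).
  - move=> j jm; rewrite /sig jm divfK; first by rewrite addrC subrK.
    by rewrite subr_eq0 gt_eqF// tl.
  - by rewrite le_max lexx orbT.
  - by rewrite ltnn.
move: e; rewrite smm !mul0r !addr0 => ->.
have /andP[_ //] : nroot k0 <= nodeS n m <= nroot k1.
by apply: nodeS_bound; rewrite m0/=.
Qed.

End Nodes.

(** * Null sets in the logarithmic variable, and rescaled profiles *)

Section NullSets.
Context {R : realType}.
Notation leb1 := (@lebesgue_measure R).

(** The map - ln sends dr / r on the half-line to dt, so the measure sought is the integral of 1 / r
    over the positive part of [C]. *)
Lemma null_exp (C : set R) : measurable C -> leb1 C = 0%E ->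
  leb1 ((fun t => expR (- t)) @^-1` C) = 0%E.
Proof.
move=> mC C0; pose K := (fun t : R => expR (- t)) @^-1` C.
have mexp : measurable_fun setT (fun t : R => expR (- t)) by apply: measurableT_comp.
have mK : measurable K by rewrite -[K]setTI; exact: mexp.
pose p (r : R) := - ln r; pose w (r : R) := r^-1 * \1_(`]0%R, +oo[) r.
have mw : measurable_fun setT w.
  by apply: measurable_funM; [exact: measurable_inv|exact: measurable_indic].
have w0 r : 0 <= w r.
  rewrite /w indicE; case: (boolP (r \in _)) => [|_]; last by rewrite mulr0.
  by rewrite inE/= in_itv/= andbT => r0; rewrite mulr1 invr_ge0 ltW.
have mp : measurable_fun setT p by apply: measurable_funN.
have mq : measurable_fun setT (\1_K : R -> R) by exact: measurable_indic.
have q0 t : 0 <= (\1_K : R -> R) t by rewrite indicE.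
have := @transfer _ _ R leb1 w p (fun=> 1) mw w0 mp (measurable_cst _) (fun=> ler01).
move=> /(_ _ (\1_K) mq q0); set H := (X in (X -> _) -> _) => h.
have {}h : (\int[leb1]_r (\1_K (p r) * w r)%:E = \int[leb1]_t (\1_K t * 1)%:E)%E.
  apply: h => a b ab.
  have sE (x y : R) : 0 < y -> (x < p y) = (y < expR (- x)).
    by move=> y0; rewrite -[in RHS](lnK y0) ltr_expR /p ltrNr.
  have pE : p @^-1` `]a, b] `&` `]0, +oo[ = `[expR (- b), expR (- a)[%classic.
    apply/seteqP; split => y /=; rewrite !in_itv/= ?andbT.
      by move=> [/andP[h1 h2] y0]; rewrite -sE// h1 andbT leNgt -sE// -leNgt.
    move=> /andP[h1 h2]; have y0 : 0 < y by rewrite (lt_le_trans (expR_gt0 _) h1).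
    by split => //; rewrite sE// h2 leNgt sE// -leNgt h1.
  have -> : (\int[leb1]_(x in p @^-1` `]a, b]) (w x)%:E = (b - a)%:E)%E.
    transitivity (\int[leb1]_(x in (p @^-1` `]a, b]) `&` `]0%R, +oo[) (x^-1)%:E)%E.
      rewrite [LHS]integral_mkcond [RHS]integral_mkcond; apply: eq_integral => x _.
      rewrite /patch in_setI /w indicE; case: (x \in p @^-1` _) => //=.
      by case: ifPn => _; rewrite ?mulr0 ?mulr1.
    rewrite pE integral_itv_bndo_bndc; last first.
      by apply/measurable_EFinP; apply: measurable_funTS; exact: measurable_inv.
    rewrite ln_inv_integral ?expR_gt0// ?expRK.
      by congr (_%:E); rewrite opprK addrC.
    by rewrite ltr_expR ltrN2.
  rewrite integral_cst//= lebesgue_measure_itv/= lte_fin ab -EFinB mul1e.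
  by split=> //; exact: ltry.
have e1 : (\int[leb1]_t (\1_K t * 1)%:E = leb1 K)%E.
  rewrite -[K in RHS]setIT -integral_indic//; apply: eq_integral => t _.
  by rewrite mulr1.
rewrite -/K -e1 -h.
have mg : measurable_fun setT (fun r => (\1_K (p r) * w r)%:E).
  by apply/measurable_EFinP; apply: measurable_funM => //; exact: measurableT_comp mq mp.
transitivity (\int[leb1]_(r in C) (\1_K (p r) * w r)%:E)%E; last first.
  by apply: null_set_integral => //; exact: measurable_funTS.
rewrite [RHS]integral_mkcond; apply: eq_integral => r _; rewrite /patch.
case: ifPn => // rC; congr (_%:E); rewrite /w indicE [X in _ * (_ * X)]indicE.
case: (boolP (r \in `]0, +oo[%classic)) => [|_]; last by rewrite !mulr0.
rewrite inE/= in_itv/= andbT => r0; rewrite (_ : (p r \in K) = false) ?mul0r//.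
by apply: contraNF rC; rewrite !inE /K/= /p opprK lnK.
Qed.

(** By polar coordinates the indicator of [N] at tt x / s, weighted by 1 / rho, has integral 0, and
    the weight is positive off the origin. *)
Lemma ae_tt (N : set R) (s : R) : 0 < s -> measurable N -> leb1 N = 0%E ->
  {ae (@leb2 R), forall x, B x -> [/\ 0 < rho x, 0 < tt x / s & ~ N (tt x / s)]}.
Proof.
move=> s0 mN N0.
have mq : measurable_fun setT (\1_N : R -> R) by exact: measurable_indic.
have q0 t : 0 <= (\1_N : R -> R) t by rewrite indicE.
have m1 : measurable_fun setT (fun x : R * R => (rho x)^-1).
  by apply: (measurableT_comp measurable_inv); exact: measurable_rho.
have m2 : measurable_fun setT (fun x : R * R => (\1_N : R -> R) (tt x / s)).
  by apply: (measurableT_comp mq); apply: measurable_funM => //; exact: measurable_tt.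
have mg : measurable_fun B (fun x : R * R => (\1_N (tt x / s) / rho x)%:E).
  by apply/measurable_EFinP; apply: measurable_funTS; apply: measurable_funM.
have [+ _] := @ae_eq_integral_abs _ _ _ (@leb2 R) B measurable_B _ mg.
have -> : (\int[@leb2 R]_(x in B) `|(\1_N (tt x / s) / rho x)%:E| = 0)%E.
  transitivity (\int[@leb2 R]_(x in B) (\1_N (tt x / s) / rho x)%:E)%E.
    by apply: eq_integral => x _; rewrite gee0_abs// lee_fin divr_ge0// rho_ge0.
  rewrite (polar s0 mq q0) integral_indic//.
  rewrite [X in (_ * X)%E](_ : _ = 0%E) ?mule0//; apply/eqP; rewrite eq_le measure_ge0 andbT -N0.
  apply: le_measure; rewrite ?inE//; apply: measurableI => //; exact: measurable_itv.
move=> /(_ erefl) A1.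
have A2 : (@leb2 R).-negligible [set (0, 0)].
  exists [set (0, 0)]; split => //; first by rewrite (_ : [set (0, 0)] = [set 0] `*` [set 0])//; [exact: measurableX|
    by apply/seteqP; split => [[a b] [-> ->]|[a b] [/= -> ->]]].
  rewrite (_ : [set (0, 0)] = [set 0] `*` [set 0]); last first.
    by apply/seteqP; split => [[a b] [-> ->]|[a b] [/= -> ->]].
  by rewrite leb2X//; rewrite [X in (X * _)%E]lebesgue_measure_set1 mul0e.
apply: negligibleS (negligibleU A1 A2) => x /= hx.
have [x0|x0] := eqVneq (rho x) 0.
  right; case: x x0 {hx} => a b; rewrite /rho/= => /eqP.
  by rewrite paddr_eq0 ?sqr_ge0// !sqrf_eq0 => /andP[/eqP -> /eqP ->].
left => h; apply: hx => Bx; have r0 : 0 < rho x by rewrite lt_neqAle eq_sym x0 rho_ge0.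
split => //; first by rewrite divr_gt0// tt_gt0//; apply/rhoB.
move=> Nx; have := h Bx; rewrite indicE mem_set//= mul1r => -[/eqP].
by rewrite invr_eq0 (negbTE x0).
Qed.

Lemma tsum_tt (l : seq (R * R)) (x : R * R) : 0 < rho x -> tsum l x = minsum l (tt x).
Proof.
move=> r0; apply: eq_bigr => p _; congr (_ * _); rewrite truncE -ln_max_exp.
by rewrite /tt mulrN opprK mulrCA mulfV// mulr1 lnK.
Qed.

(** The dilation on lists: sqrt(s) p min(t / s, b) = (p / sqrt(s)) min(t, s b). *)
Definition rescale (s : R) (l : seq (R * R)) : seq (R * R) :=
  [seq (p.1 / Num.sqrt s, s * p.2) | p <- l].

Lemma rescale_pos s l : 0 < s -> all (fun p => 0 < p.2) l -> all (fun p => 0 < p.2) (rescale s l).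
Proof.
move=> s0 /allP h; apply/allP => _ /mapP[p pl ->] /=; rewrite mulr_gt0//; exact: h.
Qed.

Lemma wsum_rescale s l t : 0 < s -> wsum (rescale s l) t = (Num.sqrt s)^-1 * wsum l (t / s).
Proof.
move=> s0; rewrite /wsum big_map mulr_sumr; apply: eq_bigr => p _ /=.
by rewrite ltr_pdivrMr// [p.2 * s]mulrC; case: ifP => _; rewrite ?mulr0// !mulr1 mulrC.
Qed.

Lemma minsum_rescale s l t : 0 < s -> minsum (rescale s l) t = Num.sqrt s * minsum l (t / s).
Proof.
move=> s0; rewrite /minsum big_map mulr_sumr; apply: eq_bigr => p _ /=.
have -> : Num.min t (s * p.2) = s * Num.min (t / s) p.2.
  by rewrite minr_pMr ?(ltW s0)// mulrCA mulfV ?mulr1// gt_eqF.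
have := sqr_sqrtr (ltW s0); have : 0 < Num.sqrt s by rewrite sqrtr_gt0.
by move: (Num.sqrt s) (Num.min _ _) => r u r0 <-; field; rewrite gt_eqF.
Qed.

Lemma rescale_energy (s : R) (h : R -> R) : 0 < s -> measurable_fun setT h ->
  let G := rfield (fun t => (Num.sqrt s)^-1 * h (t / s)) in
  (\int[@leb2 R]_(x in B) (fst_grad G x ^+ 2 + snd_grad G x ^+ 2)%:E =
   (2 * @disc1 R)%:E * \int[leb1]_(t in `]0%R, +oo[) (h t ^+ 2)%:E)%E.
Proof.
move=> s0 mh G; rewrite /G (rfield_energy s0); last first.
  apply: measurable_funM => //; apply: (measurableT_comp mh).
  by apply: measurable_funM.
congr (_ * _)%E; apply: eq_integral => t _; congr ((_ ^+ 2)%:E).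
by rewrite mulrA mulfV ?mul1r ?gt_eqF ?sqrtr_gt0// mulrAC mulfV ?mul1r// gt_eqF.
Qed.

End NullSets.

(** * The full tower as a limit in H^1_0 of finite ones *)

Section TowerLimit.
Context {R : realType}.
Notation leb1 := (@lebesgue_measure R).
Notation sq := (sqint (@leb2 R) B).
Notation ipB := (ip (@leb2 R) B).
Notation cvgLB := (cvgL2 (@leb2 R) B).
Variable K : set R.
Hypothesis ex_lo : forall q, (exists2 c, K c & c <= q) -> exists c, islo K q c.
Hypothesis ex_hi : forall q, (exists2 c, K c & q <= c) -> exists c, ishi K q c.
Hypothesis Kne : K !=set0.
Variables (k0 k1 : R).
Hypothesis k0_gt0 : 0 < k0.
Hypothesis Kk0 : forall c, K c -> k0 <= c <= k1.
Hypothesis mK : measurable K.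
Hypothesis nK : leb1 K = 0%E.

Lemma K0 c : K c -> 0 < c.
Proof. by move=> /Kk0 /andP[h _]; exact: lt_le_trans h. Qed.

(** The formulas for [omK] and [WK] are meant on the gaps of [K]. Cutting them off elsewhere makes
    the finite towers converge at every t, which also yields measurability of the limits. *)
Definition ind (t : R) : R := \1_(`]0, +oo[ `\` K) t.
Definition omL t := ind t * omK K t.
Definition WL t := ind t * WK K t.

Lemma ind1 t : 0 < t -> ~ K t -> ind t = 1.
Proof. by move=> t0 kt; rewrite /ind indicE mem_set//=; split => //=; rewrite in_itv/= t0. Qed.

Lemma ind0 t : ~ (0 < t /\ ~ K t) -> ind t = 0.
Proof.
move=> h; rewrite /ind indicE memNset// => -[/= h1 h2]; apply: h; split => //.
by move: h1; rewrite in_itv/= andbT.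
Qed.

Lemma measurable_ind : measurable_fun setT ind.
Proof. by apply: measurable_indic; apply: measurableD => //; exact: measurable_itv. Qed.

Lemma near_wL t : \forall n \near \oo, ind t * wsum (nlist K n) t = omL t /\
  ind t * minsum (nlist K n) t = WL t.
Proof.
case: (pselect (0 < t /\ ~ K t)) => [[t0 kt]|h].
  apply: filterS (near_exact K0 ex_lo ex_hi t0 kt) => n [e1 e2].
  by rewrite /omL /WL e1 e2.
by near=> n; rewrite /omL /WL ind0// !mul0r.
Unshelve. all: by end_near. Qed.

Lemma cvg_wL t : ind t * wsum (nlist K n) t @[n --> \oo] --> omL t.
Proof.
apply: (seq_near_cvg _ (cvg_cst _)); apply: filterS (near_wL t) => n [-> _] //.
Qed.

Lemma cvg_mL t : ind t * minsum (nlist K n) t @[n --> \oo] --> WL t.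
Proof.
apply: (seq_near_cvg _ (cvg_cst _)); apply: filterS (near_wL t) => n [_ ->] //.
Qed.

Lemma measurable_minsum (l : seq (R * R)) : measurable_fun setT (minsum l).
Proof.
by apply: measurable_sum => p; apply: measurable_funM => //; exact: measurable_minr.
Qed.

Lemma measurable_omL : measurable_fun setT omL.
Proof.
apply: (measurable_fun_cvg _ (fun t _ => @cvg_wL t)) => n.
by apply: measurable_funM; [exact: measurable_ind|exact: measurable_wsum].
Qed.

Lemma measurable_WL : measurable_fun setT WL.
Proof.
apply: (measurable_fun_cvg _ (fun t _ => @cvg_mL t)) => n.
by apply: measurable_funM; [exact: measurable_ind|exact: measurable_minsum].
Qed.

Definition CW := (2 * pi * nroot k0)^-1.

Lemma CW_ge0 : 0 <= CW.
Proof. by rewrite /CW invr_ge0 !mulr_ge0 ?pi_ge0 ?sqrtr_ge0. Qed.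

Lemma wsum_exp n t : 0 <= t -> `|wsum (nlist K n) t| <= CW * expR k1 * expR (- t).
Proof.
move=> t0; have /andP[h1 h2] := wsum_nlist K0 k0_gt0 Kk0 n t0.
have [h|h] := leP t k1; last first.
  by rewrite (wsum_nlist_tail K0 Kk0)// normr0 !mulr_ge0 ?expR_ge0 ?CW_ge0.
by rewrite ger0_norm//; apply: exp_bound_left => //; exact: CW_ge0.
Qed.

Lemma omL_exp t : 0 <= t -> `|omL t| <= CW * expR k1 * expR (- t).
Proof.
move=> t0; have [n [<- _]] := filter_ex (near_wL t).
rewrite normrM; apply: le_trans (wsum_exp n t0).
by rewrite ler_piMl// /ind indicE; case: (_ \in _); rewrite ?normr1 ?normr0.
Qed.

Lemma omL_bound t : 0 <= t -> `|omL t| <= CW /\ (k1 < t -> omL t = 0).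
Proof.
move=> t0; have [n [<- _]] := filter_ex (near_wL t).
have /andP[h1 h2] := wsum_nlist K0 k0_gt0 Kk0 n t0.
split; last by move=> h; rewrite (wsum_nlist_tail K0 Kk0)// mulr0.
rewrite normrM [X in _ * X]ger0_norm//; apply: le_trans h2.
by rewrite ler_piMl// /ind indicE; case: (_ \in _); rewrite ?normr1 ?normr0.
Qed.

Lemma WL_bound t : `|WL t| <= nroot k1.
Proof.
have [n [_ <-]] := filter_ex (near_wL t).
case: (pselect (0 < t /\ ~ K t)) => [[t0 kt]|h']; last by rewrite ind0// mul0r normr0 sqrtr_ge0.
have /andP[h1 h2] := minsum_nlist K0 Kk0 n (ltW t0).
by rewrite ind1// mul1r ger0_norm.
Qed.

Lemma ae_K (P : R -> Prop) : (forall t, 0 < t -> ~ K t -> P t) ->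
  {ae leb1, forall t, `]0, +oo[%classic t -> P t}.
Proof.
move=> h; exists K; split => // t /= ht; apply: contrapT => kt; apply: ht; rewrite in_itv/= andbT => t0.
exact: h.
Qed.

Lemma omL_small : exists2 dl : nat -> R, dl @ \oo --> (0 : R) & \forall n \near \oo,
  (\int[leb1]_(x in `]0%R, +oo[) ((wsum (nlist K n) x - omL x) ^+ 2)%:E <= (dl n)%:E)%E.
Proof.
apply: (@L2_cvg0 _ _ _ (fun=> omL) (CW * expR k1)); first exact: measurable_itv.
- by move=> x /=; rewrite !in_itv/= !andbT; exact: ltW.
- by move=> n; exact: measurable_wsum.
- by move=> n; exact: measurable_omL.
- by near=> n => x; rewrite /= in_itv/= andbT => x0; exact: wsum_exp (ltW x0).
- by near=> n => x; rewrite /= in_itv/= andbT => x0; exact: omL_exp (ltW x0).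
- apply: ae_K => t t0 kt; apply: (seq_near_cvg _ (cvg_cst _)).
  by apply: filterS (near_wL t) => n []; rewrite ind1// mul1r => -> _; rewrite subrr.
Unshelve. all: by end_near. Qed.

Lemma sqint1_exp (h : R -> R) (C : R) : measurable_fun setT h -> 0 <= C ->
  (forall t, 0 <= t -> `|h t| <= C * expR (- t)) -> sqint1 h.
Proof.
move=> mh C0 hC; apply: sqint1E => //; split; first exact: measurable_funTS.
have mI : measurable (`]0%R, +oo[%classic : set R) by exact: measurable_itv.
have sI : `]0%R, +oo[%classic `<=` (`[0%R, +oo[%classic : set R).
  by move=> x /=; rewrite !in_itv/= !andbT; exact: ltW.
have := exp2_integrable C mI sI; apply: le_integrable => //.
  by apply/measurable_EFinP; apply: measurable_funTS; exact: measurable_sqr.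
move=> x; rewrite /= in_itv/= andbT => x0; rewrite lee_fin !ger0_norm ?sqr_ge0//.
have := hC _ (ltW x0); rewrite -[X in _ -> X <= _]real_normK ?num_real// => h1.
by rewrite lerXn2r ?nnegrE// mulr_ge0// expR_ge0.
Qed.

Definition omS (s t : R) := (Num.sqrt s)^-1 * omL (t / s).

Lemma omS_sqint s : 0 < s -> sqint1 (omS s).
Proof.
move=> s0; have r0 : 0 <= (Num.sqrt s)^-1 by rewrite invr_ge0 sqrtr_ge0.
have C0 : 0 <= (Num.sqrt s)^-1 * CW by rewrite mulr_ge0// CW_ge0.
apply: (@sqint1_exp _ ((Num.sqrt s)^-1 * CW * expR (s * k1))).
- apply: measurable_funM => //; apply: (measurableT_comp measurable_omL); exact: measurable_funM.
- by rewrite mulr_ge0// expR_ge0.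
- move=> t t0; have ts : 0 <= t / s by rewrite divr_ge0// ltW.
  have [h1 h2] := omL_bound ts; have [h|h] := leP t (s * k1); last first.
    have e : omL (t / s) = 0 by apply: h2; rewrite ltr_pdivlMr// mulrC.
    by rewrite /omS e mulr0 normr0 mulr_ge0 ?expR_ge0// mulr_ge0 ?expR_ge0.
  apply: exp_bound_left => //.
  by rewrite /omS normrM ger0_norm// ler_wpM2l.
Qed.

Lemma nlist_pos n : all (fun p : R * R => 0 < p.2) (nlist K n).
Proof.
apply/allP => _ /mapP[j + ->] /=; rewrite mem_iota/= add0n => jm.
by apply: K0; apply: tn_K => //; exact: K0.
Qed.

(** The rescaled finite towers are explicit limits of test functions; their values converge
    boundedly and their fields in energy, so [test_limit_lim] applies. [K] being null, cutting by
    [ind] alters them on a null set only. *)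
Lemma WL_limit s : 0 < s ->
  test_limit (fun x => Num.sqrt s * WL (tt x / s)) (rfield (omS s)).
Proof.
move=> s0; pose V n x := Num.sqrt s * (ind (tt x / s) * minsum (nlist K n) (tt x / s)).
have mts : measurable_fun setT (fun x : R * R => tt x / s).
  by apply: measurable_funM => //; exact: measurable_tt.
have mW : measurable_fun B (fun x : R * R => Num.sqrt s * WL (tt x / s)).
  by apply: measurable_funTS; apply: measurable_funM => //; exact: measurableT_comp measurable_WL mts.
have mV n : measurable_fun B (V n).
  apply: measurable_funTS; apply: measurable_funM => //; apply: measurable_funM.
    exact: measurableT_comp measurable_ind mts.
  exact: measurableT_comp (measurable_minsum _) mts.
have hV n x : B x -> `|V n x| <= Num.sqrt s * nroot k1.
  move=> Bx; rewrite /V normrM ger0_norm ?sqrtr_ge0// ler_wpM2l ?sqrtr_ge0//.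
  case: (pselect (0 < tt x / s /\ ~ K (tt x / s))) => [[t0 kt]|h']; last first.
    by rewrite ind0// mul0r normr0 sqrtr_ge0.
  have /andP[h1 h2] := minsum_nlist K0 Kk0 n (ltW t0).
  by rewrite ind1// mul1r ger0_norm.
have hW (x : R * R) : B x -> `|Num.sqrt s * WL (tt x / s)| <= Num.sqrt s * nroot k1.
  by move=> Bx; rewrite normrM ger0_norm ?sqrtr_ge0// ler_wpM2l ?sqrtr_ge0// WL_bound.
have sV n := @sqint_bounded _ _ _ (@leb2 R) B measurable_B _ _ leb2_B_lty (mV n) (hV n).
have sW := @sqint_bounded _ _ _ (@leb2 R) B measurable_B _ _ leb2_B_lty mW hW.
have sG := rfield_sqG (omS_sqint s0).
pose wn n := wsum (rescale s (nlist K n)).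
have wnE n : wn n = fun t => (Num.sqrt s)^-1 * wsum (nlist K n) (t / s).
  by apply/funext => t; rewrite /wn wsum_rescale.
have tln n : test_limit (V n) (rfield (wn n)).
  have h := tsum_limit (rescale_pos s0 (nlist_pos n)).
  have [_ g1 g2 _] := h.
  apply: (test_limit_ae h (sV n) g1 g2) => //; last 2 first.
  - exact: aeT.
  - exact: aeT.
  have := ae_tt s0 mK nK; apply: aeS => x hx Bx; have [x0 t0 kt] := hx Bx.
  by rewrite tsum_tt// minsum_rescale// /V ind1// mul1r.
have [dl cdl hdl] := omL_small.
have cd : 2 * @disc1 R * dl n @[n --> \oo] --> (0 : R).
  by rewrite -[X in _ --> X](mulr0 (2 * @disc1 R)); apply: cvgMr.
pose D n := rfield (fun t => wn n t - omS s t).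
have sN n : sqG (D n).
  by rewrite /D rfieldB; apply: sqG_add; [exact: test_limit_sqG (tln n)|exact: sqG_scale].
have E : \forall n \near \oo, ipG (D n) (D n) <= 2 * @disc1 R * dl n.
  apply: filterS hdl => n hn; rewrite -lee_fin (ipG_EFin (sN n)).
  have DE : D n = rfield (fun t => (Num.sqrt s)^-1 * (wsum (nlist K n) (t / s) - omL (t / s))).
    by congr rfield; apply/funext => t; rewrite wnE mulrBr.
  rewrite DE (@rescale_energy _ s (fun t => wsum (nlist K n) t - omL t) s0); last first.
    by apply: measurable_funB; [exact: measurable_wsum|exact: measurable_omL].
  rewrite [leRHS]EFinM; apply: lee_wpmul2l; last exact: hn.
  by rewrite lee_fin mulr_ge0// disc1_ge0.
apply: (test_limit_lim tln sW) => //; [by case: sG|by case: sG|..].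
- by apply: (cvgLB_bounded mV mW hV hW) => x Bx; apply: cvgMr; exact: cvg_mL.
- rewrite /cvgL2 (_ : (fun n => _) = fun n => ipB (fst_grad (D n)) (fst_grad (D n))); last first.
    apply/funext => n; congr (ip _ _ _ _); apply/funext => x; rewrite /fst_grad/=; ring.
  apply: (squeeze_seq _ (cvg_cst (0 : R)) cd); apply: filterS E => n; rewrite ip_ge0/=.
  by apply: le_trans; rewrite /ipG lerDl ip_ge0.
- rewrite /cvgL2 (_ : (fun n => _) = fun n => ipB (snd_grad (D n)) (snd_grad (D n))); last first.
    apply/funext => n; congr (ip _ _ _ _); apply/funext => x; rewrite /snd_grad/=; ring.
  apply: (squeeze_seq _ (cvg_cst (0 : R)) cd); apply: filterS E => n; rewrite ip_ge0/=.
  by apply: le_trans; rewrite /ipG lerDr ip_ge0.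
Qed.

End TowerLimit.

(** * The given tower identified with the chord formula on the gaps *)

Section Profile.
Context {R : realType}.
Notation leb1 := (@lebesgue_measure R).
Notation sq := (sqint (@leb2 R) B).
Notation ipB := (ip (@leb2 R) B).
Variables (C : set R) (mu : R -> R).
Hypothesis Cne : C !=set0.
Hypothesis Cc : compact C.
Hypothesis C01 : C `<=` `]0, 1[.
Hypothesis C_null : leb1 C = 0%E.
Hypothesis tow : tower C set0 mu.

Definition KC : set R := (fun t => expR (- t)) @^-1` C.
Definition prof (t : R) : R := mu (expR (- t)).

Lemma compact_min (A : set R) : compact A -> A !=set0 -> exists2 c, A c & forall t, A t -> c <= t.
Proof.
move=> cA A0; have ci : {within A, continuous (fun t : R => t)}.
  by apply: continuous_subspaceT => x; exact: cvg_id.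
have [c cA' h] := compact_EVT_min A0 cA ci.
by exists c; [exact: set_mem|move=> t /mem_set; exact: h].
Qed.

Lemma compact_max (A : set R) : compact A -> A !=set0 -> exists2 c, A c & forall t, A t -> t <= c.
Proof.
move=> cA A0; have ci : {within A, continuous (fun t : R => t)}.
  by apply: continuous_subspaceT => x; exact: cvg_id.
have [c cA' h] := compact_EVT_max A0 cA ci.
by exists c; [exact: set_mem|move=> t /mem_set; exact: h].
Qed.

Lemma C_bounds r : C r -> 0 < r < 1.
Proof. by move=> /C01; rewrite /= in_itv. Qed.

Lemma KC_ln r : C r -> KC (- ln r).
Proof. by move=> cr; rewrite /KC/= opprK lnK// posrE; case/andP: (C_bounds cr). Qed.

Lemma ln_le_neg (r t : R) : 0 < r -> (- ln r <= t) = (expR (- t) <= r).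
Proof. by move=> r0; rewrite -[in RHS](lnK r0) ler_expR lerNl. Qed.

Lemma le_neg_ln (r t : R) : 0 < r -> (t <= - ln r) = (r <= expR (- t)).
Proof. by move=> r0; rewrite -[in RHS](lnK r0) ler_expR lerNr. Qed.

Lemma KC_lo q : (exists2 c, KC c & c <= q) -> exists c, islo KC q c.
Proof.
move=> [c kc cq]; have cA : compact (C `&` `[expR (- q), +oo[).
  by apply: compact_closedI => //; rewrite set_itvE; exact: closed_ge.
have [|r [Cr] hr hm] := compact_min cA.
  by exists (expR (- c)); split => //=; rewrite in_itv/= ler_expR lerN2 cq.
have r0 : 0 < r by case/andP: (C_bounds Cr).
exists (- ln r); split; first exact: KC_ln.
  by rewrite ln_le_neg//; move: hr; rewrite /= in_itv/= andbT.
move=> d kd dq; rewrite le_neg_ln//; apply: hm; split => //=.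
by rewrite in_itv/= ler_expR lerN2 dq.
Qed.

Lemma KC_hi q : (exists2 c, KC c & q <= c) -> exists c, ishi KC q c.
Proof.
move=> [c kc cq]; have cA : compact (C `&` `]-oo, expR (- q)]).
  by apply: compact_closedI => //; rewrite set_itvE; exact: closed_le.
have [|r [Cr] hr hm] := compact_max cA.
  by exists (expR (- c)); split => //=; rewrite in_itv/= ler_expR lerN2 cq.
have r0 : 0 < r by case/andP: (C_bounds Cr).
exists (- ln r); split; first exact: KC_ln.
  by rewrite le_neg_ln//; move: hr; rewrite /= in_itv.
move=> d kd dq; rewrite ln_le_neg//; apply: hm; split => //=.
by rewrite in_itv/= ler_expR lerN2 dq.
Qed.

Lemma KC_ne : KC !=set0.
Proof. by have [r Cr] := Cne; exists (- ln r); exact: KC_ln. Qed.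

Lemma KC_range : exists k0 k1 : R, [/\ 0 < k0, KC k0 & forall c, KC c -> k0 <= c <= k1].
Proof.
have [r Cr rm] := compact_max Cc Cne; have [r' Cr' rm'] := compact_min Cc Cne.
have /andP[r0 r1] := C_bounds Cr; have /andP[r0' _] := C_bounds Cr'.
exists (- ln r), (- ln r'); split; first by rewrite oppr_gt0 ln_lt0// r0.
  exact: KC_ln.
by move=> c kc; rewrite ln_le_neg// le_neg_ln// rm//= rm'.
Qed.

Lemma measurable_C : measurable C.
Proof. exact: compact_measurable. Qed.

Lemma measurable_KC : measurable KC.
Proof.
rewrite -[KC]setTI; have : measurable_fun setT (fun t : R => expR (- t)) by apply: measurableT_comp.
by move=> h; apply: h => //; exact: measurable_C.
Qed.

Lemma KC_null : leb1 KC = 0%E.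
Proof. exact: null_exp measurable_C C_null. Qed.

Lemma prof_root k : KC k -> prof k = nroot k.
Proof.
have [_ _ h _ _] := tow; move=> /h; rewrite /prof => ->.
by rewrite /nroot lnV ?posrE ?expR_gt0// expRK opprK.
Qed.

Lemma enorm_axis (r : R) : 0 <= r -> enorm ((r, 0) : R * R) = r.
Proof. by move=> r0; rewrite /enorm/= expr0n/= addr0 sqrtr_sqr ger0_norm. Qed.

Lemma radial_cont (z : R * R) : B z -> {for z, continuous (radial mu)}.
Proof.
have [_ h _ _ _] := tow; rewrite (continuous_open_subspace _ open_B) in h.
by move=> Bz; apply: h; exact: mem_set.
Qed.

(** Continuity is given for the radial function on B; it is transported to [mu] along the axis
    points (r, 0). *)
Lemma axis_cvg (F : set_system R) (FF : Filter F) (g : R -> R) (r : R) :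
  0 <= r -> r < 1 -> g t @[t --> F] --> r -> (forall t, 0 <= g t) ->
  mu (g t) @[t --> F] --> mu r.
Proof.
move=> r0 r1 cg g0.
have Bz : B ((r, 0) : R * R) by rewrite /B/= enorm_axis.
have c2 : (g t, 0 : R) @[t --> F] --> ((r, 0) : R * R)
  by exact: (cvg_comp _ _ cg (@continuous_pairl R 0 r)).
have e : (fun t => mu (g t)) = radial mu \o (fun t => (g t, 0)).
  by apply/funext => t /=; rewrite /radial enorm_axis.
have e2 : mu r = radial mu (r, 0) by rewrite /radial enorm_axis.
rewrite e e2; exact: (cvg_comp _ _ c2 (radial_cont Bz)).
Qed.

Lemma prof_cont t : 0 < t -> {for t, continuous prof}.
Proof.
move=> t0; apply: (@axis_cvg _ _ (fun t => expR (- t)) (expR (- t))); last by move=> x; exact: expR_ge0.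
- exact: expR_ge0.
- by rewrite expR_lt1 oppr_lt0.
- apply: (@continuous_comp R R R (fun t : R => - t) expR); first exact: opp_continuous.
  exact: continuous_expR.
Qed.

Lemma prof_infty : prof t @[t --> +oo] --> mu 0.
Proof.
apply: (@axis_cvg _ _ (fun t => expR (- t)) 0) => //.
exact: cvgr_expR.
Qed.

(** A segment of ]0, 1[ that avoids C is connected, hence contained in one component; in the
    variable t its ends are t and x. *)
Lemma prof_affine t : 0 < t -> ~ KC t -> exists a b, forall x, 0 < x ->
  (forall k, KC k -> ~~ (Num.min t x <= k <= Num.max t x)) -> prof x = a + b * x.
Proof.
move=> t0 kt; have [_ _ _ _ h] := tow.
have e1 x : 0 < x -> `]0, 1[%classic (expR (- x)) by move=> x0; rewrite /= in_itv/= expR_gt0 expR_lt1 oppr_lt0.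
have [|a [b hab]] := h (expR (- t)).
  by split; [exact: e1|case].
exists a, b => x x0 hk; rewrite /prof hab; last first.
  pose I := `[expR (- Num.max t x), expR (- Num.min t x)]%classic.
  have It : I (expR (- t)) by rewrite /I/= in_itv/= !ler_expR !lerN2 le_max ge_min lexx.
  have Ix : I (expR (- x)) by rewrite /I/= in_itv/= !ler_expR !lerN2 le_max ge_min lexx !orbT.
  apply: (connected_component_max It) Ix; last by apply/connected_intervalP; exact: interval_is_interval.
  move=> r; rewrite /I/= in_itv/= => /andP[r1 r2].
  have r0 : 0 < r by apply: lt_le_trans r1; exact: expR_gt0.
  split; first by rewrite /= in_itv/= r0 (le_lt_trans r2)// expR_lt1 oppr_lt0 lt_min t0 x0.
  case=> // Cr; have := hk _ (KC_ln Cr); rewrite ln_le_neg// le_neg_ln//.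
  by rewrite r1 r2.
by rewrite lnV ?posrE ?expR_gt0// expRK opprK.
Qed.

(** It extends the affine formula from the inside of a gap to its end points. *)
Lemma cont_zero (d : R -> R) (y x : R) : {for y, continuous d} -> x != y ->
  (forall z, Num.min x y < z < Num.max x y -> d z = 0) -> d y = 0.
Proof.
move=> cd xy hz; apply: contrapT => /eqP dy.
have dy0 : 0 < `|d y| by rewrite normr_gt0.
have /nbhs_ballP[e /= e0 he] : \forall z \near y, `|d y - d z| < `|d y|.
  by have := cd; move=> /cvgrPdist_lt /(_ _ dy0).
(* The test point y + q (x - y) lies strictly between y and x, and closer than e to y. *)
pose q := Num.min (e / 2) (`|x - y| / 2) / `|x - y|.
have xy0 : 0 < `|x - y| by rewrite normr_gt0 subr_eq0.
have m0 : 0 < Num.min (e / 2) (`|x - y| / 2) by rewrite lt_min !divr_gt0.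
have q0 : 0 < q by rewrite divr_gt0.
have q1 : q <= 2^-1.
  by rewrite ler_pdivrMr// [2^-1 * _]mulrC ge_min lexx orbT.
have qe : q * `|x - y| < e.
  rewrite divfK ?gt_eqF//; apply: le_lt_trans (_ : e / 2 < e); first by rewrite ge_min lexx.
  by rewrite ltr_pdivrMr// ltr_pMr// ltr1n.
have := he (y + q * (x - y)); rewrite /ball/= opprD addrA subrr sub0r normrN normrM ger0_norm ?(ltW q0)//.
move=> /(_ qe); rewrite [d (y + _)]hz ?subr0 ?ltxx//.
have [h|h] := ltP x y.
  apply/andP; split; nra.
have {h xy} h : y < x by rewrite lt_neqAle eq_sym xy.
apply/andP; split; nra.
Qed.

(** [prof] has the finite limit mu(0) at infinity, whereas two points at distance 3 / |b| would have
    values 3 apart, each within 1 of that limit. *)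
Lemma prof_infty_affine a b T : (forall x, T < x -> prof x = a + b * x) -> b = 0.
Proof.
move=> h; apply: contrapT => /eqP b0.
have nb : 0 < `|b| by rewrite normr_gt0.
have /cvgrPdist_lt/(_ 1 ltr01) [M [Mr hM]] := prof_infty.
pose x := Num.max (M + 1) (T + 1).
have x1 : M < x by rewrite lt_max ltrDl ltr01.
have x2 : T < x by rewrite lt_max; apply/orP; right; rewrite ltrDl.
have y0 : 0 < 3 / `|b| by rewrite divr_gt0.
have h1 := hM _ x1; have h2 := hM (x + 3 / `|b|) (lt_trans x1 (ltr_pwDr y0 (lexx x))).
rewrite /= !h// in h1 h2; last exact: (lt_trans x2 (ltr_pwDr y0 (lexx x))).
have := le_lt_trans (ler_distD (mu 0) (a + b * (x + 3 / `|b|)) (a + b * x)) (ltrD _ h1).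
rewrite distrC => /(_ _ h2).
have -> : a + b * (x + 3 / `|b|) - (a + b * x) = b * (3 / `|b|) by ring.
rewrite normrM normf_div normr_id mulrCA mulfV ?gt_eqF// mulr1 ger0_norm//.
by move=> h3; move: h3; rewrite [X in _ < X](_ : _ = 2) ?ltr_nat// .
Qed.

Lemma nroot0 : nroot 0 = 0 :> R.
Proof. by rewrite /nroot mulr0 sqrtr0. Qed.

Lemma KC_gt0 k : KC k -> 0 < k.
Proof. by move=> /C_bounds/andP[_]; rewrite expR_lt1 oppr_lt0. Qed.

Lemma prof_gap t : 0 < t -> ~ KC t -> above KC t -> exists a b : R,
  (forall x, lo KC t < x < hi KC t -> prof x = a + b * x) /\ t < hi KC t /\ KC (hi KC t) /\
  a + b * hi KC t = nroot (hi KC t).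
Proof.
move=> t0 kt at_; have [c hc] : exists c, ishi KC t c by apply: KC_hi; exact/asboolP.
rewrite (hi_eq hc); have [kc tc hm] := hc.
have {}tc : t < c by rewrite lt_neqAle tc andbT; apply/eqP => e; apply: kt; rewrite e.
have lt' : lo KC t < t by apply: lo_bounds => //; [exact: KC_lo].
have l0 : 0 <= lo KC t by apply: lo_ge0; [exact: KC_gt0|exact: KC_lo].
have [a [b hab]] := prof_affine t0 kt.
have h x : lo KC t < x < c -> prof x = a + b * x.
  move=> /andP[x1 x2]; apply: hab; first exact: le_lt_trans x1.
  move=> k kk; apply/negP => /andP[k1 k2].
  have [kt'|kt'] := leP k t.
    have [c' hc'] : exists c, islo KC t c by apply: KC_lo; exists k.
    rewrite (lo_eq hc') in x1 lt'; have [_ _ h'] := hc'.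
    by have := lt_le_trans (_ : c' < Num.min t x) k1; rewrite lt_min lt' x1 ltNge h'// => /(_ isT).
  have := le_trans (hm _ kk (ltW kt')) k2; rewrite le_max !leNgt tc x2.
  by [].
exists a, b; split=> //; split=> //; split=> //.
rewrite -(prof_root kc); apply/eqP; rewrite eq_sym -subr_eq0; apply/eqP.
apply: (@cont_zero (fun x => prof x - (a + b * x)) c t); last 2 first.
- by rewrite lt_eqF.
- move=> z; rewrite (min_idPl (ltW tc)) (max_idPr (ltW tc)) => /andP[z1 z2].
  by rewrite h ?subrr// z2 (lt_trans lt').
apply: cvgB; first by apply: prof_cont; exact: KC_gt0.
by apply: cvgD; [exact: cvg_cst|apply: cvgMr; exact: cvg_id].
Qed.

Lemma prof_below t : 0 < t -> ~ KC t -> below KC t -> prof t = WK KC t.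
Proof.
move=> t0 kt bt; have [c hc] : exists c, islo KC t c by apply: KC_lo; exact/asboolP.
have lc := lo_eq hc; have [kc ct hm] := hc.
have {}ct : c < t by rewrite lt_neqAle ct andbT; apply/eqP => e; apply: kt; rewrite -e.
have aff (a b d : R) : c < d -> (forall x, c < x < d -> prof x = a + b * x) -> a + b * c = nroot c.
  move=> cd h; rewrite -(prof_root kc); apply/eqP; rewrite eq_sym -subr_eq0; apply/eqP.
  apply: (@cont_zero (fun x => prof x - (a + b * x)) c d); last 2 first.
  - by rewrite gt_eqF.
  - move=> z; rewrite (min_idPr (ltW cd)) (max_idPl (ltW cd)) => z12.
    by rewrite h ?subrr.
  apply: cvgB; first by apply: prof_cont; exact: KC_gt0.
  by apply: cvgD; [exact: cvg_cst|apply: cvgMr; exact: cvg_id].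
rewrite /WK /omK lc; case: (boolP (above KC t)) => [at_|nat_].
  have [a [b [h [th [kh e2]]]]] := prof_gap t0 kt at_; rewrite lc in h.
  have e1 := aff a b _ (lt_trans ct th) h.
  rewrite h ?ct ?th// -e1 -e2; move: (hi KC t) th => d th; field.
  by rewrite subr_eq0 gt_eqF// (lt_trans ct).
have [a [b hab]] := prof_affine t0 kt.
have h x : c < x -> prof x = a + b * x.
  move=> x1; apply: hab; first exact: lt_trans (KC_gt0 kc) x1.
  move=> k kk; apply/negP => /andP[k1 k2].
  have [kt'|kt'] := leP k t; last by apply/negP: nat_; rewrite negbK; apply/asboolP; exists k => //; exact: ltW.
  by have := lt_le_trans (_ : c < Num.min t x) k1; rewrite lt_min ct x1 ltNge hm// => /(_ isT).
have b0 := prof_infty_affine h.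
have := aff a b (t + 1) (lt_trans ct _) (fun x hx => h x (andP hx).1).
rewrite ltrDl ltr01 => /(_ isT) <-; rewrite h// b0; ring.
Qed.

(** On the first gap, which reaches the boundary r = 1, continuity inside B fixes only the value at
    k0. The value a at t = 0 stays free here, since the boundary condition is encoded in H^1_0 and
    not pointwise. *)
Lemma prof_start k0 : KC k0 -> (forall c, KC c -> k0 <= c) -> exists a, forall t, 0 < t -> ~ KC t ->
  prof t = WK KC t + a * (1 - Num.min t k0 / k0).
Proof.
move=> kk hk; have k00 := KC_gt0 kk.
have nk x : x < k0 -> ~ KC x by move=> xk /hk; rewrite leNgt xk.
have h0 x : 0 < x -> x < k0 -> [/\ lo KC x = 0, hi KC x = k0 & above KC x].
  move=> x0 xk; split.
  - apply: lo_none; apply/asboolP => -[c /hk kc cx].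
    by have := le_lt_trans (le_trans kc cx) xk; rewrite ltxx.
  - by apply: hi_eq; split => //; [exact: ltW|move=> d kd _; exact: hk].
  - by apply/asboolP; exists k0 => //; exact: ltW.
have t1 : 0 < k0 / 2 by rewrite divr_gt0.
have t2 : k0 / 2 < k0 by rewrite ltr_pdivrMr// ltr_pMr// ltr1n.
have [l1 l2 l3] := h0 _ t1 t2.
have [a [b [h [_ [_ e]]]]] := prof_gap t1 (nk _ t2) l3; rewrite l1 l2 in h e.
exists a => t t0 kt; have [tk|tk] := ltP t k0.
  have [m1 m2 m3] := h0 t t0 tk.
  rewrite h ?t0 ?tk// /WK /omK m1 m2 m3 nroot0 -e subr0; field; exact: lt0r_neq0.
rewrite mulfV ?gt_eqF// subrr mulr0 addr0; apply: prof_below => //.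
by apply/asboolP; exists k0.
Qed.

End Profile.

(** * The dilated tower: membership in H^1_0 and invariance of the norm *)

Section Dilation.
Context {R : realType}.
Notation leb1 := (@lebesgue_measure R).
Notation sq := (sqint (@leb2 R) B).
Notation ipB := (ip (@leb2 R) B).

Lemma sqrt_EFin_eq (a b : R) (c : \bar R) :
  (a%:E = c)%E -> (b%:E = c)%E -> Num.sqrt a = Num.sqrt b.
Proof. by move=> <- [->]. Qed.

Lemma cst_sq (a : R) : sq (fun=> a).
Proof. by apply: cont_sq; exact: cst_continuous. Qed.

Lemma sq_ae (u v : R * R -> R) : sq u -> measurable_fun B v ->
  {ae (@leb2 R), forall x, B x -> u x = v x} -> sq v.
Proof.
move=> [mu_ /integrableP[_ fu]] mv e; split => //.
have m2 (w : R * R -> R) : measurable_fun B w -> measurable_fun B (fun x => (w x ^+ 2)%:E).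
  by move=> mw; apply/measurable_EFinP; apply: (@measurable_funX _ _ _ _ _ 2).
apply/integrableP; split; first exact: m2.
apply: le_lt_trans fu; rewrite le_eqVlt; apply/orP; left; apply/eqP.
apply: ae_eq_integral; first exact: measurable_B.
- by apply: measurableT_comp => //; exact: m2.
- by apply: measurableT_comp => //; exact: m2.
- by rewrite /ae_eq; move: e; apply: aeS => x h Bx; rewrite h.
Qed.

Lemma test_sq_int phi : sq phi -> (@leb2 R).-integrable B (EFin \o phi).
Proof. by move=> s; exact: (@sqint_integrable _ _ _ (@leb2 R) B measurable_B _ leb2_B_lty s). Qed.

Lemma ip0 phi : sq phi -> ipB (fun=> 0) phi = 0.
Proof. by move=> s; rewrite /ip RintegralZl ?mul0r//; [exact: measurable_B|exact: test_sq_int]. Qed.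

Lemma dirichlet_grad0 (u : R * R -> R) : test_limit u (fun=> (0, 0) : R * R) -> dirichlet u = 0.
Proof.
move=> h; rewrite (dirichlet_test_limit h) /ipG.
by rewrite [X in X + _](ip0 (cst_sq 0)) [X in _ + X](ip0 (cst_sq 0)) addr0.
Qed.

Lemma B_not_null : ~ (@leb2 R).-negligible B.
Proof.
move=> [N [mN N0 BN]]; pose Q : set (R * R) := `[0, 2^-1] `*` `[0, 2^-1].
have mI : measurable (`[0, 2^-1]%classic : set R) by exact: measurable_itv.
have QN : Q `<=` N.
  move=> [x y] [/=]; rewrite !in_itv/= => /andP[x0 x1] /andP[y0 y1]; apply: BN; apply/BE.
  have h (z : R) : 0 <= z -> z <= 2^-1 -> z ^+ 2 <= 4^-1 by move=> *; nra.
  by have := h x x0 x1; have := h y y0 y1; lra.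
have : (@leb2 R Q <= @leb2 R N)%E by apply: le_measure => //; rewrite inE//; exact: measurableX.
have h2 : (0 : R) < 2^-1 by rewrite invr_gt0.
have eI : leb1 `[0%R, 2^-1%R] = (2^-1)%:E.
  by rewrite [LHS]lebesgue_measure_itv/= lte_fin h2 -EFinB subr0.
have eQ : @leb2 R Q = (2^-1 * 2^-1)%:E by rewrite /Q (leb2X mI mI) EFinM; congr (_ * _)%E; exact: eI.
by rewrite N0 eQ lee_fin leNgt mulr_gt0.
Qed.

(* Poincare's inequality: a constant in H^1_0(B) vanishes. *)
Lemma test_limit_cst (a : R) G : test_limit (fun=> a : R) G -> a = 0.
Proof.
move=> tl; have s0 := cst_sq 0.
have w0 : weak_grad (fun=> a : R) (fun=> (0, 0) : R * R).
  apply/weak_gradP; split => // phi tphi.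
  have sx := test_sq (test_dx tphi); have sy := test_sq (test_dy tphi).
  have q1 : ipB (fst_grad (fun=> (0, 0) : R * R)) phi = 0 := ip0 (test_sq tphi).
  have q2 : ipB (snd_grad (fun=> (0, 0) : R * R)) phi = 0 := ip0 (test_sq tphi).
  rewrite q1 ?q2 oppr0.
  have z0 z : ~ B z -> phi z = 0 by move=> /(test_outB tphi).
  rewrite /ip !RintegralZl; try exact: measurable_B; try exact: test_sq_int.
  rewrite (integral_partial1_eq0 (test_cont (test_dx tphi)) (test_derive1 tphi) z0).
  by rewrite (integral_partial2_eq0 (test_cont (test_dy tphi)) (test_derive2 tphi) z0) mulr0.
have [e1 e2] := weak_grad_unique (test_limit_weak tl) w0.
have tl0 : test_limit (fun=> a : R) (fun=> (0, 0) : R * R).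
  by apply: (@test_limit_ae _ _ _ _ (fun=> (0, 0) : R * R) tl (cst_sq a) s0 s0 _ e1 e2); exact: aeT.
have [h _] := test_limit_H10 tl0.
have := poincare h; rewrite dirichlet_grad0// mulr0 => le0.
have e0 : ipB (fun=> a) (fun=> a) = 0 by apply/eqP; rewrite eq_le le0 ip_ge0.
have ae0 := @ip_eq0_ae _ _ _ (@leb2 R) B measurable_B _ (cst_sq a) e0.
apply: contrapT => a0; apply: B_not_null; apply: negligibleS ae0 => x Bx /= hx.
by apply: a0; exact: hx.
Qed.

Lemma enorm_tt (x : R * R) : 0 < rho x -> enorm x = expR (- tt x).
Proof.
move=> x0; rewrite /enorm -/(rho x) -powR12_sqrt ?ltW// /powR gt_eqF//.
by rewrite /tt opprK mulrC.
Qed.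

Variables (C : set R) (mu : R -> R).
Hypothesis Cne : C !=set0.
Hypothesis Cc : compact C.
Hypothesis C01 : C `<=` `]0, 1[.
Hypothesis C_null : leb1 C = 0%E.
Hypothesis tow : tower C set0 mu.

Let mK := measurable_KC Cc.
Let nK := KC_null Cc C_null.

(** With a as in [prof_start], adding (a / k0) min(t, k0) to the difference of [mu] and the chord
    formula gives a function of H^1_0 equal to a almost everywhere, so a = 0. *)
Lemma prof_WK t : 0 < t -> ~ KC C t -> prof mu t = WK (KC C) t.
Proof.
have [k0 [k1 [k0p kk hk]]] := KC_range Cne Cc C01.
have hk0 c : KC C c -> k0 <= c by move=> /hk/andP[].
have [a ha] := prof_start Cc C01 tow kk hk0.
suff a0 : a = 0 by move=> t0 kt; rewrite ha// a0 mul0r addr0.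
have [hmu _ _ _ _] := tow; have tl1 := H10_test_limit hmu.
have tl2 := WL_limit (KC_lo Cc C01) (KC_hi Cc C01) k0p hk mK nK ltr01.
have pos : all (fun p : R * R => 0 < p.2) [:: (a / k0, k0)] by rewrite /= k0p.
have tl := test_limitD (test_limitD tl1 (test_limitZ (-1) tl2)) (tsum_limit pos).
have [_ g1 g2 _] := tl.
have E : {ae (@leb2 R), forall x, B x ->
    radial mu x + -1 * (Num.sqrt 1 * WL (KC C) (tt x / 1)) + tsum [:: (a / k0, k0)] x = a}.
  have := ae_tt ltr01 mK nK; apply: aeS => x hx Bx; have [x0 t0 kt] := hx Bx.
  rewrite (tsum_tt _ x0) /radial (enorm_tt x0) -/(prof mu (tt x)) /WL ind1//.
  rewrite divr1 in t0 kt *; rewrite ha// sqrtr1 /minsum big_cons big_nil/=.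
  move: (WK _ _) (Num.min _ _) => W q; field; exact: lt0r_neq0.
apply: (@test_limit_cst a); apply: (test_limit_ae tl (cst_sq a) g1 g2 E); exact: aeT.
Qed.

Lemma radial_deltaE s x : 0 < s -> 0 < rho x ->
  radial (delta s^-1 mu) x = Num.sqrt s * prof mu (tt x / s).
Proof.
move=> s0 x0; rewrite /radial /delta powRN powR12_sqrt ?invr_ge0 ?ltW// sqrtrV ?ltW// invrK.
by rewrite (enorm_tt x0) -expRM mulNr.
Qed.

(** Measurability is known for [radial mu] on B rather than for [mu]; hence the composition with x
    -> (|x|^(1/s), 0), which maps B into itself. *)
Lemma measurable_radial_delta s : 0 < s -> measurable_fun B (radial (delta s^-1 mu)).
Proof.
move=> s0; have [hmu _ _ _ _] := tow.
have mr : measurable_fun B (radial mu) by have [[[]]] := hmu.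
pose phi (x : R * R) : R * R := (enorm x `^ s^-1, 0).
have me : measurable_fun setT (fun x : R * R => enorm x).
  apply: (measurableT_comp (f := @Num.sqrt R)); last exact: measurable_rho.
  by apply: continuous_measurable_fun; exact: sqrt_continuous.
have mphi : measurable_fun B phi.
  apply: measurable_funTS; apply: measurable_fun_pair => //.
  by apply: (measurableT_comp (measurable_powR s^-1)).
have sub : phi @` B `<=` B.
  move=> _ [x Bx <-]; rewrite /phi /B/= enorm_axis ?powR_ge0//.
  have := @gt0_ltr_powR R s^-1; rewrite invr_gt0 => /(_ s0 (enorm x) 1).
  by rewrite powR1 !nnegrE => -> //; exact: sqrtr_ge0.
have := measurable_comp measurable_B sub mr mphi.
have -> : radial mu \o phi = fun x => mu (enorm x `^ s^-1).
  by apply/funext => x; rewrite /radial /phi /= enorm_axis ?powR_ge0.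
by move=> h; apply: measurable_funM.
Qed.

Lemma radial_delta_limit s : 0 < s ->
  test_limit (radial (delta s^-1 mu)) (rfield (omS (KC C) s)).
Proof.
move=> s0; have [k0 [k1 [k0p kk hk]]] := KC_range Cne Cc C01.
have tl := WL_limit (KC_lo Cc C01) (KC_hi Cc C01) k0p hk mK nK s0.
have E : {ae (@leb2 R), forall x, B x ->
    Num.sqrt s * WL (KC C) (tt x / s) = radial (delta s^-1 mu) x}.
  have := ae_tt s0 mK nK; apply: aeS => x hx Bx; have [x0 t0 kt] := hx Bx.
  by rewrite (radial_deltaE s0 x0) prof_WK// /WL ind1// mul1r.
have [su g1 g2 _] := tl.
have sv := sq_ae su (measurable_radial_delta s0) E.
by apply: (test_limit_ae tl sv g1 g2 E); exact: aeT.
Qed.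

(** Both energies equal the same integral of the squared slope [omL], the undilated tower being the
    case s = 1. *)
Lemma dnorm_delta s : 0 < s -> dnorm (radial (delta s^-1 mu)) = dnorm (radial mu).
Proof.
have [k0 [k1 [k0p kk hk]]] := KC_range Cne Cc C01.
have key r : 0 < r -> (dirichlet (radial (delta r^-1 mu)))%:E =
    ((2 * @disc1 R)%:E * \int[leb1]_(t in `]0%R, +oo[) (omL (KC C) t ^+ 2)%:E)%E.
  move=> r0; have tl := radial_delta_limit r0.
  rewrite (dirichlet_test_limit tl) (ipG_EFin (test_limit_sqG tl)).
  by apply: rescale_energy => //; exact: (measurable_omL (KC_lo Cc C01) (KC_hi Cc C01) k0p hk mK).
have -> : radial mu = radial (delta (1 : R)^-1 mu).
  apply/funext => x; rewrite /radial /delta invr1 powRr1; last exact: sqrtr_ge0.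
  by rewrite powR1 mul1r.
move=> s0; have e1 := key s s0; have e2 := key 1 ltr01.
exact: (sqrt_EFin_eq e1 e2).
Qed.

End Dilation.

(** * One term of the sequence at a prescribed precision, and the conclusion *)

Section Stage.
Context {R : realType}.
Notation leb1 := (@lebesgue_measure R).
Notation sq := (sqint (@leb2 R) B).
Notation ipB := (ip (@leb2 R) B).
Variables (f : R -> R) (C : set R) (mu : R -> R).
Hypothesis cf : continuous f.
Hypothesis f0 : f 0 = 0.
Hypothesis fcrit : critical_growth f.
Hypothesis fg0 : g0 f.
Hypothesis fg1 : g1 f.
Hypothesis fg2 : g2 f.
Hypothesis Cne : C !=set0.
Hypothesis Cc : compact C.
Hypothesis C01 : C `<=` `]0, 1[.
Hypothesis C_null : leb1 C = 0%E.
Hypothesis tow : tower C set0 mu.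

(** The real supremum is meaningful on a nonempty bounded set: e bounds it, and the zero function
    makes it nonempty. *)
Lemma Hm1_norm_le (L : (R * R -> R) -> R) (e : R) : 0 <= e ->
  (forall v, H10 v -> `|L v| <= e * dnorm v) -> 0 <= Hm1_norm L <= e.
Proof.
move=> e0 hL; rewrite /Hm1_norm; set E := (X in sup X).
have ub : ubound E e.
  move=> _ [v [Hv nv] <-]; apply: le_trans (hL v Hv) _.
  move: (dnorm v) nv => d nv; exact: ler_piMr e0 nv.
have E0 : E `|L (fun=> 0)|.
  have [h _] := test_limit_H10 (@test_limit0 R).
  exists (fun=> 0) => //; split; first exact: h.
  by rewrite /dnorm (dirichlet_grad0 (@test_limit0 R)) sqrtr0.
apply/andP; split.
  by apply: le_trans (normr_ge0 (L (fun=> 0))) _; apply: ub_le_sup E0; exists e.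
by apply: ge_sup => //; exists `|L (fun=> 0)|.
Qed.

Lemma sqr_sub_le (a b c : R) : (a - c) ^+ 2 <= 2 * (a - b) ^+ 2 + 2 * (b - c) ^+ 2.
Proof. by have := sqr_ge0 (a - b - (b - c)); lra. Qed.

Lemma dnorm_le (u : R * R -> R) (D e : R) : 0 <= e -> dirichlet u <= D -> D <= e ^+ 2 -> dnorm u <= e.
Proof.
move=> e0; rewrite /dnorm; move: (dirichlet u) => d h1 h2.
by rewrite -[leRHS](ger0_norm e0) -sqrtr_sqr ler_wsqrtr// (le_trans h1).
Qed.

(** The order of the choices matters: n fixes the finite tower, and only then can k be taken large,
    since the rates of convergence in k depend on n. *)
Lemma stage (e : R) (N : nat) : 0 < e -> exists (k : nat) (psi : R -> R) (L : (R * R -> R) -> R),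
  let u := radial (delta (sk k)^-1 mu + psi) in
  [/\ (N <= k)%N, H10 (radial psi) /\ dnorm (radial psi) <= e,
      frechet_H10 (J f) u L, 0 <= Hm1_norm L <= e &
      H10 u /\ `|Rintegral (@leb2 R) B (fun x => primitive f (u x))| <= e].
Proof.
move=> e0; have [k0 [k1 [k0p kk hk]]] := KC_range Cne Cc C01.
have lok := KC_lo Cc C01; have hik := KC_hi Cc C01.
have mK := measurable_KC Cc; have nK := KC_null Cc C_null.
have Kp := KC_gt0 C01.
have lt_near (d : nat -> R) (x : R) : d @ \oo --> (0 : R) -> 0 < x -> \forall k \near \oo, d k < x.
  by move=> cd x0; exact: (cvgr_lt _ cd _ x0).
(* The correction has Dirichlet integral at most 2 [disc1] (2 e' + 2 e') = 8 [disc1] e'; the 1 keeps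
   the denominator positive. *)
have d0 := @disc1_ge0 R; pose e' := e ^+ 2 / (8 * @disc1 R + 1).
have den : 0 < 8 * @disc1 R + 1 by rewrite ltr_wpDl// mulr_ge0.
have e'0 : 0 < e' by rewrite divr_gt0// exprn_gt0.
have e'd : 2 * @disc1 R * (2 * e' + 2 * e') <= e ^+ 2.
  have -> : e ^+ 2 = e' * (8 * @disc1 R + 1) by rewrite divfK// gt_eqF.
  rewrite (_ : 2 * @disc1 R * (2 * e' + 2 * e') = e' * (8 * @disc1 R)); last by ring.
  by apply: ler_wpM2l; [exact: ltW|rewrite lerDl].
have [n [hn n0]] : exists n, (\int[leb1]_(x in `]0%R, +oo[)
      ((wsum (nlist (KC C) n) x - omL (KC C) x) ^+ 2)%:E <= e'%:E)%E /\ (0 < size (nodes (KC C) n))%N.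
  have [dl cdl hdl] := omL_small lok hik k0p hk mK nK.
  have hs := near_size Kp lok (KC_ne Cne C01) hk.
  have he := lt_near _ _ cdl e'0.
  have [n [[h1 h2] h3]] := filter_ex (filterI (filterI hdl he) hs).
  by exists n; split => //; apply: le_trans h1 _; rewrite lee_fin; exact: ltW.
pose S := nodeS (KC C) n; pose m := size (nodes (KC C) n).
have Slt i : (i < m)%N -> S i < S i.+1 by exact: nodeS_lt.
have S0 : S 0%N = 0 by [].
have [d1 cd1 hd1] := w_small fg0 fg1 S0 Slt n0.
have [eta ceta heta] := dJ_small cf f0 fcrit fg0 fg1 S0 Slt n0.
have cF := F_small cf f0 fcrit fg0 fg1 fg2 S0 Slt n0.
have hF : \forall k \near \oo, `|Rintegral (@leb2 R) B (fun x => primitive f (uk f S m k x))| < e.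
  by move/cvgrPdist_lt : cF => /(_ e e0); apply: filterS => k; rewrite sub0r normrN.
have h1 := lt_near _ _ cd1 e'0; have h2 := lt_near _ _ ceta e0.
have hg : \forall k \near \oo, good f S m k by apply: near_good.
have [k [[[[[[w1 w2] [eta0 w3]] w4] w5] gk] Nk]] :=
  filter_ex (filterI (filterI (filterI (filterI (filterI (filterI hd1 h1) heta) h2) hF) hg) (nbhs_infty_ge N)).
pose p := pk f S m k; pose s := sk k : R.
have s0 : 0 < s := sk_gt0 k.
(* Defined as a difference, so that the dilated tower plus the correction is [uk] at every point and
   not just almost everywhere. *)
pose psi (r : R) := \sum_(q <- p) q.1 * - ln (Num.max r (expR (- q.2))) - delta s^-1 mu r.
have uE : radial (delta (sk k)^-1 mu + psi) = uk f S m k.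
  apply/funext => x; rewrite /radial /psi /uk /tsum /=.
  rewrite [LHS](_ : _ = delta s^-1 mu (enorm x) +
    (\sum_(q <- p) q.1 * - ln (Num.max (enorm x) (expR (- q.2))) - delta s^-1 mu (enorm x)))//.
  by rewrite addrC subrK.
have tlp := uk_limit gk; have tld := radial_delta_limit Cne Cc C01 C_null tow s0.
pose w t := wsum p t - omS (KC C) s t.
have tlpsi : test_limit (radial psi) (rfield w).
  have := test_limitD tlp (test_limitZ (-1) tld).
  have -> : rfield w = fun x => ((rfield (wsum p) x).1 + -1 * (rfield (omS (KC C) s) x).1,
      (rfield (wsum p) x).2 + -1 * (rfield (omS (KC C) s) x).2) by exact: rfieldB.
  by congr (test_limit _ _); apply/funext => x; rewrite mulN1r.
have [Hpsi _] := test_limit_H10 tlpsi.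
have mo := measurable_omL lok hik k0p hk mK.
have mw : measurable_fun setT w.
  apply: measurable_funB; first exact: measurable_wsum.
  apply: measurable_funM => //; apply: (measurableT_comp mo); exact: measurable_funM.
have dpsi : dirichlet (radial psi) <= 2 * @disc1 R * (2 * e' + 2 * e').
  rewrite -lee_fin (dirichlet_test_limit tlpsi) (ipG_EFin (test_limit_sqG tlpsi)).
  rewrite (rfield_energy s0 mw) [leRHS]EFinM; apply: lee_wpmul2l; first by rewrite lee_fin mulr_ge0.
  (* The slope error splits at the finite tower: A is the effect of shifting its nodes, A' that of
     replacing the full tower by finitely many nodes. *)
  pose A x := rk k * wsum p (s * x) - om S m x; pose A' x := wsum (nlist (KC C) n) x - omL (KC C) x.
  have mA : measurable_fun setT A.
    by apply: measurable_funB; [exact: measurable_wk|exact: measurable_wsum].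
  have mA' : measurable_fun setT A' by apply: measurable_funB; [exact: measurable_wsum|exact: mo].
  have mI : measurable (`]0%R, +oo[%classic : set R) by exact: measurable_itv.
  have mz (g : R -> R) : measurable_fun setT g -> measurable_fun (`]0%R, +oo[%classic : set R) (fun x => (g x ^+ 2)%:E).
    by move=> mg; apply/measurable_EFinP; apply: measurable_funTS; exact: measurable_sqr.
  have mz2 (g : R -> R) : measurable_fun setT g -> measurable_fun (`]0%R, +oo[%classic : set R) (fun x => (2%:E * (g x ^+ 2)%:E)%E).
    by move=> mg; apply: measurable_funeM; exact: mz.
  have pz (g : R -> R) x : (`]0%R, +oo[%classic : set R) x -> (0 <= 2%:E * (g x ^+ 2)%:E)%E.
    by move=> _; rewrite -EFinM lee_fin mulr_ge0// sqr_ge0.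
  apply: (@le_trans _ _ (\int[leb1]_(x in `]0%R, +oo[) (2%:E * (A x ^+ 2)%:E + 2%:E * (A' x ^+ 2)%:E)%E)%E).
    apply: ge0_le_integral => //.
    - by move=> x _; rewrite lee_fin sqr_ge0.
    - apply: (mz (fun x => Num.sqrt s * w (s * x))); apply: measurable_funM => //.
      by apply: (measurableT_comp mw); exact: measurable_funM.
    - by apply: emeasurable_funD; exact: mz2.
    - move=> x _; rewrite -!EFinM -EFinD lee_fin.
      have -> : Num.sqrt s * w (s * x) = rk k * wsum p (s * x) - omL (KC C) x.
        rewrite /w /omS mulrBr mulrA mulfV ?mul1r ?gt_eqF ?sqrtr_gt0//.
        by rewrite [s * x / s]mulrAC mulfV ?mul1r// gt_eqF.
      exact: sqr_sub_le.
  rewrite ge0_integralD//; try exact: mz2; try exact: pz.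
  rewrite !ge0_integralZl_EFin//; try exact: mz; try by move=> x _; rewrite lee_fin sqr_ge0.
  have -> : (2 * e' + 2 * e')%:E = (2%:E * e'%:E + 2%:E * e'%:E)%E by rewrite -!EFinM -EFinD.
  apply: leeD.
    apply: lee_wpmul2l; first by rewrite lee_fin.
    by apply: (le_trans w1); rewrite lee_fin ltW.
  apply: lee_wpmul2l; first by rewrite lee_fin.
  exact: hn.
exists k, psi, (dJ f (uk f S m k)); cbv zeta; rewrite uE; split; first exact: Nk.
- split; first exact: Hpsi.
  exact: (dnorm_le (ltW e0) dpsi e'd).
- have [M hM] := uk_bounded gk; have [Cf Cf0 hCf] := critical_growth_bound cf fcrit ltr01.
  have kp : 0 <= 4 * pi + 1 :> R by rewrite addr_ge0// mulr_ge0// pi_ge0.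
  exact: (frechet_J cf Cf0 kp hCf (uk_H10 gk) hM).
- apply: (Hm1_norm_le (ltW e0)) => v Hv; apply: le_trans (w3 v Hv) _.
  by apply: ler_wpM2r; [exact: dnorm_ge0|exact: ltW].
- split; first exact: uk_H10 gk.
  exact: ltW w5.
Qed.

End Stage.

Lemma dnorm_dist {R : realType} (u v : R * R -> R) : H10 u -> H10 v ->
  `|dnorm (u + v) - dnorm u| <= dnorm v.
Proof.
move=> hu hv; have h1 := dnormD hu hv.
have h2 := dnormD (H10D hu hv) (H10Z (-1) hv).
rewrite (dnormZ (-1) hv) normrN1 mul1r scaleN1r addrK in h2.
move: (dnorm (u + v)) (dnorm u) (dnorm v) h1 h2 => a b c h1 h2.
by rewrite ler_norml; apply/andP; split; lra.
Qed.

Lemma cvg_of_dist {R : realType} (d e : nat -> R) (D : R) : (forall n, `|d n - D| <= e n) ->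
  e @ \oo --> (0 : R) -> d @ \oo --> D.
Proof.
move=> hd /cvgrPdist_lt he; apply/cvgrPdist_lt => x x0; have := he x x0.
apply: filterS => n; rewrite sub0r normrN => h; rewrite distrC.
exact: le_lt_trans (le_trans (hd n) (ler_norm _)) h.
Qed.

Lemma cvg_energy {R : realType} (d I : nat -> R) (D c : R) : d @ \oo --> D ->
  I @ \oo --> (0 : R) -> 2^-1 * d n ^+ 2 - c * I n @[n --> \oo] --> 2^-1 * D ^+ 2.
Proof.
move=> cd cI.
have c1 : 2^-1 * (d n * d n) @[n --> \oo] --> 2^-1 * (D * D) by apply: cvgMr; apply: cvgM.
have c2 : c * I n @[n --> \oo] --> c * 0 by apply: cvgMr.
have c3 := cvgB c1 c2; rewrite mulr0 subr0 in c3; exact: c3.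
Qed.

(* f_zero is forced by the conclusion: the points at which J' is taken tend
   weakly to 0, so J' -> 0 there gives J'(0) = 0, that is f(0) = 0. *)
Theorem theorem5p1 (R : realType) (f : R -> R) (C : set R) (mu : R -> R)
    (f_cont : continuous f) (f_zero : f 0 = 0)
    (f_crit : critical_growth f) (f_g0 : g0 f) (f_g1 : g1 f) (f_g2 : g2 f)
    (C_nonempty : C !=set0) (C_compact : compact C) (C_sub : C `<=` `]0, 1[)
    (C_null : lebesgue_measure C = 0%E)
    (mu_tower : tower C set0 mu) :
  exists (s : nat -> R) (psi : nat -> R -> R),
    let u k := radial (delta (s k)^-1 mu + psi k) in
    [/\ forall k, 0 < s k, s @ \oo --> +oo,
        forall k, H10 (radial (psi k)) &
        [/\ dnorm (radial (psi k)) @[k --> \oo] --> (0 : R),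
            exists dJ : nat -> (R * R -> R) -> R,
              (forall k, frechet_H10 (J f) (u k) (dJ k)) /\
              Hm1_norm (dJ k) @[k --> \oo] --> (0 : R) &
            J f (u k) @[k --> \oo] --> 2^-1 * dnorm (radial mu) ^+ 2]].
Proof.
have pos n : 0 < (sk n)^-1 :> R by rewrite invr_gt0 sk_gt0.
(* The tolerance 1/(n+1) drives all the limits to 0 at once, and the index being at least n sends
   the dilation parameter to infinity. *)
have ex n : exists z : nat * (R -> R) * ((R * R -> R) -> R),
    let u := radial (delta (sk z.1.1)^-1 mu + z.1.2) in
    [/\ (n <= z.1.1)%N, H10 (radial z.1.2) /\ dnorm (radial z.1.2) <= (sk n)^-1,
        frechet_H10 (J f) u z.2, 0 <= Hm1_norm z.2 <= (sk n)^-1 &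
        H10 u /\ `|Rintegral (@leb2 R) B (fun x => primitive f (u x))| <= (sk n)^-1].
  have [k [psi [L h]]] := stage f_cont f_zero f_crit f_g0 f_g1 f_g2 C_nonempty C_compact
    C_sub C_null mu_tower n (pos n).
  by exists (k, psi, L).
have [F hF] := choice ex.
have e0 : (sk n)^-1 @[n --> \oo] --> (0 : R) := cvg_skV.
exists (fun n => sk (F n).1.1), (fun n => (F n).1.2) => u; split.
- by move=> n; exact: sk_gt0.
- apply/cvgryPge => A; have := @cvg_sk R; move/cvgryPge => /(_ A); apply: filterS => n h.
  by apply: le_trans h _; rewrite ler_nat ltnS; have [] := hF n.
- by move=> n; have [_ []] := hF n.
split.
- apply: (norm_squeeze0 _ e0) => n; have [_ [_ h] _ _ _] := hF n.
  by rewrite ger0_norm ?dnorm_ge0.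
- exists (fun n => (F n).2); split; first by move=> n; have [] := hF n.
  apply: (norm_squeeze0 _ e0) => n; have [_ _ _ /andP[h1 h2] _] := hF n.
  by rewrite ger0_norm.
have cI : Rintegral (@leb2 R) B (fun x => primitive f (u n x)) @[n --> \oo] --> (0 : R).
  by apply: (norm_squeeze0 _ e0) => n; have [_ _ _ _ []] := hF n.
(* The dilated tower has the norm of [mu] exactly, and the correction changes it by at most
   1/(n+1). *)
have cd : (fun n => dnorm (u n)) @ \oo --> dnorm (radial mu).
  apply: (cvg_of_dist _ e0) => n; have [_ [Hp hp] _ _ _] := hF n.
  have s0 : 0 < sk (F n).1.1 :> R := sk_gt0 _.
  have [Hd _] := test_limit_H10 (radial_delta_limit C_nonempty C_compact C_sub C_null mu_tower s0).
  rewrite -(dnorm_delta C_nonempty C_compact C_sub C_null mu_tower s0).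
  exact: le_trans (dnorm_dist Hd Hp) hp.
have cJ := cvg_energy (8 * pi)^-1 cd cI.
rewrite (_ : (fun k => J f (u k)) = fun n => 2^-1 * dnorm (u n) ^+ 2 -
  (8 * pi)^-1 * Rintegral (@leb2 R) B (fun x => primitive f (u n x))); first exact: cJ.
by apply/funext => n; rewrite /J dnorm_sqr.
Qed.
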